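(* Let $q\in(-1,1)$. If $H_{\mathbb R}$ is a finite dimensional real Hilbert space equipped with a strongly continuous group of orthogonal transformations $(U_t)_{t\in\mathbb R}$, then the $q$-Araki-Woods von Neumann algebra $\Gamma_q(H_{\mathbb R},(U_t)_{t\in\mathbb R})$ is QWEP.
   Context: QWEP: a $C^*$-algebra $B$ has the weak expectation property (WEP) if the canonical inclusion $B\to B^{**}$ factorizes completely contractively through some $B(K)$, $K$ a Hilbert space. A $C^*$-algebra is QWEP if it is a quotient, by a closed (two-sided) ideal, of a $C^*$-algebra with the WEP. $q$-Araki-Woods algebra: inner products are linear in the second variable. Let $H_{\mathbb C}$ be the complexification of $H_{\mathbb R}$ and still write $(U_t)$ for the extension to a unitary group on $H_{\mathbb C}$. Let $A$ be the injective positive self-adjoint operator on $H_{\mathbb C}$ with $U_t=A^{it}$ for all $t\in\mathbb R$. Define $\langle\xi,\eta\rangle_U=\langle 2A(1+A)^{-1}\xi,\eta\rangle$ on $H_{\mathbb C}$ and let $H$ be the completion of $H_{\mathbb C}$ for this inner product. The $q$-Fock space $\mathcal F_q(H)=\mathbb C\Omega\oplus\bigoplus_{n\ge1}H^{\otimes n}$ is the Hilbert space completion of the algebraic direct sum for the inner product $\langle h_1\otimes\dots\otimes h_n,g_1\otimes\dots\otimes g_m\rangle_q=\delta_{n,m}\sum_{\pi\in S_n}q^{\mathrm{inv}(\pi)}\prod_{i=1}^n\langle h_i,g_{\pi(i)}\rangle_U$, where $\mathrm{inv}(\pi)$ is the number of inversions of $\pi$. For $h\in H$, $a^*(h)$ is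 the bounded operator with $a^*(h)\Omega=h$, $a^*(h)(h_1\otimes\dots\otimes h_n)=h\otimes h_1\otimes\dots\otimes h_n$, and $a(h)$ is its adjoint. For $f\in H_{\mathbb R}$, $G(f)=a^*(f)+a(f)$. Then $\Gamma_q(H_{\mathbb R},(U_t)_{t\in\mathbb R})$ is the von Neumann algebra generated by $\{G(f): f\in H_{\mathbb R}\}$ in $B(\mathcal F_q(H))$. *)

(* Defs.v *)
From HB Require Import structures.
From mathcomp Require Import all_boot all_order all_algebra all_fingroup.
From mathcomp Require Import complex.
From mathcomp Require Import all_classical all_reals all_analysis.

Set Implicit Arguments.
Unset Strict Implicit.
Unset Printing Implicit Defensive.

Import Order.TTheory GRing.Theory Num.Theory.
Import numFieldNormedType.Exports.
Local Open Scope classical_set_scope.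
Local Open Scope ring_scope.
Local Open Scope complex_scope.

(** * Hilbert spaces and bounded operators *)

Record realHilbertType (R : realType) := RealHilbert {
  rhilbert_sort :> completeNormedModType R ;
  rip : rhilbert_sort -> rhilbert_sort -> R ;
  rip_linear : forall a x y z, rip x (a *: y + z) = a * rip x y + rip x z ;
  rip_sym : forall x y, rip y x = rip x y ;
  rip_norm : forall x, rip x x = `|x| ^+ 2 }.

(* Inner products are linear in the second variable. The norm of a
   normedModType over R[i] takes its (real) values in R[i]. *)
Record hilbertType (R : realType) := Hilbert {
  hilbert_sort :> completeNormedModType R[i] ;
  hip : hilbert_sort -> hilbert_sort -> R[i] ;
  hip_linear : forall a x y z, hip x (a *: y + z) = a * hip x y + hip x z ;
  hip_conj : forall x y, hip y x = (hip x y)^* ;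
  hip_norm : forall x, hip x x = `|x| ^+ 2 }.

Definition finite_dimensional (K : fieldType) (V : lmodType K) : Prop :=
  exists s : seq V, forall x, exists c : V -> K, x = \sum_(v <- s) c v *: v.

Section BoundedOperators.
Context {R : realType} {K : hilbertType R}.

Definition bounded_operator : {pred (K -> K)} := fun T =>
  `[< linear T /\ exists2 c : R[i], 0 <= c & forall x, `|T x| <= c * `|x| >].

Lemma bounded_operator_submod_closed : submod_closed bounded_operator.
Proof.
split; first by apply/asboolP; split=> [a x y|];
  [rewrite scaler0 addr0 | exists 0 => // x; rewrite mul0r normr0].
move=> a S T /asboolP[linS [c c0 hc]] /asboolP[linT [d d0 hd]].
apply/asboolP; split=> [b x y|].
  have E z : (a *: S + T) z = a *: S z + T z by [].
  by rewrite !E linS linT !scalerDr !scalerA (mulrC a b) addrACA.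
exists (`|a| * c + d) => [|x]; first by rewrite addr_ge0 // mulr_ge0.
have -> : (a *: S + T) x = a *: S x + T x by [].
rewrite (le_trans (ler_normD _ _))// mulrDl lerD //.
by rewrite normrZ -mulrA ler_wpM2l.
Qed.

HB.instance Definition _ := GRing.isSubmodClosed.Build R[i] (K -> K)
  bounded_operator bounded_operator_submod_closed.

End BoundedOperators.

(* B(K) *)
Record bop (R : realType) (K : hilbertType R) := Bop {
  bop_val :> K -> K ; _ : bop_val \in bounded_operator }.

HB.instance Definition _ R K := [isSub for @bop_val R K].
HB.instance Definition _ R K := [Choice of @bop R K by <:].
HB.instance Definition _ R K := [SubChoice_isSubLmodule of @bop R K by <:].

Definition adjoint_pair (R : realType) (K : hilbertType R) (T S : bop K) :=
  forall x y, hip (T x) y = hip x (S y).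

(** * Matrix norms *)

Section OperatorNorm.
Context {R : realType} {V : normedModType R[i]} {I : finType}.

Definition l2norm (x : I -> V) : R :=
  Num.sqrt (\sum_i complex.Re `|x i| ^+ 2).

(* norm of the operator on the l^2-direct sum of copies of V, indexed by I,
   given by the matrix T of operators on V *)
Definition opmx_norm (T : I -> I -> V -> V) : \bar R :=
  ereal_sup [set (l2norm (fun i => \sum_j T i j (x j)))%:E |
             x in [set x : I -> V | l2norm x <= 1]].

End OperatorNorm.

(* Data of an operator space: a vector space E with a norm on each M_n(E). *)
Record opspace (R : realType) := OpSpace {
  opspace_sort :> lmodType R[i] ;
  mxnorm : forall n, 'M[opspace_sort]_n -> \bar R }.

Definition completely_contractive (R : realType) (E F : opspace R)
    (u : {linear E -> F}) : Prop :=
  forall n (x : 'M[E]_n), (mxnorm (map_mx u x) <= mxnorm x)%E.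

Definition bop_opspace (R : realType) (K : hilbertType R) : opspace R :=
  @OpSpace R (bop K) (fun n T => opmx_norm (fun i j => T i j : K -> K)).

Section Dual.
Context {R : realType} {E : opspace R}.

Definition bounded_functional : {pred (E -> R[i]^o)} := fun f =>
  `[< linear f /\ exists2 c : R, 0 <= c &
      forall x, ((complex.Re `|f x|)%:E <=
                 c%:E * mxnorm (const_mx x : 'M[E]_1))%E >].

Lemma bounded_functional_submod_closed : submod_closed bounded_functional.
Proof.
have ReD (x y : R[i]) : complex.Re (x + y) = complex.Re x + complex.Re y.
  by case: x y => [? ?] [? ?].
have Re_le (x y : R[i]) : x <= y -> complex.Re x <= complex.Re y.
  by case: x y => [? ?] [? ?]; rewrite lecE => /andP[].
have ReM (x y : R[i]) : complex.Re (`|x| * `|y|) =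
    complex.Re `|x| * complex.Re `|y|.
  by case: x y => [? ?] [? ?]; rewrite /= mul0r subr0.
split; first apply/asboolP; first split=> [a x y|].
- by rewrite scaler0 addr0.
- by exists 0 => // x; rewrite mul0e lee_fin normr0.
move=> a f g /asboolP[linf [c c0 hc]] /asboolP[ling [d d0 hd]].
apply/asboolP; split=> [b x y|].
  have EE z : (a *: f + g) z = a *: f z + g z by [].
  by rewrite !EE linf ling !scalerDr !scalerA (mulrC a b) addrACA.
have a0 : 0 <= complex.Re `|a| by apply: Re_le (normr_ge0 a).
exists (complex.Re `|a| * c + d) => [|x]; first by rewrite addr_ge0 // mulr_ge0.
have -> : (a *: f + g) x = a * f x + g x by [].
apply: (@le_trans _ _ (complex.Re `|a| * complex.Re `|f x|
                       + complex.Re `|g x|)%:E).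
  by rewrite lee_fin -ReM -ReD -normrM; apply/Re_le/ler_normD.
rewrite [X in (_ <= X * _)%E]EFinD ge0_muleDl ?lee_fin ?mulr_ge0//.
rewrite EFinD leeD//.
by rewrite !EFinM -muleA lee_wpmul2l ?lee_fin.
Qed.

End Dual.

(* The dual E' of E with its operator space structure: the norm of M_n(E') is
   the one of CB(E, M_n). For n = 1 this is the usual norm of functionals. *)
Record dual (R : realType) (E : opspace R) := Dual {
  dual_val :> E -> R[i]^o ; _ : dual_val \in bounded_functional }.

HB.instance Definition _ (R : realType) (E : opspace R) :=
  GRing.isSubmodClosed.Build R[i] (E -> R[i]^o)
    bounded_functional (@bounded_functional_submod_closed R E).
HB.instance Definition _ R E := [isSub for @dual_val R E].
HB.instance Definition _ R E := [Choice of @dual R E by <:].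
HB.instance Definition _ R E := [SubChoice_isSubLmodule of @dual R E by <:].

Definition dual_opspace (R : realType) (E : opspace R) : opspace R :=
  @OpSpace R (dual E) (fun n f =>
    ereal_sup [set r | exists m (x : 'M[E]_m), (mxnorm x <= 1)%E /\
      r = opmx_norm (V := R[i]^o)
            (fun k l : 'I_n * 'I_m => *%R (f k.1 l.1 (x k.2 l.2)))]).

(** * C*-algebras, WEP and QWEP *)

(* not necessarily unital *)
Record cstarAlgebra (R : realType) := CstarAlgebra {
  cstar_sort :> completeNormedModType R[i] ;
  cmul : cstar_sort -> cstar_sort -> cstar_sort ;
  cstar : cstar_sort -> cstar_sort ;
  cmulA : associative cmul ;
  cmul_linearl : forall a x y z,
    cmul (a *: x + y) z = a *: cmul x z + cmul y z ;
  cmul_linearr : forall a x y z,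
    cmul z (a *: x + y) = a *: cmul z x + cmul z y ;
  cmul_norm : forall x y, `|cmul x y| <= `|x| * `|y| ;
  cstar_semilinear : forall a x y,
    cstar (a *: x + y) = a^* *: cstar x + cstar y ;
  cstarM : forall x y, cstar (cmul x y) = cmul (cstar y) (cstar x) ;
  cstarK : involutive cstar ;
  cstar_norm : forall x, `|cmul (cstar x) x| = `|x| ^+ 2 }.

Definition star_representation (R : realType) (B : cstarAlgebra R)
    (K : hilbertType R) (rho : {linear B -> bop K}) : Prop :=
  (forall a b x, rho (cmul a b) x = rho a (rho b x)) /\
  (forall a, adjoint_pair (rho a) (rho (cstar a))).

(* The C*-norm of M_n(B), as the supremum over all *-representations. *)
Definition cstar_opspace (R : realType) (B : cstarAlgebra R) : opspace R :=
  @OpSpace R B (fun n x =>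
    ereal_sup [set r | exists (K : hilbertType R) (rho : {linear B -> bop K}),
      star_representation rho /\
      r = @mxnorm R (bop_opspace K) n (map_mx rho x)]).

Definition WEP (R : realType) (B : cstarAlgebra R) : Prop :=
  exists (K : hilbertType R)
    (u : {linear cstar_opspace B -> bop_opspace K})
    (v : {linear bop_opspace K -> dual_opspace (dual_opspace (cstar_opspace B))}),
  [/\ completely_contractive u, completely_contractive v &
      forall (b : cstar_opspace B) (f : dual_opspace (cstar_opspace B)),
        (v (u b) : dual _) f = (f : dual _) b].

Definition closed_ideal (R : realType) (B : cstarAlgebra R) (J : set B) : Prop :=
  [/\ closed J, J 0,
      (forall a x y, J x -> J y -> J (a *: x + y)) &
      (forall b x, J x -> J (cmul b x) /\ J (cmul x b))].

(* B/J is isomorphic to the C*-algebra M of operators on K: some surjective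
   *-homomorphism from B to M has kernel J. *)
Definition quotient_iso (R : realType) (B : cstarAlgebra R) (J : set B)
    (K : hilbertType R) (M : set (bop K)) : Prop :=
  exists rho : {linear B -> bop K},
    [/\ star_representation rho, range rho = M &
        forall b, rho b = 0 <-> J b].

Definition QWEP (R : realType) (K : hilbertType R) (M : set (bop K)) : Prop :=
  exists (B : cstarAlgebra R) (J : set B),
    [/\ WEP B, closed_ideal J & quotient_iso J M].

(** * von Neumann algebras *)

Section VonNeumann.
Context {R : realType} {K : hilbertType R}.

Definition commutant (M : set (bop K)) : set (bop K) :=
  [set T | forall S, M S -> forall x, T (S x) = S (T x)].

Definition von_neumann (M : set (bop K)) : Prop :=
  (forall T S, M T -> adjoint_pair T S -> M S) /\ commutant (commutant M) = M.

Definition vN_generated (G : set (bop K)) : set (bop K) :=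
  smallest von_neumann G.

End VonNeumann.

(** * Complexification *)

(* (x, y) stands for x + iy *)
Definition complexification (R : realType) (V : lmodType R) : Type :=
  (V * V)%type.

Section Complexification.
Context {R : realType} {V : lmodType R}.

HB.instance Definition _ :=
  GRing.Zmodule.copy (complexification V) (V * V)%type.

Definition cplx_scale (c : R[i]) (z : complexification V) :
    complexification V :=
  (complex.Re c *: z.1 - complex.Im c *: z.2,
   complex.Re c *: z.2 + complex.Im c *: z.1).

Fact cplx_scaleA a b z :
  cplx_scale a (cplx_scale b z) = cplx_scale (a * b) z.
Proof.
case: a b z => [a a'] [b b'] [x y]; rewrite /cplx_scale /=; congr pair.
  rewrite scalerBr scalerDr scalerBl scalerDl !scalerA opprD.
  by rewrite [in RHS]opprD (addrC (- ((a' * b) *: y))) addrACA.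
rewrite scalerBr scalerDr scalerBl scalerDl !scalerA.
by rewrite (addrC ((a' * b) *: x)) addrACA.
Qed.

Fact cplx_scale1 : left_id 1 cplx_scale.
Proof.
by case=> x y; rewrite /cplx_scale /= !scale1r !scale0r subr0 addr0.
Qed.

Fact cplx_scaleDr : right_distributive cplx_scale +%R.
Proof.
case=> [a a'] [x y] [x' y']; rewrite /cplx_scale /=; congr pair.
  by rewrite !scalerDr opprD addrACA.
by rewrite !scalerDr addrACA.
Qed.

Fact cplx_scaleDl z : {morph cplx_scale^~ z : a b / a + b}.
Proof.
case: z => x y [a a'] [b b']; rewrite /cplx_scale /=; congr pair.
  by rewrite !scalerDl opprD addrACA.
by rewrite !scalerDl addrACA.
Qed.

HB.instance Definition _ := GRing.Zmodule_isLmodule.Build R[i]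
  (complexification V) cplx_scaleA cplx_scale1 cplx_scaleDr cplx_scaleDl.

End Complexification.

Definition cplx_of (R : realType) (V : lmodType R) (x : V) :
  complexification V := (x, 0).

Definition cplx_ext (R : realType) (V : lmodType R) (T : V -> V)
  (z : complexification V) : complexification V := (T z.1, T z.2).

Definition cplx_ip (R : realType) (V : realHilbertType R)
    (z w : complexification V) : R[i] :=
  (rip z.1 w.1 + rip z.2 w.2) +i* (rip z.1 w.2 - rip z.2 w.1).

(** * q-Araki-Woods algebras *)

Section ArakiWoods.
Context {R : realType} {HR : realHilbertType R}.
Local Notation HC := (complexification HR).

Definition orthogonal_group (U : R -> HR -> HR) : Prop :=
  [/\ (forall t, linear (U t)), (forall t x y, rip (U t x) (U t y) = rip x y),
      (forall x, U 0 x = x), (forall s t x, U (s + t) x = U s (U t x)) &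
      (forall x, continuous (U^~ x : R -> HR))].

Definition positive_selfadjoint (A : {linear HC -> HC}) : Prop :=
  (forall x y, cplx_ip (A x) y = cplx_ip x (A y)) /\
  (forall x, 0 <= cplx_ip x (A x)).

(* T = A^{it}, for an injective positive operator A on the finite dimensional
   space HC and a linear operator T: by the spectral theorem the eigenvectors
   of A span HC, and A^{it} multiplies by l^{it} = exp (i t ln l) on the
   eigenspace of A for l > 0. *)
Definition is_imaginary_power (A : {linear HC -> HC}) (t : R) (T : HC -> HC) :=
  forall (l : R) (x : HC), 0 < l -> A x = l%:C *: x ->
    T x = (cos (t * ln l) +i* sin (t * ln l)) *: x.

(* For A positive, 1 + A is bijective and this is (1 + A)^{-1} x. *)
Definition inv_1D (A : {linear HC -> HC}) (x : HC) : HC :=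
  xget 0 [set z | z + A z = x].

Definition U_ip (A : {linear HC -> HC}) (x y : HC) : R[i] :=
  cplx_ip (2 *: A (inv_1D A x)) y.

Definition is_U_completion (A : {linear HC -> HC}) (H : hilbertType R)
    (j : {linear HC -> H}) : Prop :=
  (forall x y, hip (j x) (j y) = U_ip A x y) /\ dense (range j).

End ArakiWoods.

Definition inversions (n : nat) (p : 'S_n) : nat :=
  #|[set k : 'I_n * 'I_n | (k.1 < k.2)%N && (p k.2 < p k.1)%N]|.

Section FockSpace.
Context {R : realType} {H F : hilbertType R}.

(* F, with tens [:: h1; ...; hn] standing for h1 (x) ... (x) hn and tens [::]
   for the vacuum, is the completion of the algebraic direct sum of the tensor
   powers of H for the inner product < , >_q. *)
Record is_qFock (q : R) (tens : seq H -> F) : Prop := IsQFock {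
  qFock_linear : forall s1 a h k s2,
    tens (s1 ++ (a *: h + k) :: s2) =
    a *: tens (s1 ++ h :: s2) + tens (s1 ++ k :: s2) ;
  qFock_ip : forall n (h g : n.-tuple H),
    hip (tens h) (tens g) = \sum_(p : 'S_n)
      (q ^+ inversions p)%:C * \prod_(i < n) hip (tnth h i) (tnth g (p i)) ;
  qFock_ip0 : forall h g : seq H,
    size h != size g -> hip (tens h) (tens g) = 0 ;
  qFock_dense : dense
    [set v | exists l : seq (R[i] * seq H),
       v = \sum_(c <- l) c.1 *: tens c.2] }.

Definition is_creation (tens : seq H -> F) (h : H) (T : bop F) : Prop :=
  forall s, T (tens s) = tens (h :: s).

Definition is_field (tens : seq H -> F) (h : H) (G : bop F) : Prop :=
  exists c a : bop F,
    [/\ is_creation tens h c, adjoint_pair c a & G = c + a].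

End FockSpace.

(* Gamma_q(H_R, (U_t)), on the realization F of the q-Fock space *)
Definition qArakiWoods (R : realType) (HR : realHilbertType R)
    (H F : hilbertType R) (j : {linear complexification HR -> H})
    (tens : seq H -> F) : set (bop F) :=
  vN_generated [set G | exists f : HR, is_field tens (j (cplx_of f)) G].

(* Main.v *)
(* The q-Araki-Woods algebra Gamma has matrix models. Over an orthonormal eigenbasis
   of A, put a (d + d)-dimensional matrix algebra with a diagonal density at each
   of m^2 sites, and let the averages W(l) = (1/m) sum_i X_i(l) of site variables
   whose commutation signs have mean q (through an ancilla for each pair of
   sites) play the role of the fields G(l). Their moments in the product state
   converge to the vacuum moments: only words using every site 0 or 2 times
   survive, and those satisfy the recursion of the q-Fock space. The square root E
   of the density satisfies E W(l) = c(l) W(l) E.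

   Sending w Om to the columns of W(w) E defines maps V_n from the Fock space to
   vectors over l^2 that are isometric along an ultrafilter, hence a unital
   completely positive compression P(T) = lim V_n^* T V_n. It takes values in Gamma:
   the relation E W = c W E makes right multiplications bounded and P(T) commute
   with them, and such operators commute with Gamma'. Let B be the algebra of
   operators T for which T V_n ~ V_n P(T) and T^* V_n ~ V_n P(T)^*. Then P is a
   *-homomorphism on B, and it is onto Gamma, because resolvents of self-adjoint
   polynomials in the W(l) approximating X lift the resolvents of X.

   Finally B has the WEP: for T in B(K) choose a lift c_T in B of P(T); with g in
   the kernel J of P quasi-central and g^2 + k^2 = 1, the functionals
   f |-> f(g T g + k c_T k) converge along an ultrafilter to the required map
   B(K) -> B'', because g T g is in J. *)
Require Import Defs.
From HB Require Import structures.
From mathcomp Require Import all_boot all_order all_algebra all_fingroup.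
From mathcomp Require Import complex ring lra zify.
From mathcomp Require Import all_classical all_reals all_analysis.
Set Implicit Arguments.
Unset Strict Implicit.
Unset Printing Implicit Defensive.
Import Order.TTheory GRing.Theory Num.Theory.
Import numFieldNormedType.Exports.
Local Open Scope classical_set_scope.
Local Open Scope ring_scope.
Local Open Scope complex_scope.

(** * Hilbert spaces and bounded operators *)

(** The vacuum state need not be a trace, and W(l), an average of m^2 site variables with weight
    1/m, has a norm that is only bounded by a multiple of m. Polynomials in the W(l) therefore give
    no bounded operator on l^2. Two devices get around this: vectors are compared after
    multiplication by E, in Hilbert-Schmidt norm, where moments suffice; and operators enter only
    through resolvents of self-adjoint matrices, whose norm at i t is at most 1/|t| whatever the
    matrix. The relation E W = c W E does the work of modular theory: the adjoint of W(w) E is again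
    a multiple of some W(w') E, so that the modular conjugation is a formula on words. The kernel J
    of P is hereditary in all of B(l^2): S X T lies in J for S, T in J and arbitrary X. This is what
    puts g T g in B for arbitrary T. Exact norms, at all matrix sizes, come out of crude ones
    through the C*-identity: a bound with constant 1 + s for all elements, applied to x^* x, gives
    the constant sqrt(1 + s) <= 1 + s/2 for x. The start of this argument is a lift with controlled
    norm, hence the norm bounds in the surjectivity of P. *)

Section ComplexNumbers.
Context {R : realType}.
Implicit Types a b : R[i].

Definition cabs a : R := complex.Re `|a|.

Lemma cReD a b : complex.Re (a + b) = complex.Re a + complex.Re b.
Proof. by case: a b => [? ?] [? ?]. Qed.

Lemma cImD a b : complex.Im (a + b) = complex.Im a + complex.Im b.
Proof. by case: a b => [? ?] [? ?]. Qed.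

Lemma cReN a : complex.Re (- a) = - complex.Re a.
Proof. by case: a. Qed.

Lemma cImN a : complex.Im (- a) = - complex.Im a.
Proof. by case: a. Qed.

Lemma cReB a b : complex.Re (a - b) = complex.Re a - complex.Re b.
Proof. by rewrite cReD cReN. Qed.

Lemma cImB a b : complex.Im (a - b) = complex.Im a - complex.Im b.
Proof. by rewrite cImD cImN. Qed.

Lemma cReM a b : complex.Re (a * b) =
  complex.Re a * complex.Re b - complex.Im a * complex.Im b.
Proof. by case: a b => [? ?] [? ?]. Qed.

Lemma Re_conj a : complex.Re (conjc a) = complex.Re a.
Proof. by case: a. Qed.

Lemma Im_conj a : complex.Im (conjc a) = - complex.Im a.
Proof. by case: a. Qed.

Lemma Re_sum (I : Type) (s : seq I) (P : pred I) (f : I -> R[i]) :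
  complex.Re (\sum_(i <- s | P i) f i) = \sum_(i <- s | P i) complex.Re (f i).
Proof. by apply: (big_morph _ cReD). Qed.

Lemma complexP a b :
  complex.Re a = complex.Re b -> complex.Im a = complex.Im b -> a = b.
Proof. by case: a b => [? ?] [? ?] /= -> ->. Qed.

Lemma conjM a b : conjc (a * b) = conjc a * conjc b.
Proof. exact: rmorphM. Qed.

Lemma conjD a b : conjc (a + b) = conjc a + conjc b.
Proof. exact: rmorphD. Qed.

Lemma conjN a : conjc (- a) = - conjc a.
Proof. exact: rmorphN. Qed.

Lemma conjB a b : conjc (a - b) = conjc a - conjc b.
Proof. exact: rmorphB. Qed.

Lemma conj_sum (I : Type) (s : seq I) (P : pred I) (f : I -> R[i]) :
  conjc (\sum_(i <- s | P i) f i) = \sum_(i <- s | P i) conjc (f i).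
Proof. exact: rmorph_sum. Qed.

Lemma realC_real (x : R) : conjc (x%:C) = x%:C.
Proof. by apply: complexP => /=; rewrite ?oppr0. Qed.

Lemma ge0_RRe (a : R[i]) : 0 <= a -> a = (complex.Re a)%:C.
Proof. by case: a => x y; rewrite lecE /= => /andP[/eqP -> _]. Qed.

Lemma realC_inj : injective (real_complex R).
Proof. by move=> x y []. Qed.

Lemma normcE a : `|a| = (cabs a)%:C.
Proof. exact/ge0_RRe. Qed.

Lemma cabs_ge0 a : 0 <= cabs a.
Proof. by have := normr_ge0 a; rewrite normcE lecR. Qed.

Lemma cabs_sq a : cabs a ^+ 2 = complex.Re a ^+ 2 + complex.Im a ^+ 2.
Proof. by case: a => x y; rewrite /cabs /= sqr_sqrtr// addr_ge0 ?sqr_ge0. Qed.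

Lemma conj_mul a : conjc a * a = (cabs a ^+ 2)%:C.
Proof. by rewrite cabs_sq; case: a => x y; apply: complexP => /=; ring. Qed.

Lemma mul_conj a : a * conjc a = (cabs a ^+ 2)%:C.
Proof. by rewrite mulrC conj_mul. Qed.

Lemma cabsM a b : cabs (a * b) = cabs a * cabs b.
Proof.
by have := normrM a b; rewrite !normcE -rmorphM => /realC_inj.
Qed.

Lemma cabsD a b : cabs (a + b) <= cabs a + cabs b.
Proof. by have := ler_normD a b; rewrite !normcE -rmorphD lecR. Qed.

Lemma cabsN a : cabs (- a) = cabs a.
Proof. by rewrite /cabs normrN. Qed.

Lemma cabsB a b : cabs (a - b) <= cabs a + cabs b.
Proof. by rewrite -(cabsN b) cabsD. Qed.

Lemma cabs_conj a : cabs (conjc a) = cabs a.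
Proof.
apply/eqP; rewrite -(@eqrXn2 _ 2) ?cabs_ge0// !cabs_sq Re_conj Im_conj.
by rewrite sqrrN.
Qed.

Lemma cabs_real (x : R) : cabs x%:C = `|x|.
Proof. by rewrite /cabs /= expr0n addr0 sqrtr_sqr. Qed.

Lemma cabs0 : cabs 0 = 0.
Proof. by rewrite /cabs normr0. Qed.

Lemma cabs0_eq0 a : cabs a = 0 -> a = 0.
Proof. by move=> h; apply/eqP; rewrite -normr_eq0 normcE h. Qed.

Lemma Re_le_cabs a : `|complex.Re a| <= cabs a.
Proof.
rewrite -(@ler_pXn2r _ 2) ?nnegrE ?cabs_ge0// cabs_sq real_normK ?num_real//.
by rewrite lerDl sqr_ge0.
Qed.

Lemma Im_le_cabs a : `|complex.Im a| <= cabs a.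
Proof.
rewrite -(@ler_pXn2r _ 2) ?nnegrE ?cabs_ge0// cabs_sq real_normK ?num_real//.
by rewrite lerDr sqr_ge0.
Qed.

Lemma cabs_le a : cabs a <= `|complex.Re a| + `|complex.Im a|.
Proof.
rewrite -(@ler_pXn2r _ 2) ?nnegrE ?addr_ge0 ?cabs_ge0// cabs_sq.
rewrite -(real_normK (num_real (complex.Re a))).
rewrite -(real_normK (num_real (complex.Im a))) sqrrD.
by rewrite lerD2r lerDl mulrn_wge0// mulr_ge0.
Qed.

Lemma cabs_sum (I : Type) (s : seq I) (P : pred I) (f : I -> R[i]) :
  cabs (\sum_(i <- s | P i) f i) <= \sum_(i <- s | P i) cabs (f i).
Proof.
elim/big_rec2: _ => [|i x y _ h]; first by rewrite cabs0.
by rewrite (le_trans (cabsD _ _))// lerD2l.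
Qed.

End ComplexNumbers.

(** * Semi-inner products and the Cauchy-Schwarz inequality *)

Section SemiInnerProduct.
Context {R : realType} {E : lmodType R[i]}.
Variable B : E -> E -> R[i].

(** A property of a bare form, so that the same lemmas serve [hip], families of vectors, truncated
    l^2 sums, the Hilbert-Schmidt form and [cplx_ip]. *)
Definition semi_ip : Prop :=
  [/\ forall a x y z, B x (a *: y + z) = a * B x y + B x z,
      forall x y, B y x = conjc (B x y) & forall x, 0 <= complex.Re (B x x)].

Hypothesis Bs : semi_ip.
Let Blin := let: And3 h _ _ := Bs in h.
Let Bconj := let: And3 _ h _ := Bs in h.
Let Bge0 := let: And3 _ _ h := Bs in h.

Lemma semi0r x : B x 0 = 0.
Proof. by have := Blin (-1) x 0 0; rewrite scaler0 addr0 mulN1r addNr. Qed.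

Lemma semiDr x y z : B x (y + z) = B x y + B x z.
Proof. by have := Blin 1 x y z; rewrite scale1r mul1r. Qed.

Lemma semiZr a x y : B x (a *: y) = a * B x y.
Proof. by have := Blin a x y 0; rewrite !addr0 semi0r addr0. Qed.

Lemma semiNr x y : B x (- y) = - B x y.
Proof. by rewrite -scaleN1r semiZr mulN1r. Qed.

Lemma semiBr x y z : B x (y - z) = B x y - B x z.
Proof. by rewrite semiDr semiNr. Qed.

Lemma semi0l x : B 0 x = 0.
Proof. by rewrite Bconj semi0r; apply: complexP => /=; rewrite ?oppr0. Qed.

Lemma semiDl x y z : B (x + y) z = B x z + B y z.
Proof. by rewrite (Bconj z) semiDr conjD -(Bconj z) -(Bconj z). Qed.

Lemma semiZl a x y : B (a *: x) y = conjc a * B x y.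
Proof. by rewrite (Bconj y) semiZr conjM -(Bconj y). Qed.

Lemma semiNl x y : B (- x) y = - B x y.
Proof. by rewrite (Bconj y) semiNr conjN -(Bconj y). Qed.

Lemma semiBl x y z : B (x - y) z = B x z - B y z.
Proof. by rewrite semiDl semiNl. Qed.

Lemma semi_sumr (I : Type) (s : seq I) (P : pred I) x (f : I -> E) :
  B x (\sum_(i <- s | P i) f i) = \sum_(i <- s | P i) B x (f i).
Proof. by apply: (big_morph _ (semiDr x) (semi0r x)). Qed.

Lemma semi_suml (I : Type) (s : seq I) (P : pred I) x (f : I -> E) :
  B (\sum_(i <- s | P i) f i) x = \sum_(i <- s | P i) B (f i) x.
Proof. by apply: (big_morph (B^~ x) (fun y z => semiDl y z x) (semi0l x)). Qed.

Lemma semi_real x : B x x = (complex.Re (B x x))%:C.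
Proof.
apply: complexP => //=; have /(congr1 (@complex.Im R)) := Bconj x x.
by rewrite Im_conj => h; lra.
Qed.

Lemma semi_sqD x y : complex.Re (B (x + y) (x + y)) =
  complex.Re (B x x) + complex.Re (B x y) *+ 2 + complex.Re (B y y).
Proof.
rewrite !semiDr !semiDl !cReD (Bconj x y) Re_conj; ring.
Qed.

Lemma semi_sqB x y : complex.Re (B (x - y) (x - y)) =
  complex.Re (B x x) - complex.Re (B x y) *+ 2 + complex.Re (B y y).
Proof.
rewrite semi_sqD semiNr semiNl semiNr opprK cReN; ring.
Qed.

(** Positivity at [x + t conj(b) y], t real, is a quadratic inequality in t. For q > 0 take t =
    -1/q; for q = 0 it is affine in t and fails at t = -(p + 1)/(2 be) unless be = 0. *)
Lemma semi_CS x y :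
  cabs (B x y) ^+ 2 <= complex.Re (B x x) * complex.Re (B y y).
Proof.
set p := complex.Re (B x x); set q := complex.Re (B y y).
set b := B x y; set be := cabs b ^+ 2.
have be0 : 0 <= be by exact: sqr_ge0.
have key t : 0 <= p + t * be *+ 2 + t ^+ 2 * be * q.
  have := Bge0 (x + (t%:C * conjc b) *: y).
  rewrite semi_sqD !semiZr semiZl -/b [X in _ + complex.Re X]mulrA.
  have -> : t%:C * conjc b * b = (t * be)%:C.
    by rewrite -mulrA conj_mul -rmorphM.
  have -> : t%:C * conjc b * conjc (t%:C * conjc b) = (t ^+ 2 * be)%:C.
    by rewrite mul_conj cabsM cabs_conj exprMn cabs_real real_normK ?num_real.
  by rewrite (semi_real y) -rmorphM /=.
have q0 : 0 <= q by exact: Bge0.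
have [q_gt0|] := ltP 0 q; last first.
  move=> q_le0; have {q_le0 q0} q0 : q = 0 by apply/eqP; rewrite eq_le q_le0.
  rewrite q0 mulr0 leNgt; apply/negP => be_gt0.
  have p0 : 0 <= p := Bge0 x.
  have := key (- (p + 1) / (be *+ 2)); rewrite q0 mulr0 addr0.
  have -> : - (p + 1) / (be *+ 2) * be *+ 2 = - (p + 1).
    by field; rewrite gt_eqF.
  lra.
have := key (- q^-1).
have -> : p + - q^-1 * be *+ 2 + (- q^-1) ^+ 2 * be * q = p - be / q.
  by field; rewrite gt_eqF.
by rewrite subr_ge0 ler_pdivrMr.
Qed.

Lemma semi_CS_sqrt x y : cabs (B x y) <=
  Num.sqrt (complex.Re (B x x)) * Num.sqrt (complex.Re (B y y)).
Proof.
rewrite -sqrtrM ?Bge0// -[leLHS]ger0_norm ?cabs_ge0// -sqrtr_sqr ler_wsqrtr//.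
exact: semi_CS.
Qed.

End SemiInnerProduct.

Section NormC.
Context {R : realType} {V : normedModType R[i]}.
Implicit Types x y : V.

Definition nrm x : R := complex.Re `|x|.

Lemma nrmE x : `|x| = (nrm x)%:C.
Proof. exact/ge0_RRe. Qed.

Lemma nrm_ge0 x : 0 <= nrm x.
Proof. by have := normr_ge0 x; rewrite nrmE lecR. Qed.

Lemma nrmD x y : nrm (x + y) <= nrm x + nrm y.
Proof. by have := ler_normD x y; rewrite !nrmE -rmorphD lecR. Qed.

Lemma nrmN x : nrm (- x) = nrm x.
Proof. by rewrite /nrm normrN. Qed.

Lemma nrmB x y : nrm (x - y) <= nrm x + nrm y.
Proof. by rewrite -(nrmN y) nrmD. Qed.

Lemma nrmBC x y : nrm (x - y) = nrm (y - x).
Proof. by rewrite -nrmN opprB. Qed.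

Lemma nrmZ (a : R[i]) x : nrm (a *: x) = cabs a * nrm x.
Proof.
by have := normrZ a x; rewrite !nrmE normcE -rmorphM => /realC_inj.
Qed.

Lemma nrm0 : nrm 0 = 0.
Proof. by rewrite /nrm normr0. Qed.

Lemma nrm0_eq0 x : nrm x = 0 -> x = 0.
Proof. by move=> h; apply/eqP; rewrite -normr_eq0 nrmE h. Qed.

Lemma nrm_sum (I : Type) (s : seq I) (P : pred I) (f : I -> V) :
  nrm (\sum_(i <- s | P i) f i) <= \sum_(i <- s | P i) nrm (f i).
Proof.
elim/big_rec2: _ => [|i x y _ h]; first by rewrite nrm0.
by rewrite (le_trans (nrmD _ _))// lerD2l.
Qed.

Lemma nrm_trans y x z : nrm (x - z) <= nrm (x - y) + nrm (y - z).
Proof. by rewrite -{1}(subrK y x) -addrA nrmD. Qed.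

Lemma nrm_eps0 x : (forall e : R, 0 < e -> nrm x <= e) -> x = 0.
Proof.
move=> h; apply: nrm0_eq0; apply/eqP; rewrite eq_le nrm_ge0 andbT.
by apply/ler_addgt0Pr => e e0; rewrite add0r h.
Qed.

End NormC.

(** * Limits and completeness through sequences *)

Section SequentialLimits.
Context {R : realType}.

Lemma halfC : 2^-1 = (2^-1)%:C :> R[i].
Proof. by rewrite -(rmorph_nat (real_complex R)) -fmorphV. Qed.

Definition tends {V : normedModType R[i]} (u : nat -> V) (l : V) :=
  forall e : R, 0 < e -> exists N, forall n, (N <= n)%N -> nrm (u n - l) <= e.

Definition cauchy_seq_nrm {V : normedModType R[i]} (u : nat -> V) :=
  forall e : R, 0 < e ->
    exists N, forall n m, (N <= n)%N -> (N <= m)%N -> nrm (u n - u m) <= e.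

Lemma ball_nrmE {V : normedModType R[i]} (x y : V) (e : R) :
  ball x e%:C y <-> nrm (x - y) < e.
Proof. by rewrite -ball_normE /= nrmE ltcR. Qed.

Lemma pos_RRe (e : R[i]) : 0 < e -> exists2 d : R, 0 < d & e = d%:C.
Proof.
move=> e0; exists (complex.Re e); last exact/ge0_RRe/ltW.
by have := e0; rewrite {1}(ge0_RRe (ltW e0)) ltcR.
Qed.

Lemma complete_tends (V : completeNormedModType R[i]) (u : nat -> V) :
  cauchy_seq_nrm u -> exists l, tends u l.
Proof.
move=> cu; have cF : cauchy (u @ \oo).
  apply: cauchy_exP => e /pos_RRe[d d0 ->].
  have d20 : 0 < d / 2 by rewrite divr_gt0.
  have [N hN] := cu _ d20; exists (u N); exists N => // n /= Nn.
  apply/ball_nrmE; rewrite (le_lt_trans (hN _ _ (leqnn N) Nn))//.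
  by rewrite ltr_pdivrMr// mulr_natr mulr2n ltrDl.
have [l ul] := (cvg_ex _).1 (cauchy_cvg _ cF).
exists l => e e0; have : \forall n \near \oo, ball l e%:C (u n).
  by apply: ul; apply: nbhsx_ballx; rewrite ltcR.
move=> [N _ hN]; exists N => n Nn; rewrite nrmBC ltW//.
by apply/ball_nrmE; apply: hN.
Qed.

(** Completeness is defined by Cauchy filters. Sets [A n] of F of diameter less than 1/(n+1) are
    chosen, and [u n] in the first n + 1 of them; the limit of u is then a limit of F. *)
Lemma seq_complete (V : normedModType R[i]) :
  (forall u : nat -> V, cauchy_seq_nrm u -> exists l, tends u l) ->
  forall F : set_system V, ProperFilter F -> cauchy F -> cvg F.
Proof.
move=> hV F PF /cauchy_ballP cF.
pose e n : R := (n.+1%:R)^-1.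
have e0 n : 0 < e n by rewrite invr_gt0.
have eC n : 0 < (e n)%:C by rewrite ltcR.
have /choice[A hA] n : exists A : set V, F A /\
    forall x y, A x -> A y -> nrm (x - y) < e n.
  have [[A B] /= [FA FB] AB] := cF _ (eC n).
  exists (A `&` B); split; first exact: filterI.
  move=> x y [Ax _] [_ By]; apply/ball_nrmE.
  by have := AB (x, y); apply; split.
have /choice[u hu] n : exists x, forall k, (k <= n)%N -> A k x.
  have : F [set x | forall k, (k <= n)%N -> A k x].
    elim: n => [|n IH]; first by apply: filterS (hA 0).1 => x A0 k;
      rewrite leqn0 => /eqP->.
    apply: filterS (filterI IH (hA n.+1).1) => x [/= h An] k.
    by rewrite leq_eqVlt => /predU1P[->//|/h].
  by move/filter_ex.
have small (d : R) : 0 < d -> exists N, forall n, (N <= n)%N -> e n < d.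
  move=> d0; exists (Num.truncn d^-1) => n Nn.
  rewrite /e invf_plt ?posrE// (lt_le_trans (truncnS_gt _))//.
  by rewrite ler_nat.
have cu : cauchy_seq_nrm u.
  move=> d d0; have [N hN] := small d d0; exists N => n m Nn Nm.
  apply/ltW/(lt_trans _ (hN N (leqnn _))).
  by apply: (hA N).2; apply: hu.
have [l ul] := hV u cu; apply: (cvg_ex _).2; exists l.
apply/cvg_ballP => d /pos_RRe[r r0 ->].
have r20 : 0 < r / 2 by rewrite divr_gt0.
have [N hN] := ul _ r20; have [N' hN'] := small _ r20.
pose n := maxn N N'.
apply: filterS (hA n).1 => x An; apply/ball_nrmE.
rewrite (le_lt_trans (nrm_trans (u n) _ _))// [ltRHS](splitr r).
rewrite ler_ltD//; first by rewrite nrmBC hN// leq_maxl.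
rewrite (lt_trans ((hA n).2 _ _ (hu n n (leqnn _)) An))//.
by rewrite hN'// leq_maxr.
Qed.

End SequentialLimits.

Section HilbertBasics.
Context {R : realType} {K : hilbertType R}.
Implicit Types x y z : K.

Lemma Re_hip_ge0 x : 0 <= complex.Re (hip x x).
Proof. by rewrite hip_norm nrmE expr2 -rmorphM /= mulr_ge0// nrm_ge0. Qed.

Lemma hip_semi : semi_ip (@hip R K).
Proof.
by split; [exact: hip_linear|exact: hip_conj|exact: Re_hip_ge0].
Qed.

Lemma hip_nrm x : hip x x = (nrm x ^+ 2)%:C.
Proof. by rewrite hip_norm nrmE rmorphXn. Qed.

Lemma Re_hip x : complex.Re (hip x x) = nrm x ^+ 2.
Proof. by rewrite hip_nrm. Qed.

Definition hipDr := semiDr hip_semi.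
Definition hipDl := semiDl hip_semi.
Definition hipBr := semiBr hip_semi.
Definition hipBl := semiBl hip_semi.
Definition hipNr := semiNr hip_semi.
Definition hipNl := semiNl hip_semi.
Definition hipZr := semiZr hip_semi.
Definition hipZl := semiZl hip_semi.
Definition hip0r := semi0r hip_semi.
Definition hip0l := semi0l hip_semi.
Definition hip_sumr := semi_sumr hip_semi.
Definition hip_suml := semi_suml hip_semi.

Lemma hip_CS x y : cabs (hip x y) <= nrm x * nrm y.
Proof.
by have := semi_CS_sqrt hip_semi x y; rewrite !Re_hip !sqrtr_sqr
  !ger0_norm ?nrm_ge0.
Qed.

Lemma nrm_sqB x y :
  nrm (x - y) ^+ 2 = nrm x ^+ 2 - complex.Re (hip x y) *+ 2 + nrm y ^+ 2.
Proof. by rewrite -!Re_hip (semi_sqB hip_semi). Qed.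

Lemma nrm_sqD x y :
  nrm (x + y) ^+ 2 = nrm x ^+ 2 + complex.Re (hip x y) *+ 2 + nrm y ^+ 2.
Proof. by rewrite -!Re_hip (semi_sqD hip_semi). Qed.

Lemma hip_ext x y : (forall z, hip z x = hip z y) -> x = y.
Proof.
move=> h; apply/eqP; rewrite -subr_eq0; apply/eqP/nrm0_eq0/eqP.
by rewrite -sqrf_eq0 -Re_hip hipBr h subrr.
Qed.

Lemma hip_extl x y : (forall z, hip x z = hip y z) -> x = y.
Proof. by move=> h; apply: hip_ext => z; rewrite hip_conj h -hip_conj. Qed.

Section LaxMilgram.
Variable B : K -> K -> R[i].
Hypothesis Bs : semi_ip B.
Variables d M : R.
Hypothesis d0 : 0 < d.
Hypothesis Bd : forall x, d * nrm x ^+ 2 <= complex.Re (B x x).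
Hypothesis BM : forall x, complex.Re (B x x) <= M * nrm x ^+ 2.

(* Minimize B x x - 2 Re (f x); the parallelogram identity makes minimizing
   sequences Cauchy. *)
Lemma Lax_Milgram (f : K -> R[i]) (c : R) :
  (forall a x y, f (a *: x + y) = a * f x + f y) ->
  (forall x, cabs (f x) <= c * nrm x) ->
  exists x, forall y, f y = B x y.
Proof.
move=> flin fc.
have c0 : 0 <= `|c| by [].
pose b x := complex.Re (B x x).
pose Q x := b x - complex.Re (f x) *+ 2.
have fD x y : f (x + y) = f x + f y.
  by have := flin 1 x y; rewrite scale1r mul1r.
have f0 : f 0 = 0 by have := flin (-1) 0 0; rewrite scaler0 addr0 mulN1r addNr.
have fZ a x : f (a *: x) = a * f x.
  by have := flin a x 0; rewrite !addr0 f0 addr0.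
have Qlb x : - (c ^+ 2 / d) <= Q x.
  rewrite /Q /b; have h1 := Bd x; have h2 := fc x.
  have h3 := ler_norm (complex.Re (f x)); have h4 := Re_le_cabs (f x).
  have h5 : complex.Re (f x) <= c * nrm x.
    by apply: le_trans h3 _; apply: le_trans h4 h2.
  have h6 : 0 <= d * (nrm x - c / d) ^+ 2 by rewrite mulr_ge0 ?sqr_ge0 ?(ltW d0).
  have h7 : d * (nrm x - c / d) ^+ 2 =
     d * nrm x ^+ 2 - c * nrm x *+ 2 + c ^+ 2 / d by field; rewrite gt_eqF.
  rewrite h7 in h6; lra.
pose m := inf (range Q).
have hinf : has_inf (range Q).
  split; first by exists (Q 0); exists 0.
  by exists (- (c ^+ 2 / d)) => _ [x _ <-].
have mQ x : m <= Q x by apply: ge_inf; [exact: hinf.2|exists x].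
have par x y : b (x - y) + (Q (2^-1 *: (x + y))) *+ 4 = Q x *+ 2 + Q y *+ 2.
  rewrite /Q fZ fD.
  have -> : b (2^-1 *: (x + y)) = b (x + y) / 4.
    rewrite /b (semiZr Bs) (semiZl Bs) (semi_real Bs (x + y)) mulrA.
    by rewrite !halfC realC_real -!rmorphM /=; field.
  have -> : complex.Re (2^-1 * (f x + f y)) =
            (complex.Re (f x) + complex.Re (f y)) / 2.
    by rewrite halfC cReM cReD /= mul0r subr0; field.
  by rewrite /b (semi_sqB Bs) (semi_sqD Bs); field.
pose ee n : R := (n.+1%:R)^-1.
have ee0 n : 0 < ee n by rewrite invr_gt0.
have /choice[u hu] n : exists x, Q x < m + ee n.
  have [_ [x _ <-] h] := inf_adherent (ee0 n) hinf.
  by exists x.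
have cau n k : d * nrm (u n - u k) ^+ 2 <= ee n *+ 2 + ee k *+ 2.
  rewrite (le_trans (Bd _))//.
  have := par (u n) (u k); have := mQ (2^-1 *: (u n + u k)).
  have := hu n; have := hu k; rewrite /b; lra.
have small (e : R) : 0 < e -> exists N, forall n, (N <= n)%N -> ee n <= e.
  move=> e0; exists (Num.truncn e^-1) => n Nn.
  rewrite /ee invf_ple ?posrE// (le_trans (ltW (truncnS_gt _)))//.
  by rewrite ler_nat.
have cu : cauchy_seq_nrm u.
  move=> e e0; have [|N hN] := small (d * e ^+ 2 / 4).
    by rewrite divr_gt0 ?mulr_gt0 ?exprn_gt0.
  exists N => n k Nn Nk; rewrite -(@ler_pXn2r _ 2) ?nnegrE ?nrm_ge0 ?(ltW e0)//.
  suff : d * nrm (u n - u k) ^+ 2 <= d * e ^+ 2 by rewrite ler_pM2l.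
  rewrite (le_trans (cau _ _))//.
  have := hN _ Nn; have := hN _ Nk; lra.
have [l ul] := complete_tends cu.
have b_CS x y : cabs (B x y) <= `|M| * nrm x * nrm y.
  rewrite (le_trans (semi_CS_sqrt Bs x y))//.
  have hb z : Num.sqrt (complex.Re (B z z)) <= Num.sqrt `|M| * nrm z.
    have -> : Num.sqrt `|M| * nrm z = Num.sqrt (`|M| * nrm z ^+ 2).
      by rewrite sqrtrM// sqrtr_sqr (ger0_norm (nrm_ge0 z)).
    rewrite ler_wsqrtr// (le_trans (BM _))// ler_wpM2r ?sqr_ge0//.
    exact: ler_norm.
  rewrite (le_trans (ler_pM (sqrtr_ge0 _) (sqrtr_ge0 _) (hb x) (hb y)))//.
  by rewrite mulrACA -expr2 sqr_sqrtr// mulrA.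
have Ql : Q l <= m.
  apply/ler_addgt0Pr => e e0.
  pose C0 : R := 1 + (`|M| + `|M| * nrm l *+ 2 + `|c| *+ 2).
  have C00 : 0 < C0.
    by rewrite ltr_pwDl// !addr_ge0 ?mulrn_wge0 ?mulr_ge0 ?nrm_ge0.
  pose r : R := Num.min 1 (e / 2 / C0).
  have r0 : 0 < r by rewrite lt_min ltr01 !divr_gt0.
  have [N1 h1] := ul _ r0.
  have e20 : 0 < e / 2 by rewrite divr_gt0.
  have [N2 h2] := small _ e20.
  pose n := maxn N1 N2; pose w := u n - l.
  have wr : nrm w <= r by rewrite h1// leq_maxl.
  have w1 : nrm w <= 1 by rewrite (le_trans wr)// ge_min lexx.
  have w2 : nrm w * C0 <= e / 2.
    by rewrite -ler_pdivlMr// (le_trans wr)// ge_min lexx orbT.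
  have En : Q (u n) = Q l + b w + complex.Re (B l w) *+ 2
     - complex.Re (f w) *+ 2.
    have -> : u n = l + w by rewrite /w addrC subrK.
    by rewrite /Q /b (semi_sqD Bs) fD cReD; ring.
  have hn : Q (u n) <= m + e / 2.
    by rewrite (le_trans (ltW (hu n)))// lerD2l h2// leq_maxr.
  have hBw : - (`|M| * nrm l * nrm w) <= complex.Re (B l w).
    have := Re_le_cabs (B l w); rewrite ler_norml => /andP[h _].
    by have := b_CS l w; lra.
  have hfw : complex.Re (f w) <= `|c| * nrm w.
    rewrite (le_trans (ler_norm _))// (le_trans (Re_le_cabs _))//.
    by rewrite (le_trans (fc w))// ler_wpM2r ?nrm_ge0// ler_norm.
  have hbw : 0 <= b w.
    by rewrite (le_trans _ (Bd w))// mulr_ge0 ?sqr_ge0 ?(ltW d0).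
  have hC0 : nrm w * C0 = nrm w + `|M| * nrm w + `|M| * nrm l * nrm w *+ 2
    + `|c| * nrm w *+ 2 by rewrite /C0; ring.
  have h3 : 0 <= `|M| * nrm w by rewrite mulr_ge0 ?nrm_ge0.
  have h4 : 0 <= nrm w by exact: nrm_ge0.
  rewrite hC0 in w2; move: (`|M| * nrm l * nrm w) hBw w2 => X hBw w2.
  move: (`|c| * nrm w) hfw w2 => Y hfw w2; lra.
(* Vanishing derivative of Q at its minimum l, in the real direction y; the value t = g / (b y + 1)
   makes the increment negative unless g = 0, and its denominator is positive even if b y = 0. *)
have Re_eq y : complex.Re (f y) = complex.Re (B l y).
  set g := complex.Re (f y) - complex.Re (B l y).
  have key t : 0 <= t ^+ 2 * b y - t * g *+ 2.
    have := mQ (l + t%:C *: y); have := Ql.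
    rewrite /Q /b (semi_sqD Bs) (semiZr Bs) fD fZ (semiZl Bs) (semiZr Bs).
    rewrite cReD realC_real (semi_real Bs y) -!rmorphM /= !cReM /= !mul0r !subr0.
    rewrite /g; nra.
  apply/eqP; rewrite -subr_eq0 -/g; apply/eqP.
  have b0 : 0 < b y + 1.
    by rewrite ltr_wpDl// (le_trans _ (Bd y))// mulr_ge0 ?sqr_ge0 ?(ltW d0).
  have := key (g / (b y + 1)).
  have -> : (g / (b y + 1)) ^+ 2 * b y - g / (b y + 1) * g *+ 2 =
    - (g ^+ 2 * (b y + 2)) / (b y + 1) ^+ 2 by field; rewrite gt_eqF.
  rewrite mulNr oppr_ge0 pmulr_lle0 ?invr_gt0 ?exprn_gt0//.
  have b2 : 0 < b y + 2 by lra.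
  by rewrite pmulr_lle0// => h; apply/eqP; rewrite -sqrf_eq0 eq_le h sqr_ge0.
exists l => y; apply: complexP; first exact: Re_eq.
have := Re_eq ('i *: y); rewrite fZ (semiZr Bs) !cReM /= !mul0r !mul1r !sub0r.
by move/oppr_inj.
Qed.

End LaxMilgram.

Lemma Riesz (f : K -> R[i]) (c : R) :
  (forall a x y, f (a *: x + y) = a * f x + f y) ->
  (forall x, cabs (f x) <= c * nrm x) ->
  exists x, forall y, f y = hip x y.
Proof.
apply: (@Lax_Milgram _ hip_semi 1 1) => // x; by rewrite Re_hip mul1r.
Qed.

End HilbertBasics.

(** * Bounded operators: adjoints, norm, completeness, inverses *)

Section Operators.
Context {R : realType} {K : hilbertType R}.
Implicit Types (S T : bop K) (x y z : K).

Definition bb (T : K -> K) (M : R) := forall x, nrm (T x) <= M * nrm x.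

Lemma bop_lin T : linear T.
Proof. by case: T => T /= /asboolP[]. Qed.

Lemma bop_bb T : exists2 M : R, 0 <= M & bb T M.
Proof.
case: T => T /= /asboolP[_ [c c0 hc]]; exists (complex.Re c).
  by move: c0; rewrite lecE => /andP[].
move=> x; have := hc x; rewrite {1}(ge0_RRe c0) !nrmE -rmorphM.
by rewrite lecR.
Qed.

Lemma bop_ext S T : (forall x, S x = T x) -> S = T.
Proof. by move=> h; apply: val_inj; apply: funext. Qed.

Fact mkbop_subproof (T : K -> K) : linear T /\ (exists M : R, bb T M) ->
  T \in bounded_operator.
Proof.
move=> [lT [M hM]]; apply/asboolP; split=> //; exists (`|M|)%:C.
  by rewrite lecR.
move=> x; rewrite !nrmE -rmorphM lecR (le_trans (hM x))//.
by rewrite ler_wpM2r ?nrm_ge0 ?ler_norm.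
Qed.

Definition mkbop (T : K -> K) (h : linear T /\ exists M : R, bb T M) : bop K :=
  Bop (mkbop_subproof h).

Lemma mkbop_ex (T : K -> K) (M : R) : linear T -> bb T M ->
  exists S : bop K, forall x, S x = T x.
Proof. by move=> h h'; exists (mkbop (conj h (ex_intro _ M h'))). Qed.

Lemma bopD T x y : T (x + y) = T x + T y.
Proof. by have := bop_lin T 1 x y; rewrite !scale1r. Qed.

Lemma bop0 T : T 0 = 0.
Proof. by have := bop_lin T (-1) 0 0; rewrite !scaleN1r !oppr0 add0r addNr. Qed.

Lemma bopZ T a x : T (a *: x) = a *: T x.
Proof. by have := bop_lin T a x 0; rewrite !addr0 bop0 addr0. Qed.

Lemma bopN T x : T (- x) = - T x.
Proof. by rewrite -scaleN1r bopZ scaleN1r. Qed.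

Lemma bopB T x y : T (x - y) = T x - T y.
Proof. by rewrite bopD bopN. Qed.

Lemma bop_sum T (I : Type) (s : seq I) (P : pred I) (f : I -> K) :
  T (\sum_(i <- s | P i) f i) = \sum_(i <- s | P i) T (f i).
Proof. by apply: (big_morph _ (bopD T) (bop0 T)). Qed.

Lemma bopDE S T x : (S + T) x = S x + T x. Proof. by []. Qed.
Lemma bopNE T x : (- T) x = - T x. Proof. by []. Qed.
Lemma bopBE S T x : (S - T) x = S x - T x. Proof. by []. Qed.
Lemma bopZE a T x : (a *: T) x = a *: T x. Proof. by []. Qed.
Lemma bop0E x : (0 : bop K) x = 0. Proof. by []. Qed.

Lemma bop_sumE (I : Type) (s : seq I) (P : pred I) (f : I -> bop K) x :
  (\sum_(i <- s | P i) f i) x = \sum_(i <- s | P i) f i x.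
Proof. by apply: (big_morph (fun T : bop K => T x)). Qed.

Lemma bb_le T M N : bb T M -> M <= N -> bb T N.
Proof.
by move=> h MN x; rewrite (le_trans (h x))// ler_wpM2r ?nrm_ge0.
Qed.

Lemma bbD S T M N : bb S M -> bb T N -> bb (S + T) (M + N).
Proof.
by move=> h h' x; rewrite bopDE (le_trans (nrmD _ _))// mulrDl lerD.
Qed.

Lemma bbN T M : bb T M -> bb (- T) M.
Proof. by move=> h x; rewrite bopNE nrmN. Qed.

Lemma bbB S T M N : bb S M -> bb T N -> bb (S - T) (M + N).
Proof. by move=> h h'; apply: bbD => //; apply: bbN. Qed.

Lemma bbZ a T M : bb T M -> bb (a *: T) (cabs a * M).
Proof.
by move=> h x; rewrite bopZE nrmZ -mulrA ler_wpM2l ?cabs_ge0.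
Qed.

Fact bcomp_subproof S T : linear (fun x => S (T x)) /\
  exists M : R, bb (fun x => S (T x)) M.
Proof.
split=> [a x y|]; first by rewrite !bop_lin.
have [M M0 hM] := bop_bb S; have [N N0 hN] := bop_bb T.
exists (M * N) => x.
by rewrite (le_trans (hM _))// -mulrA ler_wpM2l.
Qed.

Definition bcomp S T : bop K := mkbop (bcomp_subproof S T).

Lemma bcompE S T x : bcomp S T x = S (T x). Proof. by []. Qed.

Lemma bb_comp S T M N : 0 <= M -> bb S M -> bb T N -> bb (bcomp S T) (M * N).
Proof.
move=> M0 hS hT x; rewrite bcompE (le_trans (hS _))// -mulrA.
by rewrite ler_wpM2l.
Qed.

Fact bid_subproof : linear (fun x : K => x) /\ exists M : R, bb (fun x => x) M.
Proof. by split=> //; exists 1 => x; rewrite mul1r. Qed.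

Definition bid : bop K := mkbop bid_subproof.

Lemma bidE x : bid x = x. Proof. by []. Qed.

Lemma bcompA S T (U : bop K) : bcomp S (bcomp T U) = bcomp (bcomp S T) U.
Proof. exact: bop_ext. Qed.

Lemma bcomp_linl a S T (U : bop K) :
  bcomp (a *: S + T) U = a *: bcomp S U + bcomp T U.
Proof. exact: bop_ext. Qed.

Lemma bcomp_linr a S T (U : bop K) :
  bcomp U (a *: S + T) = a *: bcomp U S + bcomp U T.
Proof.
by apply: bop_ext => v; rewrite bcompE !bopDE !bopZE bopD bopZ !bcompE.
Qed.

Lemma bcompDl S T (U : bop K) : bcomp (S + T) U = bcomp S U + bcomp T U.
Proof. exact: bop_ext. Qed.

Lemma bcompBl S T (U : bop K) : bcomp (S - T) U = bcomp S U - bcomp T U.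
Proof. exact: bop_ext. Qed.

Lemma bcompDr S T (U : bop K) : bcomp U (S + T) = bcomp U S + bcomp U T.
Proof. by apply: bop_ext => v; rewrite bcompE !bopDE bopD. Qed.

Lemma bcompBr S T (U : bop K) : bcomp U (S - T) = bcomp U S - bcomp U T.
Proof. by apply: bop_ext => v; rewrite bcompE !bopBE bopB. Qed.

Lemma bcompZl a S T : bcomp (a *: S) T = a *: bcomp S T.
Proof. exact: bop_ext. Qed.

Lemma bcompZr a S T : bcomp S (a *: T) = a *: bcomp S T.
Proof. by apply: bop_ext => v; rewrite bcompE !bopZE bopZ. Qed.

Lemma bcomp1l S : bcomp bid S = S. Proof. exact: bop_ext. Qed.
Lemma bcomp1r S : bcomp S bid = S. Proof. exact: bop_ext. Qed.

Lemma bb_id : bb bid 1.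
Proof. by move=> x; rewrite bidE mul1r. Qed.

Lemma sesqui_bop (b : K -> K -> R[i]) (M : R) :
  (forall a x y z, b x (a *: y + z) = a * b x y + b x z) ->
  (forall a x y z, b (a *: x + y) z = conjc a * b x z + b y z) ->
  (forall x y, cabs (b x y) <= M * nrm x * nrm y) ->
  exists T : bop K, bb T M /\ forall x y, hip x (T y) = b x y.
Proof.
move=> b2 b1 hb.
have /choice[T hT] y : exists z, forall x, hip z x = conjc (b x y).
  have [|x|z hz] := @Riesz R K (fun x => conjc (b x y)) (M * nrm y).
  - by move=> a x z; rewrite b1 conjD conjM conjcK.
  - by rewrite cabs_conj (le_trans (hb _ _))// mulrAC.
  by exists z => x; rewrite hz.
have hT' x y : hip x (T y) = b x y by rewrite hip_conj hT conjcK.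
have lT : linear T.
  by move=> a x y; apply: hip_ext => z; rewrite hip_linear !hT' b2.
have bT : bb T M.
  move=> y; have := hb (T y) y.
  rewrite -hT' hip_nrm cabs_real ger0_norm ?sqr_ge0// expr2 mulrAC.
  have := nrm_ge0 (T y); rewrite le_eqVlt => /predU1P[h _|h]; last first.
    by rewrite ler_pM2r.
  (* When T y = 0, the claim is 0 <= M * nrm y, although M has no given sign; the bound on the form
     at (y, y) provides it. *)
  rewrite -h; have := hb y y; have := cabs_ge0 (b y y) => h1 h2.
  have [y0|y0] := eqVneq (nrm y) 0; first by rewrite y0 mulr0.
  have := le_trans h1 h2; rewrite pmulr_lge0// lt_neqAle eq_sym y0.
  exact: nrm_ge0.
by have [S hS] := mkbop_ex lT bT; exists S; split=> x; rewrite ?hS// => y;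
  rewrite hS.
Qed.

Lemma adj_ex T : exists S : bop K, adjoint_pair T S.
Proof.
have [M M0 hM] := bop_bb T.
have [a x y z|a x y z|x y|S [_ hS]] := @sesqui_bop (fun x y => hip (T x) y) M.
- by rewrite hip_linear.
- by rewrite bop_lin hipDl hipZl.
- rewrite (le_trans (hip_CS _ _))// ler_wpM2r ?nrm_ge0//.
by exists S => x y; rewrite hS.
Qed.

Definition adj T : bop K := projT1 (cid (adj_ex T)).

Lemma adjP T x y : hip (T x) y = hip x (adj T y).
Proof. by rewrite /adj; case: cid => S /= hS. Qed.

Lemma adjPr T x y : hip x (T y) = hip (adj T x) y.
Proof. by rewrite hip_conj adjP -hip_conj. Qed.

Lemma adj_uniq T S : adjoint_pair T S -> S = adj T.
Proof.
by move=> h; apply: bop_ext => x; apply: hip_ext => y; rewrite -adjP h.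
Qed.

Lemma adjK T : adj (adj T) = T.
Proof. by apply/esym/adj_uniq => x y; rewrite -adjPr. Qed.

Lemma adjD S T : adj (S + T) = adj S + adj T.
Proof.
by apply/esym/adj_uniq => x y; rewrite !bopDE hipDl hipDr !adjP.
Qed.

Lemma adjN T : adj (- T) = - adj T.
Proof.
by apply/esym/adj_uniq => x y; rewrite !bopNE hipNl hipNr !adjP.
Qed.

Lemma adjB S T : adj (S - T) = adj S - adj T.
Proof. by rewrite adjD adjN. Qed.

Lemma adjZ a T : adj (a *: T) = conjc a *: adj T.
Proof.
by apply/esym/adj_uniq => x y; rewrite !bopZE hipZl hipZr adjP.
Qed.

Lemma adj_comp S T : adj (bcomp S T) = bcomp (adj T) (adj S).
Proof. by apply/esym/adj_uniq => x y; rewrite !bcompE !adjP. Qed.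

Lemma adj_id : adj bid = bid.
Proof. by apply/esym/adj_uniq. Qed.

Lemma adj0 : adj 0 = 0.
Proof. by apply/esym/adj_uniq => x y; rewrite !bop0E hip0l hip0r. Qed.

Lemma bb_adj T M : 0 <= M -> bb T M -> bb (adj T) M.
Proof.
move=> M0 h x; have [->|x0] := eqVneq (nrm (adj T x)) 0.
  by rewrite mulr_ge0 ?nrm_ge0.
have n0 : 0 < nrm (adj T x) by rewrite lt_neqAle eq_sym x0 nrm_ge0.
rewrite -(ler_pM2r n0) -expr2 -Re_hip -adjP.
rewrite (le_trans (ler_norm _))// (le_trans (Re_le_cabs _))//.
rewrite (le_trans (hip_CS _ _))// mulrAC ler_wpM2r ?nrm_ge0//.
Qed.

Lemma bb_adj_comp T M : 0 <= M -> bb (bcomp (adj T) T) (M ^+ 2) -> bb T M.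
Proof.
move=> M0 h x; rewrite -(@ler_pXn2r _ 2) ?nnegrE ?mulr_ge0 ?nrm_ge0//.
rewrite -Re_hip adjP (le_trans (ler_norm _))// (le_trans (Re_le_cabs _))//.
rewrite (le_trans (hip_CS _ _))// exprMn [X in _ <= _ * X]expr2 mulrCA.
by rewrite ler_wpM2l ?nrm_ge0 ?h.
Qed.

Definition opn T : R := inf [set M | 0 <= M /\ bb T M].

Let opn_has_inf T : has_inf [set M | 0 <= M /\ bb T M].
Proof.
split; first by have [M] := bop_bb T; exists M.
by exists 0 => M [].
Qed.

Lemma opn_ge0 T : 0 <= opn T.
Proof. by apply: lb_le_inf => [|M []//]; have [] := opn_has_inf T. Qed.

Lemma opn_le T M : 0 <= M -> bb T M -> opn T <= M.
Proof. by move=> M0 h; apply: ge_inf; [have [] := opn_has_inf T|split]. Qed.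

Lemma bb_opn T : bb T (opn T).
Proof.
move=> x; have [x0|x0] := eqVneq (nrm x) 0.
  by rewrite (nrm0_eq0 x0) bop0 nrm0 mulr0.
have xp : 0 < nrm x by rewrite lt_neqAle eq_sym x0 nrm_ge0.
rewrite -ler_pdivrMr//; apply: lb_le_inf; first by have [] := opn_has_inf T.
by move=> M [M0 h]; rewrite ler_pdivrMr.
Qed.

Lemma opnD S T : opn (S + T) <= opn S + opn T.
Proof.
by apply: opn_le; [rewrite addr_ge0 ?opn_ge0|apply: bbD; exact: bb_opn].
Qed.

Lemma opn_eq0 T : opn T = 0 -> T = 0.
Proof.
move=> h; apply: bop_ext => x; apply: nrm0_eq0; apply/eqP.
by rewrite eq_le nrm_ge0 andbT; have := bb_opn T x; rewrite h mul0r.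
Qed.

Lemma opnZ a T : opn (a *: T) = cabs a * opn T.
Proof.
have h b U : opn (b *: U) <= cabs b * opn U.
  by apply: opn_le; [rewrite mulr_ge0 ?cabs_ge0 ?opn_ge0|
                     apply: bbZ; exact: bb_opn].
apply/eqP; rewrite eq_le h /=; have [->|a0] := eqVneq a 0.
  by rewrite cabs0 mul0r opn_ge0.
have ca : 0 < cabs a.
  rewrite lt_neqAle cabs_ge0 andbT eq_sym; apply: contra_neq a0.
  exact: cabs0_eq0.
rewrite -ler_pdivlMl//.
have {1}-> : T = a^-1 *: (a *: T) by rewrite scalerA mulVf// scale1r.
rewrite (le_trans (h _ _))//.
suff -> : cabs a^-1 = (cabs a)^-1 by [].
apply: (mulfI (lt0r_neq0 ca)).
by rewrite -cabsM mulfV// mulfV ?lt0r_neq0// cabs_real normr1.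
Qed.

Lemma opn_comp S T : opn (bcomp S T) <= opn S * opn T.
Proof.
apply: opn_le; first by rewrite mulr_ge0 ?opn_ge0.
by apply: bb_comp; [exact: opn_ge0|exact: bb_opn|exact: bb_opn].
Qed.

Lemma opn_adj_le T : opn (adj T) <= opn T.
Proof.
by apply: opn_le; [exact: opn_ge0|apply: bb_adj (bb_opn T); exact: opn_ge0].
Qed.

Lemma opn_cstar T : opn (bcomp (adj T) T) = opn T ^+ 2.
Proof.
apply/eqP; rewrite eq_le; apply/andP; split.
  by rewrite (le_trans (opn_comp _ _))// expr2 ler_wpM2r ?opn_ge0 ?opn_adj_le.
rewrite -[leRHS]sqr_sqrtr ?opn_ge0// ler_pXn2r ?nnegrE ?opn_ge0 ?sqrtr_ge0//.
apply: opn_le; first exact: sqrtr_ge0.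
apply: bb_adj_comp; first exact: sqrtr_ge0.
by rewrite sqr_sqrtr ?opn_ge0//; exact: bb_opn.
Qed.

Lemma bop_complete (u : nat -> bop K) :
  (forall e : R, 0 < e -> exists N, forall n m, (N <= n)%N -> (N <= m)%N ->
     bb (u n - u m) e) ->
  exists T, forall e : R, 0 < e -> exists N, forall n, (N <= n)%N ->
    bb (u n - T) e.
Proof.
move=> cu.
have cux x : cauchy_seq_nrm (fun n => u n x).
  move=> e e0; have d0 : 0 < e / (nrm x + 1).
    by rewrite divr_gt0// ltr_wpDl ?nrm_ge0.
  have [N hN] := cu _ d0; exists N => n m Nn Nm.
  rewrite (le_trans (hN n m Nn Nm x))// mulrAC ler_pdivrMr.
    by rewrite ler_pM2l// lerDl.
  by rewrite ltr_wpDl ?nrm_ge0.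
have /choice[T hT] x : exists l, tends (fun n => u n x) l.
  exact: complete_tends (cux x).
have close e : 0 < e -> exists N, forall n, (N <= n)%N ->
    forall x, nrm (u n x - T x) <= e * nrm x.
  move=> e0; have [N hN] := cu e e0; exists N => n Nn x.
  apply/ler_addgt0Pr => d d0; have [N' hN'] := hT x d d0.
  rewrite (le_trans (nrm_trans (u (maxn N N') x) _ _))// lerD//.
    by apply: hN => //; exact: leq_maxl.
  by apply: hN'; exact: leq_maxr.
have lT : linear T.
  move=> a x y; apply/eqP; rewrite -subr_eq0; apply/eqP/nrm_eps0 => e e0.
  pose C0 := nrm (a *: x + y) + cabs a * nrm x + nrm y + 1.
  have C00 : 0 < C0 by rewrite ltr_wpDl// !addr_ge0 ?mulr_ge0 ?nrm_ge0 ?cabs_ge0.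
  have [N hN] := close (e / C0) (divr_gt0 e0 C00).
  have h z := hN N (leqnn _) z.
  have -> : T (a *: x + y) - (a *: T x + T y) =
     (T (a *: x + y) - u N (a *: x + y)) - (a *: (T x - u N x) + (T y - u N y)).
    by rewrite bop_lin scalerBr addrACA -opprD opprB addrA subrK.
  rewrite (le_trans (nrmB _ _))// (le_trans (lerD (lexx _) (nrmD _ _)))//.
  rewrite nrmZ !(nrmBC (T _)).
  have h1 := h (a *: x + y); have h2 := h x; have h3 := h y.
  have h2' := ler_wpM2l (cabs_ge0 a) h2.
  have et : e = e / C0 * C0 by rewrite divfK// gt_eqF.
  have d0 : 0 <= e / C0 by rewrite divr_ge0 ?ltW.
  move: h1 h2' h3 et d0; rewrite mulrCA; move: (e / C0) => t h1 h2' h3 -> d0.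
  rewrite /C0 !mulrDr mulr1; lra.
have [N hN] := close 1 ltr01.
have [M M0 hM] := bop_bb (u N).
have bT : bb T (M + 1).
  move=> x; rewrite -[T x](subrK (u N x)) (le_trans (nrmD _ _))// addrC.
  by rewrite mulrDl lerD// nrmBC hN.
have [S hS] := mkbop_ex lT bT; exists S => e e0.
by have [N' hN'] := close e e0; exists N' => n Nn x; rewrite bopBE hS hN'.
Qed.

(** Lax-Milgram for the form [hip x (T y)]. Such inverses are the only functional calculus used for
    Hilbert space operators: square roots and spectral projections are replaced by rational
    functions. *)
Lemma pos_inverse T (d : R) : 0 < d -> adj T = T ->
  (forall x, d * nrm x ^+ 2 <= complex.Re (hip x (T x))) ->
  exists U : bop K, [/\ adj U = U, bcomp T U = bid, bcomp U T = bid &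
     bb U d^-1].
Proof.
move=> d0 sT pT; have [M M0 hM] := bop_bb T.
have Bs : semi_ip (fun x y => hip x (T y)).
  split=> [a x y z|x y|x]; first by rewrite bop_lin hip_linear.
    by rewrite -[in LHS]sT -adjP hip_conj.
  by rewrite (le_trans _ (pT x))// mulr_ge0 ?sqr_ge0 ?ltW.
have BM x : complex.Re (hip x (T x)) <= M * nrm x ^+ 2.
  rewrite (le_trans (ler_norm _))// (le_trans (Re_le_cabs _))//.
  rewrite (le_trans (hip_CS _ _))// expr2 mulrCA ler_wpM2l ?nrm_ge0//.
have /choice[U hU] y : exists x, forall z, hip y z = hip x (T z).
  apply: (@Lax_Milgram _ _ _ Bs d M d0 pT BM (hip y) (nrm y)).
    by move=> a x z; rewrite hip_linear.
  exact: hip_CS.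
have TU y : T (U y) = y.
  by apply: hip_extl => z; rewrite (hU y z) -[in RHS]sT -adjP.
have inj x y : T x = T y -> x = y.
  move=> h; apply/eqP; rewrite -subr_eq0; apply/eqP/nrm0_eq0/eqP.
  rewrite -sqrf_eq0 eq_le sqr_ge0 andbT -(ler_pM2l d0) mulr0.
  by rewrite (le_trans (pT _))// bopB h subrr hip0r.
have lU : linear U by move=> a x y; apply: inj; rewrite bop_lin !TU.
have bU : bb U d^-1.
  move=> y; have := pT (U y); rewrite TU => h.
  have h2 : d * nrm (U y) ^+ 2 <= nrm (U y) * nrm y.
    rewrite (le_trans h)// (le_trans (ler_norm _))//.
    by rewrite (le_trans (Re_le_cabs _))// hip_CS.
  rewrite ler_pdivlMl//; have := nrm_ge0 (U y).
  rewrite le_eqVlt => /predU1P[<-|p]; first by rewrite mulr0 nrm_ge0.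
  by rewrite -(ler_pM2l p) (le_trans _ h2)// mulrCA expr2.
have [V hV] := mkbop_ex lU bU; exists V; split.
- apply/esym/adj_uniq => x y; rewrite !hV -{1}(TU y).
  by rewrite -{1}sT -adjP TU.
- by apply: bop_ext => x; rewrite bcompE hV TU.
- by apply: bop_ext => x; apply: inj; rewrite bcompE hV TU.
- by move=> x; rewrite hV; exact: bU.
Qed.

End Operators.

Record ultra (I : Type) := Ultra {
  uset :> set I -> Prop ; ultraP : @UltraFilter I uset }.
#[export] Existing Instance ultraP.

(** * Limits along an ultrafilter *)

Section UltraLimits.
Context {R : realType} {I : Type} {U : ultra I}.
Implicit Types (f g : I -> R[i]) (l : R[i]).

Definition ucv f l := forall e : R, 0 < e -> U [set i | cabs (f i - l) <= e].
Definition ubd f := exists M : R, U [set i | cabs (f i) <= M].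
(** One-sided: it expresses convergence to 0 for nonnegative f, such as norms and distances. *)
Definition unull (f : I -> R) := forall e : R, 0 < e -> U [set i | f i <= e].

Lemma ufilter (P Q : I -> Prop) : U [set i | P i] -> (forall i, P i -> Q i) ->
  U [set i | Q i].
Proof. by move=> h PQ; apply: filterS h => i; exact: PQ. Qed.

Lemma ufilter2 (P1 P2 Q : I -> Prop) : U [set i | P1 i] -> U [set i | P2 i] ->
  (forall i, P1 i -> P2 i -> Q i) -> U [set i | Q i].
Proof.
by move=> h1 h2 PQ; apply: filterS (filterI h1 h2) => i [/PQ]; exact.
Qed.

Lemma uex (P : I -> Prop) : U [set i | P i] -> exists i, P i.
Proof. by move=> /filter_ex. Qed.

Lemma utrue (P : I -> Prop) : (forall i, P i) -> U [set i | P i].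
Proof. by move=> h; apply: filterS filterT => i _; exact: h. Qed.

Lemma u_or_not (P : I -> Prop) : U [set i | P i] \/ U [set i | ~ P i].
Proof. exact: (in_ultra_setVsetC [set i | P i] (ultraP U)). Qed.

(** The limit is the supremum of the x with [x <= f i] for almost all i. The ultrafilter decides
    whether [sup S + e <= f i] almost everywhere, and the definition of the supremum excludes
    this. *)
Lemma ucv_real (f : I -> R) (M : R) : U [set i | `|f i| <= M] ->
  exists l : R, forall e : R, 0 < e -> U [set i | `|f i - l| <= e].
Proof.
move=> hM; pose S := [set x : R | U [set i | x <= f i]].
have supS : has_sup S.
  split.
    exists (- M); rewrite /S /=; apply: (ufilter hM) => i.
    by rewrite ler_norml => /andP[].
  exists M => x Sx; have [i [h1 h2]] := uex (filterI hM Sx).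
  by rewrite (le_trans h2)// (le_trans (ler_norm _)).
exists (sup S) => e e0.
have h1 : U [set i | sup S - e <= f i].
  have [x Sx h] := sup_adherent e0 supS.
  by apply: (ufilter Sx) => i; exact/le_trans/ltW.
have h2 : U [set i | f i <= sup S + e].
  have [h|h] := u_or_not (fun i => sup S + e <= f i).
    have : sup S + e <= sup S by apply: ub_le_sup h; exact: supS.2.
    by rewrite gerDl leNgt e0.
  by apply: (ufilter h) => i /negP; rewrite -ltNge => /ltW.
apply: (ufilter2 h1 h2) => i k1 k2.
by rewrite ler_norml lerBlDl lerBrDl k1 k2.
Qed.

Lemma ucv_ex f : ubd f -> exists l, ucv f l.
Proof.
move=> [M hM].
have [|a ha] := @ucv_real (fun i => complex.Re (f i)) M.
  by apply: (ufilter hM) => i; apply/le_trans/Re_le_cabs.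
have [|b hb] := @ucv_real (fun i => complex.Im (f i)) M.
  by apply: (ufilter hM) => i; apply/le_trans/Im_le_cabs.
exists (a +i* b) => e e0; have e20 : 0 < e / 2 by rewrite divr_gt0.
apply: (ufilter2 (ha _ e20) (hb _ e20)) => i h1 h2.
rewrite (le_trans (cabs_le _))// cReB cImB [leRHS]splitr.
exact: lerD.
Qed.

Lemma ucv_bd f l : ucv f l -> ubd f.
Proof.
move=> h; exists (cabs l + 1); apply: (ufilter (h 1 ltr01)) => i hi.
by rewrite -(subrK l (f i)) addrC (le_trans (cabsD _ _))// lerD2l.
Qed.

Lemma ucv_unique f l l' : ucv f l -> ucv f l' -> l = l'.
Proof.
move=> h h'; apply/eqP; rewrite -subr_eq0; apply/eqP/cabs0_eq0/eqP.
rewrite eq_le cabs_ge0 andbT; apply/ler_addgt0Pr => e e0; rewrite add0r.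
have e20 : 0 < e / 2 by rewrite divr_gt0.
have [i [h1 h2]] := uex (filterI (h _ e20) (h' _ e20)).
have -> : l - l' = (f i - l') - (f i - l) by rewrite opprB [RHS]addrC addrA subrK.
by rewrite (le_trans (cabsB _ _))// [leRHS]splitr lerD.
Qed.

Definition ulim f : R[i] := xget 0 [set l | ucv f l].

Lemma ulimP f : ubd f -> ucv f (ulim f).
Proof. by move=> /ucv_ex[l hl]; rewrite /ulim; case: xgetP => // /(_ l). Qed.

Lemma ulimE f l : ucv f l -> ulim f = l.
Proof. by move=> h; apply: ucv_unique (ulimP (ucv_bd h)) h. Qed.

Lemma ucv_ext f g l : U [set i | f i = g i] -> ucv f l -> ucv g l.
Proof.
by move=> h hf e e0; apply: (ufilter2 h (hf e e0)) => i ->.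
Qed.

Lemma ucv_cst l : ucv (fun=> l) l.
Proof. by move=> e e0; apply: utrue => i; rewrite subrr cabs0 ltW. Qed.

Lemma ucvD f g l l' : ucv f l -> ucv g l' -> ucv (fun i => f i + g i) (l + l').
Proof.
move=> h h' e e0; have e20 : 0 < e / 2 by rewrite divr_gt0.
apply: (ufilter2 (h _ e20) (h' _ e20)) => i h1 h2.
by rewrite opprD addrACA (le_trans (cabsD _ _))// [leRHS]splitr lerD.
Qed.

Lemma ucvZ a f l : ucv f l -> ucv (fun i => a * f i) (a * l).
Proof.
move=> h e e0; have d0 : 0 < e / (cabs a + 1).
  by rewrite divr_gt0// ltr_wpDl ?cabs_ge0.
apply: (ufilter (h _ d0)) => i hi; rewrite -mulrBr cabsM.
rewrite (le_trans (ler_wpM2l (cabs_ge0 a) hi))// mulrCA.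
rewrite ler_piMr ?(ltW e0)// ler_pdivrMr ?mul1r ?lerDl//.
by rewrite ltr_wpDl ?cabs_ge0.
Qed.

Lemma ucvN f l : ucv f l -> ucv (fun i => - f i) (- l).
Proof.
by move=> h e e0; apply: (ufilter (h e e0)) => i; rewrite -opprD cabsN.
Qed.

Lemma ucvB f g l l' : ucv f l -> ucv g l' -> ucv (fun i => f i - g i) (l - l').
Proof. by move=> h h'; apply: ucvD => //; apply: ucvN. Qed.

Lemma ucv_conj f l : ucv f l -> ucv (fun i => conjc (f i)) (conjc l).
Proof.
by move=> h e e0; apply: (ufilter (h e e0)) => i; rewrite -conjB cabs_conj.
Qed.

Lemma ucv_sum (J : Type) (s : seq J) (P : pred J) (f : J -> I -> R[i])
    (m : J -> R[i]) :
  (forall j, ucv (f j) (m j)) ->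
  ucv (fun i => \sum_(j <- s | P j) f j i) (\sum_(j <- s | P j) m j).
Proof.
move=> h; elim: s => [|j s IH].
  by rewrite big_nil; under [X in ucv X]eq_fun => i do rewrite big_nil;
     exact: ucv_cst.
rewrite big_cons; under [X in ucv X]eq_fun => i do rewrite big_cons.
by case: (P j) => //; apply: ucvD.
Qed.

Lemma ucv_Re_le f l (M : R) : ucv f l -> U [set i | complex.Re (f i) <= M] ->
  complex.Re l <= M.
Proof.
move=> h hM; apply/ler_addgt0Pr => e e0.
have [i [h1 h2]] := uex (filterI (h e e0) hM).
have -> : l = f i - (f i - l) by rewrite opprB addrC subrK.
rewrite cReB lerD// (le_trans _ h1)// (le_trans (ler_norm _))//.
by rewrite normrN Re_le_cabs.
Qed.

Lemma ucv_Re_ge f l (M : R) : ucv f l -> U [set i | M <= complex.Re (f i)] ->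
  M <= complex.Re l.
Proof.
move=> h hM; rewrite -lerN2 -cReN; apply: (ucv_Re_le (ucvN h)).
by apply: (ufilter hM) => i; rewrite cReN lerN2.
Qed.

Lemma ucv0_le f (g : I -> R) : (forall i, cabs (f i) <= g i) -> unull g ->
  ucv f 0.
Proof.
move=> h hg e e0; apply: (ufilter (hg e e0)) => i hi.
by rewrite subr0 (le_trans (h i)).
Qed.

Lemma unull_le (f g : I -> R) : (forall i, f i <= g i) -> unull g -> unull f.
Proof. by move=> h hg e e0; apply: (ufilter (hg e e0)) => i; exact: le_trans. Qed.

Lemma unullD (f g : I -> R) : unull f -> unull g -> unull (fun i => f i + g i).
Proof.
move=> hf hg e e0; have e20 : 0 < e / 2 by rewrite divr_gt0.
apply: (ufilter2 (hf _ e20) (hg _ e20)) => i h1 h2.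
by rewrite [leRHS]splitr lerD.
Qed.

Lemma unullZ (M : R) (f : I -> R) : unull f -> unull (fun i => `|M| * f i).
Proof.
move=> hf e e0; have d0 : 0 < e / (`|M| + 1).
  by rewrite divr_gt0// ltr_wpDl.
apply: (ufilter (hf _ d0)) => i hi.
rewrite (le_trans (ler_wpM2l (normr_ge0 M) hi))// mulrCA.
by rewrite ler_piMr ?(ltW e0)// ler_pdivrMr ?mul1r ?lerDl// ltr_wpDl.
Qed.

Lemma unull_sqr (f : I -> R) : (forall i, 0 <= f i) ->
  ucv (fun i => (f i ^+ 2)%:C) 0 -> unull f.
Proof.
move=> f0 h e e0; apply: (ufilter (h _ (exprn_gt0 2 e0))) => i.
rewrite subr0 cabs_real ger0_norm ?sqr_ge0//.
by rewrite ler_pXn2r ?nnegrE ?(ltW e0).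
Qed.

End UltraLimits.
Arguments ucv {R I} U f l.
Arguments ubd {R I} U f.
Arguments unull {R I} U f.
Arguments ulim {R I} U f.

(** * Finite families of vectors and bounds on matrices of operators *)

Section Families.
Context {R : realType} {V : normedModType R[i]} {I : finType}.
Implicit Types (x y : I -> V) (T : I -> I -> V -> V).

Lemma l2norm_sq x : l2norm x ^+ 2 = \sum_i nrm (x i) ^+ 2.
Proof. by rewrite sqr_sqrtr// sumr_ge0// => i _; rewrite sqr_ge0. Qed.

Lemma l2norm_ge0 x : 0 <= l2norm x.
Proof. exact: sqrtr_ge0. Qed.

Lemma l2norm_le x (M : R) : 0 <= M ->
  \sum_i nrm (x i) ^+ 2 <= M ^+ 2 -> l2norm x <= M.
Proof.
by move=> M0 h; rewrite -(@ler_pXn2r _ 2) ?nnegrE ?l2norm_ge0// l2norm_sq.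
Qed.

Lemma nrm_le_l2norm x i : nrm (x i) <= l2norm x.
Proof.
rewrite -(@ler_pXn2r _ 2) ?nnegrE ?l2norm_ge0 ?nrm_ge0// l2norm_sq.
by rewrite (bigD1 i)//= lerDl sumr_ge0// => j _; rewrite sqr_ge0.
Qed.

Lemma l2norm_le_sum x : l2norm x <= \sum_i nrm (x i).
Proof.
apply: l2norm_le; first by rewrite sumr_ge0// => i _; exact: nrm_ge0.
rewrite expr2 mulr_suml ler_sum// => i _.
rewrite expr2 ler_wpM2l ?nrm_ge0// (bigD1 i)//= lerDl.
by rewrite sumr_ge0// => j _; exact: nrm_ge0.
Qed.

Lemma l2normZ (a : R[i]) x : l2norm (fun i => a *: x i) = cabs a * l2norm x.
Proof.
apply/eqP; rewrite -(@eqrXn2 _ 2) ?mulr_ge0 ?l2norm_ge0 ?cabs_ge0//.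
rewrite exprMn !l2norm_sq mulr_sumr; apply/eqP/eq_bigr => i _.
by rewrite nrmZ exprMn.
Qed.

(** The relation [opmx_norm T <= M] without extended reals; [opmx_norm_le] and [mb_opmx_norm]
    translate between the two. *)
Definition mb (T : I -> I -> V -> V) (M : R) := forall x : I -> V,
  l2norm (fun i => \sum_j T i j (x j)) <= M * l2norm x.

Lemma opmx_norm_le T (M : R) : 0 <= M -> mb T M -> (opmx_norm T <= M%:E)%E.
Proof.
move=> M0 h; apply: ge_ereal_sup => _ [x /= x1 <-]; rewrite lee_fin.
by rewrite (le_trans (h x))// ler_piMr.
Qed.

Lemma mb_opmx_norm T (M : R) :
  (forall i j (a : R[i]) (y : V), T i j (a *: y) = a *: T i j y) ->
  (opmx_norm T <= M%:E)%E -> mb T M.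
Proof.
move=> hT h x; have [x0|x0] := eqVneq (l2norm x) 0.
  have xi i : x i = 0.
    by apply: nrm0_eq0; apply/eqP; rewrite eq_le nrm_ge0 -x0 nrm_le_l2norm.
  rewrite x0 mulr0 -x0.
  suff -> : (fun i => \sum_j T i j (x j)) = x by [].
  apply/funext => i; rewrite xi big1// => j _.
  by rewrite xi -(scale0r 0) hT !scale0r.
have xp : 0 < l2norm x by rewrite lt_neqAle eq_sym x0 l2norm_ge0.
pose a : R[i] := ((l2norm x)^-1)%:C.
have ca : cabs a = (l2norm x)^-1.
  by rewrite cabs_real ger0_norm// invr_ge0 l2norm_ge0.
have : ((l2norm (fun i => \sum_j T i j (a *: x j)))%:E <= M%:E)%E.
  rewrite (le_trans _ h)//; apply: ereal_sup_ubound => /=.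
  by exists (fun i => a *: x i) => //=; rewrite l2normZ ca mulVf.
rewrite lee_fin.
have -> : (fun i => \sum_j T i j (a *: x j)) =
          (fun i => a *: \sum_j T i j (x j)).
  by apply/funext => i; rewrite scaler_sumr; apply: eq_bigr => j _.
by rewrite l2normZ ca ler_pdivrMl// mulrC.
Qed.

Lemma mb_le T (M N : R) : mb T M -> M <= N -> mb T N.
Proof.
by move=> h MN x; rewrite (le_trans (h x))// ler_wpM2r ?l2norm_ge0.
Qed.

Lemma mb_eps T (M : R) : (forall e : R, 0 < e -> mb T (M + e)) -> mb T M.
Proof.
move=> h x; apply/ler_addgt0Pr => e e0.
have d0 : 0 < e / (l2norm x + 1) by rewrite divr_gt0// ltr_wpDl ?l2norm_ge0.
rewrite (le_trans (h _ d0 x))// mulrDl lerD2l mulrAC ler_pdivrMr.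
  by rewrite ler_pM2l// lerDl.
by rewrite ltr_wpDl ?l2norm_ge0.
Qed.

End Families.

Section MatricesOfOperators.
Context {R : realType} {K : hilbertType R} {I : finType}.
Implicit Types (x y : I -> K) (S T : I -> I -> bop K).

Definition famip x y : R[i] := \sum_i hip (x i) (y i).

Lemma famip_semi : semi_ip (famip : (I -> K) -> (I -> K) -> R[i]).
Proof.
split=> [a x y z|x y|x].
- by rewrite /famip mulr_sumr -big_split; apply: eq_bigr => i _;
    rewrite /= -hip_linear.
- by rewrite /famip conj_sum; apply: eq_bigr => i _; rewrite -hip_conj.
- by rewrite /famip Re_sum sumr_ge0// => i _; exact: Re_hip_ge0.
Qed.

Lemma famip_nrm x : famip x x = (l2norm x ^+ 2)%:C.
Proof.
rewrite l2norm_sq /famip rmorph_sum /=.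
by apply: eq_bigr => i _; rewrite hip_nrm.
Qed.

Lemma famip_CS x y : cabs (famip x y) <= l2norm x * l2norm y.
Proof.
have := semi_CS_sqrt famip_semi x y.
by rewrite !famip_nrm /= !sqrtr_sqr !ger0_norm ?l2norm_ge0.
Qed.

Lemma l2normD x y : l2norm (fun i => x i + y i) <= l2norm x + l2norm y.
Proof.
rewrite -(@ler_pXn2r _ 2) ?nnegrE ?addr_ge0 ?l2norm_ge0//.
have := semi_sqD famip_semi x y; rewrite !famip_nrm /= => ->.
rewrite sqrrD lerD2r lerD2l lerMn2r/= (le_trans (ler_norm _))//.
by rewrite (le_trans (Re_le_cabs _))// famip_CS.
Qed.

Definition mapp T x : I -> K := fun i => \sum_j T i j (x j).
Definition mmul S T : I -> I -> bop K :=
  fun i k => \sum_j bcomp (S i j) (T j k).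
Definition madj T : I -> I -> bop K := fun i j => adj (T j i).

Lemma mmulE S T x : mapp (mmul S T) x = mapp S (mapp T x).
Proof.
apply/funext => i; rewrite /mapp /mmul.
under eq_bigr => j _ do rewrite bop_sumE.
rewrite exchange_big /=; apply: eq_bigr => j _.
by rewrite bop_sum; apply: eq_bigr.
Qed.

Lemma madjP T x y : famip (mapp T x) y = famip x (mapp (madj T) y).
Proof.
rewrite /famip /mapp.
under eq_bigr => i _ do rewrite hip_suml.
rewrite exchange_big /=; apply: eq_bigr => j _.
by rewrite hip_sumr; apply: eq_bigr => i _; rewrite adjP.
Qed.

Lemma mb_mul S T (M N : R) : 0 <= M -> mb S M -> mb T N ->
  mb (mmul S T) (M * N).
Proof.
move=> M0 hS hT x; have := mmulE S T x; rewrite /mapp => ->.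
rewrite (le_trans (hS _))// -mulrA ler_wpM2l//; exact: hT.
Qed.

Lemma mbD S T (M N : R) : mb S M -> mb T N ->
  mb (fun i j => (S i j + T i j)) (M + N).
Proof.
move=> hS hT x.
have -> : (fun i => \sum_j (S i j + T i j) (x j)) =
   (fun i => \sum_j S i j (x j) + \sum_j T i j (x j)).
  by apply/funext => i; rewrite -big_split.
by rewrite (le_trans (l2normD _ _))// mulrDl; apply: lerD; [exact: hS|exact: hT].
Qed.

Lemma mb_adj T (M : R) : 0 <= M -> mb T M -> mb (madj T) M.
Proof.
move=> M0 h x; set y := (fun i => _).
have [->|y0] := eqVneq (l2norm y) 0.
  by rewrite mulr_ge0 ?l2norm_ge0.
have n0 : 0 < l2norm y by rewrite lt_neqAle eq_sym y0 l2norm_ge0.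
rewrite -(ler_pM2r n0) -expr2.
have : famip y y = famip (mapp T y) x by rewrite madjP.
rewrite famip_nrm => /(congr1 (@complex.Re R)) /= ->.
rewrite (le_trans (ler_norm _))// (le_trans (Re_le_cabs _))//.
rewrite (le_trans (famip_CS _ _))// mulrAC ler_wpM2r ?l2norm_ge0//.
exact: h.
Qed.

Lemma mb_adj_mul T (M : R) : 0 <= M -> mb (mmul (madj T) T) (M ^+ 2) -> mb T M.
Proof.
move=> M0 h x.
rewrite -(@ler_pXn2r _ 2) ?nnegrE ?mulr_ge0 ?l2norm_ge0//.
have -> : l2norm (fun i => \sum_j T i j (x j)) ^+ 2 =
    complex.Re (famip (mapp T x) (mapp T x)) by rewrite famip_nrm.
rewrite madjP -mmulE.
rewrite (le_trans (ler_norm _))// (le_trans (Re_le_cabs _))//.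
rewrite (le_trans (famip_CS _ _))// exprMn [X in _ <= _ * X]expr2 mulrCA.
by rewrite ler_wpM2l ?l2norm_ge0//; exact: h.
Qed.

(** The constant is crude. It serves to start a [halving] argument, to show that a norm is finite,
    or to bound matrices whose entries can be made as small as needed. *)
Lemma mb_entries T (m : R) : 0 <= m -> (forall i j, bb (T i j) m) ->
  mb T (#|I|%:R ^+ 2 * m).
Proof.
move=> m0 h x; rewrite (le_trans (l2norm_le_sum _))//.
have hs i : nrm (\sum_j T i j (x j)) <= #|I|%:R * (m * l2norm x).
  rewrite (le_trans (nrm_sum _ _ _))//.
  rewrite mulr_natl -sumr_const ler_sum// => j _.
  by rewrite (le_trans (h i j _))// ler_wpM2l// nrm_le_l2norm.
rewrite -mulrA expr2 -mulrA mulr_natl -sumr_const.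
by rewrite ler_sum.
Qed.

Lemma mb_entry T (M : R) : mb T M -> forall i j, bb (T i j) M.
Proof.
move=> h i j x; pose y k := if k == j then x else 0.
have yj : l2norm y = nrm x.
  apply/eqP; rewrite -(@eqrXn2 _ 2) ?l2norm_ge0 ?nrm_ge0// l2norm_sq.
  rewrite (bigD1 j)//= /y eqxx big1 ?addr0// => k /negbTE ->.
  by rewrite nrm0 expr0n.
have -> : T i j x = (fun i => \sum_k T i k (y k)) i.
  rewrite /= (bigD1 j)//= /y eqxx big1 ?addr0// => k /negbTE ->.
  by rewrite bop0.
by rewrite -yj (le_trans _ (h y))//;
  exact: (nrm_le_l2norm (fun i => \sum_k T i k (y k))).
Qed.

End MatricesOfOperators.

Record opalg (R : realType) (K : hilbertType R) := OpAlg {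
  opset : set (bop K) ;
  opset_lin : forall a S T, opset S -> opset T -> opset (a *: S + T) ;
  opset_mul : forall S T, opset S -> opset T -> opset (bcomp S T) ;
  opset_adj : forall S, opset S -> opset (adj S) ;
  opset_id : opset bid ;
  opset_closed : forall T,
    (forall e : R, 0 < e -> exists2 S, opset S & bb (T - S) e) -> opset T }.

(** * Operator algebras and their representations *)

Section OperatorAlgebra.
Context {R : realType} {K : hilbertType R}.

Definition opred (A : opalg K) : {pred (bop K)} := fun T => `[< opset A T >].

Lemma opset0 (A : opalg K) : opset A 0.
Proof.
have := opset_lin (-1) (opset_id A) (opset_id A).
by rewrite scaleN1r addNr.
Qed.

Lemma opred_submod (A : opalg K) : submod_closed (opred A).
Proof.
split; first exact/asboolP/opset0.
by move=> a S T /asboolP hS /asboolP hT; apply/asboolP/opset_lin.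
Qed.

HB.instance Definition _ (A : opalg K) := GRing.isSubmodClosed.Build R[i] (bop K)
  (opred A) (opred_submod A).

End OperatorAlgebra.

Record opel (R : realType) (K : hilbertType R) (A : opalg K) := Opel {
  opval :> bop K ; _ : opval \in opred A }.

HB.instance Definition _ R K A := [isSub for @opval R K A].
HB.instance Definition _ R K A := [Choice of @opel R K A by <:].
HB.instance Definition _ R K A := [SubChoice_isSubLmodule of @opel R K A by <:].

Section OperatorAlgebraNorm.
Context {R : realType} {K : hilbertType R} {A : opalg K}.
Implicit Types x y : opel A.

Lemma opvalP x : opset A x.
Proof. by case: x => T /= /asboolP. Qed.

Definition mkopel (T : bop K) (h : opset A T) : opel A := Opel (asboolT h).

Lemma opvalD x y : opval (x + y) = opval x + opval y. Proof. by []. Qed.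
Lemma opvalZ a x : opval (a *: x) = a *: opval x. Proof. by []. Qed.

Lemma opel_inj x y : opval x = opval y -> x = y.
Proof. exact: val_inj. Qed.

Let norm x : R[i] := (opn x)%:C.

Fact opel_normD x y : norm (x + y) <= norm x + norm y.
Proof. by rewrite /norm -rmorphD lecR opnD. Qed.

Fact opel_normZ a x : norm (a *: x) = `|a| * norm x.
Proof. by rewrite /norm opvalZ opnZ normcE rmorphM. Qed.

Fact opel_norm0 x : norm x = 0 -> x = 0.
Proof. by move=> /realC_inj /opn_eq0 h; exact: opel_inj. Qed.

HB.instance Definition _ := Lmodule_isNormed.Build R[i] (opel A)
  opel_normD opel_normZ opel_norm0.

Lemma nrm_opel x : nrm x = opn x. Proof. by []. Qed.

Fact opel_seq_complete (u : nat -> opel A) :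
  cauchy_seq_nrm u -> exists l, tends u l.
Proof.
move=> cu; have [|T hT] := @bop_complete R K (fun n => opval (u n)).
  move=> e e0; have [N hN] := cu e e0; exists N => n m Nn Nm.
  by apply: bb_le (hN n m Nn Nm); rewrite nrm_opel; exact: bb_opn.
have AT : opset A T.
  apply: opset_closed => e e0; have [N hN] := hT e e0.
  exists (u N); first exact: opvalP.
  by rewrite -opprB; apply: bbN; apply: hN.
exists (mkopel AT) => e e0; have [N hN] := hT e e0; exists N => n Nn.
by rewrite nrm_opel; apply: opn_le; [exact: ltW|exact: hN].
Qed.

HB.instance Definition _ := Uniform_isComplete.Build (opel A)
  (seq_complete opel_seq_complete).

Definition opel_mul x y : opel A := mkopel (opset_mul (opvalP x) (opvalP y)).
Definition opel_star x : opel A := mkopel (opset_adj (opvalP x)).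
Definition opel1 : opel A := mkopel (opset_id A).

Definition opalg_cstar : cstarAlgebra R.
Proof.
apply: (@CstarAlgebra R (opel A) opel_mul opel_star).
- by move=> x y z; apply: opel_inj; exact: bcompA.
- by move=> a x y z; apply: opel_inj; exact: bcomp_linl.
- by move=> a x y z; apply: opel_inj; exact: bcomp_linr.
- by move=> x y; rewrite !nrmE -rmorphM lecR opn_comp.
- by move=> a x y; apply: opel_inj; rewrite /= adjD adjZ.
- by move=> x y; apply: opel_inj; exact: adj_comp.
- by move=> x; apply: opel_inj; exact: adjK.
- by move=> x; rewrite !nrmE -rmorphXn /= nrm_opel opn_cstar.
Defined.

End OperatorAlgebraNorm.
Arguments opalg_cstar {R K} A.

(** Meant for [P k]: an estimate holds with constant k for all elements. The step from s to s/2 is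
    the C*-identity, since (1 + s/2)^2 >= 1 + s. *)
Lemma halving (R : realType) (P : R -> Prop) (t : R) : 0 <= t ->
  (forall s, 0 <= s -> P (1 + s) -> P (1 + s / 2)) ->
  (forall s s', s <= s' -> P s -> P s') ->
  P (1 + t) -> forall e, 0 < e -> P (1 + e).
Proof.
move=> t0 hP mP Pt e e0.
have Pk k : P (1 + t / 2 ^+ k).
  elim: k => [|k IH]; first by rewrite expr0 divr1.
  have -> : t / 2 ^+ k.+1 = t / 2 ^+ k / 2.
    by rewrite exprSr invfM mulrA.
  by apply: hP => //; rewrite divr_ge0// exprn_ge0.
apply: mP (Pk (Num.truncn (t / e)).+1); rewrite lerD2l.
rewrite ler_pdivrMr ?exprn_gt0// mulrC -ler_pdivrMr//.
rewrite (le_trans (ltW (truncnS_gt _)))// -natrX ler_nat.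
by rewrite ltnW// ltn_expl.
Qed.

(** * Representations of an operator algebra are completely contractive *)

Section Representations.
Context {R : realType} {K : hilbertType R} (A : opalg K).
Hypothesis opset_inv : forall T U, opset A T -> adj T = T ->
  bcomp T U = bid -> bcomp U T = bid -> opset A U.

Let B := opalg_cstar A.
Variables (L : hilbertType R) (rho : {linear B -> bop L}).
Hypothesis rhoP : star_representation rho.

Lemma repM (x y : B) : rho (cmul x y) = bcomp (rho x) (rho y).
Proof. by apply: bop_ext => v; rewrite rhoP.1. Qed.

Lemma rep_star (x : B) : rho (cstar x) = adj (rho x).
Proof. by apply: adj_uniq; exact: rhoP.2. Qed.

(* If rho a had norm m > |a|, then 1 - a^2 / m^2 would be invertible in A, hence
   1 - rho(a)^2 / m^2 bounded below, so the norm of rho(a) would be < m. *)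
Lemma rep_selfadj (a : opel A) : adj a = a -> opn (rho a) <= opn a.
Proof.
move=> sa; rewrite leNgt; apply/negP => lt_am.
set S := rho a; set m := opn S in lt_am *; set al := opn a in lt_am.
have al0 : 0 <= al by exact: opn_ge0.
have m0 : 0 < m by exact: le_lt_trans lt_am.
have sS : adj S = S by rewrite /S -rep_star; congr (rho _); exact: opel_inj.
pose c := (m ^+ 2)^-1.
have c0 : 0 < c by rewrite invr_gt0 exprn_gt0.
pose T : bop K := bid - c%:C *: bcomp a a.
have AT : opset A T.
  rewrite /T addrC -scaleNr; apply: opset_lin; last exact: opset_id.
  by apply: opset_mul; exact: opvalP.
have sT : adj T = T.
  by rewrite /T adjB adj_id adjZ adj_comp sa realC_real.
pose d := 1 - c * al ^+ 2.
have d0 : 0 < d.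
  rewrite subr_gt0 /c mulrC ltr_pdivrMr ?exprn_gt0// mul1r.
  by rewrite ltr_pXn2r ?nnegrE// ltW.
have pT x : d * nrm x ^+ 2 <= complex.Re (hip x (T x)).
  have E : hip x (a (a x)) = (nrm (a x) ^+ 2)%:C by rewrite -hip_nrm adjP sa.
  rewrite /T bopBE bopZE bidE bcompE hipBr hipZr cReB Re_hip E -rmorphM /= mulrBl mul1r lerD2l lerN2.
  rewrite -mulrA ler_pM2l// -exprMn ler_pXn2r ?nnegrE ?mulr_ge0 ?nrm_ge0//.
  exact: bb_opn.
have [U [_ TU UT _]] := pos_inverse d0 sT pT.
have AU := opset_inv AT sT TU UT.
(* [rho] may fail to preserve the unit, so it is applied to the quasi-inverse u = 1 - U; the
   relation [eqb] satisfied by u does not involve the unit. *)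
pose u : opel A := opel1 - mkopel AU.
pose b : bop L := rho u.
have eqb : c%:C *: cmul (c := B) u (cmul (c := B) a a) =
    u + c%:C *: cmul (c := B) a a.
  apply: opel_inj; rewrite opvalD !opvalZ /= bcompBl bcomp1l.
  move: UT; rewrite /T bcompBr bcomp1r bcompZr => UT.
  rewrite scalerBr -UT; set X := _ *: bcomp U _.
  have G (P Y V : bop K) : P - Y = V - Y - V + P.
    by rewrite (addrC V) addrK addrC.
  exact: G.
have eqr : c%:C *: bcomp b (bcomp S S) = b + c%:C *: bcomp S S.
  rewrite /b /S -!repM; have := congr1 rho eqb.
  by rewrite linearD !linearZ.
have key x : x = (x - c%:C *: S (S x)) - b (x - c%:C *: S (S x)).
  have h : c%:C *: b (S (S x)) = b x + c%:C *: S (S x).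
    exact: (congr1 (fun T : bop L => T x) eqr).
  rewrite bopB bopZ opprB addrA h; set X := b x; set Y := _ *: _.
  by rewrite -addrA [X + Y]addrC !addrA subrK addrK.
have [be be0 hb] := bop_bb b.
pose D := 1 + be.
have D1 : 1 <= D by rewrite lerDl.
have D0 : 0 < D by rewrite (lt_le_trans ltr01).
have low x : nrm x <= D * nrm (x - c%:C *: S (S x)).
  rewrite {1}(key x) (le_trans (nrmB _ _))// mulrDl mul1r lerD2l.
  exact: hb.
have sq x : nrm (x - c%:C *: S (S x)) ^+ 2 <= nrm x ^+ 2 - c * nrm (S x) ^+ 2.
  have E : hip x (S (S x)) = (nrm (S x) ^+ 2)%:C by rewrite -hip_nrm adjP sS.
  rewrite nrm_sqB hipZr E -rmorphM /=.
  rewrite nrmZ cabs_real ger0_norm ?(ltW c0)//.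
  have h : c * nrm (S (S x)) ^+ 2 <= nrm (S x) ^+ 2.
    rewrite /c mulrC ler_pdivrMr ?exprn_gt0// mulrC -exprMn.
    by rewrite ler_pXn2r ?nnegrE ?mulr_ge0 ?nrm_ge0 ?(ltW m0)//; exact: bb_opn.
  have h2 := ler_wpM2l (ltW c0) h.
  by rewrite exprMn expr2 -mulrA; move: h2; lra.
(* [low] and [sq] together give |x|^2 <= D^2 (|x|^2 - c |S x|^2), that is |S x|^2 <= g |x|^2; since
   g < m^2, this contradicts that m is the norm of S. *)
pose g := m ^+ 2 * (1 - (D ^+ 2)^-1).
have g0 : 0 <= g.
  rewrite mulr_ge0 ?sqr_ge0// subr_ge0 invf_le1 ?exprn_gt0//.
  by rewrite expr_ge1// ltW.
have hS : bb S (Num.sqrt g).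
  move=> x; rewrite -(@ler_pXn2r _ 2) ?nnegrE ?mulr_ge0 ?nrm_ge0 ?sqrtr_ge0//.
  rewrite exprMn sqr_sqrtr//.
  have h : nrm x ^+ 2 <= D ^+ 2 * (nrm x ^+ 2 - c * nrm (S x) ^+ 2).
    rewrite (le_trans _ (ler_wpM2l (sqr_ge0 D) (sq x)))// -exprMn.
    by rewrite ler_pXn2r ?nnegrE ?mulr_ge0 ?nrm_ge0 ?(ltW D0).
  rewrite mulrC -ler_pdivrMr ?exprn_gt0// in h.
  rewrite /g -mulrA mulrC -ler_pdivrMr ?exprn_gt0//.
  by move: h; rewrite mulrBl mul1r -/c; lra.
have : m <= Num.sqrt g by apply: opn_le => //; exact: sqrtr_ge0.
rewrite -(@ler_pXn2r _ 2) ?nnegrE ?sqrtr_ge0 ?(ltW m0)// sqr_sqrtr//.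
rewrite /g ler_pMr ?exprn_gt0// lerBrDr gerDl leNgt invr_gt0.
by rewrite exprn_gt0.
Qed.

Lemma rep_contractive (x : opel A) (M : R) : 0 <= M -> bb x M -> bb (rho x) M.
Proof.
move=> M0 hx; apply: bb_adj_comp => //; rewrite -rep_star -repM.
apply: bb_le (bb_opn _) _.
have E : adj (bcomp (adj x) x) = bcomp (adj x) x by rewrite adj_comp adjK.
apply: le_trans (@rep_selfadj (cmul (c := B) (cstar (c := B) x) x) E) _.
apply: opn_le; first exact: sqr_ge0.
by rewrite expr2; apply: bb_comp => //; apply: bb_adj.
Qed.

Section MatrixLevel.
Variable I : finType.

Let opval_sum (s : seq I) (f : I -> opel A) :
  opval (\sum_(i <- s) f i) = \sum_(i <- s) opval (f i).
Proof. by apply: (big_morph (@opval R K A)). Qed.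

(** Matrices over A are not made into a C*-algebra: the entrywise estimate holds with an extra
    factor [#|I|^2], and [halving], applied through y = x^* x, removes it. *)
Lemma rep_mx_contractive (x : I -> I -> opel A) (M : R) : 0 <= M ->
  mb (fun i j => opval (x i j) : K -> K) M ->
  mb (fun i j => rho (x i j) : L -> L) M.
Proof.
pose P (k : R) := forall (x : I -> I -> opel A) (M : R), 0 <= M ->
  mb (fun i j => opval (x i j) : K -> K) M ->
  mb (fun i j => rho (x i j) : L -> L) (k * M).
suff PP e : 0 < e -> P (1 + e).
  move=> M0 hx; apply: mb_eps => e e0.
  have d0 : 0 < e / (M + 1) by rewrite divr_gt0// ltr_wpDl.
  apply: mb_le (PP _ d0 x M M0 hx) _.
  rewrite mulrDl mul1r lerD2l mulrAC ler_pdivrMr ?ltr_wpDl//.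
  by rewrite ler_pM2l// lerDl.
apply: (@halving _ _ (#|I|%:R ^+ 2)) => {x M e}.
- exact: sqr_ge0.
- move=> s s0 hs x M M0 hx.
  have s20 : 0 <= 1 + s / 2 by rewrite addr_ge0// divr_ge0.
  apply: mb_adj_mul; first by rewrite mulr_ge0.
  pose y i j : opel A := \sum_k opel_mul (opel_star (x k i)) (x k j).
  have yE i j : opval (y i j) = mmul (madj (fun i j => opval (x i j)))
     (fun i j => opval (x i j)) i j by rewrite opval_sum.
  have ry i j : rho (y i j) = mmul (madj (fun i j => rho (x i j)))
     (fun i j => rho (x i j)) i j.
    rewrite linear_sum; apply: eq_bigr => k _.
    by rewrite repM rep_star.
  have hy : mb (fun i j => opval (y i j) : K -> K) (M ^+ 2).
    have -> : (fun i j => opval (y i j) : K -> K) =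
       (fun i j => mmul (madj (fun i j => opval (x i j)))
     (fun i j => opval (x i j)) i j) by do 2!apply/funext => ?; rewrite yE.
    by rewrite expr2; apply: mb_mul => //; apply: mb_adj.
  have := hs y (M ^+ 2) (sqr_ge0 _) hy.
  have -> : (fun i j => rho (y i j) : L -> L) =
       (fun i j => mmul (madj (fun i j => rho (x i j)))
     (fun i j => rho (x i j)) i j) by do 2!apply/funext => ?; rewrite ry.
  move=> h; apply: mb_le h _; rewrite exprMn ler_wpM2r ?sqr_ge0//.
  by rewrite sqrrD expr1n mul1r -mulr_natr divfK// lerDl sqr_ge0.
- move=> s s' ss' hs x M M0 hx; apply: mb_le (hs x M M0 hx) _.
  by rewrite ler_wpM2r.
- move=> x M M0 hx.
  apply: mb_le (mb_entries M0 (fun i j => rep_contractive M0 (mb_entry hx i j))) _.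
  by rewrite ler_wpM2r// lerDr.
Qed.

End MatrixLevel.

End Representations.

(** The norm of [cstar_opspace] is a supremum over all representations; the inclusion of A is one of
    them, and this bound shows that no other gives more. *)
Lemma cstar_mxnorm_le (R : realType) (K : hilbertType R) (A : opalg K)
    (n : nat) (x : 'M[cstar_opspace (opalg_cstar A)]_n) (M : R) :
  (forall T U, opset A T -> adj T = T ->
    bcomp T U = bid -> bcomp U T = bid -> opset A U) ->
  0 <= M -> mb (fun i j => opval (x i j) : K -> K) M ->
  (mxnorm x <= M%:E)%E.
Proof.
move=> Ainv M0 hx; apply: ge_ereal_sup => _ [L [rho [hrho ->]]].
apply: opmx_norm_le => //.
have -> : (fun i j => bop_val (map_mx rho x i j)) =
  (fun i j => rho (x i j)) by do 2!apply/funext => ?; rewrite mxE.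
exact: (rep_mx_contractive Ainv hrho).
Qed.

Section MoreUltraLimits.
Context {R : realType} {I : Type} {U : ultra I}.

Lemma ucv_eq (f g : I -> R[i]) l : ucv U f l -> (forall i, f i = g i) ->
  ucv U g l.
Proof. by move=> h fg; rewrite (_ : g = f)//; apply/funext. Qed.

Lemma ucv_near (f g : I -> R[i]) l :
  unull U (fun i => cabs (f i - g i)) -> ucv U g l -> ucv U f l.
Proof.
move=> h hg; have h0 : ucv U (fun i => f i - g i) 0.
  exact: (ucv0_le (fun i => lexx _) h).
have h1 : ucv _ _ _ := ucvD h0 hg; rewrite add0r in h1.
by apply: (ucv_eq h1) => i; rewrite subrK.
Qed.

Lemma ucvM (f g : I -> R[i]) l l' : ucv U f l -> ucv U g l' ->
  ucv U (fun i => f i * g i) (l * l').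
Proof.
move=> hf hg; have [M hM] : ubd U g := ucv_bd hg.
apply: (@ucv_near _ (fun i => l * g i)); last exact: ucvZ.
move=> e e0; have d0 : 0 < e / (`|M| + 1) by rewrite divr_gt0// ltr_wpDl.
apply: (ufilter2 (hf _ d0) hM) => i h1 h2.
rewrite -mulrBl cabsM (le_trans (ler_pM (cabs_ge0 _) (cabs_ge0 _) h1 h2))//.
rewrite mulrAC ler_pdivrMr ?ltr_wpDl// ler_pM2l//.
by rewrite (le_trans (ler_norm M))// lerDl.
Qed.

Lemma unull_bound (f : I -> R) (C : R) : 0 <= C ->
  (forall e : R, 0 < e -> U [set i | f i <= C * e]) -> unull U f.
Proof.
move=> C0 h e e0; have d0 : 0 < e / (C + 1) by rewrite divr_gt0// ltr_wpDl.
apply: (ufilter (h _ d0)) => i hi; rewrite (le_trans hi)// mulrCA.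
by rewrite ler_piMr ?(ltW e0)// ler_pdivrMr ?mul1r ?lerDl// ltr_wpDl.
Qed.

End MoreUltraLimits.

(** Cauchy-Schwarz for the matrix T amplified by the identity of l^2(I). Squares are kept on both
    sides because the squared norms of the families are what converges along an ultrafilter. *)
Lemma famip_mx_bound (R : realType) (K : hilbertType R) (I J : finType)
    (T : J -> J -> bop K) (M : R) (y x : J -> I -> K) :
  0 <= M -> mb (fun i j => T i j : K -> K) M ->
  cabs (\sum_i \sum_j famip (y i) (fun a => T i j (x j a))) ^+ 2 <=
  M ^+ 2 * ((\sum_i complex.Re (famip (y i) (y i))) *
            (\sum_i complex.Re (famip (x i) (x i)))).
Proof.
move=> M0 hT.
pose y' (p : J * I) := y p.1 p.2.
pose z (p : J * I) := \sum_j T p.1 j (x j p.2).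
have -> : \sum_i \sum_j famip (y i) (fun a => T i j (x j a)) = famip y' z.
  rewrite [RHS](_ : _ = \sum_i \sum_a hip (y i a) (z (i, a))); last first.
    by rewrite pair_bigA; apply: eq_bigr => -[].
  apply: eq_bigr => i _; rewrite exchange_big; apply: eq_bigr => a _.
  by rewrite /z hip_sumr.
have S (w : J -> I -> K) : \sum_i complex.Re (famip (w i) (w i)) =
    \sum_a \sum_i nrm (w i a) ^+ 2.
  rewrite exchange_big; apply: eq_bigr => i _.
  by rewrite famip_nrm /= l2norm_sq.
have SS (w : J * I -> K) : l2norm w ^+ 2 = \sum_a \sum_i nrm (w (i, a)) ^+ 2.
  by rewrite l2norm_sq exchange_big pair_bigA; apply: eq_bigr => -[].
have := famip_CS y' z; rewrite -(@ler_pXn2r _ 2) ?nnegrE ?cabs_ge0//; last first.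
  by rewrite mulr_ge0 ?l2norm_ge0.
move=> /le_trans; apply; rewrite exprMn [leRHS]mulrCA !SS !S; apply: ler_wpM2l.
  by rewrite sumr_ge0// => a _; rewrite sumr_ge0// => i _; rewrite sqr_ge0.
rewrite mulr_sumr ler_sum// => a _.
have h := hT (fun j => x j a).
rewrite -(@ler_pXn2r _ 2) ?nnegrE ?mulr_ge0 ?l2norm_ge0// in h.
by move: h; rewrite exprMn !l2norm_sq.
Qed.

(** * Asymptotic isometries and compressions *)

Section AsymptoticIsometry.
Context {R : realType} {K F : hilbertType R} {I : nat -> finType}.
Context {om : ultra nat}.
Variable V : forall n, F -> I n -> K.
Arguments V : clear implicits.
Hypothesis Vip : forall x y,
  ucv om (fun n => famip (V n x) (V n y)) (hip x y).

Definition ldist n (u v : I n -> K) : R := l2norm (fun a => u a - v a).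

Lemma ldist_ge0 n (u v : I n -> K) : 0 <= ldist u v.
Proof. exact: l2norm_ge0. Qed.

Lemma ldist_trans n (v u w : I n -> K) : ldist u w <= ldist u v + ldist v w.
Proof.
apply: le_trans (l2normD _ _).
rewrite /ldist; set X := l2norm _; set Y := l2norm _; suff -> : X = Y by [].
by congr l2norm; apply/funext => a; rewrite addrA subrK.
Qed.

Lemma ldistC n (u v : I n -> K) : ldist u v = ldist v u.
Proof.
rewrite /ldist -[RHS]mul1r -(normr1 R) -[`|1|]cabs_real -cabsN -l2normZ.
by congr l2norm; apply/funext => a; rewrite scaleN1r opprB.
Qed.

Lemma l2norm_comp n (T : bop K) (M : R) (u : I n -> K) : 0 <= M -> bb T M ->
  l2norm (fun a => T (u a)) <= M * l2norm u.
Proof.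
move=> M0 hT; apply: l2norm_le; first by rewrite mulr_ge0 ?l2norm_ge0.
rewrite exprMn l2norm_sq mulr_sumr ler_sum// => a _.
by rewrite -exprMn ler_pXn2r ?nnegrE ?mulr_ge0 ?nrm_ge0.
Qed.

Lemma ldist_comp n (T : bop K) (M : R) (u v : I n -> K) : 0 <= M -> bb T M ->
  ldist (fun a => T (u a)) (fun a => T (v a)) <= M * ldist u v.
Proof.
move=> M0 hT; have := l2norm_comp (fun a => u a - v a) M0 hT.
rewrite (_ : (fun a => T (u a - v a)) = fun a => T (u a) - T (v a))//.
by apply/funext => a; rewrite bopB.
Qed.

Lemma V_bound x (e : R) : 0 < e -> om [set n | l2norm (V n x) <= nrm x + e].
Proof.
move=> e0; have := Vip x x; rewrite hip_nrm => h.
apply: (ufilter (h _ (exprn_gt0 2 e0))) => n hn.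
rewrite -(@ler_pXn2r _ 2) ?nnegrE ?l2norm_ge0 ?addr_ge0 ?nrm_ge0 ?(ltW e0)//.
have h2 : l2norm (V n x) ^+ 2 - nrm x ^+ 2 <= e ^+ 2.
  apply: le_trans hn; rewrite famip_nrm -rmorphB cabs_real; exact: ler_norm.
rewrite sqrrD; move: h2; rewrite lerBlDr => /le_trans; apply.
rewrite addrC lerD2r lerDl mulrn_wge0// mulr_ge0 ?nrm_ge0 ?(ltW e0)//.
Qed.

(** [V n] is not assumed linear. The squared distance expands into nine inner products, whose limits
    cancel as they do for vectors of F. *)
Lemma V_lin a y z :
  unull om (fun n => ldist (V n (a *: y + z)) (fun i => a *: V n y i + V n z i)).
Proof.
apply: unull_sqr => [n|]; first exact: ldist_ge0.
set w := a *: y + z.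
have e1 := Vip w w; have e2 := Vip w y; have e3 := Vip w z.
have e4 := Vip y w; have e5 := Vip y y; have e6 := Vip y z.
have e7 := Vip z w; have e8 := Vip z y; have e9 := Vip z z.
have main : ucv _ _ _ := ucvB (ucvB e1 (ucvD (ucvZ a e2) e3))
   (ucvB (ucvD (ucvZ (conjc a) e4) e7)
     (ucvD (ucvD (ucvZ (conjc a) (ucvZ a e5)) (ucvZ (conjc a) e6))
       (ucvD (ucvZ a e8) e9))).
have l0 : hip w w - (a * hip w y + hip w z) - (conjc a * hip y w + hip z w -
   (conjc a * (a * hip y y) + conjc a * hip y z + (a * hip z y + hip z z))) = 0.
  by rewrite /w !(hipDr, hipDl, hipZr, hipZl); ring.
rewrite l0 in main; apply: (ucv_eq main) => n.
rewrite -famip_nrm.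
have -> : (fun i => V n w i - (a *: V n y i + V n z i)) =
   (V n w - (a *: (V n y : I n -> K) + V n z)) by [].
rewrite !(semiBr famip_semi, semiBl famip_semi, semiDr famip_semi,
  semiDl famip_semi, semiZr famip_semi, semiZl famip_semi); ring.
Qed.

Lemma V_sub y z :
  unull om (fun n => ldist (fun i => V n y i - V n z i) (V n (y - z))).
Proof.
have := V_lin (-1) z y; rewrite scaleN1r addrC => h; apply: (unull_le _ h) => n.
rewrite ldistC; set X := ldist _ _; set Y := ldist _ _; suff -> : X = Y by [].
by congr ldist; apply/funext => i; rewrite scaleN1r addrC.
Qed.

Section Compression.
Variable T : bop K.

Let form x y n := famip (V n x) (fun a => T (V n y a)).

Let form_bound (M : R) x y n : 0 <= M -> bb T M ->
  cabs (form x y n) ^+ 2 <=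
  M ^+ 2 * (complex.Re (famip (V n x) (V n x)) *
            complex.Re (famip (V n y) (V n y))).
Proof.
move=> M0 hT.
have hm : mb (fun _ _ : 'I_1 => T : K -> K) M.
  move=> u; apply: l2norm_le; first by rewrite mulr_ge0 ?l2norm_ge0.
  rewrite exprMn l2norm_sq !big_ord1 -exprMn.
  by rewrite ler_pXn2r ?nnegrE ?mulr_ge0 ?nrm_ge0.
by have := famip_mx_bound (fun _ => V n x) (fun _ => V n y) M0 hm;
  rewrite !big_ord1.
Qed.

Let form_bd x y : ubd om (form x y).
Proof.
have [M M0 hM] := bop_bb T.
exists ((nrm x + 1) * (M * (nrm y + 1))).
apply: (ufilter2 (V_bound x ltr01) (V_bound y ltr01)) => n h1 h2.
rewrite (le_trans (famip_CS _ _))// ler_pM ?l2norm_ge0//.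
by rewrite (le_trans (l2norm_comp _ M0 hM))// ler_wpM2l.
Qed.

Let lim_sq (x : F) : ucv om (fun n => (complex.Re (famip (V n x) (V n x)))%:C)
  (nrm x ^+ 2)%:C.
Proof.
have := Vip x x; rewrite hip_nrm => h; apply: (ucv_eq h) => n.
by rewrite {1}(semi_real famip_semi).
Qed.

(** The limit form is sesquilinear because the defect of linearity of [V n] vanishes in the limit.
    The bound is stated for every M that bounds T, so that P is contractive and not merely
    bounded. *)
Lemma compression_ex : exists X : bop F,
  (forall M, 0 <= M -> bb T M -> bb X M) /\
  forall x y, ucv om (form x y) (hip x (X y)).
Proof.
have [M M0 hM] := bop_bb T.
pose b x y := ulim om (form x y).
have hb x y : ucv om (form x y) (b x y) by apply/ulimP/form_bd.
have bnd N x y : 0 <= N -> bb T N -> cabs (b x y) <= N * nrm x * nrm y.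
  move=> N0 hN.
  rewrite -(@ler_pXn2r _ 2) ?nnegrE ?mulr_ge0 ?nrm_ge0 ?cabs_ge0//.
  have h1 : ucv _ _ _ := ucvM (hb x y) (ucv_conj (hb x y)); rewrite mul_conj in h1.
  have h2 : ucv _ _ _ := ucvZ (N ^+ 2)%:C (ucvM (lim_sq x) (lim_sq y)).
  have h3 : ucv _ _ _ := ucvB h2 h1.
  rewrite -subr_ge0.
  suff : 0 <= complex.Re ((N ^+ 2)%:C * ((nrm x ^+ 2)%:C * (nrm y ^+ 2)%:C) -
           (cabs (b x y) ^+ 2)%:C).
    by rewrite -!rmorphM -rmorphB /= !exprMn mulrA.
  apply: (ucv_Re_ge h3); apply: utrue => n.
  by rewrite mul_conj -!rmorphM -rmorphB /= subr_ge0; exact: form_bound.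
have [a x y z|a x y z|x y|X [_ hX]] := @sesqui_bop R F b M.
- apply: ulimE; apply: (ucv_near _ (ucvD (ucvZ a (hb x y)) (hb x z))).
  apply: (unull_le (g := (fun n => `|nrm x + 1 + l2norm (V n x)| *
    (M * ldist (V n (a *: y + z)) (fun i => a *: V n y i + V n z i))))).
    move=> n; rewrite /form.
    rewrite -(semiZr famip_semi) -(semiDr famip_semi) -(semiBr famip_semi).
    rewrite (le_trans (famip_CS _ _))// ler_pM ?l2norm_ge0//.
      rewrite (le_trans _ (ler_norm _))// lerDr addr_ge0 ?nrm_ge0//.
    have -> : ((fun i => T (V n (a *: y + z) i)) - (a *: (fun i => T (V n y i))
      + (fun i => T (V n z i)))) =
      (fun i => T (V n (a *: y + z) i - (a *: V n y i + V n z i))).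
      by apply/funext => i; rewrite bopB bopD bopZ.
    exact: l2norm_comp.
  apply: (unull_bound (C := (((nrm x + 1) * 2) * M))).
    by rewrite !mulr_ge0 ?addr_ge0 ?nrm_ge0.
  move=> e e0; apply: (ufilter2 (V_bound x ltr01) (V_lin a y z e0)) => n h1 h2.
  rewrite -mulrA ler_pM ?mulr_ge0 ?ldist_ge0 ?ler_wpM2l//.
  by rewrite ger0_norm ?addr_ge0 ?nrm_ge0 ?l2norm_ge0// mulr_natr mulr2n lerD2l.
- apply: ulimE; apply: (ucv_near _ (ucvD (ucvZ (conjc a) (hb x z)) (hb y z))).
  apply: (unull_le (g := (fun n => M * `|nrm z + 1 + l2norm (V n z)| *
    (ldist (V n (a *: x + y)) (fun i => a *: V n x i + V n y i))))).
    move=> n; rewrite /form.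
    rewrite -(semiZl famip_semi) -(semiDl famip_semi) -(semiBl famip_semi).
    rewrite (le_trans (famip_CS _ _))// mulrC ler_pM ?l2norm_ge0//.
    rewrite (le_trans (l2norm_comp _ M0 hM))// ler_wpM2l//.
    by rewrite (le_trans _ (ler_norm _))// lerDr addr_ge0 ?nrm_ge0.
  apply: (unull_bound (C := (M * ((nrm z + 1) * 2)))).
    by rewrite !mulr_ge0 ?addr_ge0 ?nrm_ge0.
  move=> e e0; apply: (ufilter2 (V_bound z ltr01) (V_lin a x y e0)) => n h1 h2.
  rewrite ler_pM ?mulr_ge0 ?ldist_ge0 ?ler_wpM2l//.
  by rewrite ger0_norm ?addr_ge0 ?nrm_ge0 ?l2norm_ge0// mulr_natr mulr2n lerD2l.
- exact: bnd.
exists X; split=> [N N0 hN y|x y]; last by rewrite hX; exact: hb.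
have := bnd N (X y) y N0 hN.
rewrite -hX hip_nrm cabs_real ger0_norm ?sqr_ge0// expr2 mulrAC.
have := nrm_ge0 (X y); rewrite le_eqVlt => /predU1P[<- _|h]; last first.
  by rewrite ler_pM2r.
by rewrite mulr_ge0 ?nrm_ge0.
Qed.

End Compression.

Definition compression (T : bop K) : bop F := projT1 (cid (compression_ex T)).

Lemma compression_bb (T : bop K) (M : R) : 0 <= M -> bb T M -> bb (compression T) M.
Proof. by rewrite /compression; case: cid => X /= [h _]; exact: h. Qed.

Lemma compressionP (T : bop K) x y :
  ucv om (fun n => famip (V n x) (fun a => T (V n y a)))
         (hip x (compression T y)).
Proof. by rewrite /compression; case: cid => X /= [_]. Qed.

Lemma compression_uniq (T : bop K) (X : bop F) :
  (forall x y, ucv om (fun n => famip (V n x) (fun a => T (V n y a)))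
     (hip x (X y))) -> compression T = X.
Proof.
move=> h; apply: bop_ext => y; apply: hip_ext => x.
exact: ucv_unique (compressionP T x y) (h x y).
Qed.

Lemma compression_lin a (S T : bop K) :
  compression (a *: S + T) = a *: compression S + compression T.
Proof.
apply: compression_uniq => x y.
rewrite bopDE bopZE hipDr hipZr.
apply: (ucv_eq (ucvD (ucvZ a (compressionP S x y)) (compressionP T x y))) => n.
rewrite -(semiZr famip_semi) -(semiDr famip_semi).
by congr famip.
Qed.

Lemma compression_adj (T : bop K) : compression (adj T) = adj (compression T).
Proof.
apply: compression_uniq => x y; rewrite -adjP hip_conj.
apply: (ucv_eq (ucv_conj (compressionP T y x))) => n.
rewrite /famip conj_sum; apply: eq_bigr => a _.
by rewrite -hip_conj adjP.
Qed.

Lemma compression_mb (J : finType) (T : J -> J -> bop K) (M : R) : 0 <= M ->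
  mb (fun i j => T i j : K -> K) M ->
  mb (fun i j => compression (T i j) : F -> F) M.
Proof.
move=> M0 hT x; set z := (fun i => _ : F).
have key (y : J -> F) : cabs (famip y z) <= M * (l2norm y * l2norm x).
  rewrite -(@ler_pXn2r _ 2) ?nnegrE ?mulr_ge0 ?l2norm_ge0 ?cabs_ge0//.
  have e : famip y z = \sum_i \sum_j hip (y i) (compression (T i j) (x j)).
    by apply: eq_bigr => i _; rewrite hip_sumr.
  have h1 : ucv om (fun n => \sum_i \sum_j
      famip (V n (y i)) (fun a => T i j (V n (x j) a))) (famip y z).
    by rewrite e; apply: ucv_sum => i; apply: ucv_sum => j; exact: compressionP.
  have h2 (w : J -> F) : ucv om (fun n => (\sum_i
       complex.Re (famip (V n (w i)) (V n (w i))))%:C) (l2norm w ^+ 2)%:C.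
    rewrite l2norm_sq rmorph_sum /=.
    have : ucv om (fun n => \sum_i famip (V n (w i)) (V n (w i)))
      (\sum_i (nrm (w i) ^+ 2)%:C).
      by apply: ucv_sum => i; rewrite -hip_nrm.
    move=> h; apply: (ucv_eq h) => n; rewrite rmorph_sum /=.
    by apply: eq_bigr => i _; rewrite {1}(semi_real famip_semi).
  have h3 : ucv _ _ _ := ucvM h1 (ucv_conj h1); rewrite mul_conj in h3.
  have h4 : ucv _ _ _ := ucvB (ucvZ (M ^+ 2)%:C (ucvM (h2 y) (h2 x))) h3.
  rewrite -subr_ge0.
  suff : 0 <= complex.Re ((M ^+ 2)%:C * ((l2norm y ^+ 2)%:C *
      (l2norm x ^+ 2)%:C) - (cabs (famip y z) ^+ 2)%:C).
    by rewrite -!rmorphM -rmorphB /= !exprMn.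
  apply: (ucv_Re_ge h4); apply: utrue => n.
  by rewrite mul_conj -!rmorphM -rmorphB /= subr_ge0; exact: famip_mx_bound.
have := key z; rewrite famip_nrm cabs_real ger0_norm ?sqr_ge0// expr2 mulrCA.
have := l2norm_ge0 z; rewrite le_eqVlt => /predU1P[<- _|h]; last first.
  by rewrite ler_pM2l.
by rewrite mulr_ge0 ?l2norm_ge0.
Qed.

Definition cvto (T : bop K) (X : bop F) := forall x,
  unull om (fun n => ldist (fun a => T (V n x a)) (V n (X x))).

Lemma cvto_compression T X : cvto T X -> compression T = X.
Proof.
move=> h; apply: compression_uniq => x y.
apply: (ucv_near _ (Vip x (X y))).
apply: (unull_le (g := (fun n => l2norm (V n x) *
   ldist (fun a => T (V n y a)) (V n (X y))))).
  by move=> n; rewrite -(semiBr famip_semi); exact: famip_CS.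
apply: (unull_bound (C := (nrm x + 1))).
  by rewrite addr_ge0 ?nrm_ge0.
move=> e e0; apply: (ufilter2 (V_bound x ltr01) (h y e e0)) => n h1 h2.
by rewrite ler_pM ?l2norm_ge0.
Qed.

Lemma cvto_lin a S T X Y : cvto S X -> cvto T Y ->
  cvto (a *: S + T) (a *: X + Y).
Proof.
move=> hS hT x.
apply: (unull_le _ (unullD (unullD (unullZ (cabs a) (hS x)) (hT x))
  (V_lin a (X x) (Y x)))) => n.
rewrite bopDE bopZE; apply: le_trans (ldist_trans
   (fun i => a *: V n (X x) i + V n (Y x) i) _ _) _.
rewrite (ldistC (V n _)) lerD2r ger0_norm ?cabs_ge0//.
rewrite /ldist -l2normZ; apply: le_trans (l2normD _ _).
set P := l2norm _; set Q := l2norm _; suff -> : P = Q by [].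
congr l2norm; apply/funext => i.
by rewrite bopDE bopZE scalerBr opprD addrACA.
Qed.

Lemma cvto_comp S T X Y : cvto S X -> cvto T Y -> cvto (bcomp S T) (bcomp X Y).
Proof.
move=> hS hT x; have [M M0 hM] := bop_bb S.
apply: (unull_le _ (unullD (unullZ M (hT x)) (hS (Y x)))) => n.
apply: le_trans (ldist_trans (fun a => S (V n (Y x) a)) _ _) _.
rewrite lerD2r (ger0_norm M0).
exact: (ldist_comp (fun a => T (V n x a)) (V n (Y x)) M0 hM).
Qed.

Lemma cvto_id : cvto bid bid.
Proof.
move=> x e e0; apply: utrue => n; rewrite /ldist (_ : (fun _ => _) = fun _ => 0).
  by rewrite (le_trans (l2norm_le_sum _))// big1 ?(ltW e0)// => i _; rewrite nrm0.
by apply/funext => a; rewrite bidE subrr.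
Qed.

Lemma cvto_closed (T : bop K) : (forall e : R, 0 < e ->
  exists2 S, cvto S (compression S) & bb (T - S) e) -> cvto T (compression T).
Proof.
move=> h x; apply: (unull_bound (C := (nrm x *+ 2 + 4))).
  by rewrite addr_ge0 ?mulrn_wge0 ?nrm_ge0.
move=> e e0; have [S hS hTS] := h e e0.
pose d : R := Num.min 1 e.
have d0 : 0 < d by rewrite lt_min ltr01.
have hc : bb (compression T - compression S) e.
  have -> : compression T - compression S = compression (T - S).
    by rewrite addrC -scaleN1r -compression_lin scaleN1r addrC.
  by apply: compression_bb hTS; exact: ltW.
set y := (compression S - compression T) x.
apply: (ufilter2 (hS x e e0) (filterI (V_bound x ltr01)
   (filterI (V_sub (compression S x) (compression T x) e0)
     (V_bound y e0)))) => n h1 [h2 [h3 h4]].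
apply: le_trans (ldist_trans (fun a => S (V n x a)) _ _) _.
have k1 : ldist (fun a => T (V n x a)) (fun a => S (V n x a)) <=
    e * (nrm x + 1).
  rewrite (le_trans (l2norm_comp (T := T - S) (V n x) (ltW e0) hTS))//.
  by rewrite ler_wpM2l ?(ltW e0).
have k2 : ldist (V n (compression S x)) (V n (compression T x)) <=
   e + (nrm y + e).
  have -> : V n (compression S x) = fun i => V n (compression S x) i by [].
  rewrite /ldist.
  set u := fun a => _.
  have -> : u = fun a => (u a - V n y a) + V n y a.
    by apply/funext => a; rewrite subrK.
  by rewrite (le_trans (l2normD _ _))// lerD.
have k3 : nrm y <= e * nrm x.
  by rewrite /y -nrmN -bopNE opprB; exact: hc.
have k4 := ldist_trans (V n (compression S x)) (fun a => S (V n x a))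
  (V n (compression T x)).
apply: (le_trans (lerD k1 (le_trans k4 (lerD h1 (le_trans k2 (lerD (lexx e)
  (lerD k3 (lexx e)))))))).
by rewrite le_eqVlt; apply/orP; left; apply/eqP; ring.
Qed.

End AsymptoticIsometry.

(** * The multiplicative domain of the compression and its kernel *)

Section AsymptoticAlgebra.
Context {R : realType} {K F : hilbertType R} {I : nat -> finType}.
Context {om : ultra nat}.
Variable V : forall n, F -> I n -> K.
Arguments V : clear implicits.
Hypothesis Vip : forall x y,
  ucv om (fun n => famip (V n x) (V n y)) (hip x y).

Local Notation P := (compression Vip).
Local Notation cvto := (@cvto R K F I om V).

Definition asym (T : bop K) := cvto T (P T) /\ cvto (adj T) (P (adj T)).

(** In [S T V_n ~ S V_n X] only the right factor has to be moved through [V n], so S is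
    arbitrary. *)
Lemma compression_mulr S T X : cvto T X -> P (bcomp S T) = bcomp (P S) X.
Proof.
move=> h; apply: compression_uniq => x y; rewrite bcompE.
have [M M0 hM] := bop_bb S.
apply: (ucv_near _ (compressionP Vip S x (X y))).
apply: (unull_le (g := fun n => l2norm (V n x) *
   (M * ldist (fun a => T (V n y a)) (V n (X y))))).
  move=> n; rewrite -(semiBr famip_semi).
  apply: le_trans (famip_CS _ _) _; apply: ler_wpM2l; first exact: l2norm_ge0.
  exact: (ldist_comp (fun a => T (V n y a)) (V n (X y)) M0 hM).
apply: (unull_bound (C := (nrm x + 1) * M)).
  by rewrite mulr_ge0 ?addr_ge0 ?nrm_ge0.
move=> e e0; apply: (ufilter2 (V_bound Vip x ltr01) (h y e e0)) => n h1 h2.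
by rewrite -mulrA ler_pM ?l2norm_ge0 ?mulr_ge0 ?ldist_ge0 ?ler_wpM2l.
Qed.

Lemma compression_comp S T : asym T -> P (bcomp S T) = bcomp (P S) (P T).
Proof. by move=> [h _]; apply: compression_mulr. Qed.

Lemma compressionD S T : P (S + T) = P S + P T.
Proof.
by have := compression_lin Vip 1 S T; rewrite !scale1r.
Qed.

Lemma compression0 : P 0 = 0.
Proof.
by have := compression_lin Vip (-1) 0 0; rewrite scaler0 addr0 scaleN1r addNr.
Qed.

Lemma compressionZ a T : P (a *: T) = a *: P T.
Proof.
by have := compression_lin Vip a T 0; rewrite !addr0 compression0 addr0.
Qed.

Lemma compressionB S T : P (S - T) = P S - P T.
Proof. by rewrite compressionD -scaleN1r compressionZ scaleN1r. Qed.

Lemma compression_id : P bid = bid.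
Proof. exact: (cvto_compression Vip (cvto_id V)). Qed.

Lemma asym_cvto T X : cvto T X -> cvto (adj T) (adj X) -> asym T.
Proof.
move=> h h'; split; first by rewrite (cvto_compression Vip h).
by rewrite (cvto_compression Vip h').
Qed.

Lemma asym_lin a S T : asym S -> asym T -> asym (a *: S + T).
Proof.
move=> [h1 h2] [h3 h4]; apply: (asym_cvto (cvto_lin Vip a h1 h3)).
rewrite adjD adjZ adjD adjZ -!(compression_adj Vip).
exact: (cvto_lin Vip).
Qed.

Lemma asym_mul S T : asym S -> asym T -> asym (bcomp S T).
Proof.
move=> [h1 h2] [h3 h4]; apply: (asym_cvto (cvto_comp h1 h3)).
by rewrite !adj_comp -!(compression_adj Vip); exact: cvto_comp.
Qed.

Lemma asym_adj S : asym S -> asym (adj S).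
Proof. by move=> [h h']; split=> //; rewrite adjK. Qed.

Lemma asym_id : asym bid.
Proof.
by apply: asym_cvto (cvto_id V) _; rewrite !adj_id; exact: cvto_id.
Qed.

Lemma asym_closed T :
  (forall e : R, 0 < e -> exists2 S, asym S & bb (T - S) e) -> asym T.
Proof.
move=> h; split; apply: cvto_closed => e e0; have [S [hS hS'] TS] := h e e0.
  by exists S.
by exists (adj S) => //; rewrite -adjB; apply: bb_adj => //; exact: ltW.
Qed.

Definition asymA : opalg K :=
  OpAlg asym_lin asym_mul asym_adj asym_id asym_closed.

(** By multiplicativity P U inverts P T. With z = P U x, the vectors U V_n x = U V_n (P T z) are
    close to U T V_n z = V_n z. *)
Lemma asym_inv T U : asym T -> adj T = T -> bcomp T U = bid ->
  bcomp U T = bid -> asym U.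
Proof.
move=> hT sT TU UT.
have sU : adj U = U.
  have h : bcomp (adj U) T = bid by rewrite -{1}sT -adj_comp TU adj_id.
  by rewrite -[LHS]bcomp1r -TU bcompA h bcomp1l.
have XP : bcomp (P U) (P T) = bid by rewrite -compression_comp// UT compression_id.
have PX : bcomp (P T) (P U) = bid.
  rewrite -[P T]adjK -[P U]adjK -adj_comp -!(compression_adj Vip) sU sT XP.
  exact: adj_id.
have cU : cvto U (P U).
  move=> x; have [M M0 hM] := bop_bb U.
  pose z := P U x; have xz : x = P T z by rewrite /z -bcompE PX.
  apply: (unull_le _ (unullZ M (hT.1 z))) => n; rewrite (ger0_norm M0).
  have := ldist_comp (fun a => T (V n z a)) (V n (P T z)) M0 hM.
  rewrite ldistC -xz; congr (ldist _ _ <= _).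
  by apply/funext => a; rewrite -bcompE UT.
by split=> //; rewrite sU.
Qed.

Definition vnull (T : bop K) := forall x,
  unull om (fun n => l2norm (fun a => T (V n x a))).
Definition JJ (T : bop K) := vnull T /\ vnull (adj T).

Lemma V0 : unull om (fun n => l2norm (V n 0)).
Proof.
apply: unull_sqr => [n|]; first exact: l2norm_ge0.
have := Vip 0 0; rewrite hip0l => h; apply: (ucv_eq h) => n.
by rewrite famip_nrm.
Qed.

Lemma vnull_cvto T : vnull T -> cvto T 0.
Proof.
move=> h x; apply: (unull_le _ (unullD (h x) V0)) => n.
rewrite bop0E; apply: le_trans (l2normD _ _) _; rewrite lerD2l.
rewrite le_eqVlt; apply/orP; left; apply/eqP.
rewrite -[RHS]mul1r -(normr1 R) -[`|1|]cabs_real -cabsN -l2normZ.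
by congr l2norm; apply/funext => a; rewrite scaleN1r.
Qed.

Lemma cvto_vnull T : cvto T 0 -> vnull T.
Proof.
move=> h x; apply: (unull_le _ (unullD (h x) V0)) => n.
apply: le_trans (l2normD _ _).
rewrite le_eqVlt; apply/orP; left; apply/eqP.
by congr l2norm; apply/funext => a; rewrite bop0E subrK.
Qed.

Lemma vnullP T X : cvto T X -> (vnull T <-> X = 0).
Proof.
move=> h; split=> [/vnull_cvto h'|X0]; last by apply: cvto_vnull; rewrite -X0.
by rewrite -(cvto_compression Vip h) (cvto_compression Vip h').
Qed.

Lemma JJ_asym T : JJ T -> asym T.
Proof.
move=> [/vnull_cvto h /vnull_cvto h']; apply: asym_cvto h _.
by rewrite adj0.
Qed.

Lemma JJ_P0 T : JJ T -> P T = 0.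
Proof. by move=> [/vnull_cvto h _]; exact: (cvto_compression Vip). Qed.

Lemma asym_JJ T : asym T -> P T = 0 -> JJ T.
Proof.
move=> [h h'] PT; split; first by apply/(vnullP h).
by apply/(vnullP h'); rewrite compression_adj PT adj0.
Qed.

Lemma vnull_compl S T : vnull T -> vnull (bcomp S T).
Proof.
move=> h x; have [M M0 hM] := bop_bb S.
apply: (unull_le _ (unullZ M (h x))) => n; rewrite (ger0_norm M0).
exact: (l2norm_comp (fun a => T (V n x a)) M0 hM).
Qed.

Lemma vnull_lin a S T : vnull S -> vnull T -> vnull (a *: S + T).
Proof.
move=> hS hT x; apply: (unull_le _ (unullD (unullZ (cabs a) (hS x)) (hT x))) => n.
rewrite ger0_norm ?cabs_ge0// -l2normZ; exact: l2normD.
Qed.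

Lemma JJ_adj T : JJ T -> JJ (adj T).
Proof. by move=> [h h']; split=> //; rewrite adjK. Qed.

Lemma JJ_lin a S T : JJ S -> JJ T -> JJ (a *: S + T).
Proof.
move=> [h1 h2] [h3 h4]; split; first exact: vnull_lin.
by rewrite adjD adjZ; exact: vnull_lin.
Qed.

Lemma JJ0 : JJ 0.
Proof.
apply: asym_JJ compression0.
by have := asym_lin (-1) asym_id asym_id; rewrite scaleN1r addNr.
Qed.

Lemma JJD S T : JJ S -> JJ T -> JJ (S + T).
Proof. by move=> hS hT; rewrite -[S]scale1r; exact: JJ_lin. Qed.

Lemma JJZ a S : JJ S -> JJ (a *: S).
Proof. by move=> hS; rewrite -[_ *: _]addr0; apply: JJ_lin => //; exact: JJ0. Qed.

Lemma JJB S T : JJ S -> JJ T -> JJ (S - T).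
Proof. by move=> hS hT; rewrite addrC -scaleN1r; exact: JJ_lin. Qed.

(** The smallness on the vectors V_n x is lost under right multiplication by X but not under left
    multiplication; T provides it, and S does so for the adjoint. *)
Lemma JJ_hered S X T : JJ S -> JJ T -> JJ (bcomp S (bcomp X T)).
Proof.
move=> [h1 h2] [h3 h4]; split; first by do 2!apply: vnull_compl.
by rewrite !adj_comp -bcompA; do 2!apply: vnull_compl.
Qed.

Lemma JJ_ideall S T : asym S -> JJ T -> JJ (bcomp S T).
Proof.
move=> hS hT; apply: asym_JJ; first by apply: asym_mul => //; exact: JJ_asym.
rewrite compression_comp ?(JJ_P0 hT)//; last exact: JJ_asym.
by apply: bop_ext => x; rewrite bcompE bop0E bop0.
Qed.

Lemma JJ_idealr S T : JJ S -> asym T -> JJ (bcomp S T).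
Proof.
move=> hS hT; rewrite -[bcomp _ _]adjK; apply: JJ_adj; rewrite adj_comp.
by apply: JJ_ideall; [exact: asym_adj|exact: JJ_adj].
Qed.

Section ApproximateUnit.

(* e = a (d + a)^-1 with a the sum of the j^* j *)
Lemma approx_unit (js : seq (bop K)) (e : R) :
  0 < e -> (forall j, j \in js -> JJ j) ->
  exists u, [/\ JJ u, adj u = u, bb u 1, bb (bid - u) 1 &
    forall j, j \in js -> bb (bcomp j (bid - u)) e].
Proof.
move=> e0 hjs; pose a := \sum_(j <- js) bcomp (adj j) j.
have hip_a x : hip x (a x) = (\sum_(j <- js) nrm (j x) ^+ 2)%:C.
  rewrite /a bop_sumE hip_sumr rmorph_sum /=.
  by apply: eq_bigr => j _; rewrite ?bcompE -adjP hip_nrm.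
have sa : adj a = a.
  rewrite /a (big_morph _ (@adjD R K) (@adj0 R K)).
  by apply: eq_bigr => j _; rewrite adj_comp adjK.
have Ja : JJ a.
  rewrite /a big_seq; elim/big_ind: _ => [||j jj]; [exact: JJ0|exact: JJD|].
  by apply: JJ_ideall; [apply/asym_adj/JJ_asym/hjs|exact: hjs].
(* With r = (d + a)^-1 one has 1 - u = d r, and the expansion [sq] of |T r x|^2 = |x|^2 yields d |j
   r x|^2 <= |x|^2. Hence |j (1 - u) x|^2 <= d |x|^2, and d must be e^2. *)
pose d := e ^+ 2; have d0 : 0 < d by rewrite exprn_gt0.
pose T : bop K := d%:C *: bid + a.
have sT : adj T = T by rewrite /T adjD adjZ adj_id realC_real sa.
have pa x : 0 <= \sum_(j <- js) nrm (j x) ^+ 2.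
  by rewrite sumr_ge0// => j _; rewrite sqr_ge0.
have pT x : d * nrm x ^+ 2 <= complex.Re (hip x (T x)).
  rewrite /T bopDE bopZE bidE hipDr hipZr hip_nrm hip_a -rmorphM -rmorphD /=.
  by rewrite lerDl.
have [r [sr Tr rT br]] := pos_inverse d0 sT pT.
have AT : asym T by apply: asym_lin; [exact: asym_id|exact: JJ_asym].
have Ar : asym r by exact: asym_inv AT sT Tr rT.
have E1 : bid - bcomp a r = d%:C *: r.
  rewrite -Tr /T; apply: bop_ext => x.
  by rewrite bopBE !bcompE bopDE bopZE bidE addrK.
have sq y : nrm (T y) ^+ 2 = d ^+ 2 * nrm y ^+ 2 +
    (d * \sum_(j <- js) nrm (j y) ^+ 2) *+ 2 + nrm (a y) ^+ 2.
  rewrite /T bopDE bopZE bidE nrm_sqD nrmZ hipZl realC_real hip_a -rmorphM /=.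
  by rewrite cabs_real (ger0_norm (ltW d0)) exprMn.
exists (bcomp a r); split.
- exact: JJ_idealr.
- have : adj (bid - bcomp a r) = bid - bcomp a r.
    by rewrite E1 adjZ realC_real sr.
  rewrite adjB adj_id => /(congr1 (fun T => bid - T)).
  by rewrite !opprB !addrA !(addrC bid) !addrK.
- move=> x; rewrite mul1r bcompE -(@ler_pXn2r _ 2) ?nnegrE ?nrm_ge0//.
  have xE : x = T (r x) by rewrite -bcompE Tr.
  rewrite {2}xE sq.
  have h1 : 0 <= d ^+ 2 * nrm (r x) ^+ 2 by rewrite mulr_ge0 ?sqr_ge0.
  have h3 := mulr_ge0 (ltW d0) (pa (r x)); lra.
- rewrite E1 => x; rewrite bopZE nrmZ cabs_real (ger0_norm (ltW d0)) mul1r.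
  by rewrite -ler_pdivlMl//; exact: br.
- move=> j jj x; rewrite E1 bcompE bopZE bopZ nrmZ cabs_real (ger0_norm (ltW d0)).
  rewrite -(@ler_pXn2r _ 2) ?nnegrE ?mulr_ge0 ?nrm_ge0 ?(ltW d0) ?(ltW e0)//.
  have xE : x = T (r x) by rewrite -bcompE Tr.
  rewrite !exprMn {2}xE sq -/d.
  have jle : nrm (j (r x)) ^+ 2 <= \sum_(j <- js) nrm (j (r x)) ^+ 2.
    by rewrite (big_rem j)//= lerDl sumr_ge0// => k _; rewrite sqr_ge0.
  rewrite expr2 -mulrA ler_wpM2l ?(ltW d0)//.
  apply: le_trans (ler_wpM2l (ltW d0) jle) _.
  have h1 : 0 <= d ^+ 2 * nrm (r x) ^+ 2 by rewrite mulr_ge0 ?sqr_ge0.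
  have h2 : 0 <= nrm (a (r x)) ^+ 2 by exact: sqr_ge0.
  have h3 := mulr_ge0 (ltW d0) (pa (r x)); lra.
Qed.

Definition bcom (e c : bop K) := bcomp e c - bcomp c e.

Lemma bcom_sum (s : seq (bop K)) c :
  bcom (\sum_(e <- s) e) c = \sum_(e <- s) bcom e c.
Proof.
elim: s => [|e s IH].
  rewrite !big_nil /bcom; apply: bop_ext => x.
  by rewrite bopBE !bcompE !bop0E bop0 subr0.
rewrite !big_cons -IH /bcom bcompDl bcompDr opprD; set A := bcomp e c.
by rewrite addrACA.
Qed.

Lemma bb_bcom (e c : bop K) (M : R) : 0 <= M -> bb e 1 -> bb c M -> bb (bcom e c) (M *+ 2).
Proof.
move=> M0 he hc; rewrite mulr2n; apply: bbB.
  by rewrite -[M]mul1r; exact: bb_comp.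
by rewrite -[M]mulr1; exact: bb_comp.
Qed.

Lemma JJ_bcom (e c : bop K) : JJ e -> asym c -> JJ (bcom e c).
Proof. by move=> he hc; apply: JJB; [exact: JJ_idealr|exact: JJ_ideall]. Qed.

Variables (js cs : seq (bop K)) (eps : R).
Hypotheses (eps0 : 0 < eps) (hjs : forall j, j \in js -> JJ j)
  (hcs : forall c, c \in cs -> asym c).

Let M := \sum_(c <- cs) opn c.
Let M0 : 0 <= M.
Proof. by rewrite sumr_ge0// => c _; exact: opn_ge0. Qed.
Let bM c : c \in cs -> bb c M.
Proof.
move=> hc; apply: bb_le (bb_opn c) _.
by rewrite /M (big_rem c)//= lerDl sumr_ge0// => k _; exact: opn_ge0.
Qed.

Let good u := [/\ JJ u, adj u = u, bb u 1 &
    forall j, j \in js -> bb (bcomp j (bid - u)) eps].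

(* The commutators [u, c] of successive, rapidly increasing approximate units
   have almost orthogonal ranges, so their averages are small. *)
Let tower (eta : R) (N : nat) : 0 < eta -> exists s : seq (bop K),
  [/\ size s = N, forall u, u \in s -> good u &
  forall c v, c \in cs -> nrm ((\sum_(u <- s) bcom u c) v) ^+ 2 <=
    ((M *+ 2) ^+ 2 * N%:R + eta * N%:R ^+ 2) * nrm v ^+ 2].
Proof.
move=> eta0; elim: N => [|N [s [sN sgood sb]]].
  exists [::]; split=> // c v _; rewrite big_nil bop0E nrm0 expr0n /=.
  by rewrite !mulr0 addr0 mul0r.
(* For z = [w, c]^* with w already chosen, z [u, c] = z c (1 - u) - z (1 - u) c. A new u that nearly
   fixes both z and z c on the right makes the ranges of [w, c] and [u, c] almost orthogonal. *)
pose X := [seq adj (bcom u c) | u <- s, c <- cs].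
pose Y := [seq bcomp x c | x <- X, c <- cs].
have hX x : x \in X -> JJ x.
  move=> /allpairsP[[u c] /= [us cc ->]]; apply: JJ_adj.
  by apply: JJ_bcom; [have [] := sgood _ us|exact: hcs].
have hY y : y \in Y -> JJ y.
  move=> /allpairsP[[x c] /= [xX cc ->]].
  by apply: JJ_idealr; [exact: hX|exact: hcs].
pose d := Num.min eps (eta / (M + 1)).
have M1 : 0 < M + 1 by rewrite ltr_wpDl.
have d0 : 0 < d by rewrite lt_min eps0 divr_gt0.
have [|u [Ju su bu _ hu]] := @approx_unit (js ++ X ++ Y) d d0.
  move=> j; rewrite !mem_cat => /or3P[]; [exact: hjs|exact: hX|exact: hY].
exists (u :: s); split; first by rewrite /= sN.
  move=> w; rewrite inE => /predU1P[->|/sgood//]; split=> // j jj.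
  apply: bb_le (hu j _) _; first by rewrite mem_cat jj.
  by rewrite ge_min lexx.
move=> c v cc; rewrite big_cons bopDE nrm_sqD.
set x := bcom u c; set y := (\sum_(w <- s) bcom w c) v.
have h1 : nrm (x v) ^+ 2 <= (M *+ 2) ^+ 2 * nrm v ^+ 2.
  rewrite -exprMn ler_pXn2r ?nnegrE ?mulr_ge0 ?mulrn_wge0 ?nrm_ge0//.
  exact: (bb_bcom M0 bu (bM cc)).
have h2 : complex.Re (hip (x v) y) <= eta * N%:R * nrm v ^+ 2.
  rewrite (le_trans (ler_norm _))// (le_trans (Re_le_cabs _))//.
  rewrite /y bop_sumE hip_sumr (le_trans (cabs_sum _ _ _))//.
  have -> : eta * N%:R * nrm v ^+ 2 = \sum_(w <- s) eta * nrm v ^+ 2.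
    by rewrite big_const_seq count_predT sN iter_addr_0 -[RHS]mulr_natr mulrAC.
  rewrite !big_seq; apply: ler_sum => w ws.
  have xX : adj (bcom w c) \in X by apply/allpairsP; exists (w, c).
  have yY : bcomp (adj (bcom w c)) c \in Y.
    by apply/allpairsP; exists (adj (bcom w c), c).
  have b1 : bb (bcomp (adj (bcom w c)) (bid - u)) d.
    by apply: hu; rewrite !mem_cat xX !orbT.
  have b2 : bb (bcomp (bcomp (adj (bcom w c)) c) (bid - u)) d.
    by apply: hu; rewrite !mem_cat yY !orbT.
  set z := adj (bcom w c) in b1 b2.
  have zx : bcomp z x = bcomp (bcomp z c) (bid - u) -
      bcomp (bcomp z (bid - u)) c.
    apply: bop_ext => t; rewrite /x /bcom !(bopBE, bcompE, bopB, bidE).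
    by rewrite opprB [RHS]addrC addrA subrK.
  have b3 : bb (bcomp z x) eta.
    rewrite zx; have h := bb_comp (ltW d0) b1 (bM cc).
    apply: bb_le (bbB b2 h) _.
    have -> : d + d * M = d * (M + 1) by ring.
    by rewrite -ler_pdivlMr// ge_min lexx orbT.
  rewrite hip_conj cabs_conj -[bcom w c]adjK -/z adjP adjK -bcompE.
  rewrite (le_trans (hip_CS _ _))// expr2 mulrA mulrC ler_wpM2r ?nrm_ge0//.
have h3 : nrm y ^+ 2 <= ((M *+ 2) ^+ 2 * N%:R + eta * N%:R ^+ 2) * nrm v ^+ 2.
  exact: sb.
have h4 : 0 <= eta * nrm v ^+ 2 by rewrite mulr_ge0 ?sqr_ge0 ?(ltW eta0).
move: h1 h2 h3 h4; rewrite -[N.+1]addn1 natrD; move: (M *+ 2) => M2.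
move: (nrm v ^+ 2) (nrm (x v) ^+ 2) (complex.Re _) (nrm y ^+ 2) => w a1 a2 a3.
lra.
Qed.

Lemma quasi_central : exists e, [/\ JJ e, adj e = e, bb e 1,
    forall j, j \in js -> bb (bcomp j (bid - e)) eps &
    forall c, c \in cs -> bb (bcom e c) eps].
Proof.
(* The average of the N commutators has squared norm at most (2 M)^2 / N + eta; N and eta = eps^2 /
   2 make each summand at most eps^2 / 2. *)
pose N := (Num.truncn ((M *+ 2) ^+ 2 * 2 / eps ^+ 2)).+1.
have eta0 : 0 < eps ^+ 2 / 2 by rewrite divr_gt0 ?exprn_gt0.
have [s [sN sgood sb]] := tower N eta0.
pose c0 : R[i] := (N%:R^-1)%:C.
have N0 : 0 < N%:R :> R by rewrite ltr0n.
have cc0 : cabs c0 = N%:R^-1 by rewrite cabs_real ger0_norm// invr_ge0 ltW.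
have avg (f : bop K -> bop K) (B : R) : 0 <= B ->
    (forall u, u \in s -> bb (f u) B) -> bb (c0 *: \sum_(u <- s) f u) B.
  move=> B0 hf x; rewrite bopZE nrmZ cc0 ler_pdivrMl// bop_sumE.
  rewrite (le_trans (nrm_sum _ _ _))//.
  have -> : N%:R * (B * nrm x) = \sum_(u <- s) B * nrm x.
    by rewrite big_const_seq count_predT sN iter_addr_0 mulr_natl.
  rewrite !big_seq; apply: ler_sum => u us; exact: hf.
have c0s : c0 *: \sum_(u <- s) bid = bid :> bop K.
  rewrite big_const_seq count_predT sN iter_addr_0 -scaler_nat scalerA.
  rewrite -(rmorph_nat (real_complex R)) -rmorphM mulVf ?gt_eqF//.
  exact: scale1r.
exists (c0 *: \sum_(u <- s) u); split.
- apply: JJZ; rewrite big_seq.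
  by elim/big_ind: _ => [||u /sgood[]//]; [exact: JJ0|exact: JJD].
- rewrite adjZ realC_real (big_morph _ (@adjD R K) (@adj0 R K)) !big_seq.
  by congr (_ *: _); apply: eq_bigr => u /sgood[].
- by apply: avg => // u /sgood[].
- move=> j jj.
  have -> : bcomp j (bid - c0 *: \sum_(u <- s) u) =
     c0 *: \sum_(u <- s) bcomp j (bid - u).
    rewrite -{1}c0s -scalerBr bcompZr -sumrB; congr (_ *: _).
    by apply: (big_morph (bcomp j) (fun S T => bcompDr S T j));
      apply: bop_ext => x; rewrite bcompE !bop0E bop0.
  by apply: avg; [exact: ltW|move=> u /sgood[_ _ _]; exact].
- move=> c cc x.
  have -> : bcom (c0 *: \sum_(u <- s) u) c = c0 *: \sum_(u <- s) bcom u c.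
    by rewrite -bcom_sum /bcom bcompZl bcompZr scalerBr.
  rewrite bopZE nrmZ cc0.
  rewrite -(@ler_pXn2r _ 2) ?nnegrE ?mulr_ge0 ?nrm_ge0 ?(ltW eps0) ?invr_ge0 ?(ltW N0)//.
  rewrite exprMn exprVn ler_pdivrMl ?exprn_gt0//.
  apply: le_trans (sb c x cc) _; rewrite [X in _ <= _ * X]exprMn [leRHS]mulrA.
  apply: ler_wpM2r; first exact: sqr_ge0.
  have hN : (M *+ 2) ^+ 2 * 2 / eps ^+ 2 <= N%:R by rewrite ltW// truncnS_gt.
  move: hN; rewrite ler_pdivrMr ?exprn_gt0//; move: ((M *+ 2) ^+ 2) => m hN.
  have := ler_wpM2r (ltW N0) hN.
  by move: (eps ^+ 2) (N%:R : R) => E n; nra.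
Qed.

End ApproximateUnit.

End AsymptoticAlgebra.

(** * Quasi-central pairs on the unit circle *)

Section QuasiCentral.
Context {R : realType} {K F : hilbertType R} {I : nat -> finType}.
Context {om : ultra nat}.
Variable V : forall n, F -> I n -> K.
Arguments V : clear implicits.
Hypothesis Vip : forall x y,
  ucv om (fun n => famip (V n x) (V n y)) (hip x y).

Local Notation P := (compression Vip).
Local Notation asym := (asym Vip).
Local Notation JJ := (@JJ R K F I om V).

(** The rational parametrization of the circle: g = 2 e / (1 + e^2) and k = (1 - e^2) / (1 + e^2)
    for a quasi-central e. It avoids square roots, and k has the factor 1 - e, which makes j k
    small. *)
Lemma gk_pair (js cs : seq (bop K)) (eps : R) : 0 < eps ->
  (forall j, j \in js -> JJ j) -> (forall c, c \in cs -> asym c) ->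
  exists g k, [/\ JJ g, adj g = g, asym k, adj k = k &
    [/\ bcomp g g + bcomp k k = bid,
    forall j, j \in js -> bb (bcomp j k) eps,
    forall c, c \in cs -> bb (bcom g c) eps &
    forall c, c \in cs -> bb (bcom k c) eps]].
Proof.
move=> eps0 hjs hcs.
(* The worst of the final estimates is that of [g, c], namely 2 (2 d + d). *)
have d0 : 0 < eps / 6 by rewrite divr_gt0.
have [e [Je se be hj hc]] := quasi_central (Vip := Vip) d0 hjs hcs.
set d := eps / 6 in d0 hj hc.
pose T := bid + bcomp e e.
have sT : adj T = T by rewrite /T adjD adj_id adj_comp se.
have pT x : 1 * nrm x ^+ 2 <= complex.Re (hip x (T x)).
  rewrite /T bopDE bidE bcompE hipDr hip_nrm cReD mul1r.
  by rewrite -{1}se -adjP Re_hip lerDl sqr_ge0.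
have [r [sr Tr rT br]] := pos_inverse ltr01 sT pT; rewrite invr1 in br.
have er : bcomp e r = bcomp r e.
  have h : bcomp e T = bcomp T e by rewrite /T bcompDr bcompDl bcomp1l bcomp1r bcompA.
  by rewrite -[LHS]bcomp1l -rT -bcompA (bcompA T) -h -!bcompA Tr bcomp1r.
have Ae := JJ_asym Vip Je.
have AT : asym T.
  rewrite /T -[bid]scale1r; apply: asym_lin; first exact: asym_id.
  exact: asym_mul.
have Ar : asym r := asym_inv AT sT Tr rT.
pose g := 2 *: bcomp e r; pose k := 2 *: r - bid.
have r2 : 2 = 2%:C :> R[i] by rewrite -(rmorph_nat (real_complex R)).
have c2 : cabs (2 : R[i]) = 2 by rewrite r2 cabs_real ger0_norm.
have kE : k = bcomp (bid - e) (bcomp (bid + e) r).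
  have -> : bcomp (bid - e) (bcomp (bid + e) r) = bcomp (bid - bcomp e e) r.
    rewrite bcompA; congr bcomp; rewrite bcompBl bcomp1l bcompDr bcomp1r.
    by rewrite opprD addrA addrK.
  have -> : bid - bcomp e e = 2 *: bid - T.
    by rewrite /T scaler_nat mulr2n opprD addrA addrK.
  by rewrite bcompBl Tr bcompZl bcomp1l.
exists g, k; split.
- by apply: JJZ => //; apply: JJ_idealr.
- by rewrite /g adjZ r2 realC_real adj_comp sr se er.
- by apply: asym_lin => //; rewrite -scaleN1r -[_ *: _]addr0;
    apply: asym_lin; [exact: asym_id|exact/JJ_asym/JJ0].
- by rewrite /k adjB adjZ r2 realC_real sr adj_id.
have key y : e (e (r y)) = y - r y.
  have h : r y + e (e (r y)) = y := congr1 (fun S : bop K => S y) Tr.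
  by apply: (addrI (r y)); rewrite h [RHS]addrC subrK.
have er' y : e (r y) = r (e y) by rewrite -!bcompE er.
have T4 : bcomp g g + bcomp k k = bid.
  apply: bop_ext => x; apply: hip_ext => z.
  rewrite bopDE !bcompE /g /k !(bopBE, bopZE, bcompE, bidE) !(bopB, bopZ).
  by rewrite -!er' key !(hipDr, hipNr, hipZr); ring.
(* Commutator of an inverse: [r, c] = - r [e^2, c] r with r = (1 + e^2)^-1 of norm at most 1. *)
have ecom c : c \in cs -> bb (bcom r c) (d *+ 2).
  move=> cc.
  have -> : bcom r c = bcomp r (bcomp (- (bcomp (bcom e c) e + bcomp e (bcom e c))) r).
    apply: bop_ext => x; rewrite /bcom !(bopBE, bopNE, bopDE, bcompE, bopB, bopD, bopN).
    rewrite key !(bopD, bopN); apply: hip_ext => z.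
    have k2 y : r (e (e y)) = y - r y by rewrite -!er' key.
    by rewrite !k2 !(hipDr, hipNr); ring.
  have h1 : bb (bcomp (bcom e c) e) (d * 1) by apply: bb_comp => //; [exact: ltW|exact: hc].
  have h2 : bb (bcomp e (bcom e c)) (1 * d) by apply: bb_comp => //; exact: hc.
  have h3 := bbN (bbD h1 h2).
  have d2 : 0 <= d * 1 + 1 * d by rewrite mulr1 mul1r addr_ge0// ltW.
  apply: bb_le (bb_comp ler01 br (bb_comp d2 h3 br)) _.
  by rewrite !mul1r !mulr1 mulr2n.
split=> //.
- move=> j jj; rewrite kE bcompA.
  have h1 : bb (bcomp (bid + e) r) ((1 + 1) * 1).
    by apply: bb_comp => //; apply: bbD => //; exact: bb_id.
  apply: bb_le (bb_comp (ltW d0) (hj j jj) h1) _.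
  by rewrite /d; move: eps0; lra.
- move=> c cc.
  have -> : bcom g c = 2 *: (bcomp e (bcom r c) + bcomp (bcom e c) r).
    apply: bop_ext => x; rewrite /bcom /g.
    rewrite !(bopZE, bopBE, bopDE, bcompE, bopB, bopZ).
    by apply: hip_ext => z; rewrite !(hipZr, hipDr, hipNr); ring.
  have h1 : bb (bcomp e (bcom r c)) (1 * (d *+ 2)).
    by apply: bb_comp => //; exact: ecom.
  have h2 : bb (bcomp (bcom e c) r) (d * 1).
    by apply: bb_comp => //; [exact: ltW|exact: hc].
  apply: bb_le (bbZ 2 (bbD h1 h2)) _.
  by rewrite c2 /d; move: eps0; lra.
- move=> c cc.
  have -> : bcom k c = 2 *: bcom r c.
    apply: bop_ext => x; rewrite /bcom /k.
    rewrite !(bopZE, bopBE, bopDE, bcompE, bopB, bopZ, bidE).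
    by apply: hip_ext => z; rewrite !(hipZr, hipDr, hipNr); ring.
  apply: bb_le (bbZ 2 (ecom c cc)) _.
  by rewrite c2 /d; move: eps0; lra.
Qed.

End QuasiCentral.

(** * The norm of matrices over the quotient B/J *)

Section QuotientNorm.
Context {R : realType} {K F : hilbertType R} {I : nat -> finType}.
Context {om : ultra nat}.
Variable V : forall n, F -> I n -> K.
Arguments V : clear implicits.
Hypothesis Vip : forall x y,
  ucv om (fun n => famip (V n x) (V n y)) (hip x y).

Local Notation P := (compression Vip).
Local Notation asym := (asym Vip).
Local Notation JJ := (@JJ R K F I om V).

Variables (M : set (bop F)) (kap : R).
Hypotheses (kap0 : 0 <= kap) (MP : forall T, M (P T)).
Hypothesis lift_ex : forall X, M X ->
  exists T, [/\ asym T, P T = X & bb T (kap * opn X)].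

(** That the injection of B/J given by P is completely isometric. [lift_ex] gives an entrywise bound
    with constant [#|J|^2 kap] for the distance to the kernel, and [halving] improves it to 1. *)
Lemma quotient_norm (J : finType) (c : J -> J -> bop K) (t eps : R) :
  0 < eps -> 0 <= t -> (forall i j, asym (c i j)) ->
  mb (fun i j => P (c i j) : F -> F) t ->
  exists j : J -> J -> bop K, (forall i k, JJ (j i k)) /\
    mb (fun i k => (c i k - j i k : bop K) : K -> K) (t + eps).
Proof.
pose dist (c : J -> J -> bop K) s := forall eps, 0 < eps ->
  exists j : J -> J -> bop K, (forall i k, JJ (j i k)) /\
    mb (fun i k => (c i k - j i k : bop K) : K -> K) (s + eps).
pose valid k := forall (c : J -> J -> bop K) t, 0 <= t ->
  (forall i j, asym (c i j)) ->
  mb (fun i j => P (c i j) : F -> F) t -> dist c (k * t).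
suff Q e : 0 < e -> valid (1 + e).
  move=> eps0 t0 hc hP.
  have d0 : 0 < eps / 2 / (t + 1) by rewrite !divr_gt0// ltr_wpDl.
  have e20 : 0 < eps / 2 by rewrite divr_gt0.
  have [j [Jj hj]] := Q _ d0 c t t0 hc hP _ e20.
  exists j; split=> //; apply: mb_le hj _.
  rewrite mulrDl mul1r -addrA lerD2l [leRHS]splitr lerD2r.
  by rewrite mulrAC ler_pdivrMr ?ltr_wpDl// ler_pM2l// lerDl.
apply: (@halving _ _ (#|J|%:R ^+ 2 * kap)) => {c t eps e}.
- by rewrite mulr_ge0// sqr_ge0.
- move=> s s0 hs c t t0 hc hP eps eps0.
  pose y := mmul (madj c) c.
  have hy i j : asym (y i j).
    rewrite /y /mmul; elim/big_ind: _ => [|S T hS hT|k _].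
    + exact/JJ_asym/JJ0.
    + by rewrite -[S]scale1r; exact: asym_lin.
    + by apply: asym_mul => //; exact: asym_adj.
  have Py i j : P (y i j) = mmul (madj (fun i j => P (c i j)))
      (fun i j => P (c i j)) i j.
    rewrite /y /mmul (big_morph P (compressionD Vip) (compression0 Vip)).
    apply: eq_bigr => k _; rewrite compression_comp//.
    by rewrite /madj compression_adj.
  have mPy : mb (fun i j => P (y i j) : F -> F) (t ^+ 2).
    have -> : (fun i j => P (y i j) : F -> F) =
      (fun i j => mmul (madj (fun i j => P (c i j))) (fun i j => P (c i j)) i j).
      by do 2!apply/funext => ?; rewrite Py.
    by rewrite expr2; apply: mb_mul => //; apply: mb_adj.
  have e10 : 0 < eps ^+ 2 / 2 by rewrite divr_gt0 ?exprn_gt0.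
  have [j [Jj hj]] := hs y (t ^+ 2) (sqr_ge0 _) hy mPy _ e10.
  pose e2 := eps ^+ 2 / 2 / (#|J|%:R ^+ 2 + 1).
  have J0 : 0 <= #|J|%:R ^+ 2 :> R by exact: sqr_ge0.
  have e20 : 0 < e2 by rewrite divr_gt0// ltr_wpDl.
  have [|u [Ju su bu b1u hu]] := @approx_unit _ _ _ _ _ _ Vip
      [seq j i k | i <- enum J, k <- enum J] e2 e20.
    by move=> x /allpairsP[[i k] /= [_ _ ->]].
  (* With w = 1 - u and j the matrix found for y = c^* c, |c w x|^2 = <w x, (y - j) w x> + <w x, j w
     x>. The first term is controlled by the previous constant, the second by the choice of u for
     the entries of j. *)
  exists (fun i k => bcomp (c i k) u); split.
    by move=> i k; exact: JJ_ideall (hc i k) Ju.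
  set w := bid - u in b1u hu.
  have -> : (fun i k => (c i k - bcomp (c i k) u : bop K) : K -> K) =
     (fun i k => bcomp (c i k) w : K -> K).
    by do 2!apply/funext => ?; rewrite /w bcompBr bcomp1r.
  have s20 : 0 <= 1 + s / 2 by rewrite addr_ge0// divr_ge0.
  move=> x; pose wx i := w (x i).
  have nwx : l2norm wx <= l2norm x.
    by have := @l2norm_comp R K (fun=> J) 0 w 1 x ler01 b1u; rewrite mul1r.
  rewrite -(@ler_pXn2r _ 2) ?nnegrE ?l2norm_ge0//; last first.
    by rewrite mulr_ge0 ?l2norm_ge0 ?addr_ge0 ?(ltW eps0)// mulr_ge0.
  have -> : l2norm (fun i => \sum_k bcomp (c i k) w (x k)) ^+ 2 =
     complex.Re (famip wx (mapp (fun i k => y i k - j i k) wx)) +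
     complex.Re (famip wx (mapp j wx)).
    rewrite -cReD -(semiDr famip_semi).
    have -> : ((mapp (fun i k => y i k - j i k) wx : J -> K) + mapp j wx) =
        mapp y wx.
      apply/funext => i; rewrite /mapp.
      have -> : (((fun i0 => \sum_j0 (y i0 j0 - j i0 j0) (wx j0)) : J -> K) +
         (fun i0 => \sum_j0 j i0 j0 (wx j0))) i =
         \sum_k (y i k - j i k) (wx k) + \sum_k j i k (wx k) by [].
      rewrite -big_split; apply: eq_bigr => k _ /=; exact: subrK.
    by rewrite /y mmulE -madjP famip_nrm.
  have h1 : complex.Re (famip wx (mapp (fun i k => y i k - j i k) wx)) <=
     ((1 + s) * t ^+ 2 + eps ^+ 2 / 2) * l2norm x ^+ 2.
    rewrite (le_trans (ler_norm _))// (le_trans (Re_le_cabs _))//.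
    rewrite (le_trans (famip_CS _ _))// expr2 mulrCA.
    rewrite ler_pM ?l2norm_ge0//; apply: le_trans (hj wx) _.
    rewrite ler_wpM2l//; apply: addr_ge0; last exact: ltW.
    by rewrite mulr_ge0 ?sqr_ge0// addr_ge0.
  have h2 : complex.Re (famip wx (mapp j wx)) <= eps ^+ 2 / 2 * l2norm x ^+ 2.
    rewrite (le_trans (ler_norm _))// (le_trans (Re_le_cabs _))//.
    rewrite (le_trans (famip_CS _ _))// expr2 mulrCA.
    rewrite ler_pM ?l2norm_ge0//.
    have be : mb (fun i k => bcomp (j i k) w : K -> K) (#|J|%:R ^+ 2 * e2).
      apply: mb_entries; first exact: ltW.
      move=> i k; apply: hu; apply/allpairsP.
      by exists (i, k); rewrite !mem_enum.
    apply: le_trans (be x) _; rewrite ler_wpM2r ?l2norm_ge0//.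
    by rewrite /e2 mulrCA ler_piMr ?(ltW e10)// ler_pdivrMr ?mul1r ?lerDl// ltr_wpDl.
  rewrite (le_trans (lerD h1 h2))// -mulrDl exprMn ler_wpM2r ?sqr_ge0//.
  have ht : 0 <= (1 + s / 2) * t * eps by rewrite !mulr_ge0// ltW.
  have hst : 0 <= (s * t) ^+ 2 by exact: sqr_ge0.
  by move: ht hst; lra.
- move=> s s' ss' hs c t t0 hc hP eps eps0.
  have [j [Jj hj]] := hs c t t0 hc hP eps eps0.
  by exists j; split=> //; apply: mb_le hj _; rewrite lerD2r ler_wpM2r.
- move=> c t t0 hc hP eps eps0.
  have /choice[f hf] (p : J * J) := lift_ex (MP (c p.1 p.2)).
  exists (fun i k => c i k - f (i, k)); split=> [i k|].
    have [h1 h2 _] := hf (i, k).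
    have h3 : asym (c i k - f (i, k)).
      by rewrite addrC -scaleN1r; exact: asym_lin.
    by apply: (asym_JJ h3); rewrite compressionB h2 subrr.
  have -> : (fun i k => (c i k - (c i k - f (i, k)) : bop K) : K -> K) =
     (fun i k => f (i, k) : K -> K).
    by do 2!apply/funext => ?; rewrite opprB addrC subrK.
  have hb i k : bb (f (i, k)) (kap * t).
    have [_ h2 h3] := hf (i, k); apply: bb_le h3 _; rewrite ler_wpM2l//.
    by apply: opn_le => //; exact: (mb_entry hP).
  apply: mb_le (mb_entries (mulr_ge0 kap0 t0) hb) _.
  by rewrite mulrA mulrDl mul1r addrAC lerDr addr_ge0// ltW.
Qed.

(** Since g^2 + k^2 = 1, the map x |-> (g x, k x) is an isometry, and the matrix is the compression
    by it of the direct sum of T and c. *)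
Lemma gk_row (J : finType) (T c : J -> J -> bop K) (g k : bop K) (a : R) :
  0 <= a -> adj g = g -> adj k = k -> bcomp g g + bcomp k k = bid ->
  mb (fun i j => T i j : K -> K) a -> mb (fun i j => c i j : K -> K) a ->
  mb (fun i j => (bcomp g (bcomp (T i j) g) + bcomp k (bcomp (c i j) k) : bop K)
     : K -> K) a.
Proof.
move=> a0 sg sk gk hT hc x.
set z := (fun i => _ : K).
have pyth (w : J -> K) : l2norm (fun i => g (w i)) ^+ 2 +
    l2norm (fun i => k (w i)) ^+ 2 = l2norm w ^+ 2.
  rewrite !l2norm_sq -big_split; apply: eq_bigr => i _ /=.
  rewrite -!Re_hip -cReD !adjP sg sk -hipDr.
  by have := congr1 (fun S : bop K => S (w i)) gk;
    rewrite bopDE !bcompE bidE => ->.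
have zz : famip z z = famip (fun i => g (z i)) (mapp T (fun i => g (x i))) +
    famip (fun i => k (z i)) (mapp c (fun i => k (x i))).
  rewrite /famip -big_split; apply: eq_bigr => i _ /=.
  rewrite !adjP sg sk -hipDr; congr hip.
  rewrite {1}/z /mapp !bop_sum -big_split; apply: eq_bigr => j _.
  by rewrite bopDE !bcompE.
have [z0|z0] := eqVneq (l2norm z) 0; first by rewrite z0 mulr_ge0 ?l2norm_ge0.
have zp : 0 < l2norm z by rewrite lt_neqAle eq_sym z0 l2norm_ge0.
rewrite -(ler_pM2r zp) -expr2.
have : complex.Re (famip z z) = l2norm z ^+ 2 by rewrite famip_nrm.
rewrite zz cReD => <-.
set p := l2norm (fun i => g (z i)); set q := l2norm (fun i => g (x i)).
set r := l2norm (fun i => k (z i)); set s := l2norm (fun i => k (x i)).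
have h1 : complex.Re (famip (fun i => g (z i)) (mapp T (fun i => g (x i)))) <=
    p * (a * q).
  rewrite (le_trans (ler_norm _))// (le_trans (Re_le_cabs _))//.
  rewrite (le_trans (famip_CS _ _))// ler_wpM2l ?l2norm_ge0//; exact: hT.
have h2 : complex.Re (famip (fun i => k (z i)) (mapp c (fun i => k (x i)))) <=
    r * (a * s).
  rewrite (le_trans (ler_norm _))// (le_trans (Re_le_cabs _))//.
  rewrite (le_trans (famip_CS _ _))// ler_wpM2l ?l2norm_ge0//; exact: hc.
rewrite (le_trans (lerD h1 h2))//.
have -> : p * (a * q) + r * (a * s) = a * (p * q + r * s) by ring.
rewrite -mulrA ler_wpM2l//.
rewrite -(@ler_pXn2r _ 2) ?nnegrE ?addr_ge0 ?mulr_ge0 ?l2norm_ge0//.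
rewrite exprMn -(pyth z) -(pyth x) -/p -/q -/r -/s -subr_ge0.
have -> : (q ^+ 2 + s ^+ 2) * (p ^+ 2 + r ^+ 2) - (p * q + r * s) ^+ 2 =
  (q * r - p * s) ^+ 2 by ring.
exact: sqr_ge0.
Qed.

End QuotientNorm.

Lemma dual_lin (R : realType) (E : opspace R) (f : dual E) : linear f.
Proof. by case: f => f /= /asboolP[]. Qed.

Lemma mb_reindex (R : realType) (V : normedModType R[i]) (I J : finType)
    (h : I -> J) (T : J -> J -> V -> V) (M : R) :
  bijective h -> mb T M -> mb (fun i j => T (h i) (h j)) M.
Proof.
move=> [h' hK h'K] hT x.
have bh : {on [pred _ | true], bijective h}.
  by apply: onW_bij; exists h'.
have e (y : J -> V) : l2norm (fun i => y (h i)) = l2norm y.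
  by congr Num.sqrt; rewrite [RHS](reindex h).
have := hT (fun j => x (h' j)).
have -> : (fun i => \sum_j T i j (x (h' j))) =
   (fun j => \sum_k T j (h k) (x k)).
  apply/funext => i; rewrite (reindex h)//.
  by apply: eq_bigr => k _; rewrite hK.
rewrite -(e (fun j => x (h' j))) -(e (fun j => \sum_k T j (h k) (x k))).
by rewrite (_ : (fun i => x (h' (h i))) = x)//; apply/funext => i; rewrite hK.
Qed.

Lemma mb_ucv (R : realType) (L : Type) (U : ultra L) (I : finType)
    (w : I -> I -> L -> R[i]) (l : I -> I -> R[i]) (M : R) : 0 <= M ->
  (forall i j, ucv U (w i j) (l i j)) ->
  U [set p | mb (fun i j => ( *%R (w i j p) : R[i]^o -> R[i]^o)) M] ->
  mb (fun i j => ( *%R (l i j) : R[i]^o -> R[i]^o)) M.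
Proof.
move=> M0 hw hM z; rewrite -(@ler_pXn2r _ 2) ?nnegrE ?mulr_ge0 ?l2norm_ge0//.
rewrite l2norm_sq.
have h i : ucv U (fun p => \sum_j w i j p * z j) (\sum_j l i j * z j).
  apply: ucv_sum => j; rewrite mulrC; apply: (ucv_eq (ucvZ (z j) (hw i j))) => p.
  by rewrite mulrC.
have h2 : ucv U (fun p => \sum_i (\sum_j w i j p * z j) *
     conjc (\sum_j w i j p * z j)) (\sum_i (\sum_j l i j * z j) *
     conjc (\sum_j l i j * z j)).
  by apply: ucv_sum => i; apply: ucvM; [exact: h|exact: ucv_conj].
have -> : \sum_i nrm (\sum_j l i j * z j : R[i]^o) ^+ 2 =
    complex.Re (\sum_i (\sum_j l i j * z j) * conjc (\sum_j l i j * z j)).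
  by rewrite Re_sum; apply: eq_bigr => i _; rewrite mul_conj.
apply: (ucv_Re_le h2); apply: (ufilter hM) => p hp.
have := hp z; rewrite -(@ler_pXn2r _ 2) ?nnegrE ?mulr_ge0 ?l2norm_ge0//.
rewrite l2norm_sq Re_sum => hz; apply: le_trans hz.
by rewrite le_eqVlt; apply/orP; left; apply/eqP; apply: eq_bigr => i _;
  rewrite mul_conj.
Qed.

(** * A criterion for QWEP *)

Section Criterion.
Context {R : realType} {K F : hilbertType R} {I : nat -> finType}.
Context {om : ultra nat}.
Variable V : forall n, F -> I n -> K.
Arguments V : clear implicits.
Hypothesis Vip : forall x y,
  ucv om (fun n => famip (V n x) (V n y)) (hip x y).

Local Notation P := (compression Vip).
Local Notation asym := (asym Vip).
Local Notation JJ := (@JJ R K F I om V).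
Local Notation A := (asymA Vip).
Local Notation B := (opalg_cstar A).

Variables (M : set (bop F)) (kap : R).
Hypotheses (kap0 : 0 <= kap) (MP : forall T, M (P T)).
Hypothesis lift_ex : forall X, M X ->
  exists T, [/\ asym T, P T = X & bb T (kap * opn X)].

Definition gkset (js cs : seq (bop K)) (eps : R) : set (bop K * bop K) :=
  [set p | [/\ JJ p.1, adj p.1 = p.1, asym p.2, adj p.2 = p.2 &
    [/\ bcomp p.1 p.1 + bcomp p.2 p.2 = bid,
    forall j, j \in js -> bb (bcomp j p.2) eps,
    forall c, c \in cs -> bb (bcom p.1 c) eps &
    forall c, c \in cs -> bb (bcom p.2 c) eps]]].

(** The net of quasi-central pairs, indexed by finite parts of J and of B and by eps, in the form of
    a filter that is then refined to an ultrafilter. *)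
Definition gkfilter : set_system (bop K * bop K) := [set S | exists js cs eps,
  [/\ 0 < eps, forall j, j \in js -> JJ j, forall c, c \in cs -> asym c &
      gkset js cs eps `<=` S]].

Lemma gkfilter_proper : ProperFilter gkfilter.
Proof.
split.
  move=> [js [cs [eps [eps0 hj hc h]]]].
  by have [g [k hgk]] := gk_pair (Vip := Vip) eps0 hj hc; exact: (h (g, k)).
split.
- by exists [::], [::], 1; split.
- move=> S T [js [cs [eps [eps0 hj hc h]]]] [js' [cs' [eps' [eps0' hj' hc' h']]]].
  exists (js ++ js'), (cs ++ cs'), (Num.min eps eps'); split.
  + by rewrite lt_min eps0.
  + by move=> j; rewrite mem_cat => /orP[/hj|/hj'].
  + by move=> c; rewrite mem_cat => /orP[/hc|/hc'].
  + move=> p [h1 h2 h3 h4 [h5 h6 h7 h8]].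
    have m1 : Num.min eps eps' <= eps by rewrite ge_min lexx.
    have m2 : Num.min eps eps' <= eps' by rewrite ge_min lexx orbT.
    split; [apply: h|apply: h']; split=> //; split=> // x hx.
    * by apply: bb_le m1; apply: h6; rewrite mem_cat hx.
    * by apply: bb_le m1; apply: h7; rewrite mem_cat hx.
    * by apply: bb_le m1; apply: h8; rewrite mem_cat hx.
    * by apply: bb_le m2; apply: h6; rewrite mem_cat hx orbT.
    * by apply: bb_le m2; apply: h7; rewrite mem_cat hx orbT.
    * by apply: bb_le m2; apply: h8; rewrite mem_cat hx orbT.
- move=> S T ST [js [cs [eps [eps0 hj hc h]]]].
  by exists js, cs, eps; split=> //; exact: subset_trans ST.
Qed.

Lemma gkultra_ex : exists U : ultra (bop K * bop K), forall js cs eps,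
  0 < eps -> (forall j, j \in js -> JJ j) -> (forall c, c \in cs -> asym c) ->
  U (gkset js cs eps).
Proof.
have [G [UG sG]] := @ultraFilterLemma _ _ gkfilter_proper.
exists (Ultra UG) => js cs eps eps0 hj hc; apply: sG.
by exists js, cs, eps; split.
Qed.

Let U := projT1 (cid gkultra_ex).
Let Ugk js cs eps : 0 < eps -> (forall j, j \in js -> JJ j) ->
  (forall c, c \in cs -> asym c) -> U (gkset js cs eps).
Proof. by rewrite /U; case: cid => U' /=; apply. Qed.

Definition lift (X : bop F) : bop K := xget 0 [set T | asym T /\ P T = X].

Lemma liftP T : asym (lift (P T)) /\ P (lift (P T)) = P T.
Proof.
rewrite /lift; case: xgetP => [X _ //|h].
by have [S [h1 h2 _]] := lift_ex (MP T); have := h S; case.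
Qed.

Definition Phi (T : bop K) (p : bop K * bop K) : bop K :=
  bcomp p.1 (bcomp T p.1) + bcomp p.2 (bcomp (lift (P T)) p.2).

(** [Phi T p] as an element of B. The default 0 only concerns pairs for which [Phi T p] is outside
    B, which the ultrafilter ignores. *)
Definition phi (T : bop K) (p : bop K * bop K) : opel A :=
  xget 0 [set x : opel A | opval x = Phi T p].

Lemma phiE js cs eps T p : gkset js cs eps p -> opval (phi T p) = Phi T p.
Proof.
move=> [h1 h2 h3 h4 _].
have hA : asym (Phi T p).
  rewrite /Phi -[bcomp p.1 _]scale1r; apply: asym_lin.
    by apply: (JJ_asym Vip); exact: JJ_hered.
  by do 2!apply: asym_mul => //; have [] := liftP T.
rewrite /phi; case: xgetP => [x _ //|h].
by case: (h (@mkopel _ _ A _ hA)).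
Qed.

Lemma gkset_bb js cs eps p : gkset js cs eps p -> bb p.1 1 /\ bb p.2 1.
Proof.
move=> [_ s1 _ s2 [h _ _ _]].
have pyth x : nrm (p.1 x) ^+ 2 + nrm (p.2 x) ^+ 2 = nrm x ^+ 2.
  rewrite -!Re_hip -cReD !adjP s1 s2 -hipDr.
  by have := congr1 (fun S : bop K => S x) h; rewrite bopDE !bcompE bidE => ->.
split=> x; rewrite mul1r -(@ler_pXn2r _ 2) ?nnegrE ?nrm_ge0//.
  by rewrite -(pyth x) lerDl sqr_ge0.
by rewrite -(pyth x) lerDr sqr_ge0.
Qed.

Lemma asymA_inv (T W : bop K) : opset A T -> adj T = T ->
  bcomp T W = bid -> bcomp W T = bid -> opset A W.
Proof. exact: asym_inv. Qed.

Let E := cstar_opspace B.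

Lemma dual_bound (f : dual E) :
  exists2 c : R, 0 <= c & forall x : opel A, cabs (f x) <= c * opn x.
Proof.
case: f => f /= /asboolP[_ [c c0 hc]]; exists c => // x.
have := hc x; rewrite -lee_fin EFinM => /le_trans; apply.
apply: lee_wpmul2l; first by rewrite lee_fin.
apply: (cstar_mxnorm_le asymA_inv); first exact: opn_ge0.
move=> y; apply: l2norm_le; first by rewrite mulr_ge0 ?opn_ge0 ?l2norm_ge0.
rewrite exprMn l2norm_sq !big_ord1 -exprMn ler_pXn2r ?nnegrE ?nrm_ge0//.
  by rewrite mxE; exact: bb_opn.
by rewrite mulr_ge0 ?opn_ge0 ?nrm_ge0.
Qed.

(** The lifts c of the entries have no good joint bound, but c - j has one for some j with entries
    in the kernel ([quotient_norm]). [gk_row] applies to T and c - j, and the remainder k j k is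
    small. *)
Lemma phi_mb (J : finType) (T : J -> J -> bop K) (t eps : R) :
  0 <= t -> 0 < eps -> mb (fun i j => T i j : K -> K) t ->
  U [set p | mb (fun i j => opval (phi (T i j) p) : K -> K) (t + eps)].
Proof.
move=> t0 eps0 hT.
have e20 : 0 < eps / 2 by rewrite divr_gt0.
pose c i j := lift (P (T i j)).
have hc i j : asym (c i j) by have [] := liftP (T i j).
have hP : mb (fun i j => P (c i j) : F -> F) t.
  have -> : (fun i j => P (c i j) : F -> F) = (fun i j => P (T i j) : F -> F).
    by do 2!apply/funext => ?; rewrite /c (liftP _).2.
  exact: compression_mb.
have [j [Jj hj]] := quotient_norm kap0 MP lift_ex e20 t0 hc hP.
pose d := eps / 2 / (#|J|%:R ^+ 2 + 1).
have d0 : 0 < d by rewrite divr_gt0// ltr_wpDl// sqr_ge0.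
pose js := [seq j i k | i <- enum J, k <- enum J].
have hjs x : x \in js -> JJ x by move=> /allpairsP[[i k] /= [_ _ ->]].
apply: (ufilter (Ugk d0 hjs (cs := [::]) _)); first by [].
move=> p hp; have [b1 b2] := gkset_bb hp.
have [h1 h2 h3 h4 [h5 h6 _ _]] := hp.
have -> : (fun i k => opval (phi (T i k) p) : K -> K) =
  (fun i k => ((bcomp p.1 (bcomp (T i k) p.1) +
     bcomp p.2 (bcomp (c i k - j i k) p.2) : bop K) +
     bcomp p.2 (bcomp (j i k) p.2) : bop K) : K -> K).
  do 2!apply/funext => ?; rewrite (phiE _ hp) /Phi -addrA -bcompDr -bcompDl.
  by rewrite subrK.
have T' : mb (fun i j => T i j : K -> K) (t + eps / 2).
  by apply: mb_le hT _; rewrite lerDl ltW.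
have h7 := gk_row (addr_ge0 t0 (ltW e20)) h2 h4 h5 T' hj.
have h8 : mb (fun i k => bcomp p.2 (bcomp (j i k) p.2) : K -> K) (eps / 2).
  have : mb (fun i k => bcomp p.2 (bcomp (j i k) p.2) : K -> K)
     (#|J|%:R ^+ 2 * d).
    apply: mb_entries; first exact: ltW.
    move=> i k; rewrite -[d]mul1r; apply: bb_comp => //; apply: h6.
    by apply/allpairsP; exists (i, k); rewrite !mem_enum.
  move/mb_le; apply; rewrite /d mulrCA ler_piMr ?(ltW e20)//.
  by rewrite ler_pdivrMr ?mul1r ?lerDl// ltr_wpDl// sqr_ge0.
apply: mb_le (mbD h7 h8) _.
by rewrite -addrA -splitr.
Qed.

Lemma phi_opn (T : bop K) (eps : R) : 0 < eps ->
  U [set p | opn (phi T p) <= opn T + eps].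
Proof.
move=> eps0.
have hm : mb (fun _ _ : 'I_1 => T : K -> K) (opn T).
  move=> u; apply: l2norm_le; first by rewrite mulr_ge0 ?opn_ge0 ?l2norm_ge0.
  rewrite exprMn l2norm_sq !big_ord1 -exprMn.
  by rewrite ler_pXn2r ?nnegrE ?mulr_ge0 ?nrm_ge0 ?opn_ge0//; exact: bb_opn.
apply: (ufilter (phi_mb (opn_ge0 T) eps0 hm)) => p hp.
apply: opn_le; first by rewrite addr_ge0 ?opn_ge0 ?(ltW eps0).
exact: (mb_entry (T := fun _ _ : 'I_1 => opval (phi T p)) hp ord0 ord0).
Qed.

Definition v0 (T : bop K) (f : dual E) : R[i] :=
  ulim U (fun p => (f : E -> R[i]^o) (phi T p)).

Lemma v0P (T : bop K) (f : dual E) : ucv U (fun p => (f : E -> R[i]^o) (phi T p)) (v0 T f).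
Proof.
apply: ulimP; have [c c0 hc] := dual_bound f.
exists (c * (opn T + 1)); apply: (ufilter (phi_opn T ltr01)) => p hp.
by rewrite (le_trans (hc _))// ler_wpM2l.
Qed.

Lemma dual_sub (f : dual E) (x y : opel A) :
  (f : E -> R[i]^o) (x - y) = (f : E -> R[i]^o) x - (f : E -> R[i]^o) y.
Proof.
have h := dual_lin f (-1) (y : E) (x : E).
transitivity ((f : E -> R[i]^o) ((-1) *: (y : E) + (x : E))).
  by congr (dual_val f _); rewrite scaleN1r addrC.
by rewrite h scaleN1r addrC.
Qed.

Lemma v0_eq (T : bop K) (f : dual E) (g : bop K * bop K -> opel A) (l : R[i]) :
  ucv U (fun p => (f : E -> R[i]^o) (g p)) l ->
  (forall e, 0 < e -> U [set p | bb (opval (phi T p) - opval (g p)) e]) ->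
  v0 T f = l.
Proof.
move=> hl h; apply: (ucv_unique (v0P T f)).
apply: (ucv_near _ hl); have [c c0 hc] := dual_bound f.
apply: (unull_bound (C := c)) => // e e0.
apply: (ufilter (h e e0)) => p hp.
rewrite -dual_sub (le_trans (hc _))// ler_wpM2l//.
by apply: opn_le hp; exact: ltW.
Qed.

(** The choice of lifts is not linear, but its defect j lies in the kernel and contributes only k j
    k, which tends to 0. *)
Lemma v0_linl a (S T : bop K) (f : dual E) : v0 (a *: S + T) f = a * v0 S f + v0 T f.
Proof.
apply: (v0_eq (g := fun p => a *: phi S p + phi T p)).
  apply: (ucv_eq (ucvD (ucvZ a (v0P S f)) (v0P T f))) => p.
  by have := dual_lin f a (phi S p) (phi T p).
move=> e e0.
pose j := lift (P (a *: S + T)) - (a *: lift (P S) + lift (P T)).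
have Jj : JJ j.
  have [h1 h2] := liftP (a *: S + T); have [h3 h4] := liftP S.
  have [h5 h6] := liftP T.
  have h7 : asym (a *: lift (P S) + lift (P T)) by exact: asym_lin.
  have h8 : asym j by rewrite /j addrC -scaleN1r; exact: asym_lin.
  apply: (asym_JJ h8).
  by rewrite /j compressionB h2 !compression_lin h4 h6 subrr.
apply: (ufilter (@Ugk [:: j] [::] e e0 _ _)) => //.
  by move=> x; rewrite inE => /eqP->.
move=> p hp; have [b1 b2] := gkset_bb hp.
have [_ _ _ _ [_ h6 _ _]] := hp.
have -> : opval (phi (a *: S + T) p) - opval (a *: phi S p + phi T p) =
   bcomp p.2 (bcomp j p.2).
  rewrite opvalD opvalZ !(phiE _ hp) /Phi /j.
  apply: bop_ext => x; apply: hip_ext => z.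
  rewrite !(bopBE, bopDE, bopNE, bopZE, bcompE, bopB, bopD, bopN, bopZ).
  by rewrite !(hipDr, hipNr, hipZr); ring.
by rewrite -[e]mul1r; apply: bb_comp => //; apply: h6; rewrite inE.
Qed.

Lemma v0_linr (T : bop K) a (f g : dual E) : v0 T (a *: f + g) = a * v0 T f + v0 T g.
Proof.
apply: ulimE; exact: (ucvD (ucvZ a (v0P T f)) (v0P T g)).
Qed.

(** Writing b = b (g^2 + k^2), the difference between [phi b p] and b is k j k + [g, b] g + [k, b] k
    with j in the kernel: three small terms, whence e / 3. *)
Lemma v0_incl (b : opel A) (f : dual E) : v0 b f = (f : E -> R[i]^o) b.
Proof.
apply: (v0_eq (g := fun=> b)); first exact: ucv_cst.
move=> e e0; have hb : asym b := opvalP b.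
have [h1 h2] := liftP b.
pose j := lift (P b) - opval b.
have Jj : JJ j.
  have h8 : asym j by rewrite /j addrC -scaleN1r; exact: asym_lin.
  by apply: (asym_JJ h8); rewrite /j compressionB h2 subrr.
have e30 : 0 < e / 3 by rewrite divr_gt0.
apply: (ufilter (@Ugk [:: j] [:: opval b] _ e30 _ _)).
- by move=> x; rewrite inE => /eqP->.
- by move=> x; rewrite inE => /eqP->.
move=> p hp; have [b1 b2] := gkset_bb hp.
have [_ _ _ _ [h5 h6 h7 h8]] := hp.
have -> : opval (phi b p) - opval b = bcomp p.2 (bcomp j p.2) +
   (bcomp (bcom p.1 b) p.1 + bcomp (bcom p.2 b) p.2).
  rewrite (phiE _ hp) /Phi -{3}[opval b]bcomp1r -h5 /j /bcom.
  apply: bop_ext => x; apply: hip_ext => z.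
  rewrite !(bopBE, bopDE, bopNE, bopZE, bcompE, bopB, bopD, bopN, bopZ).
  by rewrite !(hipDr, hipNr, hipZr); ring.
have m1 : bb (bcomp p.2 (bcomp j p.2)) (1 * (e / 3)).
  by apply: bb_comp => //; apply: h6; rewrite inE.
have m2 : bb (bcomp (bcom p.1 b) p.1) (e / 3 * 1).
  by apply: bb_comp => //; [exact: ltW|apply: h7; rewrite inE].
have m3 : bb (bcomp (bcom p.2 b) p.2) (e / 3 * 1).
  by apply: bb_comp => //; [exact: ltW|apply: h8; rewrite inE].
apply: bb_le (bbD m1 (bbD m2 m3)) _.
by lra.
Qed.

Lemma v0_mb (n m : nat) (T : 'I_n -> 'I_n -> bop K) (f : 'M[dual_opspace E]_m)
    (t s : R) : 0 <= t -> 0 <= s -> mb (fun i j => T i j : K -> K) t ->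
  (mxnorm f <= s%:E)%E ->
  mb (fun k l : 'I_n * 'I_m =>
        ( *%R (v0 (T k.1 l.1) (f k.2 l.2)) : R[i]^o -> R[i]^o)) (t * s).
Proof.
move=> t0 s0 hT hf; apply: mb_eps => e e0.
pose d := e / (s + 1).
have d0 : 0 < d by rewrite divr_gt0// ltr_wpDl.
have td : 0 < t + d by rewrite ltr_wpDl.
apply: (mb_ucv (w := fun (k l : 'I_n * 'I_m) p =>
  ((f k.2 l.2 : dual E) : E -> R[i]^o) (phi (T k.1 l.1) p))).
- by rewrite addr_ge0 ?mulr_ge0 ?(ltW e0).
- by move=> k l; exact: v0P.
apply: (ufilter (phi_mb t0 d0 hT)) => p hp.
pose a : R[i] := ((t + d)^-1)%:C.
have ca : cabs a = (t + d)^-1 by rewrite cabs_real ger0_norm// invr_ge0 ltW.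
have a0 : a != 0 by apply: contraTneq td => /(congr1 cabs) ;
  rewrite ca cabs0 => /eqP; rewrite invr_eq0 => /eqP->; rewrite ltxx.
(* The norm of f is a supremum over the unit ball, and [phi] is bounded by t + d only, so the matrix
   is divided by t + d. *)
pose x : 'M[E]_n := \matrix_(i, j) (a *: (phi (T i j) p : E)).
have x1 : (mxnorm x <= 1)%E.
  apply: (cstar_mxnorm_le asymA_inv) => // y.
  have -> : (fun i => \sum_j opval (x i j) (y j)) =
      (fun i => a *: \sum_j opval (phi (T i j) p) (y j)).
    by apply/funext => i; rewrite scaler_sumr; apply: eq_bigr => j _; rewrite mxE.
  rewrite l2normZ ca mul1r ler_pdivrMl//; exact: hp.
have h1 : (opmx_norm (V := R[i]^o) (fun k l : 'I_m * 'I_n =>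
    *%R (((f k.1 l.1 : dual E) : E -> R[i]^o) (x k.2 l.2))) <= s%:E)%E.
  by apply: le_trans hf; apply: ereal_sup_ubound; exists n, x.
have h2 := mb_opmx_norm _ h1.
have {h2} h2 : mb (fun k l : 'I_m * 'I_n =>
    ( *%R (((f k.1 l.1 : dual E) : E -> R[i]^o) (x k.2 l.2)) : R[i]^o -> R[i]^o)) s.
  by apply: h2 => i j b y; rewrite /GRing.scale /= mulrCA.
have sw : bijective (fun k : 'I_n * 'I_m => (k.2, k.1)).
  by exists (fun k : 'I_m * 'I_n => (k.2, k.1)) => -[].
have h3 := mb_reindex sw h2.
apply: (@mb_le _ _ _ _ ((t + d) * s)); last first.
  rewrite mulrDl lerD2l /d mulrAC ler_pdivrMr ?ltr_wpDl//.
  by rewrite ler_pM2l// lerDl.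
move=> z; have := h3 z; rewrite -(ler_pM2l td) mulrA => hz.
apply: le_trans hz; rewrite -(ler_pM2l (x := (t + d)^-1)) ?invr_gt0//.
rewrite mulrA mulVf ?gt_eqF// mul1r -ca -l2normZ.
rewrite le_eqVlt; apply/orP; left; apply/eqP; congr l2norm.
apply/funext => k; rewrite scaler_sumr; apply: eq_bigr => l _ /=.
rewrite mxE /GRing.scale /= mulrA; congr (_ * _).
have := dual_lin (f k.2 l.2) a (phi (T k.1 l.1) p : E) 0.
have -> : dual_val (f k.2 l.2) 0 = 0.
  by have := dual_lin (f k.2 l.2) (-1) 0 0; rewrite scaler0 addr0 scaleN1r addNr.
by rewrite !addr0.
Qed.

Fact v1_subproof (T : bop K) : (v0 T : dual_opspace E -> R[i]^o) \in bounded_functional.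
Proof.
apply/asboolP; split; first by move=> a f g; exact: v0_linr.
(* The summand 1 makes the constant positive, so that its product with an infinite norm is
   infinite. *)
exists (opn T + 1); first by rewrite addr_ge0// opn_ge0.
move=> f; have t0 : 0 < opn T + 1 by rewrite ltr_wpDl// opn_ge0.
have hm : mb (fun _ _ : 'I_1 => T : K -> K) (opn T + 1).
  move=> u; apply: l2norm_le; first by rewrite mulr_ge0 ?(ltW t0) ?l2norm_ge0.
  rewrite exprMn l2norm_sq !big_ord1 -exprMn.
  rewrite ler_pXn2r ?nnegrE ?mulr_ge0 ?nrm_ge0 ?(ltW t0)//.
  by apply: bb_le (bb_opn T) _ _; rewrite lerDl.
(* To exclude the value -oo a member of the set under the supremum is needed; the matrix x of size 0
   is one. *)
have N0 : (0 <= mxnorm (const_mx f : 'M[dual_opspace E]_1))%E.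
  apply: (@le_trans _ _ (opmx_norm (V := R[i]^o) (fun k l : 'I_1 * 'I_0 =>
     *%R (((const_mx f : 'M[dual E]_1) k.1 l.1 : E -> R[i]^o)
     ((0 : 'M[E]_0) k.2 l.2))))); last first.
    apply: ereal_sup_ubound; exists 0%N, 0; split=> //.
    apply: (cstar_mxnorm_le asymA_inv) => // y.
    by rewrite /l2norm !big_ord0 sqrtr0 mulr0.
  apply: ereal_sup_ubound => /=; exists (fun=> 0).
    by rewrite /l2norm big1 ?sqrtr0// => i _; rewrite normr0 expr0n.
  congr (_%:E); rewrite /l2norm big1 ?sqrtr0// => i _.
  by rewrite big1 ?normr0 ?expr0n// => j _; rewrite mulr0.
case: (mxnorm (const_mx f : 'M[dual_opspace E]_1)) (@v0_mb 1 1 (fun _ _ => T)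
    (const_mx f)) N0 => [s| |//] h N0.
- rewrite -EFinM lee_fin.
  have := h _ _ (ltW t0) N0 hm (lexx _) => {}h.
  pose z (_ : 'I_1 * 'I_1) : R[i]^o := 1.
  have := h z; set w := (fun k => _).
  have z1 : l2norm z <= 1.
    apply: l2norm_le => //; rewrite (bigD1 (ord0, ord0))//= big1 ?addr0.
      by rewrite /z /nrm normr1 expr1n.
    by move=> [i j]; rewrite !ord1 eqxx.
  have w1 : complex.Re `|v0 T f| <= l2norm w.
    have -> : complex.Re `|v0 T f| = nrm (w (ord0, ord0)).
      rewrite /w (bigD1 (ord0, ord0))//= big1 ?addr0.
        by rewrite mxE /z mulr1.
      by move=> [i j]; rewrite !ord1 eqxx.
    exact: nrm_le_l2norm.
  move=> hw; apply: le_trans w1 _; apply: le_trans hw _.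
  by rewrite ler_piMr// mulr_ge0// ltW.
- by rewrite gt0_muley ?leey// lte_fin.
Qed.

Definition v1 (T : bop_opspace K) : dual_opspace (dual_opspace E) :=
  Dual (v1_subproof T).

Fact v1_linear : linear v1.
Proof.
by move=> a S T; apply: val_inj; apply/funext => f; exact: v0_linl.
Qed.

HB.instance Definition _ := GRing.isLinear.Build R[i] (bop_opspace K)
  (dual_opspace (dual_opspace E)) *:%R v1 v1_linear.

Definition u1 (x : E) : bop_opspace K := opval (x : opel A).

Fact u1_linear : linear u1. Proof. by []. Qed.

HB.instance Definition _ := GRing.isLinear.Build R[i] E (bop_opspace K)
  *:%R u1 u1_linear.

Lemma asym_WEP : WEP B.
Proof.
exists K, u1, v1; split.
- move=> n x; apply: ereal_sup_ubound; exists K.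
  exists (u1 : {linear B -> bop K}); split=> //; split=> // a b z.
  exact: adjP.
- move=> n T.
  have [t t0 hT] : exists2 t : R, 0 <= t & opmx_norm (fun i j => T i j : K -> K) = t%:E.
    have [m m0 hm] : exists2 m : R, 0 <= m & forall i j, bb (T i j) m.
      exists (\sum_i \sum_j opn (T i j)) => [|i j].
        by rewrite sumr_ge0// => i _; rewrite sumr_ge0// => j _; exact: opn_ge0.
      apply: bb_le (bb_opn _) _; rewrite (bigD1 i)//= (bigD1 j)//= -addrA lerDl.
      rewrite addr_ge0// sumr_ge0// => k _; first exact: opn_ge0.
      by rewrite sumr_ge0// => l _; exact: opn_ge0.
    have h1 : (opmx_norm (fun i j => T i j : K -> K) <=
        (#|'I_n|%:R ^+ 2 * m)%:E)%E.
      apply: opmx_norm_le; first by rewrite mulr_ge0// sqr_ge0.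
      exact: mb_entries.
    have h2 : (0 <= opmx_norm (fun i j => T i j : K -> K))%E.
      apply: ereal_sup_ubound => /=; exists (fun=> 0).
        by rewrite /l2norm big1 ?sqrtr0// => i _; rewrite normr0 expr0n.
      congr (_%:E); rewrite /l2norm big1 ?sqrtr0// => i _.
      by rewrite big1 ?normr0 ?expr0n// => j _; rewrite bop0.
    case: (opmx_norm _) h1 h2 => // t _; rewrite lee_fin => t0.
    by exists t.
  have mT : mb (fun i j => T i j : K -> K) t.
    by apply: mb_opmx_norm; [move=> i j a y; exact: bopZ|rewrite hT].
  rewrite [leRHS]hT; apply: ge_ereal_sup => _ [m [f [f1 ->]]].
  apply: opmx_norm_le => //.
  have := v0_mb t0 ler01 mT f1; rewrite mulr1.
  move=> h z; have := h z; congr (l2norm _ <= _).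
  by apply/funext => k; apply: eq_bigr => l _; rewrite mxE.
- by move=> b f; exact: v0_incl.
Qed.

Definition compression_rep (x : B) : bop F := P (opval (x : opel A)).

Fact compression_rep_linear : linear compression_rep.
Proof. by move=> a x y; exact: compression_lin. Qed.

HB.instance Definition _ := GRing.isLinear.Build R[i] B (bop F)
  *:%R compression_rep compression_rep_linear.

Lemma qwep_criterion : QWEP M.
Proof.
exists B, [set b | compression_rep b = 0]; split; first exact: asym_WEP.
  split.
  - move=> b hb; apply: bop_ext => x; rewrite bop0E.
    apply: nrm_eps0 => e e0; have d0 : 0 < e / (nrm x + 1) by rewrite divr_gt0// ltr_wpDl ?nrm_ge0.
    have [|c [/= Jc /ball_nrmE bc]] := hb (ball b (e / (nrm x + 1))%:C).
      by apply: nbhsx_ballx; rewrite ltcR.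
    have h : compression_rep b = compression_rep (b - c).
      have := compression_rep_linear (-1) c b.
      by rewrite Jc scaler0 add0r scaleN1r addrC => ->.
    have hc := @compression_bb _ _ _ _ _ _ Vip (opval (b - c : opel A)) _ (ltW d0).
    rewrite h (le_trans (hc _ x))//.
      by apply: bb_le (bb_opn _) _; apply: ltW; exact: bc.
    rewrite mulrAC ler_pdivrMr ?ltr_wpDl ?nrm_ge0//.
    by rewrite ler_pM2l// lerDl.
  - exact: compression0.
  - move=> a x y /= hx hy.
    by rewrite compression_rep_linear hx hy scaler0 addr0.
  - move=> b x /= hx.
    have hb : asym (opval (b : opel A)) := opvalP (b : opel A).
    have hx' : asym (opval (x : opel A)) := opvalP (x : opel A).
    split; apply: bop_ext => y; rewrite /compression_rep /= compression_comp//.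
      by move: hx; rewrite /compression_rep bcompE => ->; rewrite bop0E bop0.
    by move: hx; rewrite /compression_rep bcompE => ->.
exists compression_rep; split=> //.
- split=> [a b x|a].
    have hb : asym (opval (b : opel A)) := opvalP (b : opel A).
    exact: (congr1 (fun S : bop F => S x)
      (compression_comp (opval (a : opel A)) hb)).
  move=> x y; transitivity (hip x (adj (P (opval (a : opel A))) y)).
    exact: adjP.
  by rewrite -(compression_adj Vip).
- apply/seteqP; split=> [_ [b _ <-]|X /lift_ex[T [hT <- _]]]; first exact: MP.
  by exists (@mkopel _ _ A _ hT).
Qed.

End Criterion.

Lemma nat_ultra_ex : exists U : ultra nat, forall N, U [set n | (N <= n)%N].
Proof.
have [G [UG sG]] := @ultraFilterLemma nat \oo _.
by exists (Ultra UG) => N; apply: sG; exists N.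
Qed.

Definition natU : ultra nat := projT1 (cid nat_ultra_ex).

Lemma natU_ge N : natU [set n | (N <= n)%N].
Proof. by rewrite /natU; case: cid. Qed.

(** * The Hilbert space of square-summable sequences *)

Section Ell2.
Context {R : realType}.
Implicit Types x y z : nat * nat -> R[i]^o.

(** The index (n, i) is coordinate i of block n: a single l^2 contains the spaces of all matrix
    models, so that one operator acts on all of them. Infinite sums are ultralimits of sums over
    square boxes. *)
Definition boxip (N : nat) x y : R[i] :=
  \sum_(m < N) \sum_(i < N) conjc (x (val m, val i)) * y (val m, val i).
Definition boxsq (N : nat) x : R :=
  \sum_(m < N) \sum_(i < N) cabs (x (val m, val i)) ^+ 2.

Lemma boxipE N x : boxip N x x = (boxsq N x)%:C.
Proof.
rewrite /boxsq rmorph_sum /=; apply: eq_bigr => m _.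
by rewrite rmorph_sum /=; apply: eq_bigr => i _; rewrite conj_mul.
Qed.

Lemma boxsq_ge0 N x : 0 <= boxsq N x.
Proof. by rewrite !sumr_ge0// => m _; rewrite sumr_ge0// => i _; rewrite sqr_ge0. Qed.

Lemma boxip_semi N :
  semi_ip (boxip N : (nat * nat -> R[i]^o) -> (nat * nat -> R[i]^o) -> R[i]).
Proof.
split=> [a x y z|x y|x].
- rewrite /boxip mulr_sumr -big_split; apply: eq_bigr => m _ /=.
  rewrite mulr_sumr -big_split; apply: eq_bigr => i _ /=.
  by rewrite mulrDr; congr (_ + _); rewrite mulrCA.
- rewrite /boxip conj_sum; apply: eq_bigr => m _.
  by rewrite conj_sum; apply: eq_bigr => i _; rewrite conjM conjcK mulrC.
- by rewrite boxipE boxsq_ge0.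
Qed.

Lemma boxsq_le N N' x : (N <= N')%N -> boxsq N x <= boxsq N' x.
Proof.
move=> NN'; rewrite /boxsq.
rewrite (big_ord_widen _ (fun m => \sum_(i < N) cabs (x (m, val i)) ^+ 2) NN').
rewrite big_mkcond; apply: ler_sum => m _.
case: ifP => _; last by rewrite sumr_ge0// => i _; rewrite sqr_ge0.
rewrite (big_ord_widen _ (fun i => cabs (x (val m, i)) ^+ 2) NN').
by rewrite big_mkcond; apply: ler_sum => i _; case: ifP => // _; rewrite sqr_ge0.
Qed.

Lemma boxsq_coord x m i : cabs (x (m, i)) ^+ 2 <= boxsq (maxn m i).+1 x.
Proof.
have hm : (m < (maxn m i).+1)%N by rewrite ltnS leq_maxl.
have hi : (i < (maxn m i).+1)%N by rewrite ltnS leq_maxr.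
rewrite /boxsq (bigD1 (Ordinal hm))//= (bigD1 (Ordinal hi))//= -addrA lerDl.
rewrite addr_ge0// sumr_ge0// => k _; first by rewrite sqr_ge0.
by rewrite sumr_ge0// => l _; rewrite sqr_ge0.
Qed.

Lemma boxsqD N x y : boxsq N (x + y) <= boxsq N x *+ 2 + boxsq N y *+ 2.
Proof.
have h1 := semi_sqD (boxip_semi N) x y; have h2 := semi_sqB (boxip_semi N) x y.
rewrite !boxipE /= in h1 h2; rewrite h1; have := boxsq_ge0 N (x - y).
by rewrite h2; lra.
Qed.

Lemma boxsqZ N a x : boxsq N (a *: x) = cabs a ^+ 2 * boxsq N x.
Proof.
rewrite /boxsq mulr_sumr; apply: eq_bigr => m _; rewrite mulr_sumr.
by apply: eq_bigr => i _; rewrite /GRing.scale /= /GRing.scale /= cabsM exprMn.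
Qed.

Definition ell2_pred : {pred (nat * nat -> R[i]^o)} :=
  fun x => `[< exists M, forall N, boxsq N x <= M >].

Lemma ell2_submod : submod_closed ell2_pred.
Proof.
split.
  apply/asboolP; exists 0 => N; rewrite /boxsq big1// => m _.
  by rewrite big1// => i _; rewrite cabs0 expr0n.
move=> a x y /asboolP[M hM] /asboolP[M' hM']; apply/asboolP.
exists (cabs a ^+ 2 * M *+ 2 + M' *+ 2) => N.
rewrite (le_trans (boxsqD _ _ _))// boxsqZ lerD ?lerMn2r//=.
by rewrite ler_wpM2l ?sqr_ge0.
Qed.

HB.instance Definition _ := GRing.isSubmodClosed.Build R[i]
  (nat * nat -> R[i]^o) ell2_pred ell2_submod.

End Ell2.

Record ell2 (R : realType) := Ell2 {
  ell2_val :> nat * nat -> R[i]^o ; _ : ell2_val \in ell2_pred }.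

HB.instance Definition _ R := [isSub for @ell2_val R].
HB.instance Definition _ R := [Choice of @ell2 R by <:].
HB.instance Definition _ R := [SubChoice_isSubLmodule of @ell2 R by <:].

Section Ell2Hilbert.
Context {R : realType}.
Implicit Types x y z : ell2 R.

Lemma ell2_bd x : exists2 M, 0 <= M & forall N, boxsq N x <= M.
Proof.
case: x => x /= /asboolP[M hM]; exists M => //.
exact: le_trans (boxsq_ge0 0 x) (hM 0%N).
Qed.

Definition ell2_ip x y : R[i] := ulim natU (fun N => boxip N x y).

Lemma ell2_ipP x y : ucv natU (fun N => boxip N x y) (ell2_ip x y).
Proof.
apply: ulimP; have [M M0 hM] := ell2_bd x; have [M' M'0 hM'] := ell2_bd y.
exists (Num.sqrt M * Num.sqrt M'); apply: utrue => N.
rewrite (le_trans (semi_CS_sqrt (boxip_semi N) x y))// !boxipE /=.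
by rewrite ler_pM ?sqrtr_ge0// ler_wsqrtr.
Qed.

Lemma ell2_ip_semi : semi_ip (ell2_ip : ell2 R -> ell2 R -> R[i]).
Proof.
split=> [a x y z|x y|x].
- apply: ulimE; apply: (ucv_eq (ucvD (ucvZ a (ell2_ipP x y)) (ell2_ipP x z))) => N.
  by have [h _ _] := boxip_semi (R := R) N; rewrite -h.
- apply: ulimE; apply: (ucv_eq (ucv_conj (ell2_ipP x y))) => N.
  by have [_ h _] := boxip_semi (R := R) N; rewrite -h.
- apply: (ucv_Re_ge (ell2_ipP x x)); apply: utrue => N.
  by rewrite boxipE boxsq_ge0.
Qed.

Lemma boxsq_ell2 x N : boxsq N x <= complex.Re (ell2_ip x x).
Proof.
apply: (ucv_Re_ge (ell2_ipP x x)); apply: (ufilter (natU_ge N)) => N' NN'.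
by rewrite boxipE /= boxsq_le.
Qed.

Lemma ell2_ip_le x (M : R) : (forall N, boxsq N x <= M) ->
  complex.Re (ell2_ip x x) <= M.
Proof.
move=> h; apply: (ucv_Re_le (ell2_ipP x x)); apply: utrue => N.
by rewrite boxipE; exact: h.
Qed.

Let norm x : R[i] := (Num.sqrt (complex.Re (ell2_ip x x)))%:C.

Fact ell2_normD x y : norm (x + y) <= norm x + norm y.
Proof.
rewrite /norm -rmorphD lecR.
have S := ell2_ip_semi; have p z : 0 <= complex.Re (ell2_ip z z) by case: S.
rewrite -(@ler_pXn2r _ 2) ?nnegrE ?addr_ge0 ?sqrtr_ge0// sqrrD !sqr_sqrtr//.
rewrite (semi_sqD S) lerD2r lerD2l lerMn2r /= (le_trans (ler_norm _))//.
by rewrite (le_trans (Re_le_cabs _))// (semi_CS_sqrt S).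
Qed.

Fact ell2_normZ a x : norm (a *: x) = `|a| * norm x.
Proof.
rewrite /norm normcE -rmorphM; congr (_%:C); have S := ell2_ip_semi.
rewrite (semiZr S) (semiZl S) mulrA mul_conj (semi_real S x) -rmorphM /=.
by rewrite sqrtrM ?sqr_ge0// sqrtr_sqr (ger0_norm (cabs_ge0 a)).
Qed.

Fact ell2_norm0 x : norm x = 0 -> x = 0.
Proof.
move=> /realC_inj /eqP; rewrite sqrtr_eq0 => h.
apply: val_inj; apply/funext => -[m i]; apply: cabs0_eq0; apply/eqP.
rewrite -sqrf_eq0 eq_le sqr_ge0 andbT.
by rewrite (le_trans (boxsq_coord _ _ _))// (le_trans (boxsq_ell2 _ _)).
Qed.

HB.instance Definition _ := Lmodule_isNormed.Build R[i] (ell2 R)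
  ell2_normD ell2_normZ ell2_norm0.

Lemma nrm_ell2 x : nrm x ^+ 2 = complex.Re (ell2_ip x x).
Proof. by rewrite sqr_sqrtr//; case: ell2_ip_semi. Qed.

Lemma nrm_ell2_le x (M : R) : 0 <= M -> (forall N, boxsq N x <= M ^+ 2) ->
  nrm x <= M.
Proof.
move=> M0 h; rewrite -(@ler_pXn2r _ 2) ?nnegrE ?nrm_ge0// nrm_ell2.
exact: ell2_ip_le.
Qed.

Lemma boxsq_nrm x N : boxsq N x <= nrm x ^+ 2.
Proof. by rewrite nrm_ell2 boxsq_ell2. Qed.

Fact ell2_seq_complete (u : nat -> ell2 R) :
  cauchy_seq_nrm u -> exists l, tends u l.
Proof.
move=> cu.
have coord (x : ell2 R) m i : cabs (x (m, i)) <= nrm x.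
  rewrite -(@ler_pXn2r _ 2) ?nnegrE ?nrm_ge0 ?cabs_ge0//.
  by rewrite (le_trans (boxsq_coord _ _ _))// boxsq_nrm.
have bd p : ubd natU (fun k => u k p).
  have [N hN] := cu 1 ltr01; exists (nrm (u N) + 1).
  apply: (ufilter (natU_ge N)) => k Nk; case: p => m i.
  rewrite (le_trans (coord _ _ _))// -(subrK (u N) (u k)) addrC.
  by rewrite (le_trans (nrmD _ _))// lerD2l hN.
pose l p : R[i]^o := ulim natU (fun k => u k p).
have hl p : ucv natU (fun k => u k p) (l p) := ulimP (bd p).
have box e : 0 < e -> exists N, forall k, (N <= k)%N -> forall n,
    boxsq n ((u k : nat * nat -> R[i]^o) - l) <= e ^+ 2.
  move=> e0; have [N hN] := cu e e0; exists N => k Nk n.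
  have h1 : ucv natU (fun k' => boxip n ((u k : nat * nat -> R[i]^o) - u k')
     ((u k : nat * nat -> R[i]^o) - u k'))
     (boxip n ((u k : nat * nat -> R[i]^o) - l)
     ((u k : nat * nat -> R[i]^o) - l)).
    apply: ucv_sum => m; apply: ucv_sum => i.
    by apply: ucvM; [apply: ucv_conj|]; apply: ucvB;
      (exact: ucv_cst || exact: hl).
  have -> : boxsq n ((u k : nat * nat -> R[i]^o) - l) = complex.Re
    (boxip n ((u k : nat * nat -> R[i]^o) - l)
     ((u k : nat * nat -> R[i]^o) - l)) by rewrite boxipE.
  apply: (ucv_Re_le h1); apply: (ufilter (natU_ge N)) => k' Nk'.
  rewrite boxipE /= (le_trans (boxsq_nrm (u k - u k') n))//.
  by rewrite ler_pXn2r ?nnegrE ?nrm_ge0 ?(ltW e0)//; exact: hN.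
have [N hN] := box 1 ltr01.
have [M M0 hM] := ell2_bd (u N).
have l2l : l \in ell2_pred.
  apply/asboolP; exists (M *+ 2 + 1 *+ 2) => n.
  have -> : l = (u N : nat * nat -> R[i]^o) -
     ((u N : nat * nat -> R[i]^o) - l) by rewrite opprB addrC subrK.
  rewrite (le_trans (boxsqD _ _ _))// lerD ?lerMn2r//=.
  rewrite -scaleN1r boxsqZ cabsN /cabs normr1 expr1n mul1r.
  by have := hN N (leqnn _) n; rewrite expr1n.
exists (Ell2 l2l) => e e0; have [N' hN'] := box e e0; exists N' => k Nk.
by apply: nrm_ell2_le; [exact: ltW|exact: hN'].
Qed.

HB.instance Definition _ := Uniform_isComplete.Build (ell2 R)
  (seq_complete ell2_seq_complete).

Definition ell2_hilbert : hilbertType R.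
Proof.
apply: (@Hilbert R (ell2 R) ell2_ip).
- by have [] := ell2_ip_semi.
- by have [] := ell2_ip_semi.
- by move=> x; rewrite nrmE -rmorphXn /= nrm_ell2 (semi_real ell2_ip_semi).
Defined.

End Ell2Hilbert.
Arguments ell2_hilbert R : clear implicits.

(** * Blocks of l^2 and block-diagonal operators *)

Section Blocks.
Context {R : realType} (d : nat -> nat).
Local Notation K := (ell2_hilbert R).

Definition ord_ext n (u : 'I_(d n) -> R[i]) (i : nat) : R[i] :=
  if insub i is Some j then u j else 0.

Lemma ord_ext_val n (u : 'I_(d n) -> R[i]) (j : 'I_(d n)) :
  ord_ext u (val j) = u j.
Proof. by rewrite /ord_ext valK. Qed.

Lemma ord_ext0 n (u : 'I_(d n) -> R[i]) i : (d n <= i)%N -> ord_ext u i = 0.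
Proof. by move=> h; rewrite /ord_ext insubF// ltnNge h. Qed.

Lemma sum_ord_eq (V : nmodType) (g : nat -> V) (D N : nat) : (D <= N)%N ->
  (forall i, (D <= i)%N -> g i = 0) -> \sum_(i < N) g i = \sum_(i < D) g i.
Proof.
move=> DN g0; rewrite [RHS](big_ord_widen _ _ DN) [RHS]big_mkcond.
by apply: eq_bigr => i _; case: ifP => // /negbT; rewrite -leqNgt => /g0.
Qed.

Lemma sum_ord_le (g : nat -> R) (D N : nat) : (forall i, 0 <= g i) ->
  (forall i, (D <= i)%N -> g i = 0) -> \sum_(i < N) g i <= \sum_(i < D) g i.
Proof.
move=> gp g0; rewrite -(sum_ord_eq (leq_maxl D N) g0).
rewrite (big_ord_widen _ g (leq_maxr D N)) big_mkcond ler_sum// => i _.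
by case: ifP.
Qed.

Definition emb_fun n (u : 'I_(d n) -> R[i]) : nat * nat -> R[i]^o :=
  fun p => if p.1 == n then ord_ext u p.2 else 0.

Lemma boxip_embr n (x : nat * nat -> R[i]^o) (v : 'I_(d n) -> R[i]) N :
  (maxn n (d n) < N)%N ->
  boxip N x (emb_fun v) = \sum_i conjc (x (n, val i)) * v i.
Proof.
rewrite gtn_max => /andP[nN dN]; rewrite /boxip (bigD1 (Ordinal nN))//=.
rewrite [X in _ + X]big1 ?addr0 => [|m mn]; last first.
  rewrite big1// => i _; rewrite /emb_fun /=; case: eqP => [e|_]; last by rewrite mulr0.
  by case/eqP: mn; apply: val_inj.
rewrite /emb_fun /= eqxx.
rewrite (@sum_ord_eq _ (fun i => conjc (x (n, i)) * ord_ext v i) _ _ (ltnW dN)).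
  by apply: eq_bigr => i _; rewrite !ord_ext_val.
by move=> i /(ord_ext0 v) ->; rewrite mulr0.
Qed.

Lemma boxip_emb n (u v : 'I_(d n) -> R[i]) N : (maxn n (d n) < N)%N ->
  boxip N (emb_fun u) (emb_fun v) = \sum_i conjc (u i) * v i.
Proof.
move=> h; rewrite boxip_embr//; apply: eq_bigr => i _.
by rewrite /emb_fun /= eqxx ord_ext_val.
Qed.

Lemma emb_subproof n (u : 'I_(d n) -> R[i]) : emb_fun u \in ell2_pred.
Proof.
apply/asboolP; exists (boxsq (maxn n (d n)).+1 (emb_fun u)) => N.
have [h|h] := leqP N (maxn n (d n)).+1; first exact: boxsq_le.
suff -> : boxsq N (emb_fun u) = boxsq (maxn n (d n)).+1 (emb_fun u) by [].
apply: realC_inj; rewrite -!boxipE !boxip_emb//.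
exact: ltn_trans h.
Qed.

Definition emb n (u : 'I_(d n) -> R[i]) : K := Ell2 (emb_subproof u).

Lemma hip_emb n (u v : 'I_(d n) -> R[i]) :
  hip (emb u) (emb v) = \sum_i conjc (u i) * v i.
Proof.
apply: ulimE; apply: (ucv_ext _ (ucv_cst (\sum_i conjc (u i) * v i))).
by apply: (ufilter (natU_ge (maxn n (d n)).+1)) => N h; rewrite boxip_emb.
Qed.

Lemma hip_embr n (x : K) (v : 'I_(d n) -> R[i]) :
  hip x (emb v) = \sum_i conjc ((x : ell2 R) (n, val i)) * v i.
Proof.
apply: ulimE; apply: (ucv_ext _ (ucv_cst
  (\sum_i conjc ((x : ell2 R) (n, val i)) * v i))).
by apply: (ufilter (natU_ge (maxn n (d n)).+1)) => N h; rewrite boxip_embr.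
Qed.

Lemma emb_lin n a (u v : 'I_(d n) -> R[i]) :
  emb (fun i => a * u i + v i) = a *: emb u + emb v.
Proof.
apply: val_inj; apply/funext => -[m i].
change (emb_fun (fun i => a * u i + v i) (m, i) =
  a * emb_fun u (m, i) + emb_fun v (m, i)).
rewrite /emb_fun /=; case: eqP => _; last by rewrite mulr0 addr0.
by rewrite /ord_ext; case: insub => [j|]//; rewrite mulr0 addr0.
Qed.

Variables (T : forall n, 'M[R[i]]_(d n)) (M : R).
Hypotheses (M0 : 0 <= M) (hT : forall n (u : 'I_(d n) -> R[i]),
  \sum_i cabs (\sum_j T n i j * u j) ^+ 2 <= M ^+ 2 * \sum_i cabs (u i) ^+ 2).

Let bfun (x : nat * nat -> R[i]^o) : nat * nat -> R[i]^o :=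
  fun p => ord_ext (fun i => \sum_j T p.1 i j * x (p.1, val j)) p.2.

(** The image on a box depends on full blocks of x, which may stick out of that box; N' is large
    enough to contain the first N blocks. *)
Let bfun_box x N : exists N', boxsq N (bfun x) <= M ^+ 2 * boxsq N' x.
Proof.
pose N' := (N + \sum_(n < N) d n)%N; exists N'.
have NN' : (N <= N')%N by rewrite leq_addr.
apply: (@le_trans _ _ (\sum_(m < N) M ^+ 2 *
    \sum_(i < N') cabs (x (val m, val i)) ^+ 2)).
  apply: ler_sum => m _.
  have dN : (d m <= N')%N.
    by rewrite /N' (bigD1 m)//= addnCA leq_addr.
  apply: (@le_trans _ _ (M ^+ 2 * \sum_(i < d m) cabs (x (val m, val i)) ^+ 2)).
    apply: le_trans (hT _).
    pose g i := cabs (ord_ext (fun i => \sum_j T m i j * x (val m, val j)) i) ^+ 2.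
    have -> : \sum_(i < d m) cabs (\sum_j T m i j * x (val m, val j)) ^+ 2 =
       \sum_(i < d m) g i by apply: eq_bigr => i _; rewrite /g ord_ext_val.
    apply: (@sum_ord_le g) => i; first by rewrite sqr_ge0.
    by move=> /ord_ext0 h; rewrite /g h cabs0 expr0n.
  rewrite ler_wpM2l ?sqr_ge0//.
  rewrite (big_ord_widen _ (fun i => cabs (x (val m, i)) ^+ 2) dN) big_mkcond.
  by apply: ler_sum => i _; case: ifP => // _; rewrite sqr_ge0.
rewrite -mulr_sumr ler_wpM2l ?sqr_ge0//.
rewrite (big_ord_widen _ (fun m => \sum_(i < N') cabs (x (m, val i)) ^+ 2) NN').
rewrite big_mkcond; apply: ler_sum => m _; case: ifP => // _.
by rewrite sumr_ge0// => i _; rewrite sqr_ge0.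
Qed.

Lemma block_operator : exists S : bop K, [/\ bb S M,
  forall n (u : 'I_(d n) -> R[i]),
    S (emb u) = emb (fun i => \sum_j T n i j * u j) &
  forall n (u : 'I_(d n) -> R[i]),
    adj S (emb u) = emb (fun j => \sum_i conjc (T n i j) * u i)].
Proof.
have mem (x : ell2 R) : bfun x \in ell2_pred.
  apply/asboolP; have [B B0 hB] := ell2_bd x; exists (M ^+ 2 * B) => N.
  have [N' h] := bfun_box x N; rewrite (le_trans h)//.
  by rewrite ler_wpM2l ?sqr_ge0.
pose S (x : K) : K := Ell2 (mem x).
have lS : linear S.
  move=> a x y; apply: val_inj; apply/funext => -[m i].
  change (bfun (a *: x + y : ell2 R) (m, i) = a * bfun x (m, i) + bfun y (m, i)).
  rewrite /bfun /ord_ext /=; case: insub => [j|]; last by rewrite mulr0 addr0.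
  rewrite mulr_sumr -big_split; apply: eq_bigr => k _ /=.
  change (T m j k * (a * x (m, val k) + y (m, val k)) =
    a * (T m j k * x (m, val k)) + T m j k * y (m, val k)).
  by ring.
have bS : bb S M.
  move=> x; apply: nrm_ell2_le; first by rewrite mulr_ge0 ?nrm_ge0.
  move=> N; have [N' h] := bfun_box x N; rewrite (le_trans h)//.
  by rewrite exprMn ler_wpM2l ?sqr_ge0//; exact: boxsq_nrm.
have [S' hS'] := mkbop_ex lS bS; exists S'; split=> [x|n u|n u].
- by rewrite hS'; exact: bS.
- rewrite hS'; apply: val_inj; apply/funext => -[m i].
  change (bfun (emb_fun u) (m, i) = emb_fun (fun i => \sum_j T n i j * u j) (m, i)).
  rewrite /bfun /emb_fun /=; case: (eqVneq m n) => [->|mn].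
    congr (ord_ext _ i); apply/funext => k; apply: eq_bigr => j _.
    by rewrite ord_ext_val.
  rewrite /ord_ext; case: insub => [j|]//.
  by rewrite big1// => k _; rewrite mulr0.
- apply: hip_ext => y; rewrite -adjP hS' !hip_embr /S /=.
  transitivity (\sum_i \sum_j conjc (T n i j) * conjc ((y : ell2 R) (n, val j)) * u i).
    apply: eq_bigr => i _; rewrite /bfun /= ord_ext_val conj_sum mulr_suml.
    by apply: eq_bigr => j _; rewrite conjM.
  rewrite exchange_big; apply: eq_bigr => j _; rewrite mulr_sumr.
  by apply: eq_bigr => i _; rewrite mulrAC mulrC.
Qed.

End Blocks.

(** * Matrix models *)

Section LinearCombinations.
Context {R : realType} {S : Type}.
Implicit Types p q : seq (R[i] * S).

(** The same list p is evaluated in F and in every matrix model; relations that hold between the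
    values in only one of them do no harm. *)
Definition lc {V : lmodType R[i]} (f : S -> V) p : V :=
  \sum_(c <- p) c.1 *: f c.2.

Definition lscale (a : R[i]) p : seq (R[i] * S) :=
  [seq (a * c.1, c.2) | c <- p].

Lemma lc_cat {V : lmodType R[i]} (f : S -> V) p q : lc f (p ++ q) = lc f p + lc f q.
Proof. by rewrite /lc big_cat. Qed.

Lemma lc_scale {V : lmodType R[i]} (f : S -> V) a p : lc f (lscale a p) = a *: lc f p.
Proof.
by rewrite /lc big_map scaler_sumr; apply: eq_bigr => c _; rewrite scalerA.
Qed.

Lemma lc_sub {V : lmodType R[i]} (f : S -> V) p q :
  lc f (p ++ lscale (-1) q) = lc f p - lc f q.
Proof. by rewrite lc_cat lc_scale scaleN1r. Qed.

Lemma lc1 {V : lmodType R[i]} (f : S -> V) s : lc f [:: (1, s)] = f s.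
Proof. by rewrite /lc big_seq1 scale1r. Qed.

Lemma lc0 {V : lmodType R[i]} (f : S -> V) : lc f [::] = 0.
Proof. by rewrite /lc big_nil. Qed.

Definition spans {V : normedModType R[i]} (f : S -> V) :=
  forall x (e : R), 0 < e -> exists p, nrm (x - lc f p) <= e.

(* The bound alone makes the operator well defined on the span of f. *)
Lemma dense_extension {F : hilbertType R} (f g : S -> F) (M : R) : spans f ->
  0 <= M -> (forall p, nrm (lc g p) <= M * nrm (lc f p)) ->
  exists T : bop F, bb T M /\ forall s, T (f s) = g s.
Proof.
move=> df M0 hM.
have hM2 p q : nrm (lc g p - lc g q) <= M * nrm (lc f p - lc f q).
  by rewrite -!lc_sub.
(* This property determines y, independently of any approximating sequence, and linearity of x |-> y
   follows from it by comparison with suitable p. *)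
have ex x : exists y, forall p, nrm (y - lc g p) <= M * nrm (x - lc f p).
  pose ee n : R := (n.+1%:R)^-1.
  have ee0 n : 0 < ee n by rewrite invr_gt0.
  have /choice[u hu] n := df x _ (ee0 n).
  have small (e : R) : 0 < e -> exists N, forall n, (N <= n)%N -> ee n <= e.
    move=> e0; exists (Num.truncn e^-1) => n Nn.
    rewrite /ee invf_ple ?posrE// (le_trans (ltW (truncnS_gt _)))//.
    by rewrite ler_nat.
  have cu : cauchy_seq_nrm (fun n => lc g (u n)).
    move=> e e0; have d0 : 0 < e / 2 / (M + 1).
      by rewrite !divr_gt0// ltr_wpDl.
    have [N hN] := small _ d0; exists N => n m Nn Nm.
    rewrite (le_trans (hM2 _ _))//.
    have h : nrm (lc f (u n) - lc f (u m)) <= e / (M + 1).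
      rewrite (le_trans (nrm_trans x _ _))// (nrmBC _ x).
      have -> : e / (M + 1) = e / 2 / (M + 1) + e / 2 / (M + 1).
        by rewrite -mulrDl -splitr.
      by rewrite lerD// (le_trans (hu _))// hN.
    rewrite (le_trans (ler_wpM2l M0 h))// mulrCA ler_piMr ?(ltW e0)//.
    by rewrite ler_pdivrMr ?mul1r ?lerDl// ltr_wpDl.
  have [y hy] := complete_tends cu; exists y => p.
  apply/ler_addgt0Pr => e e0; have e20 : 0 < e / 2 by rewrite divr_gt0.
  have [N hN] := hy _ e20.
  have d0 : 0 < e / 2 / (M + 1) by rewrite divr_gt0// ltr_wpDl.
  have [N' hN'] := small _ d0; pose n := maxn N N'.
  have h1 : nrm (y - lc g (u n)) <= e / 2 by rewrite nrmBC hN// leq_maxl.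
  have h2 : nrm (lc g (u n) - lc g p) <= M * nrm (x - lc f p) + e / 2.
    rewrite (le_trans (hM2 _ _))//.
    rewrite (le_trans (ler_wpM2l M0 (nrm_trans x _ _)))// (nrmBC _ x) mulrDr addrC.
    rewrite lerD2l (le_trans (ler_wpM2l M0 (hu _)))//.
    rewrite (le_trans (ler_wpM2l M0 (hN' _ (leq_maxr _ _))))//.
    rewrite mulrCA ler_piMr ?(ltW e20)//.
    by rewrite ler_pdivrMr ?mul1r ?lerDl// ltr_wpDl.
  apply: le_trans (nrm_trans (lc g (u n)) _ _) _.
  apply: le_trans (lerD h1 h2) _; lra.
have /choice[T hT] := ex.
have lT : linear T.
  move=> a x y; apply/eqP; rewrite -subr_eq0; apply/eqP/nrm_eps0 => e e0.
  pose D := M * (cabs a + 1 + (cabs a + 1)) + 1.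
  have D0 : 0 < D by rewrite ltr_wpDl// mulr_ge0// !addr_ge0 ?cabs_ge0.
  have d0 : 0 < e / D by rewrite divr_gt0.
  have [p hp] := df x _ d0; have [q hq] := df y _ d0.
  have h1 := hT (a *: x + y) (lscale a p ++ q).
  rewrite !lc_cat !lc_scale in h1.
  have -> : T (a *: x + y) - (a *: T x + T y) =
    (T (a *: x + y) - (a *: lc g p + lc g q)) -
    (a *: (T x - lc g p) + (T y - lc g q)).
    by rewrite scalerBr addrACA -opprD opprB addrA subrK.
  rewrite (le_trans (nrmB _ _))//.
  have h2 : nrm (a *: x + y - (a *: lc f p + lc f q)) <= (cabs a + 1) * (e / D).
    rewrite opprD addrACA -scalerBr (le_trans (nrmD _ _))// nrmZ mulrDl mul1r.
    by rewrite lerD// ler_wpM2l ?cabs_ge0.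
  have h3 : nrm (a *: (T x - lc g p) + (T y - lc g q)) <=
      M * ((cabs a + 1) * (e / D)).
    rewrite (le_trans (nrmD _ _))// nrmZ mulrDl mul1r mulrDr lerD//.
      rewrite mulrCA ler_wpM2l ?cabs_ge0// (le_trans (hT _ _))//.
      by rewrite ler_wpM2l.
    by rewrite (le_trans (hT _ _))// ler_wpM2l.
  have h4 := le_trans h1 (ler_wpM2l M0 h2).
  rewrite (le_trans (lerD h4 h3))// -mulrDr -mulrDl mulrA mulrCA.
  rewrite ler_piMr ?(ltW e0)// ler_pdivrMr// mul1r lerDl//.
have bT : bb T M by move=> x; have := hT x [::]; rewrite !lc0 !subr0.
have [T' hT'] := mkbop_ex lT bT; exists T'; split=> [x|s].
  by rewrite hT'; exact: bT.
rewrite hT'; apply/eqP; rewrite -subr_eq0; apply/eqP/nrm0_eq0/eqP.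
have := hT (f s) [:: (1, s)]; rewrite !lc1 subrr nrm0 mulr0.
by rewrite eq_le nrm_ge0 andbT.
Qed.

Lemma bop_lc {F : hilbertType R} (T : bop F) (f : S -> F) p :
  T (lc f p) = lc (fun s => T (f s)) p.
Proof. by rewrite /lc bop_sum; apply: eq_bigr => c _; rewrite bopZ. Qed.

Lemma eq_on_span {F : hilbertType R} (T T' : bop F) (f : S -> F) : spans f ->
  (forall s, T (f s) = T' (f s)) -> T = T'.
Proof.
move=> df h; apply/eqP; rewrite -subr_eq0; apply/eqP/bop_ext => x.
rewrite bop0E; apply: nrm_eps0 => e e0.
have [M M0 hM] := bop_bb (T - T').
have d0 : 0 < e / (M + 1) by rewrite divr_gt0// ltr_wpDl.
have [p hp] := df x _ d0.
have h0 : (T - T') (lc f p) = 0.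
  by rewrite bopBE !bop_lc /lc -sumrB big1// => c _; rewrite h subrr.
rewrite -[(T - T') x]subr0 -h0 -bopB (le_trans (hM _))//.
rewrite (le_trans (ler_wpM2l M0 hp))// mulrCA ler_piMr ?(ltW e0)//.
by rewrite ler_pdivrMr ?mul1r ?lerDl// ltr_wpDl.
Qed.

Lemma hip_span {F : hilbertType R} (x y : F) (f : S -> F) : spans f ->
  (forall s, hip (f s) x = hip (f s) y) -> x = y.
Proof.
move=> df h; apply/eqP; rewrite -subr_eq0; apply/eqP/nrm_eps0 => e e0.
have [p hp] := df (x - y) _ e0.
have h0 : hip (lc f p) (x - y) = 0.
  rewrite /lc hip_suml big1// => c _.
  by rewrite hipZl hipBr h subrr mulr0.
have [->|n0] := eqVneq (nrm (x - y)) 0; first exact: ltW.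
have np : 0 < nrm (x - y) by rewrite lt_neqAle eq_sym n0 nrm_ge0.
rewrite -(ler_pM2r np) -expr2 -Re_hip.
have -> : hip (x - y) (x - y) = hip (x - y - lc f p) (x - y).
  by rewrite [RHS]hipBl h0 subr0.
rewrite (le_trans (ler_norm _))// (le_trans (Re_le_cabs _))//.
by rewrite (le_trans (hip_CS _ _))// ler_wpM2r ?nrm_ge0.
Qed.

End LinearCombinations.

Section Adjm.
Context {R : realType}.
Local Notation CC := R[i].

Definition adjm m n (X : 'M[CC]_(m, n)) : 'M[CC]_(n, m) :=
  \matrix_(i, j) conjc (X j i).

Lemma adjmM m n k (X : 'M[CC]_(m, n)) (Y : 'M[CC]_(n, k)) :
  adjm (X *m Y) = adjm Y *m adjm X.
Proof.
apply/matrixP => i j; rewrite !mxE conj_sum; apply: eq_bigr => l _.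
by rewrite !mxE conjM mulrC.
Qed.

Lemma adjmK m n (X : 'M[CC]_(m, n)) : adjm (adjm X) = X.
Proof. by apply/matrixP => i j; rewrite !mxE conjcK. Qed.

Lemma adjmD m n (X Y : 'M[CC]_(m, n)) : adjm (X + Y) = adjm X + adjm Y.
Proof. by apply/matrixP => i j; rewrite !mxE conjD. Qed.

Lemma adjmZ m n a (X : 'M[CC]_(m, n)) : adjm (a *: X) = conjc a *: adjm X.
Proof. by apply/matrixP => i j; rewrite !mxE conjM. Qed.

Lemma adjm0 m n : adjm (0 : 'M[CC]_(m, n)) = 0.
Proof. by apply/matrixP => i j; rewrite !mxE conjc0. Qed.

Lemma adjm1 n : adjm (1%:M : 'M[CC]_n) = 1%:M.
Proof.
by apply/matrixP => i j; rewrite !mxE eq_sym; case: eqP => _;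
  rewrite ?conjc1 ?conjc0.
Qed.

Definition hs m n (X Y : 'M[CC]_(m, n)) : R[i] := \tr (adjm X *m Y).

Lemma hsE m n (X Y : 'M[CC]_(m, n)) :
  hs X Y = \sum_a \sum_i conjc (X i a) * Y i a.
Proof.
rewrite /hs /mxtrace; apply: eq_bigr => a _; rewrite mxE.
by apply: eq_bigr => i _; rewrite mxE.
Qed.

Lemma hs_adjm n (X Y : 'M[CC]_n) : hs (adjm X) (adjm Y) = conjc (hs X Y).
Proof.
rewrite !hsE conj_sum exchange_big; apply: eq_bigr => a _.
rewrite conj_sum; apply: eq_bigr => i _.
by rewrite !mxE conjcK conjM conjcK mulrC.
Qed.

End Adjm.

(** * Matrices as families of columns in l^2 *)

Section Columns.
Context {R : realType} (d : nat -> nat).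
Local Notation K := (ell2_hilbert R).
Local Notation CC := R[i].

(** Operators on l^2 act on each column, hence extend left multiplication, while right
    multiplication only mixes the members of the family by scalars and so commutes with all of
    them. *)
Definition kcol n (X : 'M[CC]_(d n)) : 'I_(d n) -> K :=
  fun a => emb (fun i => X i a).

Lemma famip_kcol n (X Y : 'M[CC]_(d n)) : famip (kcol X) (kcol Y) = hs X Y.
Proof. by rewrite hsE; apply: eq_bigr => a _; rewrite hip_emb. Qed.

Lemma kcol_lin n a (X Y : 'M[CC]_(d n)) :
  kcol (a *: X + Y) = (fun b => a *: kcol X b + kcol Y b).
Proof.
apply/funext => b; rewrite /kcol -emb_lin; congr emb; apply/funext => i.
by rewrite !mxE.
Qed.

Definition hn n (X : 'M[CC]_(d n)) : R := l2norm (kcol X).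

Lemma hn_ge0 n (X : 'M[CC]_(d n)) : 0 <= hn X.
Proof. exact: l2norm_ge0. Qed.

Lemma hn_sq n (X : 'M[CC]_(d n)) : hs X X = (hn X ^+ 2)%:C.
Proof. by rewrite -famip_kcol famip_nrm. Qed.

Lemma ldist_kcol n (X Y : 'M[CC]_(d n)) : ldist (kcol X) (kcol Y) = hn (X - Y).
Proof.
congr l2norm; have := kcol_lin (-1) Y X; rewrite scaleN1r addrC => ->.
by apply/funext => b; rewrite scaleN1r addrC.
Qed.

Lemma hn_trans n (Y X Z : 'M[CC]_(d n)) : hn (X - Z) <= hn (X - Y) + hn (Y - Z).
Proof. by rewrite -!ldist_kcol; exact: ldist_trans. Qed.

Lemma hn_BC n (X Y : 'M[CC]_(d n)) : hn (X - Y) = hn (Y - X).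
Proof. by rewrite -!ldist_kcol ldistC. Qed.

Lemma hs_semi n :
  semi_ip (@hs R (d n) (d n) : 'M[CC]_(d n) -> 'M[CC]_(d n) -> R[i]).
Proof.
split=> [a X Y Z|X Y|X].
- by rewrite /hs mulmxDr mxtraceD -scalemxAr mxtraceZ.
- rewrite !hsE conj_sum; apply: eq_bigr => a _; rewrite conj_sum.
  by apply: eq_bigr => i _; rewrite conjM conjcK mulrC.
- by rewrite hn_sq sqr_ge0.
Qed.

Lemma hs_CS n (X Y : 'M[CC]_(d n)) : cabs (hs X Y) <= hn X * hn Y.
Proof. by rewrite -famip_kcol; exact: famip_CS. Qed.

End Columns.

(** * Resolvents of self-adjoint matrices *)

Section Resolvent.
Context {R : realType}.
Local Notation CC := R[i].

Definition csq m (u : 'cV[CC]_m) : R := \sum_i cabs (u i 0) ^+ 2.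

Lemma csq_ge0 m (u : 'cV[CC]_m) : 0 <= csq u.
Proof. by apply: sumr_ge0 => i _; exact: sqr_ge0. Qed.

Lemma csqE m (u : 'cV[CC]_m) : (adjm u *m u) 0 0 = (csq u)%:C.
Proof.
rewrite mxE /csq rmorph_sum; apply: eq_bigr => i _.
by rewrite !mxE conj_mul.
Qed.

Lemma csq_eq0 m (u : 'cV[CC]_m) : csq u <= 0 -> u = 0.
Proof.
move=> h; have /eqP : csq u = 0 by apply/eqP; rewrite eq_le h csq_ge0.
rewrite psumr_eq0 => [|i _]; last exact: sqr_ge0.
move=> /allP h0; apply/matrixP => i j; rewrite ord1 mxE.
have := h0 i (mem_index_enum _); rewrite /= sqrf_eq0 => /eqP.
exact: cabs0_eq0.
Qed.

Definition shift m (y : 'M[CC]_m) (t : R) : 'M[CC]_m := y + (0 +i* t)%C%:M.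

Lemma adjm_shift m (y : 'M[CC]_m) t : adjm y = y -> adjm (shift y t) = shift y (- t).
Proof.
move=> sy; rewrite /shift adjmD sy; congr (_ + _).
apply/matrixP => i j; rewrite !mxE eq_sym; case: eqP => _; rewrite ?conjc0//.
Qed.

(** For self-adjoint y the cross terms cancel: |(y + i t) u|^2 = |y u|^2 + t^2 |u|^2. *)
Lemma csq_shift m (y : 'M[CC]_m) (t : R) u : adjm y = y ->
  t ^+ 2 * csq u <= csq (shift y t *m u).
Proof.
move=> sy; suff -> : csq (shift y t *m u) =
    csq (y *m u) + t ^+ 2 * csq u by rewrite lerDr csq_ge0.
apply: realC_inj; rewrite rmorphD rmorphM /= -!csqE !adjmM (adjm_shift _ sy) sy.
have e : shift y (- t) *m shift y t = y *m y + (t ^+ 2)%:C%:M.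
  rewrite /shift mulmxDl !mulmxDr -scalar_mxM mul_mx_scalar mul_scalar_mx.
  rewrite addrA -(addrA (y *m y)) -scalerDl.
  rewrite (_ : (0 +i* t)%C + (0 +i* - t)%C = 0) ?scale0r ?addr0; last first.
    by apply: complexP => /=; ring.
  by congr (_ + _%:M); apply: complexP => /=; ring.
rewrite mulmxA -(mulmxA (adjm u)) e mulmxDr mulmxDl mxE !mulmxA; congr (_ + _).
by rewrite mul_mx_scalar -scalemxAl mxE.
Qed.

Lemma shift_unit m (y : 'M[CC]_m) (t : R) : adjm y = y -> t != 0 ->
  shift y t \in unitmx.
Proof.
move=> sy t0; rewrite -row_free_unit; apply: inj_row_free => v hv.
have sy' : adjm (- y) = - y by rewrite -scaleN1r adjmZ sy rmorphN1.
have h : shift y (- t) *m adjm v = 0.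
  by rewrite -adjm_shift// -adjmM hv adjm0.
have := csq_shift (- t) (adjm v) sy; rewrite h.
have -> : csq (0 : 'cV[CC]_m) = 0.
  by rewrite /csq big1// => i _; rewrite mxE cabs0 expr0n.
rewrite sqrrN pmulr_rle0 ?exprn_even_gt0// => /csq_eq0 v0.
by rewrite -(adjmK v) v0 adjm0.
Qed.

Lemma csq_resolvent m (y : 'M[CC]_m) (t : R) u : adjm y = y -> t != 0 ->
  csq (invmx (shift y t) *m u) <= (`|t|^-1) ^+ 2 * csq u.
Proof.
move=> sy t0; have := csq_shift t (invmx (shift y t) *m u) sy.
rewrite mulKVmx ?shift_unit// exprVn real_normK ?num_real// mulrC => h.
by rewrite mulrC ler_pdivlMr ?exprn_even_gt0.
Qed.

(** The bound is uniform in n even when the norms of the [y n] are not, so that an unbounded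
    sequence of self-adjoint matrices still gives an operator on l^2. *)
Lemma resolvent_operator (d : nat -> nat) (y : forall n, 'M[CC]_(d n)) (t : R) :
  (forall n, adjm (y n) = y n) -> t != 0 ->
  exists S : bop (ell2_hilbert R), [/\ bb S `|t|^-1,
    (forall n (Z : 'M[CC]_(d n)) a,
       S (kcol Z a) = kcol (invmx (shift (y n) t) *m Z) a) &
    forall n (Z : 'M[CC]_(d n)) a,
       adj S (kcol Z a) = kcol (invmx (shift (y n) (- t)) *m Z) a].
Proof.
move=> sy t0; have [||S [bS hS hS']] :=
  @block_operator R d (fun n => invmx (shift (y n) t)) `|t|^-1.
- by rewrite invr_ge0.
- move=> n u; have := csq_resolvent (\col_i u i) (sy n) t0.
  rewrite /csq; set A := \sum_i _; set B := \sum_i _; move=> h.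
  have -> : \sum_i cabs (u i) ^+ 2 = B by apply: eq_bigr => i _; rewrite mxE.
  apply: le_trans h; rewrite le_eqVlt; apply/orP; left; apply/eqP.
  apply: eq_bigr => i _; rewrite mxE; congr (cabs _ ^+ 2).
  by apply: eq_bigr => k _; rewrite mxE.
exists S; split=> // n Z a.
  by rewrite hS; congr emb; apply/funext => i; rewrite mxE.
rewrite hS'; congr emb; apply/funext => i; rewrite mxE; apply: eq_bigr => k _.
have -> : invmx (shift (y n) (- t)) = adjm (invmx (shift (y n) t)).
  have u1 := shift_unit (sy n) t0.
  have u2 : shift (y n) (- t) \in unitmx by rewrite shift_unit ?oppr_eq0.
  apply/esym; rewrite -[RHS]mulmx1; apply: (canRL (mulKmx u2)).
  by rewrite -adjm_shift// -adjmM mulVmx// adjm1.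
by rewrite mxE.
Qed.

End Resolvent.

Lemma third_bound (R : realType) (a e : R) : 0 < e -> a <= e / 8 ->
  a *+ 3 + a + e / 2 <= e.
Proof. lra. Qed.

Lemma three_quarters_le (R : realType) (e : R) : 0 < e ->
  e / 4 + e / 4 + e / 4 <= e.
Proof. lra. Qed.

(** [k n] is the largest m <= n with [Q m n], and 0 if there is none. This is countable saturation;
    it turns a sequence of better and better approximations into a single one. *)
Lemma ultra_diagonal (Q : nat -> nat -> Prop) :
  (forall m, natU [set n | Q m n]) ->
  exists k : nat -> nat, forall m, natU [set n | (m <= k n)%N /\ Q (k n) n].
Proof.
move=> hQ.
have /choice[k hk] n : exists k, (k <= n)%N /\
    ((exists m, (m <= n)%N /\ Q m n) -> Q k n /\
    (forall m, (m <= n)%N -> Q m n -> (m <= k)%N)).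
  have [[m0 [m0n Qm0]]|no] := pselect (exists m, (m <= n)%N /\ Q m n).
    pose p m := `[< (m <= n)%N /\ Q m n >].
    have ex : exists m, p m by exists m0; apply/asboolP.
    have bd m : p m -> (m <= n)%N by move=> /asboolP[].
    case: (ex_maxnP ex bd) => k /asboolP[kn Qk] hmax.
    exists k; split=> // _; split=> // m mn Qm.
    by apply: hmax; apply/asboolP.
  by exists 0%N; split.
exists k => m; apply: (ufilter2 (hQ m) (natU_ge m)) => n Qm mn.
have [_ [|Qk hmax]] := hk n; first by exists m.
by split=> //; apply: hmax.
Qed.

Lemma invn_small (R : realType) (e : R) : 0 < e ->
  exists N, forall n, (N <= n)%N -> (n.+1%:R)^-1 <= e.
Proof.
move=> e0; exists (Num.truncn e^-1) => n Nn.
rewrite invf_ple ?posrE// (le_trans (ltW (truncnS_gt _)))//.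
by rewrite ler_nat.
Qed.

Lemma ufilter_lt {I : Type} (U : ultra I) (P : nat -> I -> Prop) m :
  (forall l, (l < m)%N -> U [set n | P l n]) ->
  U [set n | forall l, (l < m)%N -> P l n].
Proof.
elim: m => [_|m IH h]; first exact: utrue.
apply: (ufilter2 (IH _) (h m _)) => [l lm||n h1 h2 l]; last 1 first.
- by rewrite ltnS leq_eqVlt => /predU1P[->//|/h1].
- by apply: h; rewrite ltnS ltnW.
- by [].
Qed.

Lemma commutant_von_neumann (R : realType) (F : hilbertType R)
    (M : set (bop F)) : (forall T, M T -> M (adj T)) -> von_neumann (commutant M).
Proof.
move=> Ms; split=> [T S hT /adj_uniq -> X MX x|].
  apply: hip_ext => z; rewrite -adjP (adjPr X) (adjPr X) -adjP.
  by rewrite (hT _ (Ms _ MX)).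
rewrite eqEsubset; split=> [T h S MS x|T h S hS x].
  by apply: h => T' h' y; rewrite -h'.
by rewrite hS.
Qed.

(** * From convergence of moments to asymptotic isometries *)

Section GnsModel.
Context {R : realType} {F : hilbertType R} {L : countType}.
Local Notation CC := R[i].
Local Notation K := (ell2_hilbert R).
Variables (bar : L -> L) (c : L -> R) (Om : F) (G : L -> bop F).
Hypotheses (barK : involutive bar) (c0 : forall l, 0 < c l)
  (cbar : forall l, c (bar l) = (c l)^-1).
Hypothesis Gadj : forall l, adj (G l) = G (bar l).

Definition vec (w : seq L) : F := foldr (fun l x => G l x) Om w.

Hypothesis vec_spans : spans vec.

Variables (d : nat -> nat) (W : forall n, L -> 'M[CC]_(d n))
  (E : forall n, 'M[CC]_(d n)).
Arguments W : clear implicits.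
Hypotheses (Wadj : forall n l, adjm (W n l) = W n (bar l))
  (Eadj : forall n, adjm (E n) = E n)
  (EW : forall n l, E n *m W n l = (c l)%:C *: (W n l *m E n)).

Definition Ww n (w : seq L) : 'M[CC]_(d n) :=
  foldr (fun l X => W n l *m X) 1%:M w.

Hypothesis moments : forall w,
  ucv natU (fun n => \tr (E n *m Ww n w *m E n)) (hip Om (vec w)).

Definition wstar (w : seq L) := rev (map bar w).
Definition cw (w : seq L) : R := \prod_(l <- w) c l.

Lemma wstarK : involutive wstar.
Proof. by move=> w; rewrite /wstar map_rev revK -map_comp map_id_in// => l _; exact: barK. Qed.

Lemma wstar_rcons w l : wstar (rcons w l) = bar l :: wstar w.
Proof. by rewrite /wstar map_rcons rev_rcons. Qed.

Lemma wstar_cons w l : wstar (l :: w) = rcons (wstar w) (bar l).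
Proof. by rewrite /wstar /= rev_cons. Qed.

Lemma Ww_cat n w w' : Ww n (w ++ w') = Ww n w *m Ww n w'.
Proof. by elim: w => [|l w IH] /=; rewrite ?mul1mx// IH mulmxA. Qed.

Lemma Ww_wstar n w : Ww n (wstar w) = adjm (Ww n w).
Proof.
elim: w => [|l w IH] /=; first by rewrite adjm1.
by rewrite wstar_cons -cats1 Ww_cat IH /= mulmx1 adjmM Wadj.
Qed.

Lemma E_Ww n w : E n *m Ww n w = (cw w)%:C *: (Ww n w *m E n).
Proof.
elim: w => [|l w IH] /=; first by rewrite /cw big_nil scale1r mulmx1 mul1mx.
rewrite mulmxA EW -scalemxAl -mulmxA IH -scalemxAr scalerA mulmxA.
by rewrite /cw big_cons rmorphM.
Qed.

Lemma hip_vec w w' : hip (vec w) (vec w') = hip Om (vec (wstar w ++ w')).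
Proof.
elim: w w' => [//|l w IH] w'.
by rewrite /= adjP Gadj wstar_cons cat_rcons -IH.
Qed.

Definition VM n (w : seq L) : 'M[CC]_(d n) := Ww n w *m E n.

Lemma hs_VM n w w' : hs (VM n w) (VM n w') = \tr (E n *m Ww n (wstar w ++ w') *m E n).
Proof. by rewrite /hs /VM adjmM Eadj Ww_cat Ww_wstar !mulmxA. Qed.

Lemma VM_cv w w' : ucv natU (fun n => hs (VM n w) (VM n w')) (hip (vec w) (vec w')).
Proof.
by rewrite hip_vec; apply: (ucv_eq (moments _)) => n; rewrite hs_VM.
Qed.

Lemma lc_VM_cv p q :
  ucv natU (fun n => hs (lc (VM n) p) (lc (VM n) q)) (hip (lc vec p) (lc vec q)).
Proof.
have -> : hip (lc vec p) (lc vec q) = \sum_(a <- p) \sum_(b <- q)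
   conjc a.1 * (b.1 * hip (vec a.2) (vec b.2)).
  rewrite /lc hip_suml; apply: eq_bigr => a _.
  by rewrite hip_sumr; apply: eq_bigr => b _; rewrite hipZl hipZr.
have h : ucv natU (fun n => \sum_(a <- p) \sum_(b <- q)
   conjc a.1 * (b.1 * hs (VM n a.2) (VM n b.2))) (\sum_(a <- p) \sum_(b <- q)
   conjc a.1 * (b.1 * hip (vec a.2) (vec b.2))).
  apply: ucv_sum => a; apply: ucv_sum => b; do 2!apply: ucvZ; exact: VM_cv.
apply: (ucv_eq h) => n; rewrite /lc (semi_suml (hs_semi d n)).
apply: eq_bigr => a _; rewrite (semi_sumr (hs_semi d n)).
by apply: eq_bigr => b _; rewrite (semiZl (hs_semi d n)) (semiZr (hs_semi d n)).
Qed.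

Definition pJ (p : seq (CC * seq L)) : seq (CC * seq L) :=
  [seq (conjc a.1 * (cw (wstar a.2))%:C, wstar a.2) | a <- p].

(** E is self-adjoint, so the adjoint of W(w) E is E W(w') with w' = [wstar w], and E passes through
    W(w') at the price of the scalar [cw (wstar w)]. The adjoint is antiunitary in each model, hence
    so is its limit. *)
Lemma lc_VM_pJ n p : lc (VM n) (pJ p) = adjm (lc (VM n) p).
Proof.
rewrite /lc (big_morph _ (@adjmD _ _ _) (@adjm0 _ _ _)) big_map.
apply: eq_bigr => a _ /=.
rewrite adjmZ /VM adjmM Eadj -Ww_wstar E_Ww scalerA.
by [].
Qed.

(* the antiunitary J : w Om |-> c(w^* ) w^* Om *)
Lemma hip_pJ p q : hip (lc vec (pJ p)) (lc vec (pJ q)) =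
  conjc (hip (lc vec p) (lc vec q)).
Proof.
apply: (ucv_unique (lc_VM_cv _ _)).
apply: (ucv_eq (ucv_conj (lc_VM_cv p q))) => n.
by rewrite !lc_VM_pJ hs_adjm.
Qed.

Lemma nrm_pJ p : nrm (lc vec (pJ p)) = nrm (lc vec p).
Proof.
apply/eqP; rewrite -(@eqrXn2 _ 2) ?nrm_ge0//; apply/eqP.
by apply: realC_inj; rewrite -!hip_nrm hip_pJ hip_nrm realC_real.
Qed.

(** With J the antiunitary given by [pJ], J (w l Om) = c(bar l) G(bar l) J (w Om). Boundedness is
    inherited from G(bar l) because J preserves norms. *)
Lemma right_mul_ex l : exists T : bop F, forall w, T (vec w) = vec (rcons w l).
Proof.
have [M M0 hM] := bop_bb (G (bar l)).
have cb0 : 0 < c (bar l) by exact: c0.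
have [|p|T [_ hT]] :=
  @dense_extension _ _ _ vec (fun w => vec (rcons w l)) (c (bar l) * M) vec_spans.
- by rewrite mulr_ge0// ltW.
- pose p' := [seq (a.1, rcons a.2 l) | a <- p].
  have -> : lc (fun w => vec (rcons w l)) p = lc vec p'.
    by rewrite /lc big_map.
  rewrite -nrm_pJ.
  have -> : lc vec (pJ p') = (c (bar l))%:C *: G (bar l) (lc vec (pJ p)).
    rewrite bop_lc /lc /pJ !big_map scaler_sumr; apply: eq_bigr => a _ /=.
    rewrite scalerA wstar_rcons /=; congr (_ *: _).
    by rewrite /cw big_cons rmorphM mulrCA.
  rewrite nrmZ cabs_real (ger0_norm (ltW cb0)) -mulrA ler_wpM2l ?(ltW cb0)//.
  by rewrite -(nrm_pJ p).
by exists T.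
Qed.

Definition Rmul l : bop F := projT1 (cid (right_mul_ex l)).

Lemma RmulE l w : Rmul l (vec w) = vec (rcons w l).
Proof. by rewrite /Rmul; case: cid. Qed.

Lemma Rmul_comm l l' x : Rmul l (G l' x) = G l' (Rmul l x).
Proof.
rewrite -!bcompE; congr (bop_val _ x); apply: (eq_on_span vec_spans) => w.
by rewrite !bcompE RmulE -[G l' (vec w)]/(vec (l' :: w)) RmulE.
Qed.

Lemma Rmul_adj_comm l l' x : adj (Rmul l) (G l' x) = G l' (adj (Rmul l) x).
Proof.
apply: hip_ext => z; rewrite -adjP (adjPr (G l')) (adjPr (G l')) Gadj.
by rewrite -adjP Rmul_comm.
Qed.

Section Vectors.

Lemma hn_cv p q (e : R) : 0 < e ->
  natU [set n | hn (lc (VM n) p - lc (VM n) q) <= nrm (lc vec p - lc vec q) + e].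
Proof.
move=> e0; have := lc_VM_cv (p ++ lscale (-1) q) (p ++ lscale (-1) q).
rewrite hip_nrm lc_sub => h.
apply: (ufilter (h _ (exprn_gt0 2 e0))) => n; rewrite !lc_sub hn_sq -rmorphB.
rewrite cabs_real => hn2.
rewrite -(@ler_pXn2r _ 2) ?nnegrE ?hn_ge0 ?addr_ge0 ?nrm_ge0 ?(ltW e0)//.
have h2 := le_trans (ler_norm _) hn2.
rewrite sqrrD; move: h2; rewrite lerBlDr => /le_trans; apply.
by rewrite addrC lerD2r lerDl mulrn_wge0// mulr_ge0 ?nrm_ge0 ?(ltW e0).
Qed.

(** One sequence of matrices must represent x, which is only a limit of combinations of words [u m];
    in model n the approximant [u (k n)] is taken, with k from [ultra_diagonal]. *)
Lemma Vmx_ex x : exists v : forall n, 'M[CC]_(d n), forall p (e : R), 0 < e ->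
  natU [set n | hn (v n - lc (VM n) p) <= nrm (x - lc vec p) + e].
Proof.
pose ee n : R := (n.+1%:R)^-1.
have ee0 n : 0 < ee n by rewrite invr_gt0.
have small (e : R) : 0 < e -> exists N, forall n, (N <= n)%N -> ee n <= e :=
  @invn_small R e.
have /choice[u hu] n := vec_spans x (ee0 n).
(* Model n reproduces the distances of approximant m to the earlier ones. Of the three [ee l], two
   bound the distance in F through x and one is the error of the model. *)
pose Q m n := forall l, (l <= m)%N ->
  hn (lc (VM n) (u m) - lc (VM n) (u l)) <= ee l *+ 3.
have hQ m : natU [set n | Q m n].
  have one l : (l < m.+1)%N -> natU [set n |
      hn (lc (VM n) (u m) - lc (VM n) (u l)) <= ee l *+ 3].
    move=> lm; apply: (ufilter (hn_cv (u m) (u l) (ee0 l))) => n h.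
    rewrite (le_trans h)// mulrSr lerD2r (le_trans (nrm_trans x _ _))//.
    rewrite mulr2n lerD// nrmBC (le_trans (hu _))//.
    by rewrite lef_pV2 ?posrE// ler_nat.
  by apply: (ufilter (ufilter_lt one)) => n h l lm; apply: h.
have [k hk] := ultra_diagonal hQ.
exists (fun n => lc (VM n) (u (k n))) => p e e0.
have e80 : 0 < e / 8 by rewrite divr_gt0.
have [N hN] := small _ e80; have e20 : 0 < e / 2 by rewrite divr_gt0.
apply: (ufilter2 (hk N) (hn_cv (u N) p e20)) => n [Nk Qk] h.
rewrite (le_trans (hn_trans (lc (VM n) (u N)) _ _))//.
have h1 := Qk N Nk; have h2 := hN N (leqnn _).
have h3 := nrm_trans x (lc vec (u N)) (lc vec p).
rewrite (nrmBC _ x) in h3; have h4 := hu N.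
apply: le_trans (lerD h1 (le_trans h (lerD (le_trans h3 (lerD h4 (lexx _)))
  (lexx _)))) _.
have h6 := third_bound e0 h2; apply: le_trans (lerD (lexx (nrm (x - lc vec p))) h6).
by rewrite le_eqVlt; apply/orP; left; apply/eqP; ring.
Qed.

Definition Vmx x n : 'M[CC]_(d n) := projT1 (cid (Vmx_ex x)) n.

Lemma VmxP x p (e : R) : 0 < e ->
  natU [set n | hn (Vmx x n - lc (VM n) p) <= nrm (x - lc vec p) + e].
Proof. by rewrite /Vmx; case: cid => v /= h; exact: h. Qed.

Definition V n (x : F) : 'I_(d n) -> K := kcol (Vmx x n).
Arguments V : clear implicits.

Lemma Vip x y : ucv natU (fun n => famip (V n x) (V n y)) (hip x y).
Proof.
move=> e e0.
pose D := (nrm y + 2) * 2 + (nrm x + 1) * 2 + 1 + (nrm y + 1) + nrm x.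
have nx := nrm_ge0 x; have ny := nrm_ge0 y.
have D0 : 0 < D by rewrite /D; lra.
pose r : R := Num.min 1 (e / D).
have r0 : 0 < r by rewrite lt_min ltr01 divr_gt0.
have r1 : r <= 1 by rewrite ge_min lexx.
have rD : r * D <= e by rewrite -ler_pdivlMr// ge_min lexx orbT.
have [p hp] := vec_spans x r0; have [q hq] := vec_spans y r0.
have nq : nrm (lc vec q) <= nrm y + 1.
  rewrite -(subrK y (lc vec q)) addrC (le_trans (nrmD _ _))// lerD2l nrmBC.
  exact: le_trans r1.
apply: (ufilter2 (lc_VM_cv p q r0) (filterI (hn_cv q [::] ltr01)
  (filterI (VmxP x [::] ltr01) (filterI (VmxP x p r0) (VmxP y q r0)))))
  => n h1 [/= h2 [/= h3 [/= h4 h5]]].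
rewrite !lc0 !subr0 in h2 h3; rewrite famip_kcol.
set X := Vmx x n in h3 h4 *; set Y := Vmx y n in h5 *.
set A := lc (VM n) p in h1 h4; set B := lc (VM n) q in h1 h2 h5.
have -> : hs X Y - hip x y = hs (X - A) B + hs X (Y - B) + (hs A B -
   hip (lc vec p) (lc vec q)) - (hip (x - lc vec p) (lc vec q) +
   hip x (y - lc vec q)).
  rewrite (semiBl (hs_semi d n)) (semiBr (hs_semi d n)) hipBl hipBr; ring.
have k1 : cabs (hs (X - A) B) <= r * ((nrm y + 2) * 2).
  rewrite (le_trans (hs_CS _ _))// mulrA mulrAC ler_pM ?hn_ge0//.
    by rewrite (le_trans h4)// mulr_natr mulr2n lerD2r.
  by rewrite (le_trans h2)// (le_trans (lerD nq (lexx 1)))// -addrA.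
have k2 : cabs (hs X (Y - B)) <= r * ((nrm x + 1) * 2).
  rewrite (le_trans (hs_CS _ _))// mulrCA ler_pM ?hn_ge0//.
  by rewrite (le_trans h5)// mulr_natr mulr2n lerD2r.
have k3 : cabs (hip (x - lc vec p) (lc vec q)) <= r * (nrm y + 1).
  by rewrite (le_trans (hip_CS _ _))// ler_pM ?nrm_ge0.
have k4 : cabs (hip x (y - lc vec q)) <= r * nrm x.
  by rewrite (le_trans (hip_CS _ _))// mulrC ler_wpM2r ?nrm_ge0.
rewrite (le_trans (cabsB _ _))// (le_trans (lerD (cabsD _ _) (cabsD _ _)))//.
rewrite (le_trans (lerD (lerD (cabsD _ _) (lexx _)) (lexx _)))//.
apply: le_trans (lerD (lerD (lerD k1 k2) h1) (lerD k3 k4)) _.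
apply: le_trans rD; rewrite le_eqVlt; apply/orP; left; apply/eqP.
by rewrite /D; ring.
Qed.

End Vectors.

(** * Compressions commute with right multiplications; commutation theorem *)

Section Commutation.
Arguments V : clear implicits.

Lemma kcol_mul n (X Y : 'M[CC]_(d n)) a :
  kcol (X *m Y) a = \sum_b Y b a *: kcol X b.
Proof.
have h (s : seq 'I_(d n)) : emb (fun i => \sum_(b <- s) X i b * Y b a) =
    \sum_(b <- s) Y b a *: kcol X b :> K.
  elim: s => [|b s IH].
    rewrite big_nil; apply: nrm0_eq0; apply/eqP.
    rewrite -sqrf_eq0 -Re_hip hip_emb big1// => i _.
    by rewrite big_nil mulr0.
  rewrite big_cons -IH /kcol -emb_lin; congr emb; apply/funext => i.
  by rewrite big_cons mulrC.
by rewrite -h; congr emb; apply/funext => i; rewrite mxE.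
Qed.

(** Right multiplication by Z commutes with T acting on columns, so it can be moved to the other
    side as its adjoint. *)
Lemma famip_kcol_mul n (T : bop K) (X Y Z : 'M[CC]_(d n)) :
  famip (kcol X) (fun a => T (kcol (Y *m Z) a)) =
  famip (kcol (X *m adjm Z)) (fun a => T (kcol Y a)).
Proof.
transitivity (\sum_a \sum_b Z b a * hip (kcol X a) (T (kcol Y b))).
  apply: eq_bigr => a _; rewrite kcol_mul bop_sum hip_sumr.
  by apply: eq_bigr => b _; rewrite bopZ hipZr.
rewrite exchange_big; apply: eq_bigr => b _; rewrite kcol_mul hip_suml.
by apply: eq_bigr => a _; rewrite hipZl mxE conjcK.
Qed.

(** Commutation of X with right multiplication by l, tested on words: by [adj_Rmul] the right side
    is <R_l^* q Om, X r Om>. In this form it passes to limits, and for X = 1 it is the KMS symmetry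
    of the moments, from which [adj_Rmul] itself is derived. *)
Definition Mrel (X : bop F) := forall q r l,
  hip (vec q) (X (vec (rcons r l))) =
  ((c l)^-1 ^+ 2)%:C * hip (vec (rcons q (bar l))) (X (vec r)).

Lemma VM_rcons n w l : VM n (rcons w l) = ((c l)^-1)%:C *: (VM n w *m W n l).
Proof.
rewrite /VM -cats1 Ww_cat /= mulmx1 -[in RHS]mulmxA EW -scalemxAr scalerA.
by rewrite -rmorphM mulVf ?gt_eqF// scale1r mulmxA.
Qed.

Lemma Vmx_vec w (e : R) : 0 < e ->
  natU [set n | hn (Vmx (vec w) n - VM n w) <= e].
Proof.
move=> e0; apply: (ufilter (VmxP (vec w) [:: (1, w)] e0)) => n.
by rewrite !lc1 subrr nrm0 add0r.
Qed.

Lemma hn_VM w : natU [set n | hn (VM n w) <= nrm (vec w) + 1].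
Proof.
apply: (ufilter (hn_cv [:: (1, w)] [::] ltr01)) => n.
by rewrite !lc1 !lc0 !subr0.
Qed.

Lemma compression_vec (T : bop K) q r :
  ucv natU (fun n => famip (kcol (VM n q)) (fun a => T (kcol (VM n r) a)))
    (hip (vec q) (compression Vip T (vec r))).
Proof.
have [M M0 hM] := bop_bb T.
apply: (ucv_near _ (compressionP Vip T (vec q) (vec r))).
apply: (unull_bound (C := M * (nrm (vec r) + 1) + (nrm (vec q) + 1) * M)).
  by rewrite addr_ge0 ?mulr_ge0 ?addr_ge0 ?nrm_ge0.
move=> e e0; apply: (ufilter2 (filterI (Vmx_vec q e0) (Vmx_vec r e0))
  (filterI (hn_VM r) (V_bound Vip (vec q) ltr01))) => n [/= h1 h2] [/= h3 h4].
set u := kcol (VM n q); set v := kcol (VM n r).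
set u' := V n (vec q) in h4 *; set v' := V n (vec r).
have -> : famip u (fun a => T (v a)) - famip u' (fun a => T (v' a)) =
  famip (u - u' : 'I_(d n) -> K) (fun a => T (v a)) +
  famip u' ((fun a => T (v a)) - (fun a => T (v' a)) : 'I_(d n) -> K).
  by rewrite (semiBl famip_semi) (semiBr famip_semi) addrA subrK.
have du : ldist u u' <= e by rewrite ldist_kcol hn_BC.
have dv : ldist v v' <= e by rewrite ldist_kcol hn_BC.
apply: le_trans (cabsD _ _) _; rewrite mulrDl; apply: lerD.
  apply: le_trans (famip_CS _ _) _; rewrite mulrC; apply: ler_pM.
  - exact: l2norm_ge0.
  - exact: l2norm_ge0.
  - apply: le_trans (l2norm_comp v M0 hM) _; apply: ler_wpM2l => //.
  - exact: du.
apply: le_trans (famip_CS _ _) _; rewrite -mulrA; apply: ler_pM.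
- exact: l2norm_ge0.
- exact: l2norm_ge0.
- exact: h4.
- apply: le_trans (ldist_comp v v' M0 hM) _; exact: ler_wpM2l.
Qed.

(** Moving E to the end of the words turns the last letter into right multiplication, with the
    factor 1/c(l) for r l and 1/c(bar l) = c(l) for q bar(l); their quotient is the constant of
    [Mrel]. *)
Lemma Mrel_compression T : Mrel (compression Vip T).
Proof.
move=> q r l; apply: (ucv_unique (compression_vec T q (rcons r l))).
apply: (ucv_eq (ucvZ ((c l)^-1 ^+ 2)%:C (compression_vec T (rcons q (bar l)) r))).
move=> n; rewrite !VM_rcons.
have kZ a (X : 'M[CC]_(d n)) : kcol (a *: X) = fun b => a *: kcol X b.
  apply/funext => b; rewrite /kcol.
  have := emb_lin a (fun i => X i b) (fun=> 0); rewrite (_ : emb (fun=> 0) = 0).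
    rewrite addr0 => <-; congr emb; apply/funext => i.
    by rewrite !mxE addr0.
  by apply: nrm0_eq0; apply/eqP; rewrite -sqrf_eq0 -Re_hip hip_emb big1// => i _;
    rewrite mulr0.
rewrite !kZ; set A := famip _ _; set B := famip _ _.
have -> : B = ((c l)^-1)%:C * famip (kcol (VM n q))
    (fun a => T (kcol (VM n r *m W n l) a)).
  rewrite /B /famip mulr_sumr; apply: eq_bigr => a _.
  by rewrite bopZ hipZr.
have -> : A = (c l)%:C * famip (kcol (VM n q *m W n (bar l)))
    (fun a => T (kcol (VM n r) a)).
  rewrite /A /famip mulr_sumr; apply: eq_bigr => a _.
  by rewrite hipZl realC_real cbar invrK.
rewrite famip_kcol_mul Wadj mulrA -rmorphM expr2 -mulrA mulVf ?gt_eqF// mulr1.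
by [].
Qed.

Lemma Mrel_id : Mrel bid.
Proof. by rewrite -(compression_id Vip); exact: Mrel_compression. Qed.

Lemma adj_Rmul l q :
  adj (Rmul l) (vec q) = ((c l)^-1 ^+ 2)%:C *: vec (rcons q (bar l)).
Proof.
apply: (hip_span vec_spans) => w; rewrite -adjP RmulE hipZr hip_conj.
have := Mrel_id q w l; rewrite !bidE => ->.
by rewrite conjM realC_real -hip_conj.
Qed.

Fixpoint wop (w : seq L) : bop F :=
  if w is l :: w' then bcomp (G l) (wop w') else bid.

Lemma wop_vec u w : wop u (vec w) = vec (u ++ w).
Proof. by elim: u => [|l u IH] //=; rewrite IH. Qed.

Lemma wop_Om u : wop u Om = vec u.
Proof. by rewrite -[in RHS](cats0 u) -wop_vec. Qed.

Lemma wop_rcons u l : wop (rcons u l) = bcomp (wop u) (G l).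
Proof.
elim: u => [|m u IH] /=; first by rewrite bcomp1l bcomp1r.
by rewrite IH bcompA.
Qed.

Lemma adj_wop u : adj (wop u) = wop (wstar u).
Proof.
elim: u => [|l u IH] /=; first by rewrite adj_id.
by rewrite adj_comp Gadj IH wstar_cons wop_rcons.
Qed.

Lemma Mrel_wop X u v : Mrel X -> Mrel (bcomp (wop u) (bcomp X (wop v))).
Proof.
move=> hX q r l; rewrite !bcompE !wop_vec !(adjPr (wop u)) adj_wop !wop_vec.
by rewrite -!rcons_cat hX.
Qed.

Lemma Mrel_vec X q r : Mrel X -> hip (vec q) (X (vec r)) =
  ((cw r)^-1 ^+ 2)%:C * hip (vec (q ++ wstar r)) (X Om).
Proof.
move=> hX; elim/last_ind: r q => [|r l IH] q.
  by rewrite cats0 /cw big_nil invr1 expr1n mul1r.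
rewrite hX IH wstar_rcons cat_rcons mulrA -rmorphM; congr (_%:C * _).
by rewrite -exprMn -invfM /cw -cats1 big_cat big_seq1 mulrC.
Qed.

Definition pstar (p : seq (CC * seq L)) : seq (CC * seq L) :=
  [seq (conjc a.1, wstar a.2) | a <- p].

(** Gram-Schmidt on lists of coefficients, as the coefficients of the projection are needed to form
    [pstar]. The words may be dependent, which is the case v = 0. *)
Lemma word_proj (ws : seq (seq L)) x : exists p : seq (CC * seq L),
  (forall a, a \in p -> a.2 \in ws) /\
  forall w, w \in ws -> hip (vec w) (x - lc vec p) = 0.
Proof.
elim: ws x => [|w ws IH] x; first by exists [::].
have [p [pw hp]] := IH x; have [q [qw hq]] := IH (vec w).
pose v := vec w - lc vec q.
have vq z r : (forall a, a \in r -> a.2 \in ws) ->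
    (forall u, u \in ws -> hip (vec u) z = 0) -> hip (lc vec r) z = 0.
  move=> rw hz; rewrite /lc hip_suml big_seq big1// => a ar.
  by rewrite hipZl hz ?mulr0// rw.
have [v0|v0] := eqVneq (nrm v) 0.
  exists p; split=> [a /pw h|u]; first by rewrite inE h orbT.
  rewrite inE => /predU1P[->|/hp//].
  have -> : vec w = lc vec q by apply/eqP; rewrite -subr_eq0; apply/eqP/nrm0_eq0.
  exact: vq.
pose b := hip v (x - lc vec p) / (nrm v ^+ 2)%:C.
exists (p ++ lscale b ((1, w) :: lscale (-1) q)); split.
  move=> a; rewrite mem_cat => /orP[/pw h|]; first by rewrite inE h orbT.
  move=> /mapP[e]; rewrite inE => /predU1P[->|] => [->|/mapP[e' /qw h ->] ->] /=.
    by rewrite inE eqxx.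
  by rewrite inE h orbT.
have lcE : lc vec (p ++ lscale b ((1, w) :: lscale (-1) q)) = lc vec p + b *: v.
  rewrite lc_cat lc_scale; congr (_ + _ *: _).
  by rewrite /lc big_cons scale1r -/(lc vec (lscale (-1) q)) lc_scale scaleN1r.
have hv u : u \in ws -> hip (vec u) (x - lc vec p - b *: v) = 0.
  by move=> uw; rewrite hipBr hipZr hp// hq// mulr0 subr0.
move=> u; rewrite lcE opprD addrA inE => /predU1P[->|]; last exact: hv.
have -> : vec w = v + lc vec q by rewrite /v subrK.
rewrite hipDl (vq _ q)// addr0 hipBr hipZr hip_nrm /b divfK ?subrr//.
by apply: contra_neq v0 => /realC_inj /eqP; rewrite sqrf_eq0 => /eqP.
Qed.

Lemma word_proj_min (ws : seq (seq L)) (x : F) (p q : seq (CC * seq L)) : (forall a, a \in p -> a.2 \in ws) ->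
  (forall w, w \in ws -> hip (vec w) (x - lc vec p) = 0) ->
  (forall a, a \in q -> a.2 \in ws) ->
  nrm (x - lc vec p) <= nrm (x - lc vec q).
Proof.
move=> pw hp qw; rewrite -(@ler_pXn2r _ 2) ?nnegrE ?nrm_ge0//.
have h0 r : (forall a, a \in r -> a.2 \in ws) ->
    hip (x - lc vec p) (lc vec r) = 0.
  move=> rw; rewrite /lc hip_sumr big_seq big1// => a ar.
  by rewrite hipZr hip_conj hp ?conjc0 ?mulr0// rw.
have -> : x - lc vec q = (x - lc vec p) + (lc vec p - lc vec q).
  by rewrite addrA subrK.
rewrite [leRHS]nrm_sqD hipBr !h0// subrr /= mul0rn addr0 lerDl sqr_ge0//.
Qed.

(* X Om and X^* Om are projected on a space spanned by a set of words stable
   under the adjoint; the two projections are a Om and a^* Om for the same a. *)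
Lemma Mrel_approx X (e : R) : Mrel X -> 0 < e -> exists p,
  nrm (X Om - lc vec p) <= e /\ nrm (adj X Om - lc vec (pstar p)) <= e.
Proof.
move=> hX e0; have [q hq] := vec_spans (X Om) e0.
have [q' hq'] := vec_spans (adj X Om) e0.
pose ws0 := [seq a.2 | a <- q ++ q'].
pose ws := ws0 ++ map wstar ws0.
have wsP w : w \in ws -> wstar w \in ws.
  rewrite !mem_cat => /orP[h|/mapP[u h ->]]; last by rewrite wstarK h.
  by rewrite map_f ?orbT.
have mem a : a \in q ++ q' -> a.2 \in ws.
  by move=> h; rewrite mem_cat (map_f snd).
have [p [pw hp]] := word_proj ws (X Om).
exists p; split.
  rewrite (le_trans _ hq)//; apply: (word_proj_min pw hp) => a aq.
  by apply: mem; rewrite mem_cat aq.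
rewrite (le_trans _ hq')//; apply: (@word_proj_min ws).
- by move=> a /mapP[b /pw h ->]; exact: wsP.
- move=> r rw; rewrite hipBr; apply/eqP; rewrite subr_eq0; apply/eqP.
  rewrite -adjP.
  have -> : hip (X (vec r)) Om = conjc (hip (vec [::]) (X (vec r))).
    by rewrite -hip_conj.
  rewrite (Mrel_vec _ _ hX) /= conjM realC_real.
  have := hp (wstar r) (wsP _ rw); rewrite hipBr => /eqP; rewrite subr_eq0 => /eqP->.
  rewrite /lc /pstar big_map !hip_sumr conj_sum mulr_sumr; apply: eq_bigr => a _ /=.
  rewrite !hipZr conjM mulrCA; congr (_ * _).
  rewrite -hip_conj [RHS]hip_conj.
  have := Mrel_vec (wstar a.2) r Mrel_id; rewrite !bidE => ->.
  rewrite conjM realC_real -hip_conj; congr (_ * _).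
  by rewrite hip_vec.
- by move=> a aq'; apply: mem; rewrite mem_cat aq' orbT.
Qed.

(** At the vacuum, X Om and X^* Om are replaced by a Om and a^* Om for one polynomial a in the G(l),
    and Y commutes with a. Other matrix coefficients reduce to this one because [Mrel] is stable
    under multiplication by words on both sides. *)
Lemma Mrel_commute (X Y : bop F) : Mrel X -> (forall l x, Y (G l x) = G l (Y x)) ->
  bcomp X Y = bcomp Y X.
Proof.
move=> hX hY.
have Yw w x : Y (wop w x) = wop w (Y x).
  by elim: w => [//|l w IH] /=; rewrite hY IH.
have base X' : Mrel X' -> hip Om (X' (Y Om)) = hip Om (Y (X' Om)).
  move=> hX'; apply/eqP; rewrite -subr_eq0; apply/eqP/cabs0_eq0/eqP.
  rewrite eq_le cabs_ge0 andbT; apply/ler_addgt0Pr => e e0; rewrite add0r.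
  pose D := nrm (Y Om) + nrm (adj Y Om) + 1.
  have D0 : 0 < D by rewrite ltr_wpDl// addr_ge0 ?nrm_ge0.
  have d0 : 0 < e / D by rewrite divr_gt0.
  have [p [h1 h2]] := Mrel_approx hX' d0.
  have h3 : hip (lc vec (pstar p)) (Y Om) = hip (adj Y Om) (lc vec p).
    rewrite /lc /pstar big_map hip_suml hip_sumr; apply: eq_bigr => a _ /=.
    rewrite hipZl conjcK hipZr -adjPr; congr (_ * _).
    by rewrite -(wop_Om a.2) Yw (adjPr (wop a.2)) adj_wop wop_Om.
  have -> : hip Om (X' (Y Om)) - hip Om (Y (X' Om)) =
     hip (adj X' Om - lc vec (pstar p)) (Y Om) -
     hip (adj Y Om) (X' Om - lc vec p).
    by rewrite hipBl hipBr h3 -!adjPr opprB addrA subrK.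
  rewrite (le_trans (cabsB _ _))//.
  rewrite (le_trans (lerD (hip_CS _ _) (hip_CS _ _)))//.
  have h4 := ler_wpM2r (nrm_ge0 (Y Om)) h2.
  have h5 := ler_wpM2l (nrm_ge0 (adj Y Om)) h1.
  rewrite (le_trans (lerD h4 h5))// (mulrC (nrm _)) -mulrDr.
  by rewrite mulrAC ler_pdivrMr// ler_pM2l// lerDl.
apply: (eq_on_span vec_spans) => v; apply: (hip_span vec_spans) => u.
have := base _ (Mrel_wop (wstar u) v hX).
rewrite !bcompE (Yw (wstar u)) -(Yw v) wop_Om.
rewrite !(adjPr (wop (wstar u))) adj_wop wstarK wop_Om => h.
exact: h.
Qed.

End Commutation.


Section Approximation.
Arguments V : clear implicits.

Definition app (x : F) (m : forall n, 'M[CC]_(d n)) :=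
  unull natU (fun n => hn (Vmx x n - m n)).

Lemma app_Vmx x : app x (Vmx x).
Proof.
move=> e e0; apply: utrue => n; rewrite -ldist_kcol.
rewrite /ldist (le_trans (l2norm_le_sum _))// big1 ?(ltW e0)// => i _.
by rewrite subrr nrm0.
Qed.

Lemma app_vec w : app (vec w) (fun n => VM n w).
Proof. by move=> e; exact: Vmx_vec. Qed.

Lemma hnD n (X Y : 'M[CC]_(d n)) : hn (X + Y) <= hn X + hn Y.
Proof.
have := kcol_lin 1 X Y; rewrite scale1r /hn => ->.
apply: le_trans (l2normD _ _) _; rewrite lerD2r l2normZ.
by rewrite (cabs_real 1) normr1 mul1r.
Qed.

Lemma hnZ n a (X : 'M[CC]_(d n)) : hn (a *: X) = cabs a * hn X.
Proof.
apply/eqP; rewrite -(@eqrXn2 _ 2) ?mulr_ge0 ?hn_ge0 ?cabs_ge0//; apply/eqP.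
apply: realC_inj; rewrite -hn_sq (semiZl (hs_semi d n)) (semiZr (hs_semi d n)) hn_sq mulrA exprMn.
by rewrite conj_mul -rmorphM.
Qed.

Lemma Vmx_lin a x y :
  unull natU (fun n => hn (Vmx (a *: x + y) n - (a *: Vmx x n + Vmx y n))).
Proof.
apply: (unull_le _ (V_lin Vip a x y)) => n.
by rewrite -ldist_kcol kcol_lin.
Qed.

Lemma app_lin a x y m m' : app x m -> app y m' ->
  app (a *: x + y) (fun n => a *: m n + m' n).
Proof.
move=> hx hy.
apply: (unull_le _ (unullD (Vmx_lin a x y) (unullD (unullZ (cabs a) hx) hy))).
move=> n; rewrite (ger0_norm (cabs_ge0 _)) -hnZ.
apply: le_trans (hn_trans (a *: Vmx x n + Vmx y n) _ _) (lerD (lexx _) _).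
apply: le_trans (hnD _ _); rewrite scalerBr opprD addrACA.
by [].
Qed.

Lemma app_near x y m m' (e : R) : app x m -> app y m' -> 0 < e ->
  natU [set n | hn (m n - m' n) <= nrm (x - y) + e].
Proof.
move=> hx hy e0; have e4 : 0 < e / 4 by rewrite divr_gt0.
apply: (ufilter2 (filterI (hx _ e4) (hy _ e4))
   (filterI (V_sub Vip x y e4) (V_bound Vip (x - y) e4))) => n [/= h1 h2] [/= h3 h4].
rewrite (hn_BC (Vmx x n)) in h1.
have h5 : hn (Vmx x n - Vmx y n) <= e / 4 + (nrm (x - y) + e / 4).
  rewrite -ldist_kcol; apply: le_trans (lerD h3 h4).
  apply: le_trans (l2normD (fun a => V n x a - V n y a - V n (x - y) a) _).
  rewrite le_eqVlt; apply/orP; left; apply/eqP; congr l2norm.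
  by apply/funext => a; rewrite subrK.
apply: le_trans (hn_trans (Vmx x n) _ _) _.
apply: le_trans (lerD h1 (le_trans (hn_trans (Vmx y n) _ _) (lerD h5 h2))) _.
by rewrite le_eqVlt; apply/orP; left; apply/eqP; field.
Qed.

Lemma app_closed x m : (forall e : R, 0 < e -> exists y m',
  [/\ app y m', nrm (x - y) <= e & natU [set n | hn (m n - m' n) <= e]]) ->
  app x m.
Proof.
move=> h e e0; have e4 : 0 < e / 4 by rewrite divr_gt0.
have [y [m' [h1 h2 h3]]] := h _ e4.
apply: (ufilter2 (app_near (app_Vmx x) h1 e4) h3) => n h4 h5.
apply: le_trans (hn_trans (m' n) _ _) _; rewrite (hn_BC (m n)) in h5.
apply: le_trans (lerD (le_trans h4 (lerD h2 (lexx _))) h5) _.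
exact: three_quarters_le.
Qed.

Lemma app_lc (S : Type) (f : S -> F) (m : S -> forall n, 'M[CC]_(d n)) p :
  (forall s, app (f s) (m s)) -> app (lc f p) (fun n => lc (fun s => m s n) p).
Proof.
move=> h; elim: p => [|a p IH].
  have h0 := app_lin (-1) (app_Vmx 0) (app_Vmx 0).
  rewrite scaler0 addr0 in h0; rewrite lc0; apply: (unull_le _ h0) => n.
  by rewrite lc0 scaleN1r addNr.
have lcE (T : lmodType CC) (g : S -> T) : lc g (a :: p) = a.1 *: g a.2 + lc g p.
  by rewrite /lc big_cons.
rewrite lcE; apply: (unull_le _ (app_lin a.1 (h a.2) IH)) => n.
by rewrite lcE.
Qed.

End Approximation.

(** * Lifting the elements of the generated von Neumann algebra *)

Section Generated.
Arguments V : clear implicits.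
Variable Gam : set (bop F).
Hypotheses (GamvN : von_neumann Gam) (GamG : forall l, Gam (G l))
  (Gam_min : forall N, von_neumann N -> (forall l, N (G l)) -> Gam `<=` N).

Lemma Gam_adj X : Gam X -> Gam (adj X).
Proof. by move=> h; apply: GamvN.1 h _ => x y; exact: adjP. Qed.

Lemma Gam_Rmul X l : Gam X -> forall x,
  X (Rmul l x) = Rmul l (X x) /\ X (adj (Rmul l) x) = adj (Rmul l) (X x).
Proof.
pose M : set (bop F) := [set T | T = Rmul l \/ T = adj (Rmul l)].
have Ms T : M T -> M (adj T) by move=> [] ->; [right|left; rewrite adjK].
move=> GX x; have GM : commutant M X.
  apply: (Gam_min (commutant_von_neumann Ms)) => // k T [] -> y.
    by rewrite Rmul_comm.
  by rewrite Rmul_adj_comm.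
by split; apply: GM; [left|right].
Qed.

(** Minimality of [Gam] puts it in the commutant of right multiplications; conversely [Mrel_commute]
    makes X commute with the commutant of [Gam], and the bicommutant property concludes. *)
Lemma Gam_Mrel X : Gam X <-> Mrel X.
Proof.
split=> [GX q r l|hX].
  rewrite -RmulE (Gam_Rmul l GX _).1 adjPr adj_Rmul hipZl realC_real.
  by [].
rewrite -GamvN.2 => Y hY x; rewrite -!bcompE; congr (bop_val _ x).
by apply: Mrel_commute => // l y; apply: hY.
Qed.

Lemma Gam_lin a X Y : Gam X -> Gam Y -> Gam (a *: X + Y).
Proof.
move=> /Gam_Mrel hX /Gam_Mrel hY; apply/Gam_Mrel => q r l.
by rewrite !bopDE !bopZE !hipDr !hipZr hX hY mulrDr mulrCA.
Qed.

Lemma Gam_compression T : Gam (compression Vip T).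
Proof. by apply/Gam_Mrel; exact: Mrel_compression. Qed.

Definition wright (r : seq L) (p : seq (CC * seq L)) : seq (CC * seq L) :=
  [seq (a.1, a.2 ++ r) | a <- p].

Lemma lc_Ww_wright n r p : lc (Ww n) p *m VM n r = lc (VM n) (wright r p).
Proof.
rewrite /lc mulmx_suml big_map; apply: eq_bigr => a _ /=.
by rewrite -scalemxAl /VM Ww_cat mulmxA.
Qed.

Lemma lc_Ww_pstar n p : lc (Ww n) (pstar p) = adjm (lc (Ww n) p).
Proof.
rewrite /lc (big_morph _ (@adjmD _ _ _) (@adjm0 _ _ _)) big_map.
by apply: eq_bigr => a _ /=; rewrite adjmZ Ww_wstar.
Qed.

Lemma wright_bound X r : Gam X -> exists M, 0 <= M /\ forall p,
  nrm (X (vec r) - lc vec (wright r p)) <= M * nrm (X Om - lc vec p).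
Proof.
move=> GX; have [T hT XT] : exists2 T : bop F,
    (forall w, T (vec w) = vec (w ++ r)) & forall x, X (T x) = T (X x).
  elim: r => [|l r [T hT XT]].
    by exists bid => [w|x]; rewrite ?bidE ?cats0.
  exists (bcomp T (Rmul l)) => [w|x]; rewrite !bcompE.
    by rewrite RmulE hT cat_rcons.
  by rewrite XT (Gam_Rmul l GX x).1.
have [M M0 hM] := bop_bb T; exists M; split=> // p.
have -> : X (vec r) = T (X Om).
  by rewrite -XT -[Om]/(vec [::]) hT.
have -> : lc vec (wright r p) = T (lc vec p).
  by rewrite bop_lc /lc big_map; apply: eq_bigr => a _; rewrite /= hT.
by rewrite -bopB.
Qed.

(** As X Om = X^* Om, half the sum of an approximating polynomial and its adjoint still
    approximates. The bounded right multiplications carry the estimate from Om to all words. *)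
Lemma selfadjoint_models X : Gam X -> adj X = X ->
  exists y : forall n, 'M[CC]_(d n), (forall n, adjm (y n) = y n) /\
    forall r, app (X (vec r)) (fun n => y n *m VM n r).
Proof.
move=> GX sX.
pose ee k : R := (k.+1%:R)^-1.
have ee0 k : 0 < ee k by rewrite invr_gt0.
have /choice[p hp] k := Mrel_approx ((Gam_Mrel X).1 GX) (ee0 k).
pose b k := lscale (2^-1) (p k ++ pstar (p k)).
have hb k : nrm (X Om - lc vec (b k)) <= ee k.
  have [h1 h2] := hp k; rewrite sX in h2.
  have -> : X Om - lc vec (b k) = 2^-1 *: ((X Om - lc vec (p k)) +
      (X Om - lc vec (pstar (p k)))).
    rewrite /b lc_scale lc_cat.
    by apply: hip_ext => z; rewrite !(hipDr, hipNr, hipZr); field.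
  rewrite nrmZ; apply: le_trans (ler_wpM2l (cabs_ge0 _) (nrmD _ _)) _.
  apply: le_trans (ler_wpM2l (cabs_ge0 _) (lerD h1 h2)) _.
  have -> : (2^-1 : CC) = (2^-1)%:C by rewrite fmorphV rmorph_nat.
  by rewrite cabs_real ger0_norm ?invr_ge0// mulrDr !(mulrC 2^-1) -splitr.
pose B k n := lc (Ww n) (b k).
have sB k n : adjm (B k n) = B k n.
  rewrite /B /b lc_scale lc_cat lc_Ww_pstar adjmZ adjmD adjmK addrC.
  by congr (_ *: _); rewrite fmorphV rmorph_nat.
have /choice[M hM] r := wright_bound r GX.
have M0 r : 0 <= M r by have [] := hM r.
(* A single diagonal sequence has to serve all words r, so they are enumerated and stage m treats
   the first m + 1 codes. *)
pose Q m n := forall l, (l <= m)%N -> forall r : seq L, unpickle l = Some r ->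
  hn (Vmx (X (vec r)) n - B m n *m VM n r) <= (M r + 1) * ee m.
have hQ m : natU [set n | Q m n].
  have one l : (l < m.+1)%N -> natU [set n | forall r : seq L,
      unpickle l = Some r ->
      hn (Vmx (X (vec r)) n - B m n *m VM n r) <= (M r + 1) * ee m].
    move=> _; case: (unpickle l) => [r|]; last exact: utrue.
    apply: (ufilter (VmxP (X (vec r)) (wright r (b m)) (ee0 m))) => n h _ [<-].
    rewrite lc_Ww_wright; apply: le_trans h _; rewrite mulrDl mul1r lerD2r.
    have [_ h] := hM r; apply: le_trans (h (b m)) _.
    by rewrite ler_wpM2l.
  by apply: (ufilter (ufilter_lt one)) => n h l lm; apply: h.
have [k hk] := ultra_diagonal hQ.
exists (fun n => B (k n) n); split=> [n|r e e0]; first exact: sB.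
have Mr : 0 < M r + 1 by rewrite ltr_wpDl.
have [N hN] := invn_small (divr_gt0 e0 Mr).
apply: (ufilter (hk (maxn N (pickle r)))) => n [kn Qk].
rewrite geq_max in kn; case/andP: kn => Nk rk.
apply: le_trans (Qk _ rk r (pickleK r)) _.
by rewrite mulrC -ler_pdivlMr// hN.
Qed.

Lemma shift_app (X : bop F) (y : forall n, 'M[CC]_(d n)) (t : R) : (forall r, app (X (vec r)) (fun n => y n *m VM n r)) ->
  forall p, app ((X + (0 +i* t)%C *: bid) (lc vec p))
    (fun n => shift (y n) t *m lc (VM n) p).
Proof.
move=> h p; rewrite bop_lc.
have -> : (fun n => shift (y n) t *m lc (VM n) p) =
    fun n => lc (fun r => shift (y n) t *m VM n r) p.
  apply: functional_extensionality_dep => n; rewrite /lc mulmx_sumr.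
  apply: eq_bigr => a _.
  by rewrite -scalemxAr.
apply: (@app_lc _ _ (fun r n => shift (y n) t *m VM n r)) => r.
have -> : (X + (0 +i* t)%C *: bid) (vec r) = (0 +i* t)%C *: vec r + X (vec r).
  by rewrite bopDE bopZE bidE addrC.
apply: (unull_le _ (app_lin (0 +i* t)%C (app_vec r) (h r))) => n.
have -> : shift (y n) t *m VM n r = (0 +i* t)%C *: VM n r + y n *m VM n r.
  by rewrite /shift mulmxDl mul_scalar_mx addrC.
exact: lexx.
Qed.

(** [y n] models X on combinations of words only. With p close to Z x, the matrix resolvent applied
    to x differs from p by the resolvent of x - (y + i t) p, which is small because (X + i t) Z x =
    x. *)
Lemma resolvent_app (X Z : bop F) (y : forall n, 'M[CC]_(d n)) (t : R) : (forall n, adjm (y n) = y n) -> t != 0 ->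
  (forall r, app (X (vec r)) (fun n => y n *m VM n r)) ->
  bcomp (X + (0 +i* t)%C *: bid) Z = bid ->
  forall x, app (Z x) (fun n => invmx (shift (y n) t) *m Vmx x n).
Proof.
move=> sy t0 h XZ x; apply: app_closed => e e0.
have [S [bS hS _]] := resolvent_operator sy t0.
have [M M0 hM] := bop_bb (X + (0 +i* t)%C *: bid).
have ti : 0 < `|t| by rewrite normr_gt0.
pose e' := Num.min e (e * `|t| / 2 / (M + 1)).
have M1 : 0 < M + 1 by rewrite ltr_wpDl.
have et : 0 < e * `|t| / 2 by rewrite divr_gt0// mulr_gt0.
have e'0 : 0 < e' by rewrite lt_min e0 divr_gt0.
have [p hp] := vec_spans (Z x) e'0.
exists (lc vec p), (fun n => lc (VM n) p); split.
- exact: app_lc app_vec.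
- by rewrite (le_trans hp)// ge_min lexx.
have := app_near (app_Vmx x) (shift_app t h p) et => near.
apply: (ufilter near) => n hn1.
have -> : invmx (shift (y n) t) *m Vmx x n - lc (VM n) p =
    invmx (shift (y n) t) *m (Vmx x n - shift (y n) t *m lc (VM n) p).
  by rewrite mulmxBr mulKmx// shift_unit.
set Y := _ - _ in hn1 *.
have -> : hn (invmx (shift (y n) t) *m Y) = l2norm (fun a => S (kcol Y a)).
  by congr l2norm; apply/funext => a; rewrite hS.
apply: le_trans (l2norm_comp _ _ bS) _; first by rewrite invr_ge0.
rewrite -[l2norm _]/(hn Y) mulrC ler_pdivrMr//.
apply: le_trans hn1 _; rewrite [leRHS]splitr lerD2r.
have -> : x = (X + (0 +i* t)%C *: bid) (Z x) by rewrite -bcompE XZ bidE.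
rewrite -bopB; apply: le_trans (hM _) _.
apply: le_trans (ler_wpM2l M0 hp) _.
apply: (@le_trans _ _ ((M + 1) * e')); first by rewrite ler_pM2r// lerDl.
by rewrite mulrC -ler_pdivlMr// ge_min lexx orbT.
Qed.

Lemma resolvent_lift (X Zp Zm : bop F) (y : forall n, 'M[CC]_(d n)) (t : R) :
  (forall n, adjm (y n) = y n) ->
  t != 0 -> (forall r, app (X (vec r)) (fun n => y n *m VM n r)) ->
  bcomp (X + (0 +i* t)%C *: bid) Zp = bid ->
  bcomp (X + (0 +i* - t)%C *: bid) Zm = bid ->
  exists S : bop K, [/\ asym Vip S, compression Vip S = Zp & bb S `|t|^-1].
Proof.
move=> sy t0 h hp hm; have [S [bS hS hS']] := resolvent_operator sy t0.
have cS : cvto (om := natU) V S Zp.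
  move=> x; apply: (unull_le _ (resolvent_app sy t0 h hp x)) => n.
  by rewrite ldistC -ldist_kcol; under [fun a => S _]funext => a do rewrite hS.
have cS' : cvto (om := natU) V (adj S) Zm.
  have t0' : - t != 0 by rewrite oppr_eq0.
  move=> x; apply: (unull_le _ (resolvent_app sy t0' h hm x)) => n.
  by rewrite ldistC -ldist_kcol; under [fun a => adj S _]funext => a do rewrite hS'.
exists S; split; [|exact: cvto_compression cS|exact: bS].
by split; [rewrite (cvto_compression Vip cS)|rewrite (cvto_compression Vip cS')].
Qed.

(* With s = 2 |X|, the two resolvents at +-is combine to X' = s^2 X / (X^2 + s^2), and
   X - X' = X^3 / (X^2 + s^2) has norm at most |X| / 4. *)
Lemma selfadjoint_lift X (de : R) : Gam X -> adj X = X -> 0 < de -> bb X de ->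
  exists T : bop K, [/\ asym Vip T, bb T (2 * de) &
    bb (X - compression Vip T) (de / 4)].
Proof.
move=> GX sX de0 bX; pose s := 2 * de.
have s0 : 0 < s by rewrite mulr_gt0.
have [y [sy hy]] := selfadjoint_models GX sX.
pose Y := bcomp X X + (s ^+ 2)%:C *: bid.
have [||x|U [sU YU UY bU]] := @pos_inverse _ _ Y (s ^+ 2).
- by rewrite exprn_gt0.
- by rewrite /Y adjD adj_comp sX adjZ adj_id realC_real.
- rewrite /Y bopDE bopZE bidE bcompE hipDr hipZr cReD adjPr sX Re_hip.
  by rewrite hip_nrm -rmorphM /= lerDr sqr_ge0.
have XU : bcomp X U = bcomp U X.
  have XY : bcomp X Y = bcomp Y X.
    apply: bop_ext => x; rewrite /Y !bcompE !bopDE !bopZE !bidE !bcompE.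
    by rewrite bopD bopZ.
  rewrite -[LHS]bcomp1l -UY -bcompA (bcompA Y) -XY -(bcompA X) YU bcomp1r.
  by [].
have h (t : R) : t ^+ 2 = s ^+ 2 ->
    bcomp (X + (0 +i* t)%C *: bid) (bcomp (X - (0 +i* t)%C *: bid) U) = bid.
  move=> ts; rewrite bcompA -[RHS]YU; congr bcomp; apply: bop_ext => x.
  rewrite /Y !(bcompE, bopDE, bopZE, bopNE, bidE) bopB bopZ scalerBr scalerA.
  have -> : (0 +i* t)%C * (0 +i* t)%C = - (s ^+ 2)%:C.
    by rewrite -ts; apply: complexP => /=; ring.
  by rewrite scaleNr opprK addrA subrK.
have s0' : s != 0 by rewrite gt_eqF.
have hp := h s erefl; have hm := h (- s) (sqrrN s).
have [S1 [a1 c1 b1]] := resolvent_lift sy s0' hy hp hm.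
have hp' := hp; rewrite -{1}(opprK s) in hp'.
have ms0 : - s != 0 by rewrite oppr_eq0.
have [S2 [a2 c2 b2]] := resolvent_lift sy ms0 hy hm hp'.
rewrite normrN (ger0_norm (ltW s0)) in b2; rewrite (ger0_norm (ltW s0)) in b1.
(* The two resolvents add up to 2 X / (X^2 + s^2). The norm of the lift is at most k (1/s + 1/s) = s
   = 2 de. *)
pose k : R := s ^+ 2 / 2.
have k0 : 0 <= k by rewrite divr_ge0// sqr_ge0.
exists (k%:C *: (S1 + S2)); split.
- have a0 : asym Vip 0 by rewrite -(addNr S1) -scaleN1r; apply: asym_lin.
  rewrite -[_ *: _]addr0; apply: asym_lin a0; rewrite -[S1]scale1r.
  exact: asym_lin.
- have -> : 2 * de = cabs (k%:C : CC) * (s^-1 + s^-1).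
    rewrite cabs_real ger0_norm// /k expr2 -/s; field.
    by rewrite gt_eqF.
  by apply: bbZ; apply: bbD.
have k2 : k%:C * 2 = (s ^+ 2)%:C :> CC.
  by apply: complexP; rewrite /k /=; field.
have -> : X - compression Vip (k%:C *: (S1 + S2)) = bcomp X (bcomp (bcomp X X) U).
  rewrite compressionZ compressionD c1 c2.
  have e : X = bcomp X (bcomp Y U) by rewrite YU bcomp1r.
  rewrite {1}e; apply: bop_ext => x.
  rewrite /Y !(bcompE, bopDE, bopZE, bopNE, bidE).
  set u := U x; rewrite bopD bopZ.
  rewrite (_ : X u - (0 +i* s)%C *: u + (X u - (0 +i* - s)%C *: u) = 2 *: X u).
    by rewrite scalerA k2 addrK.
  rewrite (_ : (0 +i* - s)%C = - (0 +i* s)%C); last first.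
    by apply: complexP => /=; ring.
  by rewrite scaleNr opprK addrACA addNr addr0 scaler_nat mulr2n.
have -> : de / 4 = de * ((de * de) * (s ^+ 2)^-1).
  by rewrite /s; field; rewrite gt_eqF.
have d0 := ltW de0.
apply: bb_comp => //; apply: bb_comp => //; first by rewrite mulr_ge0.
exact: bb_comp.
Qed.

Lemma cabs_imag (t : R) : cabs (0 +i* t)%C = `|t|.
Proof.
apply/eqP; rewrite -(@eqrXn2 _ 2) ?cabs_ge0// cabs_sq /=.
by rewrite expr0n add0r real_normK ?num_real.
Qed.

(** Real and imaginary parts each have norm at most de; their lifts and errors add up, whence 2 de +
    2 de and de/4 + de/4. *)
Lemma approximate_lift X (de : R) : Gam X -> 0 < de -> bb X de ->
  exists T : bop K, [/\ asym Vip T, bb T (4 * de) &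
    bb (X - compression Vip T) (de * 2^-1)].
Proof.
move=> GX de0 bX; have d0 := ltW de0.
pose a : CC := (2^-1)%:C; pose b : CC := (0 +i* - 2^-1)%C.
have h0 : 0 <= 2^-1 :> R by rewrite invr_ge0.
have ha : cabs a = 2^-1 by rewrite cabs_real ger0_norm.
have hb : cabs b = 2^-1 by rewrite cabs_imag normrN ger0_norm.
pose X1 := a *: X + a *: adj X; pose X2 := b *: X + (- b) *: adj X.
have GX' : Gam (adj X) by apply: Gam_adj.
have G0 : Gam 0 by rewrite -(addNr X) -scaleN1r; apply: Gam_lin.
have GZ c' Y : Gam Y -> Gam (c' *: Y).
  by move=> GY; rewrite -[_ *: _]addr0; apply: Gam_lin.
have G1 : Gam X1 by apply: Gam_lin => //; apply: GZ.
have G2 : Gam X2 by apply: Gam_lin => //; apply: GZ.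
have bX' : bb (adj X) de by apply: bb_adj.
have half2 : 2^-1 * de + 2^-1 * de = de by rewrite !(mulrC _ de) -splitr.
have s1 : adj X1 = X1 by rewrite /X1 adjD !adjZ adjK realC_real addrC.
have s2 : adj X2 = X2.
  rewrite /X2 adjD !adjZ adjK addrC; congr (_ *: _ + _ *: _);
  by apply: complexP => /=; ring.
have b1 : bb X1 de.
  by rewrite -half2; apply: bbD; rewrite -ha; apply: bbZ.
have b2 : bb X2 de.
  rewrite -half2; apply: bbD; first by rewrite -hb; apply: bbZ.
  by rewrite -hb -cabsN; apply: bbZ.
have [T1 [a1 c1 e1]] := selfadjoint_lift G1 s1 de0 b1.
have [T2 [a2 c2 e2]] := selfadjoint_lift G2 s2 de0 b2.
have ci : cabs (0 +i* 1 : CC)%C = 1 by rewrite cabs_imag normr1.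
exists ((0 +i* 1)%C *: T2 + T1); split.
- exact: asym_lin.
- have -> : 4 * de = cabs (0 +i* 1 : CC)%C * (2 * de) + 2 * de by rewrite ci; ring.
  apply: bbD; [apply: bbZ; exact: c2|exact: c1].
have -> : X - compression Vip ((0 +i* 1)%C *: T2 + T1) =
    (0 +i* 1)%C *: (X2 - compression Vip T2) + (X1 - compression Vip T1).
  rewrite compression_lin scalerBr opprD addrACA; congr (_ + _).
  rewrite /X1 /X2 scalerDr !scalerA addrACA -!scalerDl.
  rewrite (_ : _ * b + a = 1); last by apply: complexP; rewrite /a /b /=; field.
  rewrite (_ : _ * - b + a = 0); last by apply: complexP; rewrite /a /b /=; field.
  by rewrite scale0r addr0 scale1r.
have -> : de * 2^-1 = cabs (0 +i* 1 : CC)%C * (de / 4) + de / 4.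
  by rewrite ci; field.
apply: bbD; [apply: bbZ; exact: e2|exact: e1].
Qed.

Lemma half_small (e : R) : 0 < e -> exists N, (2^-1) ^+ N <= e.
Proof.
move=> e0; have [N hN] := invn_small e0; exists N; apply: le_trans (hN N _) => //.
rewrite exprVn lef_pV2 ?posrE ?exprn_gt0// -natrX ler_nat.
exact: ltn_expl.
Qed.

(** As in the open mapping theorem: the remainder X - P(T) is lifted again, and it is halved each
    time, so the lifts form a series of norm at most 4 |X| (1 + 1/2 + 1/4 + ...) = 8 |X|. *)
Lemma lift_ex X : Gam X -> exists T : bop K,
  [/\ asym Vip T, compression Vip T = X & bb T (8 * opn X)].
Proof.
move=> GX; pose de := opn X.
have a00 : asym Vip 0.
  have ai := asym_id Vip.
  by rewrite -(addNr bid) -scaleN1r; apply: asym_lin.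
have [de0|de0] := eqVneq de 0.
  exists 0; split=> //; first by rewrite (opn_eq0 de0) compression0.
  by rewrite -/de de0 mulr0 => x; rewrite bop0E nrm0 mul0r.
have dep : 0 < de by rewrite lt_neqAle eq_sym de0 opn_ge0.
pose h n : R := de * 2^-1 ^+ n.
have hS n : h n.+1 = h n * 2^-1 by rewrite /h exprSr mulrA.
have hp n : 0 < h n by rewrite mulr_gt0// exprn_gt0// invr_gt0.
have /choice[f hf] (Y : bop F * nat) : exists T : bop K,
    Gam Y.1 -> bb Y.1 (h Y.2) -> [/\ asym Vip T, bb T (4 * h Y.2) &
    bb (Y.1 - compression Vip T) (h Y.2.+1)].
  have [GY|] := pselect (Gam Y.1); last by exists 0.
  have [bY|] := pselect (bb Y.1 (h Y.2)); last by exists 0.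
  have [T hT] := approximate_lift GY (hp Y.2) bY; exists T => _ _.
  by rewrite hS.
pose fix Xn n := if n is n'.+1 then Xn n' - compression Vip (f (Xn n', n')) else X.
pose Tn n := f (Xn n, n).
have inv n : Gam (Xn n) /\ bb (Xn n) (h n).
  elim: n => [|n [IG Ib]] /=; first by rewrite /h expr0 mulr1; split=> //; exact: bb_opn.
  have [_ _ b3] := hf (Xn n, n) IG Ib; split=> //.
  by rewrite addrC -scaleN1r; apply: Gam_lin => //; exact: Gam_compression.
have hT n : asym Vip (Tn n) /\ bb (Tn n) (4 * h n).
  by have [i1 i2] := inv n; have [t1 t2 _] := hf (Xn n, n) i1 i2.
pose S n := \sum_(k < n) Tn k.
have SS n : S n.+1 = S n + Tn n by rewrite /S big_ord_recr.
have aS n : asym Vip (S n).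
  elim: n => [|n IH]; first by rewrite /S big_ord0.
  by rewrite SS -[S n]scale1r; apply: asym_lin; [exact: IH|exact: (hT n).1].
have PS n : X - compression Vip (S n) = Xn n.
  elim: n => [|n IH]; first by rewrite /S big_ord0 compression0 subr0.
  by rewrite SS compressionD opprD addrA IH.
have dS m j : bb (S (m + j)%N - S m) (8 * (h m - h (m + j)%N)).
  elim: j => [|j IH].
    by rewrite addn0 !subrr mulr0 => x; rewrite bop0E nrm0 mul0r.
  rewrite addnS SS addrAC.
  have -> : 8 * (h m - h (m + j).+1) = 8 * (h m - h (m + j)%N) + 4 * h (m + j)%N.
    by rewrite hS; field.
  apply: bbD; [exact: IH|exact: (hT _).2].
have dSN N n : (N <= n)%N -> bb (S n - S N) (8 * h N).
  move=> Nn; have := dS N (n - N)%N; rewrite subnKC// => /bb_le; apply.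
  by rewrite ler_pM2l// lerBlDr lerDl ltW.
have smallh (e : R) : 0 < e -> exists N, 8 * h N <= e.
  move=> e0; have d8 : 0 < 8 * de by rewrite mulr_gt0.
  have [N hN] := half_small (divr_gt0 e0 d8); exists N.
  by rewrite /h mulrA mulrC -ler_pdivlMr.
have [e e0|T hTl] := @bop_complete _ _ S.
  have [N hN] := smallh _ (divr_gt0 e0 (ltr0n R 2)); exists N => n m Nn Nm.
  have -> : S n - S m = (S n - S N) + (- 1) *: (S m - S N).
    by rewrite scaleN1r opprB addrA subrK.
  have -> : e = e / 2 + cabs (-1 : CC) * (e / 2).
    by rewrite cabsN (cabs_real 1) normr1 mul1r -splitr.
  by apply: bbD; [|apply: bbZ]; apply: bb_le (dSN _ _ _) hN.
have h00 : h 0%N = de by rewrite /h expr0 mulr1.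
have opnT : opn T <= 8 * de.
  apply/ler_addgt0Pr => e e0; have [N hN] := hTl e e0.
  have -> : T = (S N - S 0%N) + (-1) *: (S N - T).
    by rewrite /S big_ord0 subr0 scaleN1r opprB addrC subrK.
  apply: opn_le; first by rewrite addr_ge0 ?(ltW e0)// mulr_ge0// ltW.
  apply: bbD; first by have := @dSN 0%N N (leq0n _); rewrite h00.
  rewrite -[e]mul1r -[X in X * e](normr1 R) -(cabs_real 1) -cabsN.
  by apply: bbZ; apply: hN.
exists T; split.
- apply: asym_closed => e e0; have [N hN] := hTl e e0; exists (S N); first exact: aS.
  rewrite -[e]mul1r -[X in X * e](normr1 R) -(cabs_real 1) -cabsN -(opprB (S N)).
  by rewrite -scaleN1r; apply: bbZ; apply: hN.
- apply/eqP; rewrite -subr_eq0; apply/eqP/opn_eq0/eqP.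
  rewrite eq_le opn_ge0 andbT; apply/ler_addgt0Pr => e e0; rewrite add0r.
  have e2 : 0 < e / 2 by rewrite divr_gt0.
  have [N hN] := hTl _ e2; have [N' hN'] := smallh _ e2.
  pose n := maxn N N'.
  have -> : compression Vip T - X = (-1) *: (compression Vip (S n - T) + Xn n).
    by rewrite -PS scaleN1r opprD opprB compressionB opprB addrA subrK.
  apply: opn_le; first exact: ltW.
  have -> : e = cabs (-1 : CC) * (e / 2 + e / 2).
    by rewrite cabsN (cabs_real 1) normr1 mul1r -splitr.
  apply: bbZ; apply: bbD.
    by apply: compression_bb (ltW e2) (hN n _); rewrite leq_maxl.
  have [_ bn] := inv n; apply: bb_le bn _; apply: le_trans hN'.
  apply: (@le_trans _ _ (h N')).
    by rewrite /h ler_pM2l// ler_wiXn2l ?leq_maxr ?invr_ge0// invf_le1 ?ler1n.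
  by rewrite ler_peMl ?(ltW (hp _))// ler1n.
- by apply: bb_le (bb_opn T) opnT.
Qed.

Theorem generated_QWEP : QWEP Gam.
Proof.
apply: (@qwep_criterion _ K F _ natU V Vip Gam 8) => //.
- exact: Gam_compression.
- exact: lift_ex.
Qed.

End Generated.

End GnsModel.

(** * Counting words *)

Section IteratedSums.
Context {V : nmodType} (n : nat).

(** Lists with the last entry summed innermost, because words are read from their right end in the
    recursion for the moments. *)
Fixpoint isum (k : nat) (F : seq 'I_n -> V) : V :=
  if k is k'.+1 then isum k' (fun f => \sum_i F (rcons f i)) else F [::].

Lemma eq_isum k F F' : (forall f, size f = k -> F f = F' f) ->
  isum k F = isum k F'.
Proof.
elim: k F F' => [|k IH] F F' h /=; first exact: h.
by apply: IH => f sf; apply: eq_bigr => i _; apply: h; rewrite size_rcons sf.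
Qed.

Lemma isum0 k : isum k (fun=> 0) = 0.
Proof.
by elim: k => //= k IH; rewrite -[RHS]IH; apply: eq_isum => f _; rewrite big1.
Qed.

Lemma isumD k F F' : isum k (fun f => F f + F' f) = isum k F + isum k F'.
Proof.
elim: k F F' => //= k IH F F'; rewrite -IH; apply: eq_isum => f _.
by rewrite big_split.
Qed.

Lemma isum_exchange k (I : Type) (s : seq I) (P : pred I) F :
  isum k (fun f => \sum_(i <- s | P i) F i f) = \sum_(i <- s | P i) isum k (F i).
Proof.
elim: s => [|i s IH].
  by rewrite big_nil -[RHS](isum0 k); apply: eq_isum => f _; rewrite big_nil.
rewrite big_cons -IH; case: ifP => Pi; last first.
  by apply: eq_isum => f _; rewrite big_cons Pi.
by rewrite -isumD; apply: eq_isum => f _; rewrite big_cons Pi.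
Qed.

End IteratedSums.

Lemma isum_morph (V W : nmodType) (phi : V -> W) n k (F : seq 'I_n -> V) :
  {morph phi : a b / a + b} -> phi 0 = 0 ->
  phi (isum k F) = isum k (fun f => phi (F f)).
Proof.
move=> phiD phi0; elim: k F => //= k IH F; rewrite IH; apply: eq_isum => f _.
exact: big_morph.
Qed.

Lemma isum_le (R : numDomainType) n k (F F' : seq 'I_n -> R) :
  (forall f, size f = k -> F f <= F' f) -> isum k F <= isum k F'.
Proof.
elim: k F F' => [|k IH] F F' h /=; first exact: h.
by apply: IH => f sf; apply: ler_sum => i _; apply: h; rewrite size_rcons sf.
Qed.

Lemma cabs_isum (R : realType) n k (F : seq 'I_n -> R[i]) :
  cabs (isum k F) <= isum k (fun f => cabs (F f)).
Proof.
elim: k F => //= k IH F; apply: le_trans (IH _) _; apply: isum_le => f _.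
exact: cabs_sum.
Qed.

Lemma size_undup_rcons (T : eqType) (f : seq T) i :
  size (undup (rcons f i)) = (size (undup f) + (i \notin f))%N.
Proof.
have /perm_size -> : perm_eq (undup (rcons f i)) (undup (i :: f)).
  by apply: perm_undup => x; rewrite mem_rcons.
by rewrite /=; case: (i \in f); rewrite ?addn0 ?addn1.
Qed.

Lemma isumZ (R : pzRingType) n k (a : R) (F : seq 'I_n -> R) :
  isum k (fun f => a * F f) = a * isum k F.
Proof. by rewrite (@isum_morph _ _ ( *%R a)) ?mulr0// => x y; rewrite mulrDr. Qed.

(** An added letter is either new, with at most n choices and r lowered by one, or one of at most k
    old ones: k! n^r + k k! n^r = (k+1)! n^r. *)
Lemma isum_few_values (R : numDomainType) n k r : (0 < n)%N ->
  isum k (fun f : seq 'I_n => (size (undup f) <= r)%N%:R : R) <=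
  k`!%:R * n%:R ^+ r.
Proof.
move=> n0; elim: k r => [|k IH] r /=.
  by rewrite fact0 mul1r -natrX ler1n expn_gt0 n0.
have step (f : seq 'I_n) : size f = k ->
  \sum_i (size (undup (rcons f i)) <= r)%N%:R <=
   n%:R * (size (undup f) < r)%N%:R + k%:R * (size (undup f) <= r)%N%:R :> R.
  move=> sf; rewrite (bigID (fun i => i \notin f)) /=.
  rewrite (eq_bigr (fun=> (size (undup f) < r)%N%:R)) => [|i nif]; last first.
    by rewrite size_undup_rcons nif addn1.
  rewrite [X in _ + X](eq_bigr (fun=> (size (undup f) <= r)%N%:R)) => [|i]; last first.
    by move=> /negPn nif; rewrite size_undup_rcons nif addn0.
  rewrite !sumr_const; apply: lerD; rewrite -[leLHS]mulr_natl ler_wpM2r ?ler0n// ler_nat.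
    by rewrite (leq_trans (max_card _)) ?card_ord.
  rewrite -sf; apply: leq_trans (card_size f).
  by apply/subset_leq_card/fintype.subsetP => i /negPn.
apply: le_trans (isum_le step) _; rewrite isumD !isumZ factS natrM.
rewrite -[k.+1]addn1 natrD mulrDl mul1r mulrDl addrC lerD//.
  by rewrite -mulrA ler_wpM2l ?ler0n.
case: r {step} => [|r].
  rewrite (@eq_isum _ _ _ _ (fun=> 0)) ?isum0 ?mulr0 ?expr0 ?mulr1 ?ler0n//.
rewrite exprS mulrCA ler_wpM2l ?ler0n//.
exact: IH.
Qed.

Lemma count_gt2 a b c : (0 < a)%N -> (2 < a + (b + (1 + c + (1 + c))))%N.
Proof. lia. Qed.

Lemma count_lt2 a c : (a + (1 + c) < 2)%N -> a = 0%N /\ c = 0%N.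
Proof. lia. Qed.

Section Counting.
Context {R : realType} {L : Type}.
Local Notation CC := R[i].
Variables (q : R) (g : L -> L -> CC).

Definition remk {T} k (s : seq T) := take k s ++ drop k.+1 s.

Lemma size_remk T k (s : seq T) : (k < size s)%N -> size (remk k s) = (size s).-1.
Proof.
move=> ks; rewrite size_cat size_drop size_take ks.
by rewrite subnS -subn1 addnBA ?subn_gt0// subnKC ?subn1// ltnW.
Qed.

Lemma map_remk T T' (f : T -> T') k s : map f (remk k s) = remk k (map f s).
Proof. by rewrite /remk map_cat map_take map_drop. Qed.

Lemma split_remk T (x0 : T) k s : (k < size s)%N ->
  s = take k s ++ nth x0 s k :: drop k.+1 s.
Proof. by move=> ks; rewrite -drop_nth// cat_take_drop. Qed.

(* <Om, G(x_1) ... G(x_j) (u_1 (x) ... (x) u_r)> in the Fock space, for the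
   reversed word x_j, ..., x_1 *)
Fixpoint fm (rx u : seq L) : CC :=
  if rx is h :: rx' then fm rx' (h :: u) +
     \sum_(k < size u) (q ^+ k)%:C * g h (nth h u k) * fm rx' (remk k u)
  else (nilp u)%:R.

Lemma fm_cons h rx u : fm (h :: rx) u = fm rx (h :: u) +
  \sum_(k < size u) (q ^+ k)%:C * g h (nth h u k) * fm rx (remk k u).
Proof. by []. Qed.

Lemma fm_eq0 rx u : (size rx < size u)%N || odd (size rx + size u) ->
  fm rx u = 0.
Proof.
elim: rx u => [|h rx IH] u /=; first by case: u.
move=> H; rewrite IH /=; last by lia.
rewrite add0r big1// => k _; have ku := ltn_ord k.
by rewrite IH ?mulr0// size_remk//; lia.
Qed.

Variables (n : nat) (ev : seq ('I_n * L) -> CC) (B : R).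
Local Notation idx := (map fst).
Local Notation let_ := (map snd).
Hypotheses (ev_nil : ev [::] = 1)
  (ev_single : forall x i l y, i \notin idx x -> i \notin idx y ->
     ev (x ++ (i, l) :: y) = 0)
  (ev_close : forall x i h u1 h' u2, i \notin idx x ->
     uniq (i :: idx (u1 ++ u2)) ->
     ev (x ++ (i, h) :: u1 ++ (i, h') :: u2) =
     (q ^+ size u1)%:C * g h h' * ev (x ++ u1 ++ u2))
  (B0 : 0 <= B) (ev_bound : forall w, cabs (ev w) <= B ^+ size w).

Definition good (s : seq 'I_n) := [forall i, (count_mem i s <= 2)%N].

Lemma perm_good s s' : perm_eq s s' -> good s = good s'.
Proof. by move=> /seq.permP h; apply: eq_forallb => i; rewrite h. Qed.

Definition gsum (rx : seq L) (u : seq ('I_n * L)) (U : seq 'I_n) : CC :=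
  isum (size rx) (fun f => if good (f ++ idx u ++ U ++ U) then
    ev (zip f (rev rx) ++ u) else 0).

Lemma gsum_cons h rx u U : gsum (h :: rx) u U = \sum_i
  isum (size rx) (fun f => if good (f ++ i :: idx u ++ U ++ U) then
    ev (zip f (rev rx) ++ (i, h) :: u) else 0).
Proof.
rewrite /gsum /= -isum_exchange; apply: eq_isum => f sf.
apply: eq_bigr => i _; rewrite cat_rcons rev_cons zip_rcons ?size_rev//.
by rewrite cat_rcons.
Qed.

Lemma gsum_closed f i s : i \in s -> good (f ++ i :: s ++ s) = false.
Proof.
move=> iU; apply/negbTE/forallPn; exists i; rewrite -ltnNge.
have c0 : (0 < count_mem i s)%N by rewrite -has_count has_pred1.
rewrite count_cat /= eqxx count_cat addnCA add1n ltnS.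
exact: leq_trans (leq_add c0 c0) (leq_addl _ _).
Qed.

(** The next letter h sits on a new site, which opens it (creation), or on the k-th site of [u],
    where [ev_close] contracts the pair with weight q^k g (annihilation). This is the recursion of
    [fm]; the falling factorial counts the choices of new sites. *)
Lemma gsumE rx u U : uniq (idx u ++ U) ->
  gsum rx u U = ((n - size U - size u) ^_ ((size rx - size u)./2))%:R *
    fm rx (let_ u).
Proof.
elim: rx u U => [|h rx IH] u U uu.
  rewrite /gsum /= ffactn0 mul1r.
  case: u uu => [|[i l] u] uu.
    rewrite /= ev_nil; case: ifP => // /negP[]; apply/forallP => i.
    by rewrite count_cat; have := count_uniq_mem i uu; case: (i \in _) => /= ->.
  rewrite /= (ev_single (x := [::]))//; first by case: ifP.
  by move: uu => /= /andP[]; rewrite mem_cat negb_or => /andP[].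
have uU : uniq U by move: uu; rewrite cat_uniq => /and3P[].
have ui : uniq (idx u) by move: uu; rewrite cat_uniq => /and3P[].
have szu : size (idx u ++ U) = (size u + size U)%N by rewrite size_cat size_map.
pose F i := isum (size rx) (fun f => if good (f ++ i :: idx u ++ U ++ U) then
  ev (zip f (rev rx) ++ (i, h) :: u) else 0).
have -> : gsum (h :: rx) u U = \sum_(i <- idx u) F i + \sum_(i <- U) F i +
    \sum_(i | i \notin idx u ++ U) F i.
  by rewrite gsum_cons (bigID (mem (idx u ++ U))) /= -big_uniq// big_cat.
have -> : \sum_(i <- U) F i = 0.
  rewrite big_seq big1// => i iU; rewrite /F -[RHS](isum0 n (size rx)).
  apply: eq_isum => f _; rewrite (_ : good _ = false)//.
  rewrite -(gsum_closed (f ++ idx u) iU); apply: perm_good.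
  by rewrite -catA perm_cat2l -[i :: idx u ++ _]cat1s perm_catCA.
rewrite addr0.
have -> : \sum_(i | i \notin idx u ++ U) F i =
    ((n - size U - size u) * (n - size U - size u).-1 ^_
     ((size rx - (size u).+1)./2))%:R * fm rx (h :: let_ u).
  rewrite (eq_bigr (fun=> ((n - size U - size u).-1 ^_
     ((size rx - (size u).+1)./2))%:R * fm rx (h :: let_ u))) => [|i]; last first.
    move=> iu; rewrite -[F i]/(gsum rx ((i, h) :: u) U) IH /=.
      by rewrite subnS.
    by rewrite iu.
  rewrite sumr_const -[LHS]mulr_natl mulrA -natrM; congr (_%:R * _); congr (_ * _)%N.
  rewrite (_ : #|_| = #|predC (mem (idx u ++ U))|); last by apply: eq_card.
  rewrite -subnDA addnC -szu -(card_uniqP uu) -[X in (X - _)%N](card_ord n).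
  by rewrite -(cardC (mem (idx u ++ U))) addKn.
have -> : \sum_(i <- idx u) F i = \sum_(k < size u)
   ((n - size U - size u) ^_ (((size rx).+1 - size u)./2))%:R *
   ((q ^+ k)%:C * g h (nth h (let_ u) k) * fm rx (remk k (let_ u))).
  case: u uu ui szu @F => [|[j0 l0] u0] uu ui szu F.
    by rewrite big_nil big_ord0.
  set u := _ :: u0 in uu ui szu F *.
  rewrite big_map (big_nth (j0, l0)) big_mkord; apply: eq_bigr => k _.
  have ks := ltn_ord k; set i := (nth _ u k).1.
  have us := split_remk (j0, l0) ks; rewrite -/i in us.
  have iE : nth (j0, l0) u k = (i, nth h (let_ u) k).
    by rewrite /i (nth_map (j0, l0))// -surjective_pairing.
  rewrite iE in us.
  have pu : perm_eq (idx u) (i :: idx (remk k u)).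
    by rewrite {1}us !map_cat /= perm_catC /= perm_cons perm_catC.
  have pu' : perm_eq (idx u ++ U) (idx (remk k u) ++ i :: U).
    apply: (@perm_trans _ ((i :: idx (remk k u)) ++ U)); first by rewrite perm_cat2r.
    by rewrite -[in X in perm_eq _ X](cat1s i) perm_sym perm_catCA.
  have uu' : uniq (idx (remk k u) ++ i :: U) by rewrite -(perm_uniq pu').
  have nr : i \notin idx (remk k u) by move: ui; rewrite (perm_uniq pu) /= => /andP[].
  transitivity ((q ^+ k)%:C * g h (nth h (let_ u) k) * gsum rx (remk k u) (i :: U)).
    rewrite /gsum -isumZ; apply: eq_isum => f sf.
    have -> : good (f ++ i :: idx u ++ U ++ U) =
        good (f ++ idx (remk k u) ++ (i :: U) ++ i :: U).
      apply: perm_good; rewrite perm_cat2l.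
      apply: (@perm_trans _ (i :: (idx (remk k u) ++ i :: U) ++ U)).
        by rewrite perm_cons catA perm_cat2r.
      by rewrite -(cat1s i (_ ++ U)) -catA perm_catCA perm_cat2l perm_catCA.
    case: ifP => [gd|_]; last by rewrite mulr0.
    have inf : i \notin f.
      apply/negP => fi; have c0 : (0 < count_mem i f)%N by rewrite -has_count has_pred1.
      have /forallP/(_ i) := gd; rewrite !count_cat /= eqxx; apply/negP; rewrite -ltnNge.
      exact: count_gt2.
    have nx : i \notin idx (zip f (rev rx)).
      by rewrite -/unzip1 unzip1_zip// size_rev sf.
    have -> : (q ^+ k)%:C = (q ^+ size (take k u))%:C by rewrite size_take ks.
    by rewrite {1}us ev_close//= -/(remk k u) nr; move: uu'; rewrite cat_uniq => /and3P[].
  rewrite IH// map_remk size_remk//= mulrCA; congr (_ %:R * _).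
  congr (_ ^_ _)%N; lia.
rewrite addrC fm_cons mulrDr; congr (_ + _).
  have [lt|le] := ltnP (size rx) (size u).+1.
    have z : fm rx (h :: let_ u) = 0 by rewrite fm_eq0//= size_map lt.
    by rewrite z !mulr0.
  rewrite -ffactnS; congr ((_ ^_ _)%:R * _).
  by rewrite [size (h :: rx)]/=; lia.
by rewrite size_map mulr_sumr.
Qed.

Lemma size_sum_count (f : seq 'I_n) :
  size f = (\sum_(i <- undup f) count_mem i f)%N.
Proof.
have -> : size f = (\sum_(i < n) count_mem i f)%N.
  elim: f => [|x f IH] /=; first by rewrite big1.
  rewrite big_split /= -IH (bigD1 x)//= eqxx big1 ?addn0 ?add1n// => i ix.
  by rewrite eq_sym (negbTE ix).
rewrite (big_uniq _ (undup_uniq f)) [RHS]big_mkcond; apply: eq_bigr => i _.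
by rewrite mem_undup; case: ifP => // /negbT/count_memPn.
Qed.

(** A site met once kills the expectation, so all sites of f occur at least twice, and one of them
    at least three times. *)
Lemma ev_bad (f : seq 'I_n) (w : seq L) : size f = size w -> ~~ good f ->
  ev (zip f w) != 0 -> (2 * size (undup f) < size w)%N.
Proof.
move=> sf bad nz.
have c2 i : i \in undup f -> (2 <= count_mem i f)%N.
  rewrite mem_undup => fi; rewrite leqNgt; apply/negP => c1.
  have [f1 [f2 fE]] : exists f1 f2, f = f1 ++ i :: f2.
    by case/splitPr: fi => f1 f2; exists f1, f2.
  move: c1; rewrite fE count_cat /= eqxx => /count_lt2[k1 k2].
  have n1 : i \notin f1 by apply/count_memPn.
  have n2 : i \notin f2 by apply/count_memPn.
  (* Some letter of w, as a default value for [nth]. *)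
  have [l l0] : exists l : L, l = l by case: (w) sf; rewrite fE ?size_cat ?addnS// => l; exists l.
  move: nz; suff -> : ev (zip f w) = 0 by rewrite eqxx.
  have sw : (size f1 < size w)%N by rewrite -sf fE size_cat /= addnS ltnS leq_addr.
  rewrite (split_remk l sw) fE zip_cat ?size_takel ?(ltnW sw)//=.
  apply: ev_single; rewrite -/unzip1 unzip1_zip// ?size_takel ?(ltnW sw)//.
  rewrite size_drop -sf fE size_cat /=; lia.
rewrite -sf; have [i ci] : exists i, (2 < count_mem i f)%N.
  by move/forallPn: bad => [i hi]; exists i; rewrite ltnNge.
have fi : i \in undup f by rewrite mem_undup -has_pred1 has_count (leq_trans _ ci).
rewrite size_sum_count (bigD1_seq i) ?undup_uniq//=.
have -> : (2 * size (undup f) = 2 + \sum_(j <- undup f | j != i) 2)%N.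
  by rewrite mulnC -sum1_size big_distrl (bigD1_seq i) ?undup_uniq.
rewrite -addSn leq_add//.
rewrite big_seq_cond [X in (_ <= X)%N]big_seq_cond.
by apply: leq_sum => j /andP[jf _]; apply: c2.
Qed.

(** The error comes from words with at most (|w| - 1)/2 sites, a lower power of n than the main
    term. The empty word is set apart: there the general bound would be 1 instead of 0. *)
Lemma ev_sum_near w : (0 < n)%N ->
  cabs (isum (size w) (fun f => ev (zip f w)) -
    (n ^_ (size w)./2)%:R * fm (rev w) [::]) <=
  if w is [::] then 0 else
    B ^+ size w * ((size w)`!%:R * n%:R ^+ (size w).-1./2).
Proof.
move=> n0; have := @gsumE (rev w) [::] [::] isT; rewrite size_rev !subn0 /= => <-.
have -> : isum (size w) (fun f => ev (zip f w)) - gsum (rev w) [::] [::] =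
    isum (size w) (fun f => if good f then 0 else ev (zip f w)).
  apply/eqP; rewrite subr_eq /gsum size_rev -isumD; apply/eqP.
  apply: eq_isum => f _; rewrite revK !cats0.
  by case: ifP; rewrite ?add0r ?addr0.
case: w => [|l w].
  rewrite /= (_ : good [::]) ?cabs0//.
  by apply/forallP.
set W := l :: w; apply: le_trans (cabs_isum _ _) _.
rewrite -[leRHS]/(B ^+ size W * ((size W)`!%:R * n%:R ^+ (size W).-1./2)).
apply: (@le_trans _ _ (isum (size W) (fun f : seq 'I_n =>
    B ^+ size W * (size (undup f) <= (size W).-1./2)%N%:R))).
  apply: isum_le => f sf; have Bn : 0 <= B ^+ size W by rewrite exprn_ge0.
  case: ifP => [_|/negbT bad]; first by rewrite cabs0 mulr_ge0.
  have [->|nz] := eqVneq (ev (zip f W)) 0; first by rewrite cabs0 mulr_ge0.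
  rewrite (_ : (_ <= _)%N = true); last first.
    by have := ev_bad sf bad nz; rewrite /=; lia.
  rewrite mulr1; apply: le_trans (ev_bound _) _.
  by rewrite size1_zip ?sf// lexx.
by rewrite isumZ; apply: ler_wpM2l; [exact: exprn_ge0|exact: isum_few_values].
Qed.

End Counting.

Lemma ffact_le_expn n p : (n ^_ p <= n ^ p)%N.
Proof.
elim: p => [|p IH]; first by rewrite ffactn0.
by rewrite ffactnSr expnSr leq_mul// leq_subr.
Qed.

(** Each of the p factors of the falling factorial loses at most p; multiplying by n keeps the
    relative error p^2 / n in natural numbers. *)
Lemma ffact_near n p : (n ^ p * n <= n ^_ p * n + p ^ 2 * n ^ p)%N.
Proof.
elim: p => [|p IH]; first by rewrite expn0 ffactn0 leq_addr.
have h := ffact_le_expn n p.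
rewrite ffactnSr expnSr.
have h2 : (n <= n - p + p)%N by lia.
have h3 := leq_mul IH (leqnn n).
have h4 := leq_mul (leq_mul (leqnn (n ^_ p)) h2) (leqnn n).
have h5 := leq_mul h (leqnn (p * n)).
move: (n - p)%N h4 => e; move: (n ^_ p) (n ^ p)%N h3 h5 => a A; nia.
Qed.

Lemma ffact_square (R : realType) m k : (0 < m)%N -> ~~ odd k ->
  `|(((m ^ 2) ^_ k./2)%:R - m%:R ^+ k : R)| * m%:R <= k%:R ^+ 2 * m%:R ^+ k.
Proof.
move=> m0 ek; have kE : k = (k./2 * 2)%N by lia.
set p := k./2 in kE *; have n0 : (0 < m ^ 2)%N by rewrite expn_gt0 m0.
have le := ffact_le_expn (m ^ 2) p.
have mk : m%:R ^+ k = ((m ^ 2) ^ p)%:R :> R by rewrite -natrX kE mulnC expnM.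
rewrite mk distrC ger0_norm ?subr_ge0 ?ler_nat// -natrB// -natrX -!natrM ler_nat.
have h := ffact_near (m ^ 2) p.
have h1 : (((m ^ 2) ^ p - (m ^ 2) ^_ p) * m ^ 2 <= p ^ 2 * (m ^ 2) ^ p)%N.
  by rewrite mulnBl leq_subLR.
have mm : (m <= m ^ 2)%N by rewrite expnS expn1 leq_pmulr.
apply: leq_trans (leq_trans h1 _); first by rewrite leq_mul2l mm orbT.
rewrite leq_mul2r; apply/orP; right.
rewrite leq_sqr /p; lia.
Qed.

(** Central limit scaling: m^2 sites and weight 1/m per letter. The bad words and the replacement of
    the falling factorial by a power both cost a factor 1/m. *)
Lemma moment_rate (R : realType) (m k : nat) (I z : R[i]) (B : R) :
  (0 < m)%N -> 0 <= B ->
  (odd k -> z = 0) ->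
  cabs (I - ((m ^ 2) ^_ k./2)%:R * z) <= (if k is 0 then 0 else
     B ^+ k * (k`!%:R * (m ^ 2)%:R ^+ k.-1./2)) ->
  cabs ((m%:R ^- k) * I - z) <= (B ^+ k * k`!%:R + k%:R ^+ 2 * cabs z) * m%:R^-1.
Proof.
move=> m0 B0 hz hI; have mR : 0 < m%:R :> R by rewrite ltr0n.
have mk : 0 < m%:R ^+ k :> R by rewrite exprn_gt0.
have mkC : (m%:R ^+ k : R[i]) = (m%:R ^+ k)%:C by rewrite rmorphXn rmorph_nat.
have mk0 : (m%:R ^+ k : R[i]) != 0 by rewrite expf_neq0// pnatr_eq0 -lt0n.
rewrite ler_pdivlMr// -(ler_pM2r mk) mulrAC.
have -> : cabs (m%:R ^- k * I - z) * m%:R ^+ k = cabs (I - m%:R ^+ k * z).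
  rewrite -[X in _ * X](ger0_norm (ltW mk)) -cabs_real -mkC -cabsM mulrBl.
  by rewrite mulrC mulVKf// (mulrC z).
set D := ((m ^ 2) ^_ k./2)%:R in hI *.
have -> : I - m%:R ^+ k * z = (I - D * z) + (D - m%:R ^+ k) * z by ring.
apply: le_trans (ler_wpM2r (ltW mR) (cabsD _ _)) _; rewrite [leLHS]mulrDl [leRHS]mulrDl.
apply: lerD.
  apply: le_trans (ler_wpM2r (ltW mR) hI) _.
  case: k {hz D hI mk mkC mk0} => [|k]; first by rewrite mul0r !mulr_ge0 ?exprn_ge0 ?ler0n.
  rewrite -!mulrA ler_wpM2l ?exprn_ge0// ler_wpM2l ?ler0n//.
  rewrite -!natrX -natrM ler_nat -expnM -expnSr leq_pexp2l//; lia.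
rewrite cabsM mulrAC; have [ok|ek] := boolP (odd k).
  by rewrite hz// cabs0 !mulr0 mul0r.
have h := @ffact_square R m k m0 ek.
have -> : cabs (D - m%:R ^+ k) = `|(((m ^ 2) ^_ k./2)%:R - m%:R ^+ k : R)|.
  by rewrite /D mkC -(rmorph_nat (real_complex R)) -rmorphB cabs_real.
rewrite (le_trans (ler_wpM2r (cabs_ge0 z) h))//.
by rewrite mulrAC.
Qed.

(** * Tensor products of matrices *)

Section Tensor.
Context {R : realType} (s : nat) (Q : finType).
Local Notation CC := R[i].
Local Notation tix := {ffun Q -> 'I_s}.

Definition tdim := #|{: tix}|.

Definition tens_mx (A : Q -> 'M[CC]_s) : 'M[CC]_tdim :=
  \matrix_(a, b) \prod_x A x ((enum_val a : tix) x) ((enum_val b : tix) x).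

Lemma sum_tix (F : tix -> CC) : \sum_(a < tdim) F (enum_val a) = \sum_f F f.
Proof. by rewrite /tdim -(big_enum_val F). Qed.

Lemma tens_mxM A B : tens_mx A *m tens_mx B = tens_mx (fun x => A x *m B x).
Proof.
apply/matrixP => a b; rewrite !mxE.
under [RHS]eq_bigr => x _ do rewrite mxE.
rewrite bigA_distr_bigA -sum_tix; apply: eq_bigr => c _.
by rewrite !mxE -big_split.
Qed.

Lemma eq_tens_mx A B : (forall x, A x = B x) -> tens_mx A = tens_mx B.
Proof.
by move=> h; apply/matrixP => a b; rewrite !mxE; apply: eq_bigr => x _; rewrite h.
Qed.

Lemma tens_mx1 : tens_mx (fun=> 1%:M) = 1%:M.
Proof.
apply/matrixP => a b; rewrite !mxE; case: (eqVneq a b) => [->|ab].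
  by rewrite big1// => x _; rewrite mxE eqxx.
have /eqP/ffunP nab : (enum_val a : tix) != enum_val b.
  by apply: contra_neq ab; exact: enum_val_inj.
have [x abx] : exists x, (enum_val a : tix) x != (enum_val b : tix) x.
  apply/existsP; rewrite -negb_forall; apply/negP => /forallP h.
  by apply: nab => x; apply/eqP.
by rewrite (bigD1 x)//= mxE (negbTE abx) mul0r.
Qed.

Lemma adjm_tens_mx A : adjm (tens_mx A) = tens_mx (fun x => adjm (A x)).
Proof.
apply/matrixP => a b; rewrite !mxE (big_morph _ (@conjM R) (conjc1 R)).
by apply: eq_bigr => x _; rewrite mxE.
Qed.

Lemma mxtrace_tens A : \tr (tens_mx A) = \prod_x \tr (A x).
Proof.
rewrite /mxtrace bigA_distr_bigA -sum_tix; apply: eq_bigr => a _.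
by rewrite mxE.
Qed.

Lemma tens_mx_scale A B y (c : CC) : A y = c *: B y ->
  (forall x, x != y -> A x = B x) -> tens_mx A = c *: tens_mx B.
Proof.
move=> hy h; apply/matrixP => a b; rewrite !mxE (bigD1 y)//= hy mxE -mulrA.
by rewrite [in RHS](bigD1 y)//=; congr (_ * (_ * _)); apply: eq_bigr => x /h ->.
Qed.

End Tensor.

(** * Operator bounds and states on matrices *)

Section MatrixBound.
Context {R : realType}.
Local Notation CC := R[i].

Definition mxb s (M : 'M[CC]_s) (K : R) := forall u, csq (M *m u) <= K ^+ 2 * csq u.

Lemma mxb1 s : mxb (1%:M : 'M[CC]_s) 1.
Proof. by move=> u; rewrite mul1mx expr1n mul1r. Qed.

Lemma mxbM s (M N : 'M[CC]_s) K K' : mxb M K -> mxb N K' -> mxb (M *m N) (K * K').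
Proof.
move=> hM hN u; rewrite -mulmxA; apply: le_trans (hM _) _.
rewrite exprMn -[leRHS]mulrA; apply: ler_wpM2l; [exact: sqr_ge0|exact: hN].
Qed.

Lemma mxb_unitary s (M : 'M[CC]_s) : adjm M *m M = 1%:M -> mxb M 1.
Proof.
move=> h u; rewrite expr1n mul1r le_eqVlt; apply/orP; left; apply/eqP.
by apply: realC_inj; rewrite -!csqE adjmM mulmxA -(mulmxA (adjm u)) h mulmx1.
Qed.

Lemma csq_col_sum s (X : 'M[CC]_s) : hs X X = (\sum_a csq (col a X))%:C.
Proof.
transitivity (\sum_a (csq (col a X))%:C); last by rewrite rmorph_sum.
rewrite hsE; apply: eq_bigr => a _; rewrite -csqE mxE.
by apply: eq_bigr => i _; rewrite !mxE.
Qed.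

Lemma state_bound s (E M : 'M[CC]_s) K : 0 <= K -> adjm E = E -> \tr (E *m E) = 1 ->
  mxb M K -> cabs (\tr (E *m M *m E)) <= K.
Proof.
(* A constant sequence of dimensions, so that the Hilbert-Schmidt lemmas apply to a single
   matrix. *)
move=> K0 sE tE hM; pose d (_ : nat) := s.
have h1 : hn (d := d) (n := 0) E = 1.
  apply/eqP; rewrite -(@eqrXn2 _ 2) ?hn_ge0// expr1n; apply/eqP.
  by apply: realC_inj; rewrite -hn_sq /hs sE.
have -> : \tr (E *m M *m E) = hs E (M *m E) by rewrite /hs sE mulmxA.
apply: le_trans (hs_CS (d := d) (n := 0) E (M *m E)) _; rewrite h1 mul1r.
rewrite -(@ler_pXn2r _ 2) ?nnegrE ?hn_ge0//.
have -> : K ^+ 2 = K ^+ 2 * hn (d := d) (n := 0) E ^+ 2 by rewrite h1 expr1n mulr1.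
have sqE (X : 'M[CC]_s) : hn (d := d) (n := 0) X ^+ 2 = \sum_a csq (col a X).
  by apply: realC_inj; rewrite -csq_col_sum -hn_sq.
rewrite !sqE mulr_sumr; apply: ler_sum => a _; rewrite !colE -mulmxA.
exact: hM.
Qed.

End MatrixBound.

(** * Site variables with commutation signs of mean q *)

Section Model.
Context {R : realType} {L : countType}.
Local Notation CC := R[i].
Variables (s : nat) (q : R) (g : L -> L -> CC) (bar : L -> L) (c : L -> R).
Variables (Es p r : 'M[CC]_s.+1) (x : L -> 'M[CC]_s.+1) (B : R).
Hypotheses (B0 : 0 <= B) (xB : forall l, mxb (x l) B)
  (Esa : adjm Es = Es) (Es1 : \tr (Es *m Es) = 1)
  (xadj : forall l, adjm (x l) = x (bar l))
  (Esx : forall l, Es *m x l = (c l)%:C *: (x l *m Es))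
  (x1 : forall l, \tr (Es *m x l *m Es) = 0)
  (x2 : forall l l', \tr (Es *m (x l *m x l') *m Es) = g l l')
  (pa : adjm p = p) (ra : adjm r = r) (pp : p *m p = 1%:M) (rr : r *m r = 1%:M)
  (tp : \tr p = 0) (tr0 : \tr r = 0)
  (tpr : \tr (p *m r *m p *m r) = (q * s.+1%:R)%:C).

Section Sites.
Variable n : nat.
Local Notation Q := ('I_n * 'I_n)%type.

(* Site a is the tensor factor (a, a). For a < b the factor (a, b) carries the
   commutation sign of the sites a and b: p for a and r for b. *)
Definition factor (y : Q) (i : 'I_n) (l : L) : 'M[CC]_s.+1 :=
  if y.1 == y.2 then if i == y.1 then x l else 1%:M
  else if (y.1 < y.2)%N then
    if i == y.1 then p else if i == y.2 then r else 1%:M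
  else 1%:M.

Definition Ea : 'M[CC]_s.+1 := (Num.sqrt s.+1%:R^-1)%:C%:M.

Definition factor_state (y : Q) := if y.1 == y.2 then Es else Ea.

Definition site_mx i l := tens_mx (fun y => factor y i l).
Definition state_mx := tens_mx factor_state.

Definition fprod (y : Q) (w : seq ('I_n * L)) : 'M[CC]_s.+1 :=
  foldr (fun a X => factor y a.1 a.2 *m X) 1%:M w.

Definition site_prod (w : seq ('I_n * L)) :=
  foldr (fun a X => site_mx a.1 a.2 *m X) 1%:M w.

Definition fval (y : Q) (w : seq ('I_n * L)) : CC :=
  \tr (factor_state y *m fprod y w *m factor_state y).

Definition ev (w : seq ('I_n * L)) : CC := \prod_y fval y w.

Lemma eq_fval y w w' : fprod y w = fprod y w' -> fval y w = fval y w'.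
Proof. by rewrite /fval => ->. Qed.

Lemma site_prodE w : site_prod w = tens_mx (fun y => fprod y w).
Proof.
elim: w => [|a w IH] /=; first by rewrite -tens_mx1.
by rewrite IH tens_mxM.
Qed.

Lemma trace_site_prod w : \tr (state_mx *m site_prod w *m state_mx) = ev w.
Proof. by rewrite site_prodE !tens_mxM mxtrace_tens. Qed.

Lemma fprod_cat y w w' : fprod y (w ++ w') = fprod y w *m fprod y w'.
Proof. by elim: w => [|a w IH] /=; rewrite ?mul1mx// IH mulmxA. Qed.

Lemma fprod1 y w : (forall i l, i \in map fst w -> factor y i l = 1%:M) ->
  fprod y w = 1%:M.
Proof.
elim: w => [//|a w IH] h /=; rewrite h ?inE ?eqxx// mul1mx IH// => i l iw.
by apply: h; rewrite inE iw orbT.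
Qed.

Lemma factor_site i j l : factor (i, i) j l = if j == i then x l else 1%:M.
Proof. by rewrite /factor /= eqxx. Qed.

Lemma fprod_site i w : i \notin map fst w -> fprod (i, i) w = 1%:M.
Proof.
move=> iw; apply: fprod1 => j l jw; rewrite factor_site; case: eqP => // ji.
by move: iw; rewrite -ji jw.
Qed.

(** Outside its own tensor factor, a site acts by a symmetry that does not depend on the letter; two
    adjacent letters of the same site therefore interact in the factor (i, i) only. *)
Lemma factor_sq y i l l' : y != (i, i) -> factor y i l *m factor y i l' = 1%:M.
Proof.
case: y => a b; rewrite /factor /= xpair_eqE.
case: (eqVneq a b) => [->|ab].
  by rewrite andbb eq_sym => /negbTE ->; rewrite mul1mx.
by move=> _; case: ifP => _; [case: ifP => _ //; case: ifP => _ //|];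
  rewrite mul1mx.
Qed.

Lemma ev_nil : ev [::] = 1.
Proof.
rewrite /ev big1// => y _; rewrite /fval /factor_state /= mulmx1; case: ifP => _//.
rewrite -scalar_mxM mxtrace_scalar -rmorphM -expr2 sqr_sqrtr ?invr_ge0//.
by rewrite -(rmorphMn (real_complex R)) -[_ *+ _]mulr_natr mulVf ?pnatr_eq0.
Qed.

Lemma ev_single w i l w' : i \notin map fst w -> i \notin map fst w' ->
  ev (w ++ (i, l) :: w') = 0.
Proof.
move=> iw iw'; rewrite /ev (bigD1 (i, i) isT) /=; suff -> : fval (i, i) (w ++ (i, l) :: w') = 0.
  by rewrite mul0r.
rewrite /fval fprod_cat /= factor_site eqxx (fprod_site iw) (fprod_site iw').
by rewrite mul1mx mulmx1 /factor_state eqxx x1.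
Qed.

Lemma fval_pair w i l l' u : i \notin map fst w -> i \notin map fst u ->
  fval (i, i) (w ++ (i, l) :: (i, l') :: u) = g l l' * fval (i, i) (w ++ u).
Proof.
move=> iw iu; rewrite /fval !fprod_cat /= !factor_site eqxx.
rewrite (fprod_site iw) (fprod_site iu) !mul1mx !mulmx1.
by rewrite /factor_state eqxx x2 Es1 mulr1.
Qed.

Lemma ev_pair w i l l' u : i \notin map fst w -> i \notin map fst u ->
  ev (w ++ (i, l) :: (i, l') :: u) = g l l' * ev (w ++ u).
Proof.
move=> iw iu; rewrite /ev (bigD1 (i, i) isT) [in RHS](bigD1 (i, i) isT) /= mulrA.
rewrite (fval_pair l l' iw iu); congr (_ * _); apply: eq_bigr => y yi.
apply: eq_fval; rewrite !fprod_cat /=; congr (_ *m _).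
by rewrite mulmxA (factor_sq l l' yi) mul1mx.
Qed.

Definition link (i b : 'I_n) : Q := if (i < b)%N then (i, b) else (b, i).

Lemma factor_link i b : i != b -> exists P T : 'M[CC]_s.+1,
  [/\ (P, T) = (p, r) \/ (P, T) = (r, p), forall l, factor (link i b) i l = P,
      forall l, factor (link i b) b l = T &
      forall j l, j != i -> j != b -> factor (link i b) j l = 1%:M].
Proof.
move=> ib; rewrite /link; case: (ltnP i b) => [lt|ge].
  exists p, r; split; first by left.
  - by move=> l; rewrite /factor /= (negbTE ib) lt eqxx.
  - by move=> l; rewrite /factor /= (negbTE ib) lt eq_sym (negbTE ib) eqxx.
  - by move=> j l /negbTE ji /negbTE jb; rewrite /factor /= (negbTE ib) lt ji jb.
have lt : (b < i)%N by rewrite ltn_neqAle ge andbT eq_sym.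
have bi : (b == i) = false by rewrite eq_sym (negbTE ib).
exists r, p; split; first by right.
- by move=> l; rewrite /factor /= bi lt (negbTE ib) eqxx.
- by move=> l; rewrite /factor /= bi lt eqxx.
- by move=> j l /negbTE ji /negbTE jb; rewrite /factor /= bi lt ji jb.
Qed.

Lemma factor_comm y i b l l' : i != b -> y != link i b ->
  factor y b l *m factor y i l' = factor y i l' *m factor y b l.
Proof.
move=> ib yl; suff [->|->] : factor y b l = 1%:M \/ factor y i l' = 1%:M.
- by rewrite mul1mx mulmx1.
- by rewrite mul1mx mulmx1.
case: y yl => a a'; rewrite /factor /link /=.
case: (eqVneq a a') => [_|aa].
  by move=> _; case: (eqVneq b a) => [<-|]; [right; rewrite (negbTE ib)|left].
case: (ltnP a a') => [lt|_]; last by left.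
move=> h; case: (eqVneq b a) => [ba|nba].
  right; rewrite -ba (negbTE ib); case: (eqVneq i a') => [ia|//].
  by subst a a'; move: h; rewrite ltnNge (ltnW lt) eqxx.
case: (eqVneq b a') => [ba|]; last by left.
right; case: (eqVneq i a) => [ia|_]; first by subst a a'; move: h; rewrite lt eqxx.
by rewrite -ba (negbTE ib).
Qed.

Lemma trace_Ea (X : 'M[CC]_s.+1) : \tr (Ea *m X *m Ea) = (s.+1%:R^-1)%:C * \tr X.
Proof.
rewrite /Ea mul_scalar_mx mul_mx_scalar !mxtraceZ mulrA -rmorphM -expr2.
by rewrite sqr_sqrtr ?invr_ge0.
Qed.

(** For X = T the two traces are tr(p r p r) and the dimension, with quotient q; for X = 1 both
    sides vanish because p and r have trace 0. *)
Lemma trace_swap P T (X : 'M[CC]_s.+1) :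
  (P, T) = (p, r) \/ (P, T) = (r, p) -> X = 1%:M \/ X = T ->
  \tr (X *m (P *m (T *m P))) = q%:C * \tr (X *m (P *m (P *m T))).
Proof.
move=> hPT; have [PP TT tT tPT] : [/\ P *m P = 1%:M, T *m T = 1%:M, \tr T = 0 &
    \tr (T *m (P *m (T *m P))) = (q * s.+1%:R)%:C].
  case: hPT => -[-> ->]; split=> //; last by rewrite !mulmxA.
  by rewrite mxtrace_mulC !mulmxA.
rewrite (mulmxA P P) PP mul1mx; case=> ->.
  by rewrite !mul1mx mxtrace_mulC -mulmxA PP mulmx1 tT mulr0.
by rewrite tPT TT mxtrace1 rmorphM rmorph_nat.
Qed.

Lemma fprod_link i b w P T : i != b -> i \notin map fst w ->
  (P, T) = (p, r) \/ (P, T) = (r, p) ->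
  (forall l, factor (link i b) b l = T) ->
  (forall j l, j != i -> j != b -> factor (link i b) j l = 1%:M) ->
  fprod (link i b) w = 1%:M \/ fprod (link i b) w = T.
Proof.
move=> ib iw hPT hT h1; have TT : T *m T = 1%:M by case: hPT => -[_ ->].
elim: w iw => [|[j l] w IH] /=; first by left.
rewrite inE negb_or => /andP[ji /IH{}IH].
case: (eqVneq j b) => [->|jb]; rewrite ?hT.
  by case: IH => ->; [right; rewrite mulmx1|left].
by rewrite h1 ?mul1mx// eq_sym.
Qed.

(** The sites i and b commute in every factor except [link i b]. There the letters of i contribute P
    twice, u and v contribute 1, and the prefix w, which may contain b but not i, contributes 1 or
    T. *)
Lemma ev_swap w i l u b l' l'' v : i != b -> i \notin map fst w ->
  i \notin map fst u -> b \notin map fst u ->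
  i \notin map fst v -> b \notin map fst v ->
  ev (w ++ (i, l) :: u ++ (b, l') :: (i, l'') :: v) =
  q%:C * ev (w ++ (i, l) :: u ++ (i, l'') :: (b, l') :: v).
Proof.
move=> ib iw iu bu iv bv; have [P [T [hPT hP hT h1]]] := factor_link ib.
have lE : factor_state (link i b) = Ea.
  by rewrite /factor_state /link; case: ltnP => _ /=; rewrite ?(negbTE ib)// eq_sym (negbTE ib).
have one z : i \notin map fst z -> b \notin map fst z -> fprod (link i b) z = 1%:M.
  move=> iz bz; apply: fprod1 => j k jz; apply: h1.
    by apply: contraNneq iz => <-.
  by apply: contraNneq bz => <-.
rewrite /ev (bigD1 (link i b) isT) [in RHS](bigD1 (link i b) isT) /= mulrA.
congr (_ * _).
  rewrite /fval lE !trace_Ea mulrCA; congr (_ * _).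
  rewrite !fprod_cat /= !fprod_cat /= !hP !hT (one u iu bu) (one v iv bv).
  rewrite !mul1mx !mulmx1.
  exact: trace_swap hPT (fprod_link ib iw hPT hT h1).
apply: eq_bigr => y yl; apply: eq_fval; rewrite !fprod_cat /= !fprod_cat /=.
congr (_ *m (_ *m (_ *m _))).
by rewrite !mulmxA (factor_comm _ _ ib yl).
Qed.

Lemma ev_close w i l u l' v : i \notin map fst w ->
  uniq (i :: map fst (u ++ v)) ->
  ev (w ++ (i, l) :: u ++ (i, l') :: v) =
  (q ^+ size u)%:C * g l l' * ev (w ++ u ++ v).
Proof.
move=> iw; elim/last_ind: u v => [|u [b k] IH] v /=.
  by move=> /andP[iv _]; rewrite ev_pair// expr0 mul1r.
rewrite !cat_rcons /= => /andP[ib uu].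
have pu : perm_eq (map fst (u ++ (b, k) :: v)) (b :: map fst (u ++ v)).
  by rewrite !map_cat /= perm_catC /= perm_cons perm_catC.
move: (ib) (uu); rewrite (perm_mem pu) (perm_uniq pu) /= inE negb_or => /andP[nib iuv].
rewrite map_cat !mem_cat !negb_or in iuv * => /andP[/andP[bu bv] _].
case/andP: iuv => iu iv.
rewrite (ev_swap _ _ _ nib iw iu bu iv bv) IH; last by rewrite /= ib.
by rewrite size_rcons exprS rmorphM !mulrA.
Qed.

Lemma adj_factor_state y : adjm (factor_state y) = factor_state y.
Proof.
rewrite /factor_state; case: ifP => // _; rewrite /Ea; apply/matrixP => a b.
by rewrite !mxE eq_sym; case: eqP => _; rewrite ?mulr1n ?realC_real// mulr0n conjc0.
Qed.

Lemma adj_site_mx i l : adjm (site_mx i l) = site_mx i (bar l).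
Proof.
rewrite /site_mx adjm_tens_mx; apply: eq_tens_mx => y; rewrite /factor.
by do !case: ifP => _; rewrite ?adjm1 ?xadj ?pa ?ra.
Qed.

Lemma state_site i l : state_mx *m site_mx i l = (c l)%:C *: (site_mx i l *m state_mx).
Proof.
rewrite /state_mx /site_mx !tens_mxM; apply: (@tens_mx_scale _ _ _ _ _ (i, i)).
  by rewrite factor_site eqxx /factor_state eqxx Esx.
move=> [a b]; rewrite /factor_state /factor /= xpair_eqE.
case: (eqVneq a b) => [->|ab _]; last by rewrite /Ea mul_scalar_mx mul_mx_scalar.
by rewrite andbb eq_sym => /negbTE ->; rewrite mul1mx mulmx1.
Qed.

Lemma site_prod_rcons w i l : site_prod (rcons w (i, l)) = site_prod w *m site_mx i l.
Proof. by elim: w => [|a w IH] /=; rewrite ?mul1mx ?mulmx1// IH mulmxA. Qed.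

(** Each letter has norm at most B in its own factor (i, i) and is unitary in all the others. *)
Lemma ev_bound w : cabs (ev w) <= B ^+ size w.
Proof.
pose be (y : Q) (i : 'I_n) : R := if y == (i, i) then B else 1.
have be0 y i : 0 <= be y i by rewrite /be; case: ifP.
have fb y i l : mxb (factor y i l) (be y i).
  case: y => a b; rewrite /factor /be /= xpair_eqE; case: (eqVneq a b) => [->|ab].
    by rewrite andbb eq_sym; case: ifP => _; [exact: xB|exact: mxb1].
  have -> : (a == i) && (b == i) = false.
    by apply/negP => /andP[/eqP ai /eqP bi]; move: ab; rewrite ai bi eqxx.
  by do !case: ifP => _; first [exact: mxb1|apply: mxb_unitary; rewrite ?pa ?ra].
have fw y : mxb (fprod y w) (\prod_(a <- w) be y a.1).
  elim: w => [|a w IH]; first by rewrite big_nil; exact: mxb1.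
  by rewrite big_cons /=; apply: mxbM.
have -> : B ^+ size w = \prod_y \prod_(a <- w) be y a.1.
  rewrite exchange_big /=; elim: w {fw} => [|a w IH]; first by rewrite big_nil.
  rewrite big_cons -IH exprS; congr (_ * _).
  rewrite (bigD1 (a.1, a.1))//= /be eqxx big1 ?mulr1// => y /negbTE ya.
  by rewrite ya.
rewrite /ev (big_morph _ cabsM (cabs_real 1)) normr1.
apply: ler_prod => y _; rewrite cabs_ge0 /=; apply: state_bound.
- exact: prodr_ge0.
- exact: adj_factor_state.
- rewrite /factor_state; case: ifP => // _; rewrite -[X in X *m _](mulmx1 Ea) trace_Ea.
  rewrite mxtrace1 -(rmorph_nat (real_complex R)) -rmorphM mulVf ?pnatr_eq0//.
- exact: fw.
Qed.

End Sites.

Definition model_dim N := tdim s.+1 ('I_(N.+1 ^ 2) * 'I_(N.+1 ^ 2))%type.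

Definition model_W N l : 'M[CC]_(model_dim N) :=
  N.+1%:R^-1 *: \sum_(i < N.+1 ^ 2) site_mx i l.

Definition model_E N : 'M[CC]_(model_dim N) := state_mx (N.+1 ^ 2).

Lemma adj_model_W N l : adjm (model_W N l) = model_W N (bar l).
Proof.
rewrite /model_W adjmZ fmorphV rmorph_nat (big_morph _ (@adjmD _ _ _) (@adjm0 _ _ _)).
by congr (_ *: _); apply: eq_bigr => i _; rewrite adj_site_mx.
Qed.

Lemma adj_model_E N : adjm (model_E N) = model_E N.
Proof.
rewrite /model_E /state_mx adjm_tens_mx; apply: eq_tens_mx => y.
exact: adj_factor_state.
Qed.

Lemma model_EW N l : model_E N *m model_W N l =
  (c l)%:C *: (model_W N l *m model_E N).
Proof.
rewrite /model_W -scalemxAr mulmx_sumr -scalemxAl scalerA mulrC -scalerA.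
congr (_ *: _); rewrite mulmx_suml scaler_sumr; apply: eq_bigr => i _.
exact: state_site.
Qed.

Lemma model_Ww N w : Ww model_W N w = (N.+1%:R ^- size w) *:
  isum (size w) (fun f : seq 'I_(N.+1 ^ 2) => site_prod (zip f w)).
Proof.
elim/last_ind: w => [|w l IH]; first by rewrite /= expr0 invr1 scale1r.
rewrite -cats1 Ww_cat /= mulmx1 cats1 IH size_rcons /model_W -scalemxAl -scalemxAr.
rewrite scalerA -invfM -exprSr; congr (_ *: _).
set S := \sum_i _.
have := @isum_morph _ _ (fun X : 'M[CC]_(model_dim N) => X *m S) (N.+1 ^ 2) (size w)
  (fun f => site_prod (zip f w)) (fun X Y => mulmxDl X Y S) (mul0mx _ S).
move=> ->; apply: eq_isum => f sf; rewrite mulmx_sumr; apply: eq_bigr => i _.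
by rewrite zip_rcons// site_prod_rcons.
Qed.

Lemma model_moments w : ucv natU
  (fun N => \tr (model_E N *m Ww model_W N w *m model_E N)) (fm q g (rev w) [::]).
Proof.
set z := fm q g (rev w) [::].
pose C : R := B ^+ size w * (size w)`!%:R + (size w)%:R ^+ 2 * cabs z.
have C0 : 0 <= C by rewrite addr_ge0 ?mulr_ge0 ?exprn_ge0 ?ler0n ?cabs_ge0.
have C1 : 0 < C + 1 by rewrite ltr_wpDl.
move=> e e0; have [N0 hN0] := invn_small (divr_gt0 e0 C1).
apply: (ufilter (natU_ge N0)) => N /hN0 hN.
have -> : \tr (model_E N *m Ww model_W N w *m model_E N) = (N.+1%:R ^- size w) *
    isum (size w) (fun f : seq 'I_(N.+1 ^ 2) => ev (zip f w)).
  rewrite model_Ww -scalemxAr -scalemxAl mxtraceZ; congr (_ * _).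
  pose phi (X : 'M[CC]_(model_dim N)) := \tr (model_E N *m X *m model_E N).
  have phiD : {morph phi : X Y / X + Y}.
    by move=> X Y; rewrite /phi mulmxDr mulmxDl mxtraceD.
  have phi0 : phi 0 = 0 by rewrite /phi mulmx0 mul0mx mxtrace0.
  rewrite -[LHS]/(phi _) (isum_morph _ _ phiD phi0); apply: eq_isum => f _.
  exact: trace_site_prod.
have n0 : (0 < N.+1 ^ 2)%N by rewrite expn_gt0.
have near := ev_sum_near (@ev_nil (N.+1 ^ 2)) (@ev_single (N.+1 ^ 2))
  (@ev_close (N.+1 ^ 2)) B0 (@ev_bound (N.+1 ^ 2)) w n0.
apply: le_trans (moment_rate (ltn0Sn N) B0 _ _) _.
- by move=> ow; rewrite /z fm_eq0// size_rev addn0 ow orbT.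
- by apply: le_trans near _; case: (w).
apply: (@le_trans _ _ ((C + 1) * (e / (C + 1)))); last first.
  by rewrite mulrC divfK// gt_eqF.
by rewrite ler_pM ?invr_ge0 ?ler0n// lerDl.
Qed.

End Model.

Lemma nth_remk T (x0 : T) k s i : (k < size s)%N ->
  nth x0 (remk k s) i = nth x0 s (bump k i).
Proof.
move=> ks; rewrite nth_cat size_take ks /bump; case: ltnP => ki.
  by rewrite nth_take.
rewrite nth_drop; congr (nth x0 s _); lia.
Qed.

(** * The q-Fock space *)

Section PermutationSplit.

Lemma ltn_bump h i j : (bump h i < bump h j)%N = (i < j)%N.
Proof. by rewrite ltnNge leq_bump2 -ltnNge. Qed.

Lemma inversionsE n (p : 'S_n) :
  inversions p = (\sum_(a < n) \sum_(b < n) ((a < b) && (p b < p a)))%N.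
Proof.
rewrite /inversions -sum1_card big_mkcond pair_bigA; apply: eq_bigr => -[a b] _ /=.
by rewrite -[_ \in _]/`[< _ >] asboolb; case: ifP.
Qed.

Lemma count_ord_lt n k : (k <= n)%N -> (\sum_(b < n) (b < k) = k)%N.
Proof.
move=> kn; transitivity (\sum_(b < n | (b < k)%N) 1)%N.
  by rewrite [RHS]big_mkcond; apply: eq_bigr => b _; case: ltnP.
by rewrite (big_ord_narrow kn) sum1_card card_ord.
Qed.

(** The inversions that involve 0 are counted by the k values below its image k. *)
Lemma inversions_lift n (k : 'I_n.+1) (p : 'S_n) :
  inversions (lift_perm ord0 k p) = (k + inversions p)%N.
Proof.
rewrite !inversionsE big_ord_recl; congr (_ + _)%N.
  have kn : (k <= n)%N by rewrite -ltnS.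
  rewrite big_ord_recl /= add0n -[RHS](count_ord_lt kn).
  rewrite [RHS](reindex_inj (@perm_inj _ p)); apply: eq_bigr => b _.
  rewrite lift_perm_lift lift_perm_id /= /bump; congr nat_of_bool.
  by case: leqP => h; apply/idP/idP => h'; lia.
apply: eq_bigr => a _; rewrite big_ord_recl /= add0n; apply: eq_bigr => b _.
by rewrite !lift_perm_lift /= !ltn_bump.
Qed.

Lemma sum_perm_split (V : nmodType) n (f : 'S_n.+1 -> V) :
  \sum_p f p = \sum_(k < n.+1) \sum_(p : 'S_n) f (lift_perm ord0 k p).
Proof.
pose h (kp : 'I_n.+1 * 'S_n) := lift_perm ord0 kp.1 kp.2.
have hi : injective h.
  move=> [k p] [k' p'] e; have kk : k = k'.
    by have := congr1 (fun s : {perm 'I_n.+1} => s (@ord0 n)) e; rewrite /h /= !lift_perm_id.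
  congr pair => //; apply/permP => i.
  have := congr1 (fun s : {perm 'I_n.+1} => s (fintype.lift (@ord0 n) i)) e.
  by rewrite /h /= kk !lift_perm_lift => /lift_inj.
have hb : bijective h.
  apply: inj_card_bij hi _; rewrite card_prod card_ord.
  by rewrite !card_Sn factS.
by rewrite (reindex h) ?pair_bigA//; apply: onW_bij.
Qed.

End PermutationSplit.

(** * Creation, annihilation and vacuum moments *)

Section Fock.
Context {R : realType} {H F : hilbertType R} {q : R} {tens : seq H -> F}.
Hypothesis hF : is_qFock q tens.
Hypotheses (q1 : -1 < q) (q2 : q < 1).
Local Notation CC := R[i].

Lemma qFock_nth n h g : size h = n -> size g = n -> hip (tens h) (tens g) =
  \sum_(p : 'S_n) (q ^+ inversions p)%:C * \prod_(i < n) hip (nth 0 h i) (nth 0 g (p i)).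
Proof.
move=> /eqP sh /eqP sg; have := qFock_ip hF (Tuple sh) (Tuple sg) => /= ->.
apply: eq_bigr => p _; congr (_ * _); apply: eq_bigr => i _.
by rewrite !(tnth_nth 0).
Qed.

Definition ann (f : H) (t : seq H) : F :=
  \sum_(k < size t) ((q ^+ k)%:C * hip f (nth 0 t k)) *: tens (remk k t).

Lemma tens_cons_ip f h g : hip (tens (f :: h)) (tens g) = hip (tens h) (ann f g).
Proof.
rewrite hip_sumr; have [sg|sg] := eqVneq (size g) (size h).+1; last first.
  rewrite (qFock_ip0 hF); last by rewrite eq_sym.
  rewrite big1// => k _; rewrite hipZr (qFock_ip0 hF) ?mulr0// size_remk//.
  have kg := ltn_ord k; apply/negP => /eqP e; move: sg; rewrite e prednK ?eqxx//.
  exact: leq_ltn_trans (leq0n _) kg.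
rewrite (@qFock_nth (size h).+1)// sum_perm_split.
pose T k := hip (tens h) (((q ^+ k)%:C * hip f (nth 0 g k)) *: tens (remk k g)).
transitivity (\sum_(0 <= k < size g) T k); last by rewrite big_mkord.
rewrite sg big_mkord; apply: eq_bigr => k _; rewrite /T.
have kg : (k < size g)%N by rewrite sg.
rewrite hipZr (@qFock_nth (size h))//; last by rewrite size_remk// sg.
rewrite mulr_sumr; apply: eq_bigr => p _; rewrite inversions_lift exprD rmorphM.
rewrite big_ord_recl lift_perm_id /= mulrACA; congr (_ * (_ * _)).
by apply: eq_bigr => i _; rewrite lift_perm_lift nth_remk.
Qed.

Lemma ann_ip f g h : hip (ann f g) (tens h) = hip (tens g) (tens (f :: h)).
Proof. by rewrite hip_conj -tens_cons_ip -hip_conj. Qed.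

(** The q-commutation relation a(f) a^*(f) = |f|^2 + q a^*(f) a(f), in weak form: the term k = 0 of
    [ann] splits off. *)
Lemma tens_cons_cons_ip f s t : hip (tens (f :: s)) (tens (f :: t)) =
  hip f f * hip (tens s) (tens t) + q%:C * hip (ann f s) (ann f t).
Proof.
rewrite tens_cons_ip {1}/ann /= big_ord_recl hipDr hipZr expr0 mul1r /remk /= drop0.
congr (_ + _); rewrite {2}/ann !hip_sumr mulr_sumr; apply: eq_bigr => k _.
by rewrite !hipZr ann_ip /= exprS rmorphM !mulrA.
Qed.

Let cr f p := lc (fun s => tens (f :: s)) p.
Let an f p := lc (ann f) p.

Let cr_an f p p' : hip (cr f p) (lc tens p') = hip (lc tens p) (an f p').
Proof.
rewrite /cr /an /lc !hip_suml; apply: eq_bigr => a _; rewrite !hip_sumr.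
by apply: eq_bigr => b _; rewrite !(hipZl, hipZr) tens_cons_ip.
Qed.

Let cr_cr f p : nrm (cr f p) ^+ 2 =
  nrm f ^+ 2 * nrm (lc tens p) ^+ 2 + q * nrm (an f p) ^+ 2.
Proof.
have e : hip (cr f p) (cr f p) =
    hip f f * hip (lc tens p) (lc tens p) + q%:C * hip (an f p) (an f p); last first.
  apply: realC_inj; rewrite -hip_nrm e !hip_nrm; apply: complexP => /=; ring.
rewrite /cr /an /lc !hip_suml !mulr_sumr -big_split; apply: eq_bigr => a _ /=.
rewrite !hip_sumr !mulr_sumr -big_split; apply: eq_bigr => b _ /=.
rewrite !(hipZl, hipZr) tens_cons_cons_ip; ring.
Qed.

(** A list for the annihilated combination, with shorter tensors, to which the induction hypothesis
    of [cr_bound] applies. *)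
Let anp f (p : seq (CC * seq H)) : seq (CC * seq H) :=
  flatten [seq [seq (a.1 * ((q ^+ k)%:C * hip f (nth 0 a.2 k)), remk k a.2)
                | k <- iota 0 (size a.2)] | a <- p].

Let lc_anp f p : lc tens (anp f p) = an f p.
Proof.
rewrite /an /lc /anp big_flatten big_map; apply: eq_bigr => a _.
have -> : iota 0 (size a.2) = index_iota 0 (size a.2) by rewrite /index_iota subn0.
rewrite big_map big_mkord.
by rewrite scaler_sumr; apply: eq_bigr => k _; rewrite scalerA.
Qed.

Let absq : 0 < 1 - `|q|.
Proof. by rewrite subr_gt0 ltr_norml q1 q2. Qed.

(** For y = a(f) x, |y|^2 = <a^*(f) y, x>, so the bound M2 for a^*(f) on shorter tensors gives |y|^2
    <= M2 |x|^2. The q-commutation relation then bounds a^*(f) at x by |f|^2 + |q| M2, and M2 is the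
    fixed point of this expression. *)
Let cr_bound f N p : all (fun a => size a.2 < N)%N p ->
  nrm (cr f p) ^+ 2 <= nrm f ^+ 2 / (1 - `|q|) * nrm (lc tens p) ^+ 2.
Proof.
elim: N p => [|N IH] p hp.
  case: p hp => // _; rewrite /cr !lc0 !nrm0 expr0n mulr0//.
set M2 := _ / _; have M20 : 0 <= M2 by rewrite divr_ge0 ?sqr_ge0// ltW.
have := IH (anp f p); rewrite lc_anp -/M2.
set y := an f p; set x := lc tens p => h.
have {}h : nrm (cr f (anp f p)) ^+ 2 <= M2 * nrm y ^+ 2.
  apply: h; apply/allP => a /flatten_mapP[b /(allP hp)/= bN] /mapP[k].
  rewrite mem_iota add0n => /andP[_ kb] -> /=; rewrite size_remk//.
  by move: bN kb; case: (size b.2) => //= n; lia.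
have y2 : nrm y ^+ 2 <= nrm (cr f (anp f p)) * nrm x.
  have yE : hip y y = hip (cr f (anp f p)) x by rewrite /y /x cr_an lc_anp.
  rewrite -Re_hip yE; apply: le_trans (ler_norm _) _.
  by apply: le_trans (Re_le_cabs _) _; exact: hip_CS.
have y4 : nrm y ^+ 2 <= M2 * nrm x ^+ 2.
  have [y0|yn0] := eqVneq (nrm y) 0; first by rewrite y0 expr0n mulr_ge0 ?sqr_ge0.
  have yp : 0 < nrm y ^+ 2 by rewrite exprn_gt0// lt_neqAle eq_sym yn0 nrm_ge0.
  rewrite -(ler_pM2l yp) -expr2; apply: (@le_trans _ _ ((nrm (cr f (anp f p)) * nrm x) ^+ 2)).
    by rewrite ler_pXn2r ?nnegrE ?sqr_ge0 ?mulr_ge0 ?nrm_ge0.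
  by rewrite exprMn [leRHS]mulrA ler_wpM2r ?sqr_ge0// mulrC.
rewrite cr_cr -/y -/x; apply: (@le_trans _ _ (nrm f ^+ 2 * nrm x ^+ 2 + `|q| * (M2 * nrm x ^+ 2))).
  rewrite lerD2l; apply: (@le_trans _ _ (`|q| * nrm y ^+ 2)).
    by rewrite ler_wpM2r ?sqr_ge0// ler_norm.
  by rewrite ler_wpM2l.
rewrite (mulrA `|q|) -mulrDl ler_wpM2r ?sqr_ge0// le_eqVlt; apply/orP; left; apply/eqP.
by rewrite /M2; field; rewrite gt_eqF.
Qed.

Lemma tens_spans : spans tens.
Proof.
move=> x e e0; have oB : open (ball x e%:C).
  by apply: ball_open; rewrite ltcR.
have ne : ball x e%:C !=set0 by exists x; apply: ballxx; rewrite ltcR.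
have [y [/= hy [l ly]]] := qFock_dense hF ne oB.
by exists l; rewrite /lc -ly; apply/ltW/ball_nrmE.
Qed.

Lemma creation_ex f : exists T : bop F, is_creation tens f T.
Proof.
have [|p|T [_ hT]] := @dense_extension _ _ _ tens (fun s => tens (f :: s))
  (Num.sqrt (nrm f ^+ 2 / (1 - `|q|))) tens_spans; first exact: sqrtr_ge0.
  rewrite -(@ler_pXn2r _ 2) ?nnegrE ?mulr_ge0 ?nrm_ge0 ?sqrtr_ge0//.
  rewrite exprMn sqr_sqrtr ?divr_ge0 ?sqr_ge0 ?(ltW absq)//.
  apply: (@cr_bound f (\max_(a <- p) size a.2).+1); apply/allP => a ap.
  by rewrite ltnS; apply: (leq_bigmax_seq (P := xpredT) (F := fun a : CC * seq H => size a.2)).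
by exists T.
Qed.

Definition creation f : bop F := projT1 (cid (creation_ex f)).

Lemma creationE f s : creation f (tens s) = tens (f :: s).
Proof. by rewrite /creation; case: cid => T /= ->. Qed.

Lemma adj_creation f s : adj (creation f) (tens s) = ann f s.
Proof.
by apply: (hip_span tens_spans) => t; rewrite -adjP creationE tens_cons_ip.
Qed.

Lemma creation_lin a f g : creation (a *: f + g) = a *: creation f + creation g.
Proof.
apply: (eq_on_span tens_spans) => s; rewrite bopDE bopZE !creationE.
exact: (qFock_linear hF [::]).
Qed.

Lemma creation_lc (I : Type) (f : I -> H) p :
  creation (lc f p) = lc (fun i => creation (f i)) p.
Proof.
have c0 : creation 0 = 0.
  by have := creation_lin (-1) 0 0; rewrite scaler0 addr0 scaleN1r addNr.
elim: p => [|a p IH]; first by rewrite !lc0.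
by rewrite /lc !big_cons creation_lin -/(lc f p) IH.
Qed.

Lemma is_fieldE h G : is_field tens h G <-> G = creation h + adj (creation h).
Proof.
split=> [[c [a [hc /adj_uniq -> ->]]]|->].
  suff -> : c = creation h by [].
  by apply: (eq_on_span tens_spans) => s; rewrite hc creationE.
exists (creation h), (adj (creation h)); split=> // [s|x y].
  exact: creationE.
exact: adjP.
Qed.

Section Words.
Context {L : countType}.
Variables (jl : L -> H) (bar : L -> L).
Hypothesis barK : involutive bar.
Hypothesis jl_span : forall u : H, exists p, u = lc jl p.

(** The complex linear extension of the field: annihilation is antilinear, so it takes the conjugate
    vector. *)
Definition fld l : bop F := creation (jl l) + adj (creation (jl (bar l))).

Lemma adj_fld l : adj (fld l) = fld (bar l).
Proof. by rewrite /fld adjD adjK barK addrC. Qed.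

Lemma fld_tens l s : fld l (tens s) = tens (jl l :: s) + ann (jl (bar l)) s.
Proof. by rewrite bopDE creationE adj_creation. Qed.

(** The last letter of w acts first on the tensor: creation puts it in front, annihilation removes
    the k-th entry with weight q^k, as in [fm]. *)
Lemma vacuum_moment w u : hip (tens [::]) (wop fld w (tens (map jl u))) =
  fm q (fun l l' => hip (jl (bar l)) (jl l')) (rev w) u.
Proof.
elim/last_ind: w u => [|w l IH] u.
  rewrite bidE /=; case: u => [|l u] /=; last by rewrite (qFock_ip0 hF).
  rewrite (@qFock_nth 0)// (bigD1 1%g)//= big_ord0 mulr1 inversionsE big_ord0 expr0.
  rewrite big1 ?addr0// => p /eqP[]; apply/permP => -[].
  by [].
rewrite wop_rcons bcompE fld_tens bopD hipDr rev_rcons fm_cons -IH /=; congr (_ + _).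
rewrite /ann size_map bop_sum hip_sumr; apply: eq_bigr => k _.
by rewrite bopZ hipZr -map_remk IH (nth_map l).
Qed.

(** By induction on the length, since f (x) s is the field of f applied to s, up to an annihilation
    term of smaller length. *)
Lemma tens_words s : exists p, tens s = lc (vec (tens [::]) fld) p.
Proof.
pose Sp x := exists p, x = lc (vec (tens [::]) fld) p.
have Sp0 : Sp 0 by exists [::]; rewrite lc0.
have SpD x y : Sp x -> Sp y -> Sp (x + y).
  by move=> [p ->] [p' ->]; exists (p ++ p'); rewrite lc_cat.
have SpZ a x : Sp x -> Sp (a *: x).
  by move=> [p ->]; exists (lscale a p); rewrite lc_scale.
have SpG l x : Sp x -> Sp (fld l x).
  move=> [p ->]; exists [seq (a.1, l :: a.2) | a <- p].
  by rewrite bop_lc /lc big_map.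
elim: {s}(size s).+1 {-2}s (ltnSn (size s)) => // N IH [|f s] sN.
  by exists [:: (1, [::])]; rewrite lc1.
have [p ->] := jl_span f.
rewrite -creationE creation_lc /lc bop_sumE; elim: p => [|a p IHp].
  by rewrite big_nil.
rewrite big_cons; apply: (SpD) => //; rewrite bopZE; apply: (SpZ).
have -> : creation (jl a.2) (tens s) =
    fld a.2 (tens s) + (-1) *: ann (jl (bar a.2)) s.
  by rewrite fld_tens creationE scaleN1r addrK.
apply: (SpD); first by apply/SpG/IH.
apply: (SpZ); rewrite /ann.
apply: (big_ind Sp) => // k _; apply/SpZ/IH.
by rewrite size_remk//; move: sN => /=; have := ltn_ord k; lia.
Qed.

Lemma words_spans : spans (vec (tens [::]) fld).
Proof.
move=> x e e0; have [p hp] := tens_spans x e0.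
have /choice[r hr] := tens_words.
exists (flatten [seq lscale a.1 (r a.2) | a <- p]).
rewrite (_ : lc _ _ = lc tens p)//; elim: p {hp} => [|a p IH]; first by rewrite !lc0.
by rewrite /= lc_cat lc_scale -hr IH /lc big_cons.
Qed.

End Words.
End Fock.

(** * Closure properties of generated von Neumann algebras *)

Section GeneratedVN.
Context {R : realType} {K : hilbertType R}.
Implicit Types M S : set (bop K).

Lemma vN_generated_von_neumann S : von_neumann (vN_generated S).
Proof.
split=> [T U hT TU N [hN SN]|].
  by apply: hN.1 TU; apply: hT.
rewrite eqEsubset; split=> [X hX N [hN SN]|X hX Y hY x].
  rewrite -hN.2 => Y hY x; apply: hX => T hT y; apply: hY.
  by apply: hT.
by rewrite hY.
Qed.

Lemma von_neumann_lin M a X Y : von_neumann M -> M X -> M Y -> M (a *: X + Y).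
Proof.
move=> [_ MM] MX MY; rewrite -MM => T hT x.
rewrite !bopDE !bopZE bopD bopZ.
by rewrite (hT _ MX) (hT _ MY).
Qed.

Lemma von_neumann_lc M (I : Type) (f : I -> bop K) p : von_neumann M ->
  (forall i, M (f i)) -> M (lc f p).
Proof.
move=> hM hf; elim: p => [|a p IH].
  by rewrite lc0 -hM.2 => T _ x; rewrite !bop0E bop0.
by rewrite /lc big_cons; apply: von_neumann_lin.
Qed.

End GeneratedVN.

(** * Eigenvectors of A *)

Section RealFrame.
Context {R : realType} {V : realHilbertType R}.
Implicit Types (x y z : V) (b : seq V).

Lemma ripDr x y z : rip x (y + z) = rip x y + rip x z.
Proof. by have := rip_linear 1 x y z; rewrite scale1r mul1r. Qed.

Lemma rip0r x : rip x 0 = 0.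
Proof. by apply: (@addrI _ (rip x 0)); rewrite addr0 -ripDr addr0. Qed.

Lemma ripZr a x y : rip x (a *: y) = a * rip x y.
Proof. by have := rip_linear a x y 0; rewrite rip0r !addr0. Qed.

Lemma ripNr x y : rip x (- y) = - rip x y.
Proof. by rewrite -scaleN1r ripZr mulN1r. Qed.

Lemma ripNl x y : rip (- x) y = - rip x y.
Proof. by rewrite !(rip_sym y) ripNr. Qed.

Lemma ripZl a x y : rip (a *: x) y = a * rip x y.
Proof. by rewrite !(rip_sym y) ripZr. Qed.

Lemma rip_sumr (I : Type) (s : seq I) (P : pred I) (f : I -> V) x :
  rip x (\sum_(i <- s | P i) f i) = \sum_(i <- s | P i) rip x (f i).
Proof. exact: (big_morph _ (ripDr x) (rip0r x)). Qed.

Definition fproj b z := \sum_(u <- b) rip u z *: u.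

Lemma fproj_sym b x y : rip x (fproj b y) = rip (fproj b x) y.
Proof.
rewrite (rip_sym y) !rip_sumr; apply: eq_bigr => u _.
by rewrite !ripZr mulrC (rip_sym u x) (rip_sym u y).
Qed.

Lemma fproj_lin b a x y : fproj b (a *: x + y) = a *: fproj b x + fproj b y.
Proof.
rewrite /fproj scaler_sumr -big_split; apply: eq_bigr => u _ /=.
by rewrite ripDr ripZr scalerDl scalerA.
Qed.

Lemma gram_schmidt (s : seq V) : exists b,
  (forall u, u \in b -> fproj b u = u) /\ (forall v, v \in s -> fproj b v = v).
Proof.
elim: s => [|v s [b [hb hs]]]; first by exists [::].
pose w := v - fproj b v.
have [w0|w0] := eqVneq w 0.
  exists b; split=> // x; rewrite inE => /predU1P[->|/hs//].
  by apply/esym/eqP; rewrite -subr_eq0; apply/eqP.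
have nw : `|w| != 0 by rewrite normr_eq0.
pose e := `|w|^-1 *: w.
have uw u : u \in b -> rip u w = 0.
  by move=> ub; rewrite /w ripDr ripNr fproj_sym hb// subrr.
have be : fproj b e = 0.
  rewrite /fproj big_seq big1// => u ub.
  by rewrite /e ripZr uw// mulr0 scale0r.
have ey y : fproj b y = y -> rip e y = 0.
  by move=> <-; rewrite fproj_sym be (rip_sym y) rip0r.
have ev : rip e v = `|w|.
  have -> : v = w + fproj b v by rewrite /w subrK.
  rewrite ripDr fproj_sym be (_ : rip 0 v = 0) ?addr0; last by rewrite rip_sym rip0r.
  by rewrite /e ripZl rip_norm expr2 mulKf.
have cons z : fproj (e :: b) z = rip e z *: e + fproj b z.
  by rewrite /fproj big_cons.
exists (e :: b); split=> u; rewrite inE => /predU1P[->|h]; rewrite cons.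
- by rewrite be addr0 /e ripZl ripZr rip_norm expr2 mulKf// mulVf// scale1r.
- by rewrite ey ?hb// scale0r add0r.
- by rewrite ev /e scalerA mulfV// scale1r /w subrK.
- by rewrite ey ?hs// scale0r add0r.
Qed.

Lemma parseval_frame : finite_dimensional V -> exists n (b : 'I_n.+1 -> V),
  forall x, x = \sum_k rip (b k) x *: b k.
Proof.
move=> [s hs]; have [b [_ hb]] := gram_schmidt s.
(* A zero vector is put in front so that the index type is nonempty even when V is trivial; it does
   not change the sum. *)
exists (size b), (fun k => nth 0 (0 :: b) k) => x.
rewrite -(big_mkord xpredT (fun k => rip (nth 0 (0 :: b) k) x *: nth 0 (0 :: b) k)).
rewrite -(big_nth 0 xpredT (fun u => rip u x *: u) (r := 0 :: b)) big_cons scaler0 add0r.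
rewrite -/(fproj b x); have [c ->] := hs x.
have f0 : fproj b 0 = 0.
  by have := fproj_lin b (-1) 0 0; rewrite scaler0 addr0 scaleN1r addNr.
rewrite big_seq; apply: (big_ind (fun y => y = fproj b y)) => //.
  by move=> y z hy hz; rewrite -[y]scale1r fproj_lin -hy -hz.
move=> v vs; rewrite -[c v *: v]addr0 fproj_lin f0 !addr0.
by rewrite hb.
Qed.

End RealFrame.

(** * Eigenvectors in the complexification and the form of U *)

Section ComplexFrame.
Context {R : realType} {HR : realHilbertType R}.
Local Notation CC := R[i].
Local Notation HC := (complexification HR).
Implicit Types x y z w : HC.

Lemma cplx_eq z w : z.1 = w.1 -> z.2 = w.2 -> z = w.
Proof. by case: z w => [a b] [a' b'] /= -> ->. Qed.

Lemma cplx_ipC x y : cplx_ip y x = conjc (cplx_ip x y).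
Proof.
by apply: complexP => /=; rewrite ?(rip_sym y.1) ?(rip_sym y.2) ?(rip_sym x.1 y.2);
  rewrite ?opprB ?(rip_sym y.1) ?(rip_sym x.2).
Qed.

Lemma cplx_ip_semi : semi_ip (@cplx_ip R HR).
Proof.
split=> [a x y z|x y|x]; last 2 first.
- exact: cplx_ipC.
- by rewrite /= !rip_norm addr_ge0 ?sqr_ge0.
case: a => a a'; have e1 : ((a +i* a')%C *: y + z).1 = a *: y.1 - a' *: y.2 + z.1 by [].
have e2 : ((a +i* a')%C *: y + z).2 = a *: y.2 + a' *: y.1 + z.2 by [].
by apply: complexP; rewrite /cplx_ip e1 e2 /= !(ripDr, ripNr, ripZr); ring.
Qed.

Lemma cplx_ip_ge0 z : 0 <= cplx_ip z z.
Proof.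
rewrite /cplx_ip !rip_norm (rip_sym z.1) subrr lecE /= eqxx.
by rewrite addr_ge0 ?sqr_ge0.
Qed.

Local Notation ip := (@cplx_ip R HR).

Lemma cplx_ip_eq0 z : ip z z = 0 -> z = 0.
Proof.
move=> /(congr1 (@complex.Re R)) /= /eqP; rewrite !rip_norm paddr_eq0 ?sqr_ge0//.
rewrite !sqrf_eq0 !normr_eq0 => /andP[/eqP h1 /eqP h2].
exact: cplx_eq.
Qed.

Definition cplx_conj z : HC := (z.1, - z.2).

Lemma cplx_conjK : involutive cplx_conj.
Proof. by move=> [x y]; rewrite /cplx_conj /= opprK. Qed.

Lemma cplx_conj_lin a z w :
  cplx_conj (a *: z + w) = conjc a *: cplx_conj z + cplx_conj w.
Proof.
case: a => a a'; apply: cplx_eq => /=; rewrite !(scalerN, scaleNr, opprK, opprD)//.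
Qed.

Lemma ip_conj z w : ip (cplx_conj z) (cplx_conj w) = conjc (ip z w).
Proof.
by apply: complexP; rewrite /= !(ripNr, ripNl); ring.
Qed.

Lemma ip_conj_swap z w : ip (cplx_conj z) w = ip (cplx_conj w) z.
Proof. by rewrite -{1}(cplx_conjK w) ip_conj [RHS]cplx_ipC. Qed.

(** A Parseval frame instead of an orthonormal basis: zero or dependent vectors are allowed, and the
    reconstruction formula takes the place of orthogonality. *)
Definition cframe n (e : 'I_n -> HC) := forall z, z = \sum_k ip (e k) z *: e k.

Lemma cframe_ip n (e : 'I_n -> HC) : cframe e -> forall z w,
  ip z w = \sum_k ip z (e k) * ip (e k) w.
Proof.
move=> he z w; rewrite {1}(he w) (semi_sumr cplx_ip_semi).
by apply: eq_bigr => k _; rewrite (semiZr cplx_ip_semi) mulrC.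
Qed.

Lemma cplx_frame : finite_dimensional HR -> exists n (e : 'I_n.+1 -> HC), cframe e.
Proof.
move=> /parseval_frame[n [b hb]]; exists n, (fun k => cplx_of (b k)) => z.
have s1 (f : 'I_n.+1 -> HC) : (\sum_k f k).1 = \sum_k (f k).1.
  by apply: (big_morph (fun z : HC => z.1)).
have s2 (f : 'I_n.+1 -> HC) : (\sum_k f k).2 = \sum_k (f k).2.
  by apply: (big_morph (fun z : HC => z.2)).
have r0 (x : HR) : rip 0 x = 0 by rewrite rip_sym rip0r.
apply: cplx_eq; rewrite ?s1 ?s2.
  rewrite {1}(hb z.1); apply: eq_bigr => k _ /=.
  by rewrite !r0 addr0 scaler0 subr0.
rewrite {1}(hb z.2); apply: eq_bigr => k _ /=.
by rewrite !r0 subr0 scaler0 add0r.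
Qed.

Variable A : {linear HC -> HC}.
Hypotheses (Ainj : injective A) (Apos : positive_selfadjoint A).

(** The matrix of A in a frame b still satisfies A b_l = sum_m M_ml b_m. The spectral theorem
    diagonalizes M, and a unitary change of coefficients turns b into another Parseval frame, of
    eigenvectors. *)
Lemma eigenframe : finite_dimensional HR -> exists n (e : 'I_n.+1 -> HC)
  (a : 'I_n.+1 -> R), [/\ cframe e, forall k, 0 < a k &
  forall k, A (e k) = (a k)%:C *: e k].
Proof.
move=> /cplx_frame[n [b hb]].
pose M : 'M[CC]_n.+1 := \matrix_(k, l) ip (b k) (A (b l)).
have Mh : adjm M = M.
  apply/matrixP => k l; rewrite !mxE -cplx_ipC.
  by rewrite Apos.1.
have adjE m (X : 'M[CC]_m) : map_mx (@Num.conj CC) X^T = adjm X.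
  by apply/matrixP => k l; rewrite !mxE.
have /orthomx_spectralP : M \is normalmx by apply/normalmxP; rewrite adjE Mh.
set P := spectralmx M; set dg := spectral_diag M; move=> ME.
have PP : P *m adjm P = 1%:M.
  by rewrite -adjE; apply/unitarymxP; exact: spectral_unitarymx.
have PP' : adjm P *m P = 1%:M by apply: mulmx1C.
pose U := adjm P.
have MU : M *m U = U *m diag_mx dg.
  have Pu : P \in unitmx by exact: spectral_unit.
  have iP : invmx P = U by rewrite -[RHS]mul1mx -(mulVmx Pu) -mulmxA PP mulmx1.
  by rewrite ME iP -!mulmxA PP mulmx1.
pose e l := \sum_k U k l *: b k.
have Ae l : A (e l) = dg 0 l *: e l.
  rewrite /e linear_sum scaler_sumr.
  transitivity (\sum_m (M *m U) m l *: b m); last first.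
    apply: eq_bigr => m _; rewrite MU scalerA mul_mx_diag !mxE mulrC; congr (_ *: _).
  transitivity (\sum_k \sum_m (U k l * M m k) *: b m).
    apply: eq_bigr => k _; rewrite linearZ /= {1}(hb (A (b k))) scaler_sumr.
    by apply: eq_bigr => m _; rewrite scalerA [M m k]mxE.
  rewrite exchange_big; apply: eq_bigr => m _; rewrite -scaler_suml [(M *m U) m l]mxE.
  by congr (_ *: _); apply: eq_bigr => k _; rewrite mulrC.
have fe : cframe e.
  move=> z; transitivity (\sum_l \sum_k \sum_k' (conjc (U k l) * U k' l) *: (ip (b k) z *: b k')).
    rewrite (exchange_big_dep xpredT)//= {1}(hb z); apply: eq_bigr => k _.
    rewrite (exchange_big_dep xpredT)//=.
    under eq_bigr => k' _ do rewrite -scaler_suml.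
    have UU k' : \sum_l conjc (U k l) * U k' l = (k' == k)%:R.
      transitivity ((U *m adjm U) k' k); last by rewrite /U adjmK PP' mxE.
      rewrite [RHS]mxE; apply: eq_bigr => l _.
      by rewrite [adjm U l k]mxE mulrC.
    rewrite (bigD1 k)//= UU eqxx scale1r big1 ?addr0// => k' kk.
    by rewrite UU (negbTE kk) scale0r.
  apply: eq_bigr => l _; rewrite {1}/e (semi_suml cplx_ip_semi) scaler_suml.
  apply: eq_bigr => k _; rewrite (semiZl cplx_ip_semi) /e scaler_sumr.
  by apply: eq_bigr => k' _; rewrite !scalerA; congr (_ *: _); ring.
have /choice[a ha] l : exists al : R, 0 < al /\ A (e l) = al%:C *: e l.
  have [e0|e0] := eqVneq (e l) 0.
    (* A zero vector of the frame is given the eigenvalue 1, to keep all of them positive. *)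
    by exists 1; split=> //; rewrite e0 linear0 scaler0.
  have ep : 0 < ip (e l) (e l).
    rewrite lt_neqAle cplx_ip_ge0 andbT eq_sym.
    by apply: contra_neq e0; exact: cplx_ip_eq0.
  have dE : dg 0 l = ip (e l) (A (e l)) / ip (e l) (e l).
    by rewrite Ae (semiZr cplx_ip_semi) mulfK// gt_eqF.
  have d0 : 0 <= dg 0 l by rewrite dE divr_ge0// ?Apos.2// ltW.
  have dR : dg 0 l = (complex.Re (dg 0 l))%:C.
    by move: d0; rewrite lecE /= => /andP[/eqP i0 _]; apply: complexP.
  exists (complex.Re (dg 0 l)); rewrite -dR; split=> //.
  rewrite lt_neqAle -lecR -dR d0 andbT eq_sym; apply: contra_neq e0 => r0.
  by apply: Ainj; rewrite Ae dR r0 scale0r linear0.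
by exists n, e, a; split=> // l; have [] := ha l.
Qed.

Section Eigenframe.
Variables (n : nat) (e : 'I_n -> HC) (a : 'I_n -> R).
Hypotheses (fe : cframe e) (a0 : forall k, 0 < a k)
  (Ae : forall k, A (e k) = (a k)%:C *: e k).

Lemma eigen_match k l : ip (e k) (e l) != 0 -> a k = a l.
Proof.
move=> nz; have := Apos.1 (e k) (e l); rewrite !Ae (semiZl cplx_ip_semi).
rewrite (semiZr cplx_ip_semi) realC_real => /(mulIf nz)/realC_inj.
by [].
Qed.

Variable U : R -> HR -> HR.
Hypotheses (hU : orthogonal_group U)
  (AU : forall t, is_imaginary_power A t (cplx_ext (U t))).

(** U_t is isometric and real, so it preserves <conj e_k, e_l> and multiplies it by (a_k a_l)^{i t}.
    If the logarithm were nonzero, t = pi / ln(a_k a_l) would give the factor -1. *)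
Lemma eigen_conj_match k l : ip (cplx_conj (e k)) (e l) != 0 -> a k * a l = 1.
Proof.
move=> nz; have [Ul Uo _ _ _] := hU.
have UN t (x : HR) : U t (- x) = - U t x.
  have U0 : U t 0 = 0.
    by have := Ul t (-1) 0 0; rewrite scaler0 addr0 scaleN1r addNr.
  by have := Ul t (-1) x 0; rewrite addr0 U0 addr0 !scaleN1r.
have Uip t z w : ip (cplx_ext (U t) z) (cplx_ext (U t) w) = ip z w.
  by rewrite /cplx_ip /= !Uo.
have Uconj t z : cplx_ext (U t) (cplx_conj z) = cplx_conj (cplx_ext (U t) z).
  by apply: cplx_eq => //=; rewrite UN.
have cos1 t : cos (t * (ln (a k) + ln (a l))) = 1.
  have := Uip t (cplx_conj (e k)) (e l).
  rewrite Uconj (AU t (a0 k) (Ae k)) (AU t (a0 l) (Ae l)).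
  rewrite -[X in cplx_conj X]addr0 cplx_conj_lin (_ : cplx_conj 0 = 0); last first.
    by apply: cplx_eq => //=; rewrite oppr0.
  rewrite addr0 (semiZl cplx_ip_semi) (semiZr cplx_ip_semi) conjcK mulrA.
  rewrite -[RHS]mul1r => /(mulIf nz) /(congr1 (@complex.Re R)) /=.
  by rewrite mulrDr cosD.
have s0 : ln (a k) + ln (a l) = 0.
  apply/eqP; apply/negPn/negP => sn0.
  have := cos1 (pi / (ln (a k) + ln (a l))); rewrite divfK// cospi => /eqP.
  by rewrite eq_sym -subr_eq0 opprK -mulr2n pnatr_eq0.
rewrite -(lnK (x := a k)) ?posrE// -(lnK (x := a l)) ?posrE//.
by rewrite -expRD s0 expR0.
Qed.

(** The frame need not be orthogonal, but a nonzero <e_k, e_m> forces a_m = a_k, so f(a_m) can be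
    taken out of the sum. *)
Lemma eigen_sum_match (f : R -> CC) z k :
  \sum_m f (a m) * (ip (e k) (e m) * ip (e m) z) = f (a k) * ip (e k) z.
Proof.
rewrite (cframe_ip fe (e k) z) mulr_sumr; apply: eq_bigr => m _.
have [->|nz] := eqVneq (ip (e k) (e m)) 0; first by rewrite !mul0r !mulr0.
by rewrite (eigen_match nz).
Qed.

Lemma U_ipE x y : U_ip A x y =
  \sum_k (2 * a k / (1 + a k))%:C * (ip x (e k) * ip (e k) y).
Proof.
have S := cplx_ip_semi.
pose z0 := \sum_k ((1 + a k)^-1)%:C *: (ip (e k) x *: e k).
have a1 k : 1 + a k != 0 by rewrite gt_eqF// addr_gt0.
have Az0 : A z0 = \sum_k (a k / (1 + a k))%:C *: (ip (e k) x *: e k).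
  rewrite /z0 linear_sum; apply: eq_bigr => k _.
  by rewrite !linearZ /= Ae !scalerA; congr (_ *: _); rewrite rmorphM; ring.
have iE : inv_1D A x = z0.
  rewrite /inv_1D; apply: xget_unique => [|z /= hz].
    rewrite /= Az0 /z0 -big_split [RHS](fe x); apply: eq_bigr => k _ /=.
    rewrite -scalerDl -rmorphD -[X in X + _]mul1r -mulrDl mulfV//.
    by rewrite scale1r.
  have z0E : z0 + A z0 = x.
    rewrite Az0 /z0 -big_split [RHS](fe x); apply: eq_bigr => k _ /=.
    rewrite -scalerDl -rmorphD -[X in X + _]mul1r -mulrDl mulfV//.
    by rewrite scale1r.
  apply/eqP; rewrite -subr_eq0; apply/eqP/cplx_ip_eq0.
  set w := z - z0; have w0 : w + A w = 0.
    by rewrite /w linearB /= addrACA -opprD hz z0E subrr.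
  have h : ip w w + ip w (A w) = 0 by rewrite -(semiDr S) w0 (semi0r S).
  apply/eqP; rewrite eq_le cplx_ip_ge0 andbT.
  by rewrite -h lerDl Apos.2.
rewrite /U_ip iE Az0 scaler_sumr (semi_suml S); apply: eq_bigr => k _.
rewrite !(semiZl S) -cplx_ipC realC_real mulrA; congr (_ * _).
rewrite rmorph_nat -[2 : CC](rmorph_nat (real_complex R)) -rmorphM.
by rewrite mulrA.
Qed.

(** Conjugation exchanges the eigenvalues a and 1/a, and 1/(1 + a) = b/(1 + b) for b = 1/a. *)
Lemma covariance_match h h' :
  \sum_k ((1 + a k)^-1)%:C * (ip (e k) h * ip (cplx_conj (e k)) h') =
  \sum_k (a k / (1 + a k))%:C * (ip (cplx_conj (e k)) h * ip (e k) h').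
Proof.
transitivity (\sum_k \sum_l (a l / (1 + a l))%:C *
    ((ip (cplx_conj (e l)) (e k) * ip (e k) h) * ip (e l) h')).
  apply: eq_bigr => k _; rewrite (cframe_ip fe _ h') !mulr_sumr.
  apply: eq_bigr => l _; rewrite (ip_conj_swap (e l)).
  have [->|nz] := eqVneq (ip (cplx_conj (e k)) (e l)) 0.
    by rewrite !(mul0r, mulr0).
  have m := eigen_conj_match nz.
  have -> : (1 + a k)^-1 = a l / (1 + a l).
    have al : a l != 0 by rewrite gt_eqF.
    have a1 : 1 + a l != 0 by rewrite gt_eqF// addr_gt0.
    have -> : a k = (a l)^-1 by apply: (mulIf al); rewrite m mulVf.
    have a1' : a l + 1 != 0 by rewrite addrC.
    by field; rewrite ?al ?a1 ?a1'.
  by ring.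
rewrite exchange_big; apply: eq_bigr => l _.
by rewrite (cframe_ip fe _ h) -mulr_sumr mulr_suml.
Qed.

End Eigenframe.
End ComplexFrame.

(** * The matrices at one site and the commutation signs *)

Section SiteModel.
Context {R : realType} {L : finType}.
Local Notation CC := R[i].

Lemma mxb_ex s (M : 'M[CC]_s) : exists K, 0 <= K /\ mxb M K.
Proof.
pose S i := \sum_j cabs (M i j).
have S0 i : 0 <= S i by apply: sumr_ge0 => j _; exact: cabs_ge0.
exists (Num.sqrt (\sum_i S i ^+ 2)); split; first exact: sqrtr_ge0.
move=> u; rewrite sqr_sqrtr; last by apply: sumr_ge0 => i _; exact: sqr_ge0.
rewrite [leLHS]/csq mulr_suml; apply: ler_sum => i _; rewrite mxE.
have uj j : cabs (u j 0) <= Num.sqrt (csq u).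
  rewrite -(@ler_pXn2r _ 2) ?nnegrE ?cabs_ge0 ?sqrtr_ge0// sqr_sqrtr ?csq_ge0//.
  by rewrite /csq (bigD1 j)//= lerDl sumr_ge0// => k _; exact: sqr_ge0.
rewrite -[X in _ * X]sqr_sqrtr ?csq_ge0// -exprMn.
rewrite ler_pXn2r ?nnegrE ?cabs_ge0 ?mulr_ge0 ?sqrtr_ge0//.
rewrite /S mulr_suml; apply: le_trans (cabs_sum _ _ _) _; apply: ler_sum => j _.
by rewrite cabsM ler_wpM2l ?cabs_ge0.
Qed.

Lemma mxb_le s (M : 'M[CC]_s) K K' : 0 <= K -> K <= K' -> mxb M K -> mxb M K'.
Proof.
move=> K0 KK h u; apply: le_trans (h u) _; apply: ler_wpM2r; first exact: csq_ge0.
by rewrite ler_pXn2r// nnegrE (le_trans K0).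
Qed.

Lemma adjm_block m1 m2 n1 n2 (A : 'M[CC]_(m1, n1)) (B : 'M[CC]_(m1, n2))
    (C : 'M[CC]_(m2, n1)) (D : 'M[CC]_(m2, n2)) :
  adjm (block_mx A B C D) = block_mx (adjm A) (adjm C) (adjm B) (adjm D).
Proof.
apply/matrixP => i j; rewrite [LHS]mxE; case: (splitP i) => i' ei; case: (splitP j) => j' ej.
- have -> : i = lshift _ i' by apply: val_inj.
  have -> : j = lshift _ j' by apply: val_inj.
  by rewrite !block_mxEul mxE.
- have -> : i = lshift _ i' by apply: val_inj.
  have -> : j = fintype.rshift _ j' by apply: val_inj.
  by rewrite block_mxEur block_mxEdl mxE.
- have -> : i = fintype.rshift _ i' by apply: val_inj.
  have -> : j = lshift _ j' by apply: val_inj.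
  by rewrite block_mxEur block_mxEdl mxE.
- have -> : i = fintype.rshift _ i' by apply: val_inj.
  have -> : j = fintype.rshift _ j' by apply: val_inj.
  by rewrite !block_mxEdr mxE.
Qed.

Lemma adjm_scalar n (x : R) : adjm (x%:C%:M : 'M[CC]_n) = x%:C%:M.
Proof.
apply/matrixP => i j; rewrite !mxE eq_sym; case: eqP => _.
  by rewrite !mulr1n realC_real.
by rewrite !mulr0n conjc0.
Qed.

Lemma adjm_diag n (v : 'rV[CC]_n) : adjm (diag_mx v) = diag_mx (\row_k conjc (v 0 k)).
Proof.
apply/matrixP => i j; rewrite !mxE eq_sym; case: eqP => [->|_].
  by rewrite !mulr1n.
by rewrite !mulr0n conjc0.
Qed.

Lemma mxtrace_block2 m n (A : 'M[CC]_m) B C (D : 'M[CC]_n) :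
  \tr (block_mx A B C D) = \tr A + \tr D.
Proof. exact: mxtrace_block. Qed.

Variables (q : R) (D : nat) (bar : L -> L) (c : L -> R) (a : 'I_D.+1 -> R).
Variables (P Q : L -> 'I_D.+1 -> CC).
Hypotheses (q1 : -1 < q) (q2 : q < 1) (a0 : forall k, 0 < a k)
  (PQ : forall l k, conjc (P l k) = Q (bar l) k)
  (QP : forall l k, conjc (Q l k) = P (bar l) k)
  (cP : forall l k, P l k != 0 -> c l = (Num.sqrt (a k))^-1)
  (cQ : forall l k, Q l k != 0 -> c l = Num.sqrt (a k)).

Definition cov l l' : CC := \sum_k (((1 + a k)^-1)%:C * (P l k * Q l' k) +
  (a k / (1 + a k))%:C * (Q l k * P l' k)).

Let n := D.+1.
Let rt : R := Num.sqrt n%:R.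
Let uu k : R := Num.sqrt ((n%:R * (1 + a k))^-1).
Let x l : 'M[CC]_(n + n) := block_mx 0 (diag_mx (\row_k (rt%:C * P l k)))
  (diag_mx (\row_k (rt%:C * Q l k))) 0.
(** Its square is the density with weights 1/(n (1 + a_k)) and a_k/(n (1 + a_k)). The variable [x l]
    exchanges the two copies of each k, so passing through [Es] costs sqrt(a_k) or its inverse; the
    factor [rt] in [x] cancels 1/n in the covariance. *)
Let Es : 'M[CC]_(n + n) := block_mx (diag_mx (\row_k (uu k)%:C)) 0 0
  (diag_mx (\row_k (uu k * Num.sqrt (a k))%:C)).
(** Cosine and sine of an angle whose double has cosine q: r^2 = 1 as c0^2 + s0^2 = 1, and p r p r
    has normalized trace c0^2 - s0^2 = q. *)
Let c0 : R := Num.sqrt ((1 + q) / 2).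
Let s0 : R := Num.sqrt ((1 - q) / 2).
Let p : 'M[CC]_(n + n) := block_mx 1%:C%:M 0 0 (-1)%:C%:M.
Let r : 'M[CC]_(n + n) := block_mx c0%:C%:M s0%:C%:M s0%:C%:M (- c0)%:C%:M.

Let n0 : 0 < n%:R :> R. Proof. by rewrite ltr0n. Qed.
Let a1 k : 0 < 1 + a k. Proof. by rewrite addr_gt0. Qed.
Let uu2 k : uu k ^+ 2 = (n%:R * (1 + a k))^-1.
Proof. by rewrite /uu sqr_sqrtr// invr_ge0 mulr_ge0// ltW. Qed.
Let rt2 : rt ^+ 2 = n%:R.
Proof. by rewrite /rt sqr_sqrtr// ltW. Qed.
Let sa2 k : Num.sqrt (a k) ^+ 2 = a k.
Proof. by rewrite sqr_sqrtr// ltW. Qed.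
Let c02 : c0 ^+ 2 = (1 + q) / 2.
Proof. by rewrite /c0 sqr_sqrtr// divr_ge0// -lerBlDl sub0r ltW. Qed.
Let s02 : s0 ^+ 2 = (1 - q) / 2.
Proof. by rewrite /s0 sqr_sqrtr// divr_ge0// subr_ge0 ltW. Qed.

Let adj_x l : adjm (x l) = x (bar l).
Proof.
rewrite /x adjm_block !adjm0 !adjm_diag; congr block_mx; congr diag_mx;
by apply/rowP => k; rewrite !mxE conjM realC_real ?QP ?PQ.
Qed.

Let adj_Es : adjm Es = Es.
Proof.
rewrite /Es adjm_block !adjm0 !adjm_diag; congr block_mx; congr diag_mx;
by apply/rowP => k; rewrite !mxE realC_real.
Qed.

Let Es1 : \tr (Es *m Es) = 1.
Proof.
rewrite /Es mulmx_block !(mulmx0, mul0mx, addr0, add0r) mxtrace_block2 !mulmx_diag !mxtrace_diag.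
rewrite -big_split -[RHS](rmorph1 (real_complex R)).
transitivity ((\sum_(k < n) (n%:R)^-1 : R)%:C).
  rewrite rmorph_sum; apply: eq_bigr => k _ /=; rewrite !mxE -!rmorphM -rmorphD.
  rewrite -!expr2 exprMn uu2 sa2 /=; congr (_ %:C); field.
  by rewrite !gt_eqF.
by rewrite sumr_const card_ord -[_ *+ _]mulr_natr mulVf// gt_eqF.
Qed.

Let Es_x l : Es *m x l = (c l)%:C *: (x l *m Es).
Proof.
rewrite /Es /x !mulmx_block !(mulmx0, mul0mx, addr0, add0r) !mulmx_diag scale_block_mx.
rewrite !scaler0; congr block_mx; apply/matrixP => i j; rewrite !mxE;
  case: eqP => _; rewrite ?mulr0n ?mulr0// !mulr1n.
  have [->|nz] := eqVneq (P l i) 0; first by rewrite !(mulr0, mul0r).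
  rewrite (cP nz) rmorphM /=.
  have sn : (Num.sqrt (a i))%:C != 0 :> CC.
    by apply/eqP => /realC_inj/eqP; rewrite sqrtr_eq0 leNgt a0.
  by rewrite fmorphV; field.
have [->|nz] := eqVneq (Q l i) 0; first by rewrite !(mulr0, mul0r).
by rewrite (cQ nz) rmorphM /=; ring.
Qed.

Let x1 l : \tr (Es *m x l *m Es) = 0.
Proof.
rewrite /Es /x !mulmx_block !(mulmx0, mul0mx, addr0, add0r) mxtrace_block2.
by rewrite !mxtrace0 addr0.
Qed.

Let x2 l l' : \tr (Es *m (x l *m x l') *m Es) = cov l l'.
Proof.
rewrite /Es /x !mulmx_block !(mulmx0, mul0mx, addr0, add0r) mxtrace_block2 !mulmx_diag !mxtrace_diag.
rewrite -big_split; apply: eq_bigr => k _; rewrite !mxE /=.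
have h1 : ((1 + a k)^-1)%:C = (uu k)%:C * (uu k)%:C * (rt%:C * rt%:C) :> CC.
  rewrite -!rmorphM -!expr2 uu2 rt2; congr (_ %:C); field.
  by rewrite !gt_eqF.
have h2 : (a k / (1 + a k))%:C = (Num.sqrt (a k))%:C * (Num.sqrt (a k))%:C *
    ((uu k)%:C * (uu k)%:C * (rt%:C * rt%:C)) :> CC.
  by rewrite -h1 -!rmorphM -!expr2 sa2.
by rewrite h1 h2 rmorphM; ring.
Qed.

Let block_scalar (y z t w y' z' t' w' : R) :
  block_mx (y%:C%:M : 'M[CC]_n) z%:C%:M t%:C%:M (w%:C%:M : 'M[CC]_n) *m
  block_mx y'%:C%:M z'%:C%:M t'%:C%:M w'%:C%:M =
  block_mx (y * y' + z * t')%:C%:M (y * z' + z * w')%:C%:M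
    (t * y' + w * t')%:C%:M (t * z' + w * w')%:C%:M.
Proof. by rewrite mulmx_block -!scalar_mxM -!raddfD /= -!rmorphM -!rmorphD. Qed.

Let pE : p = block_mx 1%:C%:M 0%:C%:M 0%:C%:M (-1)%:C%:M.
Proof. by rewrite /p !raddf0. Qed.

Let oneE : block_mx (1%:C%:M : 'M[CC]_n) 0%:C%:M 0%:C%:M (1%:C%:M : 'M[CC]_n) = 1%:M.
Proof.
have -> : (0%:C%:M : 'M[CC]_n) = 0.
  by apply/matrixP => i j; rewrite !mxE; case: eqP.
by rewrite [RHS]scalar_mx_block.
Qed.

Let pp : p *m p = 1%:M.
Proof. by rewrite pE block_scalar -oneE; congr block_mx; congr (_%:C%:M); ring. Qed.

Let rr : r *m r = 1%:M.
Proof.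
rewrite /r block_scalar -oneE; have e1 : c0 * c0 + s0 * s0 = 1.
  by rewrite -!expr2 c02 s02; field.
congr block_mx; congr (_%:C%:M); rewrite -?e1; ring.
Qed.

Let tscal (y z t w : R) : \tr (block_mx (y%:C%:M : 'M[CC]_n) z%:C%:M t%:C%:M
    (w%:C%:M : 'M[CC]_n)) = ((y + w) * n%:R)%:C.
Proof.
by rewrite mxtrace_block2 !mxtrace_scalar -!(rmorphMn (real_complex R)) -rmorphD
  -mulrnDl mulr_natr.
Qed.

Let tpr : \tr (p *m r *m p *m r) = (q * (n + n)%:R)%:C.
Proof.
rewrite pE /r !block_scalar tscal; congr (_%:C).
have -> : q = c0 ^+ 2 - s0 ^+ 2 by rewrite c02 s02; field.
by rewrite natrD; ring.
Qed.

Lemma site_model : exists (d : nat -> nat) (W : forall N, L -> 'M[CC]_(d N))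
  (E : forall N, 'M[CC]_(d N)), [/\ forall N l, adjm (W N l) = W N (bar l),
    forall N, adjm (E N) = E N,
    forall N l, E N *m W N l = (c l)%:C *: (W N l *m E N) &
    forall w, ucv natU (fun N => \tr (E N *m Ww W N w *m E N))
      (fm q cov (rev w) [::])].
Proof.
have /choice[K hK] l := mxb_ex (x l).
pose B := \sum_l K l.
have B0 : 0 <= B by apply: sumr_ge0 => l _; have [] := hK l.
have xB l : mxb (x l) B.
  have [K0 hl] := hK l; apply: mxb_le K0 _ hl.
  by rewrite /B (bigD1 l)//= lerDl sumr_ge0// => k _; have [] := hK k.
have pa : adjm p = p by rewrite /p adjm_block !adjm0 !adjm_scalar.
have ra : adjm r = r by rewrite /r adjm_block !adjm_scalar.
have tp : \tr p = 0 by rewrite pE tscal addrN mul0r.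
have tr0 : \tr r = 0 by rewrite /r tscal addrN mul0r.
(* [n + n] is convertible to [s.+1], the form of the dimension in the site model. *)
pose s := (D + n)%N.
exists (model_dim s), (@model_W R L s p r x), (@model_E R s Es); split.
- move=> N l; exact: adj_model_W.
- by move=> N; apply: adj_model_E.
- by move=> N l; apply: model_EW => l'; exact: Es_x.
- move=> w.
  exact: (model_moments B0 xB adj_Es Es1 x1 x2 pa ra pp rr tp tr0 tpr w).
Qed.

End SiteModel.

(** * The completion H in terms of the eigenvectors *)

Section Completion.
Context {R : realType} {HR : realHilbertType R} {H : hilbertType R}.
Local Notation CC := R[i].
Local Notation HC := (complexification HR).
Local Notation ip := (@cplx_ip R HR).
Variable A : {linear HC -> HC}.
Hypothesis Apos : positive_selfadjoint A.
Variables (n : nat) (e : 'I_n -> HC) (a : 'I_n -> R).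
Hypotheses (fe : cframe e) (a0 : forall k, 0 < a k)
  (Ae : forall k, A (e k) = (a k)%:C *: e k).
Variable j : {linear HC -> H}.
Hypothesis hj : is_U_completion A j.

Lemma hip_j_frame k x :
  hip (j (e k)) (j x) = (2 * a k / (1 + a k))%:C * ip (e k) x.
Proof.
rewrite hj.1 (U_ipE Apos fe a0 Ae).
exact: (eigen_sum_match Apos fe Ae (fun t => (2 * t / (1 + t))%:C)).
Qed.

Lemma j_spans : spans (fun x : HC => j x).
Proof.
move=> u r r0; have oB : open (ball u r%:C) by apply: ball_open; rewrite ltcR.
have ne : ball u r%:C !=set0 by exists u; apply: ballxx; rewrite ltcR.
have [y [/= hy [x _ xy]]] := hj.2 _ ne oB.
by exists [:: (1, x)]; rewrite lc1 xy; apply/ltW/ball_nrmE.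
Qed.

(** Testing against the dense range of j shows that the images of the frame vectors span H: the
    completion adds no vector. *)
Lemma j_frame u : u =
  \sum_k (((2 * a k / (1 + a k))^-1)%:C * hip (j (e k)) u) *: j (e k).
Proof.
apply: (hip_span j_spans) => x; rewrite hip_sumr.
rewrite {1}(fe x) linear_sum hip_suml; apply: eq_bigr => k _.
rewrite linearZ /= hipZl hipZr [hip (j x) _]hip_conj hip_j_frame conjM realC_real.
have l0 : 2 * a k / (1 + a k) != 0.
  by rewrite gt_eqF// divr_gt0 ?mulr_gt0// addr_gt0.
by rewrite mulrACA -rmorphM mulVf// rmorph1 mul1r mulrC.
Qed.

End Completion.

(** * Assembling the model of the q-Araki-Woods algebra *)

Section ArakiWoodsQWEP.
Context {R : realType} {HR : realHilbertType R} {H F : hilbertType R}.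
Local Notation CC := R[i].
Local Notation HC := (complexification HR).
Local Notation ip := (@cplx_ip R HR).
Variables (q : R) (U : R -> HR -> HR) (A : {linear HC -> HC})
  (j : {linear HC -> H}) (tens : seq H -> F).
Hypotheses (q1 : -1 < q) (q2 : q < 1) (hU : orthogonal_group U)
  (Apos : positive_selfadjoint A)
  (AU : forall t : R, is_imaginary_power A t (cplx_ext (U t)))
  (hj : is_U_completion A j) (hF : is_qFock q tens).
Variables (n : nat) (e : 'I_n.+1 -> HC) (a : 'I_n.+1 -> R).
Hypotheses (fe : cframe e) (a0 : forall k, 0 < a k)
  (Ae : forall k, A (e k) = (a k)%:C *: e k).

(** The letters are the frame vectors and their conjugates: adjoints of fields correspond to
    conjugation, so the letters must be stable under it. *)
Let L : finType := ('I_n.+1 * bool)%type.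
Let hl (l : L) : HC := if l.2 then cplx_conj (e l.1) else e l.1.
Let bar (l : L) : L := (l.1, ~~ l.2).
(** In both cases the eigenvalue of A to the power -1/2, since conjugation inverts eigenvalues. *)
Let c (l : L) : R := if l.2 then Num.sqrt (a l.1) else (Num.sqrt (a l.1))^-1.
Let P (l : L) k := ip (e k) (hl l).
Let Q (l : L) k := ip (cplx_conj (e k)) (hl l).
Let jl (l : L) : H := j (hl l).

Let barK : involutive bar.
Proof. by move=> [k b]; rewrite /bar /= negbK. Qed.

Let hl_bar l : hl (bar l) = cplx_conj (hl l).
Proof. by case: l => k [] /=; rewrite /hl /= ?cplx_conjK. Qed.

Let PQ l k : conjc (P l k) = Q (bar l) k.
Proof. by rewrite /Q hl_bar ip_conj. Qed.

Let QP l k : conjc (Q l k) = P (bar l) k.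
Proof. by rewrite /Q -ip_conj cplx_conjK /P hl_bar. Qed.

Let sqrt_inv k l : a k * a l = 1 -> Num.sqrt (a k) = (Num.sqrt (a l))^-1.
Proof.
move=> h; have al : a l != 0 by rewrite gt_eqF.
have -> : a k = (a l)^-1 by apply: (mulIf al); rewrite h mulVf.
by rewrite sqrtrV// ltW.
Qed.

Let cP l k : P l k != 0 -> c l = (Num.sqrt (a k))^-1.
Proof.
case: l => m [] /=; rewrite /P /c /hl /= => nz; last first.
  by rewrite (eigen_match Apos Ae nz).
apply/sqrt_inv/(eigen_conj_match a0 Ae hU AU).
by apply: contra_neq nz; rewrite [ip (e k) _]cplx_ipC => ->; rewrite conjc0.
Qed.

Let cQ l k : Q l k != 0 -> c l = Num.sqrt (a k).
Proof.
case: l => m [] /=; rewrite /Q /c /hl /= => nz.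
  rewrite (eigen_match Apos Ae (k := k) (l := m))//.
  by apply: contra_neq nz; rewrite ip_conj => ->; rewrite conjc0.
apply/esym/sqrt_inv.
exact: (eigen_conj_match a0 Ae hU AU nz).
Qed.

(** The two halves of [cov] agree by [covariance_match]; this accounts for the factor 2 in 2 A (1 +
    A)^-1. *)
Let covE l l' : cov a P Q l l' = hip (jl (bar l)) (jl l').
Proof.
rewrite /jl hj.1 (U_ipE Apos fe a0 Ae) hl_bar /cov big_split /=.
rewrite (covariance_match fe a0 Ae hU AU) -big_split; apply: eq_bigr => k _ /=.
rewrite (ip_conj_swap (hl l)) -mulrDl -rmorphD; congr (_%:C * _).
by rewrite -mulrDl mulr_natl mulr2n.
Qed.

Let fieldh (z : HC) : bop F :=
  creation hF q1 q2 (j z) + adj (creation hF q1 q2 (j (cplx_conj z))).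

Let fieldh_lin b z w : fieldh (b *: z + w) = b *: fieldh z + fieldh w.
Proof.
rewrite /fieldh cplx_conj_lin !linearP /= !creation_lin adjD adjZ conjcK.
by rewrite scalerDr addrACA.
Qed.

Let fieldh_lc (I : Type) (f : I -> HC) p : fieldh (lc f p) = lc (fun i => fieldh (f i)) p.
Proof.
have f0 : fieldh 0 = 0.
  by have := fieldh_lin (-1) 0 0; rewrite scaler0 addr0 scaleN1r addNr.
elim: p => [|x p IH]; first by rewrite !lc0.
by rewrite /lc !big_cons fieldh_lin -/(lc f p) IH.
Qed.

Let fldE l : fld hF q1 q2 jl bar l = fieldh (hl l).
Proof. by rewrite /fld /fieldh /jl hl_bar. Qed.

Let Gam := qArakiWoods j tens.

Let field_Gam f : Gam (fieldh (cplx_of f)).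
Proof.
move=> N [hN]; apply; exists f; apply/(is_fieldE hF q1 q2).
rewrite /fieldh (_ : cplx_conj (cplx_of f) = cplx_of f)//.
by apply: cplx_eq => //=; rewrite oppr0.
Qed.

Let fieldh_Gam z : Gam (fieldh z).
Proof.
have -> : z = (0 +i* 1)%C *: cplx_of z.2 + cplx_of z.1.
  case: z => x y; apply: cplx_eq => /=.
    by rewrite scale0r scaler0 subr0 add0r.
  by rewrite scale1r scaler0 add0r addr0.
rewrite fieldh_lin.
exact: (@von_neumann_lin R F Gam _ _ _ (vN_generated_von_neumann _)
  (field_Gam _) (field_Gam _)).
Qed.

Lemma qArakiWoods_frame_QWEP : QWEP Gam.
Proof.
have [d [W [E [Wadj Eadj EW mom]]]] := site_model q1 q2 a0 PQ QP cP cQ.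
have jl_span u : exists p, u = lc jl p.
  exists [seq (((2 * a k / (1 + a k))^-1)%:C * hip (j (e k)) u, (k, false)) |
    k <- enum 'I_n.+1].
  by rewrite {1}(j_frame Apos fe a0 Ae hj u) /lc big_map big_enum.
have moments w : ucv natU (fun N => \tr (E N *m Ww W N w *m E N))
    (hip (tens [::]) (vec (tens [::]) (fld hF q1 q2 jl bar) w)).
  rewrite -wop_Om (vacuum_moment hF q1 q2 jl bar w [::]).
  rewrite (_ : (fun l l' => _) = cov a P Q); first exact: mom.
  by apply/funext => l; apply/funext => l'; rewrite covE.
apply: (@generated_QWEP R F L bar c (tens [::]) (fld hF q1 q2 jl bar) _ _ _ _ _ d W E).
- exact: barK.
- by move=> [k []]; rewrite /c /= ?invr_gt0 sqrtr_gt0.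
- by move=> [k []]; rewrite /c /= ?invrK.
- by move=> l; apply: adj_fld.
- exact: words_spans jl_span.
- exact: Wadj.
- exact: Eadj.
- exact: EW.
- exact: moments.
- exact: vN_generated_von_neumann.
- by move=> l; rewrite fldE; exact: fieldh_Gam.
move=> N hN NG; apply: smallest_sub => // G [f /(is_fieldE hF q1 q2) ->].
have -> : creation hF q1 q2 (j (cplx_of f)) + adj (creation hF q1 q2 (j (cplx_of f))) =
    fieldh (cplx_of f).
  rewrite /fieldh (_ : cplx_conj (cplx_of f) = cplx_of f)//.
  by apply: cplx_eq => //=; rewrite oppr0.
(* A real vector f is in general not a letter; its field is a combination of the fields of the e_k,
   which N contains. *)
have -> : cplx_of f = lc e [seq (ip (e k) (cplx_of f), k) | k <- enum 'I_n.+1].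
  by rewrite {1}(fe (cplx_of f)) /lc big_map big_enum.
rewrite fieldh_lc; apply: von_neumann_lc => // k.
by rewrite -[e k]/(hl (k, false)) -fldE.
Qed.

End ArakiWoodsQWEP.

Theorem theorem5p8 (R : realType) (q : R) (HR : realHilbertType R)
  (U : R -> HR -> HR)
  (A : {linear complexification HR -> complexification HR})
  (H : hilbertType R) (j : {linear complexification HR -> H})
  (F : hilbertType R) (tens : seq H -> F) :
  -1 < q -> q < 1 ->
  finite_dimensional HR ->
  orthogonal_group U ->
  injective A -> positive_selfadjoint A ->
  (forall t : R, is_imaginary_power A t (cplx_ext (U t))) ->
  is_U_completion A j ->
  is_qFock q tens ->
  QWEP (qArakiWoods j tens).
Proof.
move=> q1 q2 fd hU Ainj Apos AU hj hF.
have [n [e [a [fe a0 Ae]]]] := eigenframe Ainj Apos fd.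
exact: (qArakiWoods_frame_QWEP q1 q2 hU Apos AU hj hF fe a0 Ae).
Qed.
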